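(* Let $q$ be a prime power, $n\ge 2$, and let $\mathcal{L}$ be a non-empty set of lines of $\mathrm{PG}(n,q)$. Then $\mathcal{L}$ is the line set of a split Cayley hexagon $\mathbf{H}(q)$ naturally embedded in $\mathrm{PG}(6,q)$ if and only if $\mathcal{L}$ satisfies all of the following: (Pt) every point of $\mathrm{PG}(n,q)$ is incident with either $0$ or $q+1$ elements of $\mathcal{L}$; (Pl) every plane of $\mathrm{PG}(n,q)$ contains either $0$, $1$ or $q+1$ elements of $\mathcal{L}$; (Sd) every solid ($3$-dimensional subspace) of $\mathrm{PG}(n,q)$ contains either $0$, $1$, $q+1$ or $2q+1$ elements of $\mathcal{L}$; (4d) every $4$-dimensional subspace of $\mathrm{PG}(n,q)$ contains at most $q^3-q^2+4q$ elements of $\mathcal{L}$; (To) $|\mathcal{L}|\le q^5+q^4+q^3+q^2+q+1$.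
   Context: A line is said to be contained in (incident with) a subspace if it is a subset of it. The natural embedding of the split Cayley hexagon $\mathbf{H}(q)$ in $\mathrm{PG}(6,q)$ with homogeneous coordinates $(x_0,\dots,x_6)$: its points are the points of the parabolic quadric $\mathbf{Q}(6,q)$ given by $x_0x_4+x_1x_5+x_2x_6=x_3^2$, and its lines are those lines of $\mathbf{Q}(6,q)$ whose Grassmann coordinates $p_{ij}=x_iy_j-x_jy_i$ (for a line spanned by points $x,y$) satisfy $p_{12}=p_{34}$, $p_{54}=p_{32}$, $p_{20}=p_{35}$, $p_{65}=p_{30}$, $p_{01}=p_{36}$, $p_{46}=p_{31}$. ''$\mathcal{L}$ is the line set of a split Cayley hexagon naturally embedded in $\mathrm{PG}(6,q)$'' means that $\mathcal{L}$ spans a $6$-dimensional subspace of $\mathrm{PG}(n,q)$ and, up to a projectivity (choice of coordinates in that subspace), $\mathcal{L}$ is exactly the line set of this natural embedding of $\mathbf{H}(q)$. *)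

(* Defs.v *)
From HB Require Import structures.
From mathcomp Require Import all_boot all_order all_algebra.
Set Implicit Arguments. Unset Strict Implicit. Unset Printing Implicit Defensive.
Import GRing.Theory.
Local Open Scope ring_scope.

(* Projective space PG(m-1, F) = subspaces of the row space F^m.
   A projective subspace of projective dimension k is represented canonically
   by a square matrix S : 'M[F]_m equal to its own canonical row-space
   representative <<S>>, of rank k+1.  Incidence/containment is row-space
   inclusion (S <= T)%MS. *)
Definition proj_subspace (F : fieldType) (m k : nat) (S : 'M[F]_m) : bool :=
  (<<S>>%MS == S) && (\rank S == k.+1)%N.

Definition cd (F : fieldType) (x : 'rV[F]_7) (i : nat) : F := x 0 (inord i).

Definition Qform (F : fieldType) (x : 'rV[F]_7) : F :=
  cd x 0 * cd x 4 + cd x 1 * cd x 5 + cd x 2 * cd x 6 - cd x 3 ^+ 2.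

Definition pl (F : fieldType) (x y : 'rV[F]_7) (i j : nat) : F :=
  cd x i * cd y j - cd x j * cd y i.

(* x, y span a line of Q(6,q) satisfying the split Cayley hexagon relations *)
Definition hex_cond (F : finFieldType) (x y : 'rV[F]_7) : bool :=
  [&& \rank (col_mx x y) == 2%N,
      [forall a : F, forall b : F, Qform (a *: x + b *: y) == 0],
      pl x y 1 2 == pl x y 3 4, pl x y 5 4 == pl x y 3 2,
      pl x y 2 0 == pl x y 3 5, pl x y 6 5 == pl x y 3 0,
      pl x y 0 1 == pl x y 3 6 & pl x y 4 6 == pl x y 3 1].

Definition hexL (F : finFieldType) : {set 'M[F]_7} :=
  [set <<col_mx xy.1 xy.2>>%MS | xy : 'rV[F]_7 * 'rV[F]_7 & hex_cond xy.1 xy.2].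

(* L is the line set of a split Cayley hexagon naturally embedded in a
   6-dimensional subspace of PG(n,q): there is an injective linear map
   F^7 -> F^{n+1} (a full-rank 7 x (n+1) matrix M) mapping the lines of H(q)
   exactly onto L. *)
Definition is_split_cayley_hexagon (F : finFieldType) (n : nat)
    (L : {set 'M[F]_(n.+1)}) : Prop :=
  exists M : 'M[F]_(7, n.+1),
    row_free M /\ L = [set <<(X *m M)>>%MS | X in hexL F].

Definition nb_in (F : finFieldType) (n : nat) (L : {set 'M[F]_(n.+1)})
    (S : 'M[F]_(n.+1)) : nat := #|[set l in L | (l <= S)%MS]|.

Definition nb_through (F : finFieldType) (n : nat) (L : {set 'M[F]_(n.+1)})
    (p : 'M[F]_(n.+1)) : nat := #|[set l in L | (p <= l)%MS]|.

(* Main.v *)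
(* Collinearity of two points is x ~ y.  Counting in planes and solids shows that the lines
   of L through a point x fill a plane Pi x, that no solid contains three such planes, and
   hence that there are no triangles and no quadrangles.  A pentagon would give a subspace
   of dimension 4 containing five of these planes; the second moment of the number of lines
   in its solids, together with (4d), forbids this.  (To) then forces every line to have a
   point at distance at most two from any given point, so L is a generalized hexagon in
   which the lines of a solid form a pencil, two pencils or a regulus.

   Reguli linearize the geometry: the points not opposite z span a hyperplane of a
   7-dimensional space V carrying L.  An ordinary hexagon spans a 6-dimensional W inside V,
   on which L induces the flags of a projective plane with point coordinates x and line
   coordinates y.  A point (x, 1, y) outside W is collinear in W exactly with the vectors
   (a, k x * a), a . y = 0, where the scalars k and x . y do not depend on the point because
   the points outside W are connected.  Rescaling gives the equations of H(q), so L is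
   contained in H(q), and both have (q^6 - 1) / (q - 1) lines.

   Conversely, collinearity in H(q) is the vanishing of the product of trace-zero split
   octonions, and orthogonal points p, p' have the common neighbour p p'. *)

Require Import Defs.
From HB Require Import structures.
From mathcomp Require Import all_boot all_order all_algebra.
From mathcomp Require Import zify ring.
Set Implicit Arguments. Unset Strict Implicit. Unset Printing Implicit Defensive.
Import GRing.Theory.
Local Open Scope ring_scope.

(** The pentagon argument rests on the quadratic (c - 1)(c - q - 1) in the number c of lines of a
    solid. On the values allowed by (Sd) it is non-negative, and it is 2q^2 at c = 2q + 1; summed
    over the solids of a 4-space it gives a quadratic inequality for the number b of lines there.
    Let k be the least degree of the collinearity graph on the points whose plane lies in the
    4-space. If k is at least 2, the inequality fails at the geometric lower bound b = q^2 + q + 1 +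
    qk and at the bound of (4d), hence by convexity everywhere between. No form is given in advance.
    Linearity has one source: the lines of a regulus match the points of two transversals linearly,
    once one scalar is fixed. Later relations between scalars, such as the sign in a frame and the
    constancy of k, come from the fact that the lines through a point span only a plane.
    Characteristic two is not treated apart: the polar form then has a radical, but this contains no
    singular point. *)

Ltac sub_sum :=
  first [ exact: submx_refl | assumption
        | apply/andP; split; sub_sum
        | rewrite addsmx_sub; sub_sum
        | apply: submx_trans (addsmxSl _ _); sub_sum
        | apply: submx_trans (addsmxSr _ _); sub_sum ].

(* Cardinals are turned into variables first: the comparison of atoms up to
   conversion makes lia diverge on terms that contain matrices. *)
Ltac card_gen := try unfold reverse_coercion; simpl; repeat match goal with |- context [@card ?T ?A] => generalize (@card T A) end;
  repeat match goal with |- context [@mxrank ?F ?m ?n ?A] => generalize (@mxrank F m n A) end;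
  clear; intros.
Ltac card_lia := card_gen; lia.
Ltac card_nia := card_gen; nia.

(** * Subspaces and points *)

Section Subspaces.
Variables (F : finFieldType) (N : nat).
Implicit Types (x y z u v : 'rV[F]_N).

Lemma nonzero_in m (A : 'M[F]_(m, N)) :
  (0 < \rank A)%N -> exists2 v : 'rV[F]_N, v != 0 & (v <= A)%MS.
Proof.
move=> rA; have: A != 0 by rewrite -mxrank_eq0 -lt0n.
by case/rowV0Pn=> v vA v0; exists v.
Qed.

Lemma rank_nz x : x != 0 -> \rank x = 1%N.
Proof. by rewrite rank_rV => ->. Qed.

Lemma sub_eq_rank m1 m2 (A : 'M[F]_(m1, N)) (B : 'M[F]_(m2, N)) :
  (A <= B)%MS -> (\rank B <= \rank A)%N -> (B <= A)%MS.
Proof. by move=> sAB; rewrite -(geq_leqif (mxrank_leqif_sup sAB)). Qed.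

Lemma sub_notsub_rank m1 m2 (A : 'M[F]_(m1, N)) (B : 'M[F]_(m2, N)) :
  (A <= B)%MS -> ~~ (B <= A)%MS -> (\rank A < \rank B)%N.
Proof. by move=> sAB nBA; rewrite ltnNge; apply: contra nBA; apply: sub_eq_rank. Qed.

Lemma outside_vector m1 m2 (A : 'M[F]_(m1, N)) (B : 'M[F]_(m2, N)) :
  (\rank B < \rank A)%N -> exists2 v : 'rV[F]_N, (v <= A)%MS & ~~ (v <= B)%MS.
Proof.
move=> rAB; have: ~~ (A <= B)%MS by apply/negP => /mxrankS; rewrite leqNgt rAB.
by case/row_subPn=> i ni; exists (row i A); rewrite ?row_sub.
Qed.

Lemma rank_addv m (A : 'M[F]_(m, N)) v :
  ~~ (v <= A)%MS -> \rank (A + v)%MS = (\rank A).+1.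
Proof.
move=> nvA; have v0 : v != 0 by apply: contra nvA => /eqP->; rewrite sub0mx.
have := mxrank_sum_cap A v; rewrite (rank_nz v0).
suff -> : \rank (A :&: v)%MS = 0%N by lia.
apply/eqP; rewrite mxrank_eq0; apply/rowV0P => u.
rewrite sub_capmx => /andP[uA /sub_rVP[a Du]]; rewrite Du.
case: (eqVneq a 0) => [->|a0]; first by rewrite scale0r.
by case/negP: nvA; rewrite -[v]scale1r -(mulVf a0) -scalerA -Du scalemx_sub.
Qed.

Lemma rank_addv_le m (A : 'M[F]_(m, N)) v : (\rank (A + v)%MS <= (\rank A).+1)%N.
Proof.
case: (boolP (v <= A)%MS) => [vA|/rank_addv->//].
have /mxrankS/leq_trans-> // : (A + v <= A)%MS by rewrite addsmx_sub submx_refl.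
Qed.

Lemma rank_cap_ge m1 m2 m3 (A : 'M[F]_(m1, N)) (B : 'M[F]_(m2, N)) (C : 'M[F]_(m3, N)) :
  (A <= C)%MS -> (B <= C)%MS -> (\rank A + \rank B <= \rank C + \rank (A :&: B)%MS)%N.
Proof.
move=> AC BC; rewrite -mxrank_sum_cap leq_add2r.
by apply: mxrankS; rewrite addsmx_sub AC.
Qed.

Lemma sub_add2P x y v :
  reflect (exists a b, v = a *: x + b *: y) (v <= x + y)%MS.
Proof.
apply: (iffP sub_addsmxP) => [[[a b] /= ->]|[a [b ->]]].
  exists (a 0 0), (b 0 0).
  by rewrite [a]mx11_scalar [b]mx11_scalar !mul_scalar_mx !mxE !eqxx.
by exists (a%:M, b%:M); rewrite /= !mul_scalar_mx.
Qed.

Lemma sub_addvP m (A : 'M[F]_(m, N)) v u :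
  reflect (exists a, (u - a *: v <= A)%MS) (u <= A + v)%MS.
Proof.
apply: (iffP idP) => [/sub_addsmxP[[D b] /= ->]|[a uA]].
  exists (b 0 0); rewrite [b]mx11_scalar mul_scalar_mx !mxE eqxx mulr1n addrK.
  exact: submxMl.
rewrite -[u](subrK (a *: v)) addmx_sub_adds //.
by apply: scalemx_sub; apply: submx_refl.
Qed.

Lemma par_sym x y : x != 0 -> (x <= y)%MS -> (y <= x)%MS.
Proof.
move=> x0 xy; apply: sub_eq_rank => //.
by rewrite (rank_nz x0) rank_leq_row.
Qed.

Lemma npar_sym x y : y != 0 -> ~~ (x <= y)%MS -> ~~ (y <= x)%MS.
Proof. by move=> y0; apply: contra; apply: par_sym. Qed.

Lemma npar_nz m x (A : 'M[F]_(m, N)) : ~~ (x <= A)%MS -> x != 0.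
Proof. by apply: contraNneq => ->; rewrite sub0mx. Qed.

Lemma rank_add2 x y : x != 0 -> ~~ (y <= x)%MS -> \rank (x + y)%MS = 2%N.
Proof. by move=> x0 /rank_addv->; rewrite rank_nz. Qed.

Lemma genmx_eqP m1 m2 (A : 'M[F]_(m1, N)) (B : 'M[F]_(m2, N)) :
  (A <= B)%MS -> (B <= A)%MS -> <<A>>%MS = <<B>>%MS.
Proof. by move=> AB BA; apply/genmxP; rewrite AB BA. Qed.

Lemma comb_eq0 x y a b :
  x != 0 -> ~~ (y <= x)%MS -> a *: x + b *: y = 0 -> a = 0 /\ b = 0.
Proof.
move=> x0 nyx e; have b0 : b = 0.
  apply/eqP; apply: contraNT nyx => b0; apply/sub_rVP; exists (- (b^-1 * a)).
  by rewrite -[y]scale1r -(mulVf b0) -scalerA -(addKr (a *: x) (b *: y)) e addr0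
             scalerN scaleNr scalerA.
split=> //; move: e; rewrite b0 scale0r addr0 => /eqP.
by rewrite scaler_eq0 (negPf x0) orbF => /eqP.
Qed.

Lemma exchange m (A : 'M[F]_(m, N)) v (w : 'rV[F]_N) :
  (w <= A + v)%MS -> ~~ (w <= A)%MS -> (v <= A + w)%MS.
Proof.
move=> wAv wA; apply: submx_trans (addsmxSr A v) _; apply: sub_eq_rank.
  by rewrite addsmx_sub addsmxSl.
by rewrite (rank_addv wA) rank_addv_le.
Qed.

Lemma comb3_eq0 x y z a b c : x != 0 -> ~~ (y <= x)%MS -> ~~ (z <= x + y)%MS ->
  a *: x + b *: y + c *: z = 0 -> [/\ a = 0, b = 0 & c = 0].
Proof.
move=> x0 yx zxy e; have c0 : c = 0.
  apply/eqP; apply: contraNT zxy => c0.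
  have -> : z = (- (c^-1 * a)) *: x + (- (c^-1 * b)) *: y.
    apply: (scalerI c0); rewrite scalerDr !scalerA !mulrN !mulrA !divff // !mul1r !scaleNr.
    by apply/eqP; rewrite -subr_eq0 opprD !opprK addrC e.
  by apply/sub_add2P; eexists; eexists.
by move: e; rewrite c0 scale0r addr0 => /(comb_eq0 x0 yx)[].
Qed.

End Subspaces.

(** * Numbers of points and double counting *)

Section Counting.
Variables (F : finFieldType) (N : nat).
Local Notation q := #|F|.

Lemma q_gt1 : (1 < q)%N.
Proof. exact: card_finNzRing_gt1. Qed.

Lemma card_rowspace m (A : 'M[F]_(m, N)) :
  #|[set v : 'rV[F]_N | (v <= A)%MS]| = (q ^ \rank A)%N.
Proof.
have -> : [set v : 'rV[F]_N | (v <= A)%MS]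
        = [set c *m row_base A | c : 'rV[F]_(\rank A)].
  apply/setP=> v; rewrite inE -(eq_row_base A); apply/submxP/imsetP.
    by case=> c ->; exists c.
  by case=> c _ ->; exists c.
rewrite card_imset; last exact/row_free_inj/row_base_free.
by rewrite card_mx mul1n.
Qed.

Definition normalize (x : 'rV[F]_N) : 'rV[F]_N :=
  if [pick i | x 0 i != 0] is Some i then (x 0 i)^-1 *: x else 0.

Lemma normalize_scale a x : a != 0 -> normalize (a *: x) = normalize x.
Proof.
move=> a0; rewrite /normalize.
have -> : [pick i | (a *: x) 0 i != 0] = [pick i | x 0 i != 0].
  by apply: eq_pick => i; rewrite mxE mulf_eq0 (negPf a0).
case: pickP => // i xi; rewrite mxE scalerA invfM mulrAC mulVf ?mul1r //.
Qed.

Lemma normalizeE x : x != 0 -> exists2 a, a != 0 & normalize x = a *: x.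
Proof.
move=> x0; rewrite /normalize; case: pickP => [i xi|xE].
  by exists (x 0 i)^-1; rewrite ?invr_eq0.
case/eqP: x0; apply/rowP=> i; rewrite mxE.
by apply/eqP; move/(_ i)/negbFE: xE.
Qed.

Lemma normalize_nz x : x != 0 -> normalize x != 0.
Proof. by move=> x0; have [a a0 ->] := normalizeE x0; rewrite scaler_eq0 negb_or a0. Qed.

Lemma normalize_eqmx x : x != 0 -> (normalize x :=: x)%MS.
Proof. by move=> x0; have [a a0 ->] := normalizeE x0; apply: eqmx_scale. Qed.

Lemma normalize_idem x : x != 0 -> normalize (normalize x) = normalize x.
Proof. by move=> x0; have [a a0 {1}->] := normalizeE x0; rewrite normalize_scale. Qed.

(* The projective points of the row space of A, each represented by the
   multiple whose first nonzero coordinate is 1. *)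
Definition pts m (A : 'M[F]_(m, N)) : {set 'rV[F]_N} :=
  [set x | [&& x != 0, normalize x == x & (x <= A)%MS]].

Lemma ptsP m (A : 'M[F]_(m, N)) x :
  reflect [/\ x != 0, normalize x = x & (x <= A)%MS] (x \in pts A).
Proof. by rewrite inE; apply: (iffP and3P) => -[-> /eqP-> ->]. Qed.

Lemma normalize_pts m (A : 'M[F]_(m, N)) x :
  x != 0 -> (x <= A)%MS -> normalize x \in pts A.
Proof.
by move=> x0 xA; rewrite inE normalize_nz // normalize_idem // eqxx normalize_eqmx.
Qed.

Lemma pts_par m (A : 'M[F]_(m, N)) x y :
  x \in pts A -> y \in pts A -> (x <= y)%MS -> x = y.
Proof.
case/ptsP=> x0 nx xA /ptsP[y0 ny yA] /sub_rVP[a Dx].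
have a0 : a != 0 by apply: contraNneq x0 => a0; rewrite Dx a0 scale0r.
by rewrite -nx Dx normalize_scale.
Qed.

(** [normalize] maps the nonzero vectors of the row space onto its points, with fibres of size q -
    1. The successor avoids a subtraction. *)
Lemma card_pts m (A : 'M[F]_(m, N)) : (q.-1 * #|pts A|).+1 = (q ^ \rank A)%N.
Proof.
rewrite -card_rowspace [RHS](cardsD1 0) inE sub0mx add1n; congr _.+1.
rewrite -[RHS]sum1_card [RHS](partition_big normalize (fun x => x \in pts A)) /=; last first.
  by move=> v; rewrite !inE => /andP[v0 vA]; have := normalize_pts v0 vA; rewrite inE.
rewrite -[X in (_ * X)%N]sum1_card big_distrr /=; apply: eq_bigr => x /ptsP[x0 nx xA].
rewrite muln1 sum1dep_card.
have -> : [set v | (v \in [set v | (v <= A)%MS] :\ 0) && (normalize v == x)]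
   = [set a *: x | a : F & a != 0].
  apply/setP=> v; rewrite !inE; apply/idP/imsetP.
    case/andP=> /andP[v0 vA] /eqP nv; have [a a0 Da] := normalizeE v0.
    exists a^-1; rewrite ?inE ?invr_eq0 // -nv Da scalerA mulVf ?scale1r //.
  case=> a; rewrite inE => a0 ->; rewrite scaler_eq0 negb_or a0 x0 scalemx_sub //=.
  by rewrite normalize_scale ?nx.
rewrite card_imset; last first.
  move=> a b /eqP; rewrite -subr_eq0 -scalerBl scaler_eq0 (negPf x0) orbF subr_eq0.
  by move/eqP.
by rewrite -(cardsC1 (0 : F)); apply: eq_card => a; rewrite !inE.
Qed.

Lemma card_pts_line m (A : 'M[F]_(m, N)) : \rank A = 2%N -> #|pts A| = q.+1.
Proof. by move=> rA; have := card_pts A; rewrite rA; have := q_gt1; card_nia. Qed.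

Lemma card_pts_plane m (A : 'M[F]_(m, N)) :
  \rank A = 3%N -> #|pts A| = (q ^ 2 + q + 1)%N.
Proof. by move=> rA; have := card_pts A; rewrite rA; have := q_gt1; card_nia. Qed.

Lemma double_count (T U : finType) (X : {set T}) (Y : {set U}) (R : T -> U -> bool) :
  (\sum_(x in X) #|[set y in Y | R x y]| = \sum_(y in Y) #|[set x in X | R x y]|)%N.
Proof.
under eq_bigr do rewrite -sum1dep_card.
under [RHS]eq_bigr do rewrite -sum1dep_card.
rewrite (exchange_big_dep (fun y => y \in Y)) /=; last by move=> x y _ /andP[].
apply: eq_bigr => y yY; apply: eq_bigl => x; rewrite yY andbC //.
Qed.

Lemma sum_set_const (T : finType) (A : {set T}) n : (\sum_(i in A) n = #|A| * n)%N.
Proof. exact: sum_nat_const. Qed.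

Lemma sum_pred_const (T : finType) (P : pred T) n :
  (\sum_(i | P i) n = #|[set i | P i]| * n)%N.
Proof. by rewrite sum_nat_const cardsE. Qed.

End Counting.

(** * Planar pencils *)

Section Geometry.
Variables (F : finFieldType) (N : nat) (L : {set 'M[F]_N}).
Implicit Types (x y z u v c : 'rV[F]_N) (l : 'M[F]_N).
Local Notation q := #|F|.

(** The zero vector lies on every line, so [adj] holds between 0 and any point of L; hence the
    nonvanishing conditions here and in later statements. On points of L both [adj] and [dist2] are
    reflexive. *)
Definition onL x := (x != 0) && [exists l in L, (x <= l)%MS].
Definition adj x y := [exists l in L, (x <= l)%MS && (y <= l)%MS].
Definition dist2 x y := [exists c, [&& c != 0, adj x c & adj c y]].
Definition lines_thru x : {set 'M[F]_N} := [set l in L | (x <= l)%MS].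
Definition Pi x : 'M[F]_N := (\sum_(l in L | (x <= l)%MS) l)%MS.

(** [flat_full] says that the lines through x cover their plane and [flat_vertex] that this plane
    contains no other line; the latter forbids triangles. *)
Record flat : Prop := Flat {
  flat_line : forall l, l \in L -> <<l>>%MS = l /\ \rank l = 2%N;
  flat_rank : forall x, onL x -> \rank (Pi x) = 3%N;
  flat_full : forall x y, onL x -> (y <= Pi x)%MS -> adj x y;
  flat_vertex : forall x l, onL x -> l \in L -> (l <= Pi x)%MS -> (x <= l)%MS }.

(** Phrased as uniqueness: two non-collinear points have at most one common neighbour. *)
Definition no_quadrangle := forall x y u v, x != 0 -> y != 0 -> u != 0 -> v != 0 ->
  adj x y -> adj y u -> adj u v -> adj v x -> ~~ adj x u -> (v <= y)%MS.

(** Phrased positively: a line with two points at distance at most two from x has a point collinear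
    with x. If it had none, the two paths from x would close a pentagon. *)
Definition no_pentagon := forall x y y', onL x -> y != 0 -> adj y y' -> ~~ (y' <= y)%MS ->
  dist2 x y -> dist2 x y' -> exists w, [/\ w != 0, (w <= y + y')%MS & adj x w].

Definition no_three_pencils := forall m (T : 'M[F]_(m, N)) x y z, (\rank T <= 4)%N ->
  onL x -> onL y -> onL z -> ~~ (y <= x)%MS -> ~~ (z <= x)%MS -> ~~ (z <= y)%MS ->
  (Pi x <= T)%MS -> (Pi y <= T)%MS -> (Pi z <= T)%MS -> False.

Definition lines_near := forall x l, onL x -> l \in L ->
  exists y, [/\ y != 0, (y <= l)%MS & dist2 x y].

Lemma onL_nz x : onL x -> x != 0. Proof. by case/andP. Qed.

Lemma onLP x : x != 0 -> reflect (exists2 l, l \in L & (x <= l)%MS) (onL x).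
Proof. by move=> x0; rewrite /onL x0; apply: (iffP exists_inP). Qed.

Lemma adjP x y :
  reflect (exists l, [/\ l \in L, (x <= l)%MS & (y <= l)%MS]) (adj x y).
Proof.
apply: (iffP exists_inP) => [[l lL /andP[xl yl]]|[l [lL xl yl]]]; first by exists l.
by exists l; rewrite // xl.
Qed.

Lemma adjC x y : adj x y = adj y x.
Proof. by apply/adjP/adjP=> -[l [lL xl yl]]; exists l. Qed.

Lemma adj_sub x y u v : adj x y -> (u <= x)%MS -> (v <= y)%MS -> adj u v.
Proof.
case/adjP=> l [lL xl yl] ux vy; apply/adjP; exists l.
by rewrite lL (submx_trans ux xl) (submx_trans vy yl).
Qed.

Lemma onL_sub x y : y != 0 -> onL x -> (y <= x)%MS -> onL y.
Proof.
move=> y0 ox yx; apply/onLP=> //; have [l lL xl] := onLP (onL_nz ox) ox.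
by exists l; rewrite ?(submx_trans yx).
Qed.

Lemma adj_onL x y : x != 0 -> adj x y -> onL x.
Proof. by move=> x0 /adjP[l [lL xl _]]; apply/onLP=> //; exists l. Qed.

Lemma adj_onR x y : y != 0 -> adj x y -> onL y.
Proof. by rewrite adjC; apply: adj_onL. Qed.

Lemma adj_refl x : onL x -> adj x x.
Proof. by move=> ox; have [l lL xl] := onLP (onL_nz ox) ox; apply/adjP; exists l. Qed.

Lemma adj_Pi x y : adj x y -> (y <= Pi x)%MS.
Proof. by case/adjP=> l [lL xl yl]; rewrite (sumsmx_sup l) // lL. Qed.

Lemma line_Pi x l : l \in L -> (x <= l)%MS -> (l <= Pi x)%MS.
Proof. by move=> lL xl; rewrite (sumsmx_sup l) // lL. Qed.

Lemma onL_Pi x : onL x -> (x <= Pi x)%MS.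
Proof. by move/adj_refl/adj_Pi. Qed.

Lemma dist2P x y :
  reflect (exists c, [/\ c != 0, adj x c & adj c y]) (dist2 x y).
Proof. by apply: (iffP existsP) => -[c /and3P]; exists c. Qed.

Lemma dist2C x y : dist2 x y = dist2 y x.
Proof. by apply: eq_existsb => c; rewrite adjC [adj c y]adjC [adj c x && _]andbC. Qed.

Lemma adj_dist2 x y : x != 0 -> adj x y -> dist2 x y.
Proof. by move=> x0 xy; apply/dist2P; exists x; rewrite adj_refl // (adj_onL x0 xy). Qed.

Lemma dist2_sub x y u v : dist2 x y -> (u <= x)%MS -> (v <= y)%MS -> dist2 u v.
Proof.
case/dist2P=> c [c0 xc cy] ux vy; apply/dist2P; exists c.
by rewrite c0 (adj_sub xc) // (adj_sub cy).
Qed.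

Hypothesis fL : flat.

Lemma line_rank l : l \in L -> \rank l = 2%N. Proof. by case/(flat_line fL). Qed.
Lemma line_gen l : l \in L -> <<l>>%MS = l. Proof. by case/(flat_line fL). Qed.

Lemma adjE x y : onL x -> adj x y = (y <= Pi x)%MS.
Proof. by move=> ox; apply/idP/idP; [apply: adj_Pi | apply: flat_full]. Qed.

Lemma line_eq l x y : l \in L -> x != 0 -> ~~ (y <= x)%MS -> (x <= l)%MS -> (y <= l)%MS ->
  l = <<(x + y)%MS>>%MS.
Proof.
move=> lL x0 yx xl yl; rewrite -{1}(line_gen lL).
have s : (x + y <= l)%MS by rewrite addsmx_sub xl.
by apply: genmx_eqP => //; apply: sub_eq_rank s _; rewrite rank_add2 // line_rank.
Qed.

Lemma line_in x y : x != 0 -> ~~ (y <= x)%MS -> adj x y -> <<(x + y)%MS>>%MS \in L.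
Proof. by move=> x0 yx /adjP[l [lL xl yl]]; rewrite -(line_eq lL). Qed.

Lemma line_basis l x : l \in L -> x != 0 -> (x <= l)%MS ->
  exists y, [/\ ~~ (y <= x)%MS, adj x y & l = <<(x + y)%MS>>%MS].
Proof.
move=> lL x0 xl; have [|y yl yx] := @outside_vector _ _ _ _ l x.
  by rewrite rank_nz // line_rank.
by exists y; split=> //; [apply/adjP; exists l | apply: line_eq].
Qed.

Lemma line_two l : l \in L ->
  exists x y, [/\ x != 0, ~~ (y <= x)%MS, adj x y & l = <<(x + y)%MS>>%MS].
Proof.
move=> lL; have [|x x0 xl] := @nonzero_in _ _ _ l; first by rewrite line_rank.
by have [y [? ? ?]] := line_basis lL x0 xl; exists x, y.
Qed.

Lemma adj_comb x y u v : x != 0 -> adj x y -> (u <= x + y)%MS -> (v <= x + y)%MS -> adj u v.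
Proof.
move=> x0 /adjP[l [lL xl yl]] ux vy; apply/adjP; exists l.
by split=> //; [apply: submx_trans ux _ | apply: submx_trans vy _]; rewrite addsmx_sub xl.
Qed.

Lemma adj_add x y z : onL x -> adj x y -> adj x z -> adj x (y + z).
Proof. by move=> ox; rewrite !adjE //; apply: addmx_sub. Qed.

Lemma adj_scale x y a : adj x y -> adj x (a *: y).
Proof. by move=> xy; apply: adj_sub xy _ _ => //; apply: scalemx_sub. Qed.

Lemma adj_scalel x y a : adj x y -> adj (a *: x) y.
Proof. by rewrite ![adj _ y]adjC; apply: adj_scale. Qed.

Lemma adj_lin x y z a b : onL x -> adj x y -> adj x z -> adj x (a *: y + b *: z).
Proof. by move=> ox xy xz; apply: adj_add; rewrite ?adj_scale. Qed.

(** Unless y and z coincide, the line yz lies in the plane [Pi x], so by [flat_vertex] it passes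
    through x. *)
Lemma triangle x y z : onL x -> ~~ (y <= x)%MS -> adj x y -> adj x z -> adj y z ->
  (z <= x + y)%MS.
Proof.
move=> ox yx xy xz yz; have y0 := npar_nz yx.
case: (boolP (z <= y)%MS) => [zy|zy]; first by rewrite (submx_trans zy) ?addsmxSr.
have yzL := line_in y0 zy yz.
have : (x <= <<(y + z)%MS>>)%MS.
  by apply: (flat_vertex fL) => //; rewrite genmxE addsmx_sub -!adjE // xy.
rewrite genmxE => /sub_add2P[a [b Dx]].
have b0 : b != 0.
  apply: contraNneq yx => b0; apply: par_sym (onL_nz ox) _.
  by rewrite Dx b0 scale0r addr0 scalemx_sub.
have -> : z = b^-1 *: x + (- (b^-1 * a)) *: y.
  by rewrite Dx scalerDr !scalerA mulVf // scale1r addrAC scaleNr subrr add0r.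
by apply/sub_add2P; exists b^-1, (- (b^-1 * a)).
Qed.

Lemma Pi_span x y z : onL x -> adj x y -> adj x z -> ~~ (y <= x)%MS -> ~~ (z <= x + y)%MS ->
  (Pi x <= x + y + z)%MS.
Proof.
move=> ox xy xz yx zxy; apply: sub_eq_rank.
  by rewrite !addsmx_sub onL_Pi // -!adjE // xy.
by rewrite (flat_rank fL) // rank_addv // rank_add2 ?onL_nz.
Qed.

Lemma Pi_sub m (S : 'M[F]_(m, N)) x y z : onL x -> adj x y -> adj x z ->
  ~~ (y <= x)%MS -> ~~ (z <= x + y)%MS ->
  (x <= S)%MS -> (y <= S)%MS -> (z <= S)%MS -> (Pi x <= S)%MS.
Proof.
move=> ox xy xz yx zxy xS yS zS; apply: submx_trans (Pi_span ox xy xz yx zxy) _.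
by rewrite !addsmx_sub xS yS.
Qed.

Lemma Pi_out m (A : 'M[F]_(m, N)) x : onL x -> (\rank A < 3)%N ->
  exists2 y, adj x y & ~~ (y <= A)%MS.
Proof.
move=> ox rA; have [|y yP yA] := @outside_vector _ _ _ _ (Pi x) A; first by rewrite flat_rank.
by exists y; rewrite ?adjE.
Qed.

(** If x and y were distinct, every point of the common plane would form a triangle with them and so
    lie on the line xy. *)
Lemma Pi_eq_par x y : onL x -> onL y -> (Pi x <= Pi y)%MS -> (y <= x)%MS.
Proof.
move=> ox oy s; apply/negP => /negP yx; have xy : adj x y.
  by rewrite adjC adjE // (submx_trans _ s) // onL_Pi.
have [|z xz zA] := @Pi_out _ (x + y)%MS x ox; first by rewrite rank_add2 ?onL_nz.
case/negP: zA; apply: triangle => //.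
by rewrite adjE // (submx_trans _ s) // -adjE.
Qed.

Lemma PiE x y : onL x -> (x <= y)%MS -> (Pi x :=: Pi y)%MS.
Proof.
move=> ox xy; have yx := par_sym (onL_nz ox) xy.
have e l : (x <= l)%MS = (y <= l)%MS.
  by apply/idP/idP; apply: submx_trans.
by rewrite /Pi (eq_bigl (fun l => (l \in L) && (y <= l)%MS)) // => l; rewrite e.
Qed.

(** The lines through x partition the q^2 + q other points of [Pi x] into classes of size q. *)
Lemma card_lines_through x : onL x -> #|lines_thru x| = q.+1.
Proof.
move=> ox; have x0 := onL_nz ox.
set Lx := lines_thru x.
pose X := pts (Pi x) :\ normalize x.
have cX : #|X| = (q ^ 2 + q)%N.
  have := cardsD1 (normalize x) (pts (Pi x)).
  by rewrite normalize_pts ?onL_Pi // card_pts_plane ?flat_rank // -/X add1n addn1 => -[].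
have := double_count Lx X (fun l y => (y <= l)%MS).
rewrite (eq_bigr (fun=> q)); last first.
  move=> l; rewrite inE => /andP[lL xl].
  have := cardsD1 (normalize x) (pts l).
  rewrite normalize_pts // card_pts_line ?line_rank // add1n => -[->].
  apply: eq_card => y; rewrite !inE; case: (y != normalize x) => //=.
  apply/idP/idP => [/andP[/and3P[-> -> _] ->] //|/and3P[-> -> yl]].
  by rewrite yl (submx_trans yl) ?line_Pi.
rewrite [RHS](eq_bigr (fun=> 1%N)); last first.
  move=> y; rewrite !inE => /and4P[ynx y0 /eqP ny yP].
  have yx : ~~ (y <= x)%MS.
    apply: contra ynx => yx; apply/eqP.
    apply: (@pts_par _ _ _ x); first by rewrite inE y0 ny eqxx yx.
      exact: normalize_pts.
    by rewrite normalize_eqmx.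
  apply/eqP/cards1P; exists <<(x + y)%MS>>%MS; apply/setP=> l; rewrite !inE.
  apply/idP/eqP => [/andP[/andP[lL xl] yl]|->]; first exact: line_eq.
  by rewrite line_in ?adjE // !genmxE addsmxSl addsmxSr.
rewrite !sum_nat_const cX muln1; have := q_gt1 F; card_nia.
Qed.

End Geometry.

Lemma card_three_sets (T : finType) (A B C : {set T}) :
  (#|A| + #|B| + #|C| <= #|A :|: B :|: C| + #|A :&: B| + #|A :&: C| + #|B :&: C|)%N.
Proof.
have := cardsUI A B; have := cardsUI (A :|: B) C.
have : (#|(A :|: B) :&: C| <= #|A :&: C| + #|B :&: C|)%N.
  by rewrite setIUl -cardsUI leq_addr.
card_lia.
Qed.

Lemma cards_le1 (T : finType) (A : {set T}) :
  (forall x y, x \in A -> y \in A -> x = y) -> (#|A| <= 1)%N.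
Proof.
move=> h; case: (set_0Vmem A) => [->|[x xA]]; first by rewrite cards0.
rewrite -(cards1 x); apply: subset_leq_card; apply/subsetP=> y yA.
by rewrite inE (h y x).
Qed.

Definition lines_in (F : finFieldType) N (L : {set 'M[F]_N}) m (T : 'M[F]_(m, N)) : {set 'M[F]_N} :=
  [set l in L | (l <= T)%MS].

(** * Consequences of the intersection numbers *)

Section IntersectionNumbers.
Variables (F : finFieldType) (N : nat) (L : {set 'M[F]_N}).
Local Notation q := #|F|.

(** The conditions are restated for row spaces of matrices of any shape. The premise that two lines
    are present leaves only the larger admissible values. *)
Record intersection_numbers : Prop := IntersectionNumbers {
  in_line : forall l, l \in L -> <<l>>%MS = l /\ \rank l = 2%N;
  in_pt : forall x : 'rV[F]_N, onL L x -> #|lines_thru L x| = q.+1;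
  in_pl : forall m (T : 'M[F]_(m, N)), \rank T = 3%N -> (1 < #|lines_in L T|)%N ->
    #|lines_in L T| = q.+1;
  in_sd : forall m (T : 'M[F]_(m, N)), \rank T = 4%N -> (1 < #|lines_in L T|)%N ->
    #|lines_in L T| = q.+1 \/ #|lines_in L T| = (2 * q).+1;
  in_4d : forall m (T : 'M[F]_(m, N)), \rank T = 5%N ->
    (#|lines_in L T| <= q ^ 3 - q ^ 2 + 4 * q)%N;
  in_to : (#|L| <= q ^ 5 + q ^ 4 + q ^ 3 + q ^ 2 + q + 1)%N }.

Hypothesis hL : intersection_numbers.
Implicit Types (x y z u v c : 'rV[F]_N) (l k : 'M[F]_N).

Lemma lines_inP m (T : 'M[F]_(m, N)) l :
  reflect (l \in L /\ (l <= T)%MS) (l \in lines_in L T).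
Proof. by rewrite inE; apply: andP. Qed.

Lemma in_gt1 m (T : 'M[F]_(m, N)) l k : l \in L -> k \in L -> l != k ->
  (l <= T)%MS -> (k <= T)%MS -> (1 < #|lines_in L T|)%N.
Proof. by move=> lL kL lk lT kT; apply/card_gt1P; exists l, k; rewrite !inE lL kL lk lT kT. Qed.

Lemma lines_sub_eq l k : l \in L -> k \in L -> (l <= k)%MS -> l = k.
Proof.
move=> lL kL lk; have [el rl] := in_line hL lL; have [ek rk] := in_line hL kL.
by rewrite -el -ek; apply: genmx_eqP => //; apply: sub_eq_rank lk _; rewrite rl rk.
Qed.

Lemma lines_rank3 l k : l \in L -> k \in L -> l != k -> (2 < \rank (l + k)%MS)%N.
Proof.
move=> lL kL lk; have [el rl] := in_line hL lL; have [ek rk] := in_line hL kL.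
rewrite -rl; apply: sub_notsub_rank; first exact: addsmxSl.
apply: contra lk => s; apply/eqP; apply/esym/lines_sub_eq => //.
by apply: submx_trans s; apply: addsmxSr.
Qed.

Lemma meeting_rank3 x l k : x != 0 -> l \in L -> k \in L -> l != k ->
  (x <= l)%MS -> (x <= k)%MS -> \rank (l + k)%MS = 3%N.
Proof.
move=> x0 lL kL lk xl xk; have h := lines_rank3 lL kL lk.
have := mxrank_sum_cap l k; have [_ ->] := in_line hL lL; have [_ ->] := in_line hL kL.
have : (1 <= \rank (l :&: k)%MS)%N.
  by rewrite -(rank_nz x0); apply: mxrankS; rewrite sub_capmx xl.
lia.
Qed.

(** A second common line would span, together with l, both planes. *)
Lemma planes_share_line l k j : l \in L -> k \in L -> j \in L -> l != k ->
  \rank (l + k)%MS = 3%N -> \rank (l + j)%MS = 3%N ->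
  ~~ (j <= l + k)%MS -> (#|lines_in L (l + k)%MS :&: lines_in L (l + j)%MS| <= 1)%N.
Proof.
move=> lL kL jL lk rk rj njk.
have key i : i \in lines_in L (l + k)%MS :&: lines_in L (l + j)%MS -> i = l.
  rewrite inE => /andP[/lines_inP[iL ik] /lines_inP[_ ij]].
  apply/eqP/negPn/negP => nil; case/negP: njk.
  rewrite eq_sym in nil; have r3 := lines_rank3 lL iL nil.
  have s1 : (l + i <= l + k)%MS by rewrite addsmx_sub addsmxSl ik.
  have s2 : (l + i <= l + j)%MS by rewrite addsmx_sub addsmxSl ij.
  have t2 := sub_eq_rank s2; rewrite rj in t2; move: (t2 r3) => {}t2.
  apply: submx_trans s1; apply: submx_trans t2; exact: addsmxSr.
by apply: cards_le1 => i i' /key-> /key->.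
Qed.

(** Three lines through x in no common plane span a solid and three planes with q + 1 lines each.
    Inclusion-exclusion gives at least 3q lines in the solid, more than 2q + 1. *)
Lemma pencil_coplanar x l k j : x != 0 -> l \in L -> k \in L -> j \in L -> l != k ->
  (x <= l)%MS -> (x <= k)%MS -> (x <= j)%MS -> (j <= l + k)%MS.
Proof.
move=> x0 lL kL jL lk xl xk xj; apply: contraT => njk.
have jl : l != j by apply: contraNneq njk => <-; rewrite addsmxSl.
have jk : k != j by apply: contraNneq njk => <-; rewrite addsmxSr.
have r1 := meeting_rank3 x0 lL kL lk xl xk.
have r2 := meeting_rank3 x0 lL jL jl xl xj.
have r3 := meeting_rank3 x0 kL jL jk xk xj.
have [_ rj] := in_line hL jL.
have rT : \rank (l + k + j)%MS = 4%N.
  have := mxrank_sum_cap (l + k)%MS j; rewrite r1 rj.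
  have : (1 <= \rank ((l + k) :&: j)%MS)%N.
    rewrite -(rank_nz x0); apply: mxrankS; rewrite sub_capmx xj.
    by rewrite (submx_trans xl) ?addsmxSl.
  have := sub_notsub_rank (addsmxSl (l + k)%MS j); rewrite addsmx_sub submx_refl /=.
  move/(_ njk); rewrite r1; card_lia.
set T := (l + k + j)%MS in rT.
have c1 := in_pl hL r1 (in_gt1 lL kL lk (addsmxSl _ _) (addsmxSr _ _)).
have c2 := in_pl hL r2 (in_gt1 lL jL jl (addsmxSl _ _) (addsmxSr _ _)).
have c3 := in_pl hL r3 (in_gt1 kL jL jk (addsmxSl _ _) (addsmxSr _ _)).
have i12 := planes_share_line lL kL jL lk r1 r2 njk.
have r1' : \rank (k + l)%MS = 3%N by rewrite addsmxC.
have njk' : ~~ (j <= k + l)%MS by rewrite addsmxC.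
have kl : k != l by rewrite eq_sym.
have i13 := planes_share_line kL lL jL kl r1' r3 njk'.
have i23 : (#|lines_in L (l + j)%MS :&: lines_in L (k + j)%MS| <= 1)%N.
  rewrite [(l + j)%MS]addsmxC [(k + j)%MS]addsmxC.
  apply: planes_share_line; rewrite // 1?eq_sym // 1?addsmxC //.
  apply: contra njk => klj.
  have s : (l + k <= l + j)%MS by rewrite addsmx_sub addsmxSl.
  by apply: submx_trans (addsmxSr l j) _; apply: sub_eq_rank s _; rewrite r1 r2.
have := card_three_sets (lines_in L (l + k)%MS) (lines_in L (l + j)%MS) (lines_in L (k + j)%MS).
rewrite c1 c2 c3; move: i12 i13 i23.
rewrite [lines_in L (l + k)%MS :&: lines_in L (k + j)%MS]
   (_ : _ = lines_in L (k + l)%MS :&: lines_in L (k + j)%MS); last by rewrite addsmxC.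
have : (#|lines_in L (l + k)%MS :|: lines_in L (l + j)%MS :|: lines_in L (k + j)%MS|
    <= #|lines_in L T|)%N.
  apply: subset_leq_card; apply/subsetP=> i; rewrite !inE.
  by case/orP=> [/orP[]|] /andP[-> iT]; apply: (submx_trans iT); rewrite /T; sub_sum.
have g1 : (1 < #|lines_in L T|)%N by apply: (in_gt1 lL kL lk); rewrite /T; sub_sum.
by have [->|->] := in_sd hL rT g1; have := q_gt1 F; card_lia.
Qed.

Lemma two_lines_through x : onL L x ->
  exists l k, [/\ l \in L, k \in L, l != k, (x <= l)%MS & (x <= k)%MS].
Proof.
move=> ox; have : (1 < #|lines_thru L x|)%N.
  by rewrite (in_pt hL) // ltnS; have := q_gt1 F; card_lia.
by case/card_gt1P=> l [k []]; rewrite !inE => /andP[lL xl] /andP[kL xk] lk; exists l, k.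
Qed.

Lemma Pi_two_lines x l k : onL L x -> l \in L -> k \in L -> l != k ->
  (x <= l)%MS -> (x <= k)%MS -> (Pi L x :=: l + k)%MS.
Proof.
move=> ox lL kL lk xl xk; apply/eqmxP/andP; split.
  apply/sumsmx_subP => j /andP[jL xj].
  exact: (pencil_coplanar (onL_nz ox) lL kL jL).
by rewrite addsmx_sub !line_Pi.
Qed.

Lemma rank_Pi x : onL L x -> \rank (Pi L x) = 3%N.
Proof.
move=> ox; have [l [k [lL kL lk xl xk]]] := two_lines_through ox.
by rewrite (Pi_two_lines ox lL kL lk xl xk) (meeting_rank3 (onL_nz ox)).
Qed.

Lemma line_eq_pre l x y : l \in L -> x != 0 -> ~~ (y <= x)%MS -> (x <= l)%MS ->
  (y <= l)%MS -> l = <<(x + y)%MS>>%MS.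
Proof.
move=> lL x0 yx xl yl; have [el rl] := in_line hL lL; rewrite -{1}el.
have s : (x + y <= l)%MS by rewrite addsmx_sub xl.
by apply: genmx_eqP => //; apply: sub_eq_rank s _; rewrite rank_add2 // rl.
Qed.

(** If y were on no line through x, the q(q + 1) points other than x on these lines would fit into
    the q^2 + q - 1 points of the plane different from x and y. *)
Lemma Pi_adj x y : onL L x -> (y <= Pi L x)%MS -> adj L x y.
Proof.
move=> ox yP; have x0 := onL_nz ox; apply: contraT => nxy.
have yx : ~~ (y <= x)%MS.
  by apply: contra nxy => yx; apply: adj_sub (adj_refl ox) _ yx.
have y0 := npar_nz yx.
set Lx := lines_thru L x.
pose X := pts (Pi L x) :\ normalize x :\ normalize y.
have nyx : normalize y != normalize x.
  apply: contraNneq yx => e; have := normalize_eqmx y0; rewrite e => e'.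
  by rewrite -e' normalize_eqmx.
have cX : #|X|.+1 = (q ^ 2 + q)%N.
  have := cardsD1 (normalize x) (pts (Pi L x)).
  rewrite normalize_pts ?onL_Pi // card_pts_plane ?rank_Pi // add1n addn1 => -[->].
  rewrite [RHS](cardsD1 (normalize y)) -/X.
  suff -> : normalize y \in pts (Pi L x) :\ normalize x by [].
  by rewrite in_setD1 nyx normalize_pts.
have := double_count Lx X (fun l y => (y <= l)%MS).
rewrite (eq_bigr (fun=> q)); last first.
  move=> l; rewrite inE => /andP[lL xl].
  have := cardsD1 (normalize x) (pts l).
  have [_ rl] := in_line hL lL.
  rewrite normalize_pts // card_pts_line // add1n => -[->].
  apply: eq_card => z; rewrite !inE.
  case: (eqVneq z (normalize y)) => [->|] /=.
    rewrite normalize_eqmx //; case: (boolP (y <= l)%MS) => yl; last by rewrite !andbF.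
    by case/negP: nxy; apply/adjP; exists l.
  move=> _; case: (z != normalize x) => //=.
  apply/idP/idP => [/andP[/and3P[-> -> _] ->] //|/and3P[-> -> zl]].
  by rewrite zl (submx_trans zl) ?line_Pi.
rewrite !sum_nat_const in_pt // => e.
have : (\sum_(z in X) #|[set l in Lx | (z <= l)%MS]| <= \sum_(z in X) 1)%N.
  apply: leq_sum => z; rewrite !inE => /and5P[zny znx z0 /eqP nz zP].
  have zx : ~~ (z <= x)%MS.
    apply: contra znx => zx; apply/eqP.
    apply: (@pts_par _ _ _ x); first by rewrite inE z0 nz eqxx zx.
      exact: normalize_pts.
    by rewrite normalize_eqmx.
  apply: cards_le1 => l k; rewrite !inE => /andP[/andP[lL xl] zl] /andP[/andP[kL xk] zk].
  by rewrite (line_eq_pre lL x0 zx) // (line_eq_pre kL x0 zx).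
rewrite -e sum1_card; move: cX; have := q_gt1 F; card_nia.
Qed.

(** The plane has q + 1 lines by (Pl), and the lines through x are already that many. *)
Lemma Pi_vertex x l : onL L x -> l \in L -> (l <= Pi L x)%MS -> (x <= l)%MS.
Proof.
move=> ox lL lP; pose Lx := lines_thru L x.
have s : Lx \subset lines_in L (Pi L x).
  by apply/subsetP=> k; rewrite !inE => /andP[kL xk]; rewrite kL line_Pi.
have c : #|lines_in L (Pi L x)| = #|Lx|.
  rewrite in_pt //; apply: (in_pl hL (rank_Pi ox)).
  apply: leq_trans (subset_leq_card s); rewrite in_pt // ltnS.
  by have := q_gt1 F; card_lia.
have : l \in lines_in L (Pi L x) by rewrite inE lL.
have /eqP <- : Lx == lines_in L (Pi L x) by rewrite eqEcard s c leqnn.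
by rewrite inE => /andP[].
Qed.

Lemma numbers_flat : flat L.
Proof.
split; [exact: in_line | exact: rank_Pi | exact: Pi_adj | exact: Pi_vertex].
Qed.

Let fL := numbers_flat.

Lemma card_common_lines x y : x != 0 -> ~~ (y <= x)%MS ->
  (#|lines_thru L x :&: lines_thru L y| <= 1)%N.
Proof.
move=> x0 yx; apply: cards_le1 => l k; rewrite !inE.
move=> /andP[/andP[lL xl] /andP[_ yl]] /andP[/andP[kL xk] /andP[_ yk]].
by rewrite (line_eq_pre lL x0 yx) // (line_eq_pre kL x0 yx).
Qed.

(** Two of the pencils share at most one line, which leaves at least 3q lines in a solid that admits
    2q + 1. *)
Lemma numbers_no_three_pencils : no_three_pencils L.
Proof.
move=> m T x y z rT ox oy oz yx zx zy xT yT zT.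
have [x0 y0 z0] : [/\ x != 0, y != 0 & z != 0] by split; apply: onL_nz; eassumption.
have rT4 : \rank T = 4%N.
  apply/eqP; rewrite eqn_leq rT ltnNge; apply/negP => rT3.
  case/negP: yx; apply: (Pi_eq_par fL) => //; apply: (submx_trans xT).
  by apply: sub_eq_rank yT _; rewrite rank_Pi.
have := card_three_sets (lines_thru L x) (lines_thru L y)
  (lines_thru L z).
have := card_common_lines x0 yx; have := card_common_lines x0 zx.
have := card_common_lines y0 zy; rewrite !in_pt //.
set U := _ :|: _; have sU : U \subset lines_in L T.
  apply/subsetP=> l; rewrite !inE => /orP[/orP[]|] /andP[lL s]; rewrite lL;
  by apply: submx_trans (line_Pi lL s) _.
have := subset_leq_card sU.
have [l [k [lL kL lk xl xk]]] := two_lines_through ox.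
have g1 : (1 < #|lines_in L T|)%N.
  by apply: (in_gt1 lL kL lk); apply: submx_trans xT; apply: line_Pi.
by have [->|->] := in_sd hL rT4 g1; have := q_gt1 F; card_lia.
Qed.

(** A proper quadrangle spans at most a solid T. The two neighbours of a vertex on the quadrangle
    span its plane with it, so T contains the planes of x, y and u. *)
Lemma numbers_no_quadrangle : no_quadrangle L.
Proof.
move=> x y u v x0 y0 u0 v0 xy yu uv vx nxu; apply: contraT => vy.
have [ox oy ou] : [/\ onL L x, onL L y & onL L u].
  by rewrite (adj_onL x0 xy) (adj_onL y0 yu) (adj_onL u0 uv).
have yx : ~~ (y <= x)%MS by apply: contra nxu => yx; apply: adj_sub yu (par_sym y0 yx) _.
have yx' : ~~ (x <= y)%MS by apply: npar_sym x0 yx.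
have ux : ~~ (u <= x)%MS.
  by apply: contra nxu => ux; apply: adj_sub (adj_refl ox) _ ux.
have uy : ~~ (u <= y)%MS.
  by apply: contra nxu => uy; apply: adj_sub xy _ uy.
have vx' : ~~ (v <= x)%MS.
  by apply: contra nxu => vx'; rewrite adjC; apply: adj_sub uv _ (par_sym v0 vx').
have nvxy : ~~ (v <= x + y)%MS.
  apply/negP => /sub_add2P[a [b Dv]].
  have b0 : b != 0 by apply: contraNneq vx' => b0; rewrite Dv b0 scale0r addr0 scalemx_sub.
  have a0 : a != 0 by apply: contraNneq vy => a0; rewrite Dv a0 scale0r add0r scalemx_sub.
  case/negP: nxu; rewrite adjC -[x]scale1r -(mulVf a0) -scalerA.
  have -> : a *: x = v + (- b) *: y by rewrite Dv scaleNr addrK.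
  apply: (adj_scale _ (adj_add fL ou uv _)); apply: adj_scale; by rewrite adjC.
pose T := (x + y + v + u)%MS.
have xT : (x <= T)%MS by rewrite /T; sub_sum.
have yT : (y <= T)%MS by rewrite /T; sub_sum.
have uT : (u <= T)%MS by rewrite /T; sub_sum.
have vT : (v <= T)%MS by rewrite /T; sub_sum.
exfalso; apply: (@numbers_no_three_pencils _ T x y u) => //.
- apply: leq_trans (rank_addv_le _ _) _; rewrite ltnS.
  apply: leq_trans (rank_addv_le _ _) _; rewrite ltnS.
  by apply: leq_trans (rank_addv_le _ _) _; rewrite ltnS rank_leq_row.
- by apply: (Pi_sub fL ox xy _ yx nvxy); rewrite // adjC.
- apply: (Pi_sub fL oy _ yu yx') => //; first by rewrite adjC.
  apply/negP => /sub_add2P[a [b Du]].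
  have a0 : b != 0.
    by apply: contraNneq uy => b0; rewrite Du b0 scale0r addr0 scalemx_sub.
  case/negP: nxu; rewrite Du; apply: (adj_lin fL) => //; exact: adj_refl.
have uy' : adj L u y by rewrite adjC.
apply: (Pi_sub fL ou uy' uv) => //; first exact: npar_sym uy.
apply/negP => /sub_add2P[a [b Dv]].
case: (eqVneq a 0) => [a0|a0]; first by case/negP: vy; rewrite Dv a0 scale0r add0r scalemx_sub.
case/negP: nxu; rewrite -[u]scale1r -(mulVf a0) -scalerA.
have -> : a *: u = v + (- b) *: y by rewrite Dv scaleNr addrK.
apply: (adj_scale _ (adj_add fL ox _ _)); first by rewrite adjC.
exact: adj_scale.
Qed.

End IntersectionNumbers.

(** X and Y are the second and the first moment over the nonzero functionals, r counts the rich
    ones, and K is the sum of the degrees. *)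
Lemma second_moment_arith (q b f K X Y r : nat) : (1 < q)%N ->
  (b ^ 2 + X + q * (q * (q.+1 * f)) + b * q = b * q ^ 3 + q ^ 2 * (q * (q.+1 * f)) + b ^ 2 * q)%N ->
  (b + Y = b * q ^ 3)%N ->
  (q.+2 * Y + 2 * q ^ 2 * r <= X + (q ^ 5).-1 * q.+1)%N ->
  (q.-1 * K <= 2 * r)%N ->
  (b * (q ^ 3 + 2 * q ^ 2 + 2 * q + 2) + q ^ 2 * K
   <= b ^ 2 + q ^ 2 * q.+1 * f + q.+1 * (q ^ 4 + q ^ 3 + q ^ 2 + q + 1))%N.
Proof.
case: q => [|p] //= p0 hX hY key deg; rewrite ltnS in p0.
have deg2 := leq_mul (leqnn (p.+1 ^ 2)%N) deg.
rewrite -(leq_pmul2l p0).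
have e5 : (((p.+1 ^ 5).-1).+1 = p.+1 ^ 5)%N by rewrite prednK // expn_gt0.
move: ((p.+1 ^ 5).-1)%N e5 key => Z e5 key.
have hY2 : (p.+3 * (b + Y) = p.+3 * (b * p.+1 ^ 3))%N by rewrite hY.
have hZ2 : (p.+2 * Z.+1 = p.+2 * p.+1 ^ 5)%N by rewrite e5.
rewrite !expnS !expn0 !muln1 in hX hY2 hZ2 deg2 key *.
lia.
Qed.

(** * The fourth intersection number excludes pentagons *)

Section Moments.
Variables (F : finFieldType) (N : nat) (L : {set 'M[F]_N}).
Local Notation q := #|F|.
Hypothesis hL : intersection_numbers L.
Let fL := numbers_flat hL.
Let s1 := numbers_no_three_pencils hL.
Variable (S : 'M[F]_N).
Hypothesis rS : \rank S = 5%N.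
Implicit Types (x y z u v c : 'rV[F]_N) (l k : 'M[F]_N) (phi : 'cV[F]_(\rank S)).

(* Functionals on S describe the hyperplanes (solids) of S; phi = 0 gives S itself. *)
Definition solid phi : 'M[F]_(\rank S, N) := kermx phi *m row_base S.

Lemma solid_sub phi : (solid phi <= S)%MS.
Proof. by rewrite -(eq_row_base S) submxMl. Qed.

Lemma sub_solid m (A : 'M[F]_(m, N)) phi : (A <= S)%MS ->
  (A <= solid phi)%MS = (A *m pinvmx (row_base S) *m phi == 0).
Proof.
rewrite -(eq_row_base S) => AS; rewrite -{1}(mulmxKpV AS) /solid.
by rewrite submxMfree ?row_base_free // sub_kermx.
Qed.

Lemma rank_solid phi : phi != 0 -> \rank (solid phi) = 4%N.
Proof.
move=> p0; have r1 : \rank phi = 1%N.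
  by rewrite -mxrank_tr rank_nz // -trmx0 (inj_eq trmx_inj).
by rewrite mxrankMfree ?row_base_free // mxrank_ker r1 rS.
Qed.

Lemma card_solids m (A : 'M[F]_(m, N)) : (A <= S)%MS ->
  #|[set phi | (A <= solid phi)%MS]| = (q ^ (5 - \rank A))%N.
Proof.
move=> AS; pose A' := A *m pinvmx (row_base S).
have rA : \rank A' = \rank A.
  move: AS; rewrite -(eq_row_base S) => /mulmxKpV AS.
  by rewrite -[in RHS]AS mxrankMfree ?row_base_free.
have -> : [set phi | (A <= solid phi)%MS] = trmx @^-1: [set v : 'rV_(\rank S) | (v <= kermx A'^T)%MS].
  apply/setP=> phi; rewrite !inE sub_solid // sub_kermx -trmx_mul.
  by rewrite -[RHS](inj_eq trmx_inj) trmxK trmx0.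
rewrite on_card_preimset; last by exists trmx => v; rewrite trmxK.
by rewrite card_rowspace mxrank_ker mxrank_tr rA rS.
Qed.

Local Notation LS := (lines_in L S).
Local Notation cs phi := #|lines_in L (solid phi)|.
(** A point of S lies on 0, 1 or q + 1 lines of L inside S, because two such lines span its plane.
    These are the points with q + 1. *)
Definition full_pts := locked [set x in pts S | onL L x && (Pi L x <= S)%MS].
Local Notation b := #|LS|.
Local Notation f := #|full_pts|.
Definition full_deg x := #|[set y in full_pts | (y != x) && adj L x y]|.

Lemma full_ptsP x : reflect [/\ x \in pts S, onL L x & (Pi L x <= S)%MS] (x \in full_pts).
Proof.
rewrite /full_pts -lock; apply: (iffP idP) => [|[px ox sx]]; rewrite in_set.
  by case/andP=> px /andP[ox sx].
by rewrite px ox.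
Qed.

Lemma full_npar x y : x \in full_pts -> y \in full_pts -> y != x -> ~~ (y <= x)%MS.
Proof.
case/full_ptsP=> xp _ _ /full_ptsP[yp _ _]; apply: contra => yx.
by apply/eqP; apply: (pts_par yp).
Qed.

Lemma lines_in_solid phi : lines_in L (solid phi) = [set l in LS | (l <= solid phi)%MS].
Proof.
apply/setP=> l; rewrite !inE; case: (boolP (l <= solid phi)%MS); rewrite ?andbF // => lT.
by rewrite (submx_trans lT (solid_sub phi)) !andbT.
Qed.

Lemma sum_solids : (\sum_phi cs phi = b * q ^ 3)%N.
Proof.
have := double_count [set: 'cV[F]_(\rank S)] LS (fun phi l => (l <= solid phi)%MS).
rewrite (eq_bigl xpredT); last by move=> phi; rewrite inE.
under eq_bigr do rewrite -lines_in_solid.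
move=> ->; rewrite -sum_nat_const; apply: eq_bigr => l /lines_inP[lL lS].
rewrite (eq_card (B := mem [set phi | (l <= solid phi)%MS])) => [|phi]; last by rewrite !inE.
by rewrite card_solids // (line_rank fL).
Qed.

Lemma sum_solids_sq :
  (\sum_phi cs phi ^ 2 = \sum_(l in LS) \sum_(k in LS) q ^ (5 - \rank (l + k)%MS))%N.
Proof.
have := double_count [set: 'cV[F]_(\rank S)] (setX LS LS)
  (fun phi p => (p.1 <= solid phi)%MS && (p.2 <= solid phi)%MS).
rewrite (eq_bigl xpredT); last by move=> phi; rewrite inE.
rewrite (eq_bigr (fun phi => cs phi ^ 2)%N); last first.
  move=> phi _; rewrite -mulnn -cardsX lines_in_solid; apply: eq_card => -[l k].
  by rewrite !inE /= andbACA.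
move=> ->; rewrite pair_big_dep /=; apply: eq_big => [[l k]|[l k]] /=.
  by rewrite !inE.
rewrite !inE /= => /andP[/andP[_ lS] /andP[_ kS]].
rewrite (eq_card (B := mem [set phi | (l + k <= solid phi)%MS])) => [|phi]; last first.
  by rewrite !inE addsmx_sub.
by rewrite card_solids // addsmx_sub lS.
Qed.

Definition meet_num l := #|[set k in LS | (k != l) && (\rank (l + k)%MS == 3%N)]|.

(** The rank of l + k is 2, 3 or 4 according as k equals l, meets l or is skew to l, which gives the
    weights q^3, q^2 and q. *)
Lemma sum_line l : l \in LS ->
  (\sum_(k in LS) q ^ (5 - \rank (l + k)%MS) + meet_num l * q + q
     = q ^ 3 + meet_num l * q ^ 2 + b * q)%N.
Proof.
move=> /[dup] lLS /lines_inP[lL lS].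
rewrite (bigD1 l) //=.
have -> : \rank (l + l)%MS = 2%N.
  by have /addsmx_idPr-> := submx_refl l; rewrite (line_rank fL).
rewrite (bigID (fun k => \rank (l + k)%MS == 3%N)) /=.
rewrite (eq_bigr (fun=> q ^ 2)%N); last by move=> k /andP[_ /eqP->].
rewrite [X in (_ + (_ + X))%N](eq_bigr (fun=> q)); last first.
  move=> k /andP[/andP[/lines_inP[kL kS] kl] r3].
  have := lines_rank3 hL lL kL; rewrite eq_sym kl => /(_ isT) r.
  have -> : \rank (l + k)%MS = 4%N; last by rewrite expn1.
  by move: r r3 (mxrank_sum_cap l k); rewrite (line_rank fL lL) (line_rank fL kL); card_lia.
rewrite !sum_pred_const.
have e1 : #|[set k | (k \in LS) && (k != l) && (\rank (l + k)%MS == 3%N)]| = meet_num l.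
  by apply: eq_card => k; rewrite !inE andbA.
have e2 : (#|[set k | (k \in LS) && (k != l) && (\rank (l + k)%MS != 3%N)]| + meet_num l + 1 = b)%N.
  rewrite [X in _ = X](cardsD1 l) lLS add1n addn1; congr _.+1.
  rewrite -e1 addnC -[RHS](cardID [pred k | \rank (l + k)%MS == 3%N]); congr addn.
    by apply: eq_card => k; rewrite !inE; case: (k \in L); case: (k <= S)%MS; case: (k != l); case: (_ == 3%N).
  by apply: eq_card => k; rewrite !inE; case: (k \in L); case: (k <= S)%MS; case: (k != l); case: (_ == 3%N).
rewrite e1 -e2 -[(5 - 2)%N]/3%N; move: (meet_num l); card_gen; rewrite !expnS !expn0 !muln1; lia.
Qed.

(** Another line of S that meets l does so in a full point, and each full point of l is on q further
    lines, all in S. *)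
Lemma meet_numE l : l \in LS -> meet_num l = (q * #|[set x in full_pts | (x <= l)%MS]|)%N.
Proof.
move=> /[dup] lLS /lines_inP[lL lS].
have := double_count [set x in full_pts | (x <= l)%MS]
  [set k in LS | (k != l) && (\rank (l + k)%MS == 3%N)] (fun x k => (x <= k)%MS).
rewrite (eq_bigr (fun=> q)); last first.
  move=> x; rewrite inE => /andP[/full_ptsP[/ptsP[x0 nx xS] ox xP] xl].
  apply/eqP; rewrite -eqSS -(card_lines_through fL ox) [X in _ == X](cardsD1 l) inE lL xl add1n eqSS.
  apply/eqP/eq_card => k; rewrite in_set in_set in_setD1 in_set; apply/idP/idP.
    by case/andP=> /andP[/andP[kL _] /andP[kl _]] xk; rewrite kl inE kL.
  case/andP=> kl; rewrite inE => /andP[kL xk]; rewrite kl xk (meeting_rank3 hL x0 lL kL _ xl xk) 1?eq_sym //.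
  by rewrite !andbT kL; apply: submx_trans (line_Pi kL xk) xP.
rewrite sum_nat_const mulnC => ->; rewrite /meet_num -sum1_card; apply: eq_bigr => k.
rewrite !inE => /andP[/andP[kL kS] /andP[kl /eqP r3]].
have : (0 < \rank (l :&: k)%MS)%N.
  have := mxrank_sum_cap l k; rewrite r3 (line_rank fL lL) (line_rank fL kL); card_lia.
case/nonzero_in=> x x0; rewrite sub_capmx => /andP[xl xk].
have ox : onL L x by apply/onLP=> //; exists l.
apply/esym/eqP/cards1P; exists (normalize x); apply/setP=> y; rewrite !inE.
apply/idP/eqP => [/andP[/andP[/full_ptsP[/ptsP[y0 ny yS] _ _] yl] yk]|->].
  have yx : (y <= x)%MS.
    apply/negPn/negP => yx; have e1 := line_eq fL lL x0 yx xl yl.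
    by have e2 := line_eq fL kL x0 yx xk yk; rewrite e1 -e2 eqxx in kl.
  apply: (@pts_par _ _ _ x); [by rewrite inE y0 ny eqxx | exact: normalize_pts |].
  by rewrite normalize_eqmx.
have on : onL L (normalize x) by rewrite (onL_sub _ ox) ?normalize_nz ?normalize_eqmx.
rewrite !normalize_eqmx // xl xk !andbT; apply/full_ptsP; split=> //.
  by apply: normalize_pts (submx_trans xl lS).
rewrite (PiE on (y := x)) ?normalize_eqmx // (Pi_two_lines hL ox lL kL) // 1?eq_sym //.
by rewrite addsmx_sub lS.
Qed.

Lemma sum_meet : (\sum_(l in LS) meet_num l = q * (q.+1 * f))%N.
Proof.
rewrite (eq_bigr (fun l => q * #|[set x in full_pts | (x <= l)%MS]|)%N); last exact: meet_numE.
rewrite -big_distrr /= -double_count; congr muln.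
rewrite mulnC -sum_nat_const; apply: eq_bigr => x /full_ptsP[_ ox xS].
rewrite -(card_lines_through fL ox); apply: eq_card => l; rewrite !inE.
case: (boolP (l \in L)) => //= lL; case: (boolP (x <= l)%MS) => xl; rewrite ?andbF // andbT.
by rewrite (submx_trans (line_Pi lL xl) xS).
Qed.

Lemma rank_two_Pi x y : onL L x -> onL L y -> ~~ (y <= x)%MS -> adj L x y ->
  \rank (Pi L x + Pi L y)%MS = 4%N.
Proof.
move=> ox oy yx xy; have x0 := onL_nz ox.
have := mxrank_sum_cap (Pi L x) (Pi L y); rewrite !(flat_rank fL) //.
have : (2 <= \rank (Pi L x :&: Pi L y)%MS)%N.
  rewrite -(rank_add2 x0 yx); apply: mxrankS.
  by rewrite addsmx_sub !sub_capmx !onL_Pi // -!(adjE fL) // xy adjC xy.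
have : (\rank (Pi L x :&: Pi L y)%MS < 3)%N.
  rewrite -(flat_rank fL ox); apply: sub_notsub_rank; first exact: capmxSl.
  by rewrite sub_capmx submx_refl /=; apply: contra yx; apply: (Pi_eq_par fL).
card_lia.
Qed.

Lemma full_in_solid_le2 phi : phi != 0 ->
  (#|[set x in full_pts | (Pi L x <= solid phi)%MS]| <= 2)%N.
Proof.
move=> p0; rewrite leqNgt; apply/negP => /card_gt2P[x [y [z [[]]]]].
rewrite ![_ \in [set _ in _ | _]]inE => /andP[xf xs] /andP[yf ys] /andP[zf zs] [xy yz zx].
have [_ ox _] := full_ptsP _ xf; have [_ oy _] := full_ptsP _ yf.
have [_ oz _] := full_ptsP _ zf.
apply: (@s1 _ (solid phi) x y z); rewrite ?rank_solid //; apply: full_npar => //.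
  by rewrite eq_sym.
by rewrite eq_sym.
Qed.

Definition nzf phi := phi != 0.

(** These solids attain the value 2q + 1; they carry the surplus 2q^2 in the second moment. *)
Definition rich := [set phi | nzf phi &&
  [exists x in full_pts, exists y in full_pts,
     [&& y != x, (Pi L x <= solid phi)%MS & (Pi L y <= solid phi)%MS]]].

(** The planes of two collinear full points span a solid, which is the kernel of q - 1 nonzero
    functionals. Conversely a solid holds at most two such planes, hence at most two ordered
    pairs. *)
Lemma sum_full_deg : (q.-1 * \sum_(x in full_pts) full_deg x <= 2 * #|rich|)%N.
Proof.
pose X := [set p in setX full_pts full_pts | (p.2 != p.1) && adj L p.1 p.2].
have cX : #|X| = (\sum_(x in full_pts) full_deg x)%N.
  rewrite -sum1dep_card (eq_bigl (fun p => (p.1 \in full_pts) &&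
     (p.2 \in [set y in full_pts | (y != p.1) && adj L p.1 y]))); last first.
    by case=> x y; rewrite !inE /= -!andbA.
  rewrite -(pair_big_dep (fun x => x \in full_pts)
     (fun x y => y \in [set y in full_pts | (y != x) && adj L x y]) (fun _ _ => 1%N)) /=.
  by apply: eq_bigr => x _; rewrite sum1_card.
have := double_count X rich
  (fun p phi => (Pi L p.1 <= solid phi)%MS && (Pi L p.2 <= solid phi)%MS).
rewrite (eq_bigr (fun=> q.-1)); last first.
  case=> x y; rewrite !inE /= -andbA => /and4P[xf yf yx xy].
  have [_ ox xS] := full_ptsP _ xf; have [_ oy yS] := full_ptsP _ yf.
  have sS : (Pi L x + Pi L y <= S)%MS by rewrite addsmx_sub xS.
  have := card_solids sS; rewrite rank_two_Pi ?full_npar // expn1 => <-.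
  rewrite [in RHS](cardsD1 0) inE.
  have -> : (Pi L x + Pi L y <= solid 0)%MS by rewrite sub_solid // mulmx0.
  rewrite add1n /=; apply: eq_card => phi; rewrite !inE /nzf addsmx_sub.
  case: (phi =P 0) => //= _; apply: andb_idl => /andP[xs ys].
  by apply/exists_inP; exists x => //; apply/exists_inP; exists y; rewrite // yx xs.
rewrite sum_nat_const cX mulnC => ->.
rewrite mulnC -sum_nat_const; apply: leq_sum => phi; rewrite inE => /andP[p0 _].
set Y := [set x in full_pts | (Pi L x <= solid phi)%MS].
have cY := full_in_solid_le2 p0; rewrite -/Y in cY.
(* Ordered pairs of distinct elements of Y: their number |Y|^2 - |Y| is at most 2. *)
pose Z := [set p in setX Y Y | p.2 != p.1].
apply: (@leq_trans #|Z|).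
  apply: subset_leq_card; apply/subsetP=> -[x y]; rewrite !inE /=.
  by case/andP=> /andP[/andP[-> ->] /andP[-> _]] /andP[-> ->].
have := cardsID (setX Y Y :\: Z) (setX Y Y); rewrite cardsX.
have -> : setX Y Y :\: (setX Y Y :\: Z) = Z.
  rewrite setDDr setDv set0U; apply/setIidPr/subsetP=> p.
  by rewrite in_set => /andP[].
have -> : #|setX Y Y :&: (setX Y Y :\: Z)| = #|Y|.
  have -> : setX Y Y :&: (setX Y Y :\: Z) = (fun x => (x, x)) @: Y.
    apply/setP=> -[x y]; apply/idP/imsetP.
      rewrite !inE /= => /andP[/andP[xY yY] /andP[]].
      by rewrite xY yY /= negbK => /eqP-> _; exists x; rewrite // inE.
    by case=> u uY [-> ->]; move: uY; rewrite !inE /= => ->; rewrite eqxx.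
  by rewrite card_imset // => x y [].
move: cY; card_nia.
Qed.

Lemma solid_num phi : phi != 0 ->
  [\/ cs phi = 0%N, cs phi = 1%N, cs phi = q.+1 | cs phi = (2 * q).+1].
Proof.
move=> p0; have r := rank_solid p0.
case e: (cs phi) => [|[|i]]; [by constructor 1 | by constructor 2 |].
have g : (1 < cs phi)%N by rewrite e.
by case: (in_sd hL r g) => <-; rewrite e; [constructor 3 | constructor 4].
Qed.

(** Two pencils with at most one common line already contain 2q + 1 lines. *)
Lemma rich_num phi : phi \in rich -> cs phi = (2 * q).+1.
Proof.
rewrite inE => /andP[p0 /exists_inP[x xf /exists_inP[y yf /and3P[yx xs ys]]]].
have [_ ox xS] := full_ptsP _ xf; have [_ oy yS] := full_ptsP _ yf.
have [c c1 e] : exists2 c, (c <= 1)%N &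
  (#|lines_thru L x :|: lines_thru L y| + c = q.+1 + q.+1)%N.
  exists #|lines_thru L x :&: lines_thru L y|.
    by refine (card_common_lines hL (onL_nz ox) (full_npar xf yf yx)).
  by rewrite cardsUI !(in_pt hL).
have sU : lines_thru L x :|: lines_thru L y \subset lines_in L (solid phi).
  apply/subsetP=> l; rewrite !inE => /orP[] /andP[lL s]; rewrite lL.
    exact: submx_trans (line_Pi lL s) xs.
  exact: submx_trans (line_Pi lL s) ys.
have : (q.+1 + q.+1 <= cs phi + c)%N by rewrite -e leq_add2r subset_leq_card.
by case: (solid_num p0) => ->; move: c1; have := q_gt1 F; card_lia.
Qed.

Lemma second_moment :
  (b * (q ^ 3 + 2 * q ^ 2 + 2 * q + 2) + q ^ 2 * \sum_(x in full_pts) full_deg x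
   <= b ^ 2 + q ^ 2 * q.+1 * f + q.+1 * (q ^ 4 + q ^ 3 + q ^ 2 + q + 1))%N.
Proof.
have h2 : (\sum_phi cs phi ^ 2 + q * (q * (q.+1 * f)) + b * q
   = b * q ^ 3 + q ^ 2 * (q * (q.+1 * f)) + b ^ 2 * q)%N.
  rewrite sum_solids_sq -sum_meet.
  have : (\sum_(l in LS) (\sum_(k in LS) q ^ (5 - \rank (l + k)%MS) + meet_num l * q + q)
     = \sum_(l in LS) (q ^ 3 + meet_num l * q ^ 2 + b * q))%N by apply: eq_bigr => l /sum_line.
  have e1 : (\sum_(l in LS) meet_num l * q = (\sum_(l in LS) meet_num l) * q)%N.
    by rewrite big_distrl.
  have e2 : (\sum_(l in LS) meet_num l * q ^ 2 = (\sum_(l in LS) meet_num l) * q ^ 2)%N.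
    by rewrite big_distrl.
  have e3 i : (\sum_(l in LS) i = b * i)%N by exact: sum_set_const.
  rewrite !big_split /= e1 e2 !e3.
  move: (\sum_(l in LS) \sum_(k in LS) q ^ (5 - \rank (l + k)%MS))%N.
  move: (\sum_(l in LS) meet_num l)%N; card_nia.
have h1 := sum_solids.
(* The zero functional stands for S itself and is split off from both moments. *)
have c0 : cs 0 = b.
  rewrite lines_in_solid; apply: eq_card => l; rewrite !inE.
  case: (boolP ((l \in L) && (l <= S)%MS)) => // /andP[_ lS].
  by rewrite sub_solid // mulmx0 eqxx.
(* For each solid (c - 1)(c - q - 1) is non-negative on the values 0, 1, q + 1 and 2q + 1, and it
   equals 2q^2 at the last one. *)
have key : (\sum_(phi | nzf phi) cs phi ^ 2 + \sum_(phi | nzf phi) q.+1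
   >= \sum_(phi | nzf phi) q.+2 * cs phi + 2 * q ^ 2 * #|rich|)%N.
  have -> : (2 * q ^ 2 * #|rich| = \sum_(phi | nzf phi) (phi \in rich) * (2 * q ^ 2))%N.
    rewrite mulnC -sum_nat_const big_mkcond /= [RHS]big_mkcond /=.
    apply: eq_bigr => phi _; case: (boolP (phi \in rich)) => [|_].
      by rewrite inE => /andP[-> _]; rewrite mul1n.
    by case: ifP.
  rewrite -!big_split /=; apply: leq_sum => phi p0.
  case: (boolP (phi \in rich)) => [/rich_num->|_].
    by card_nia.
  by case: (solid_num p0) => ->; have := q_gt1 F; card_nia.
have h1' : (b + \sum_(phi | nzf phi) cs phi = b * q ^ 3)%N.
  by rewrite -h1 [RHS](bigD1 0) //= c0.
have h2' : (\sum_phi cs phi ^ 2 = b ^ 2 + \sum_(phi | nzf phi) cs phi ^ 2)%N.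
  by rewrite [LHS](bigD1 0) //= c0.
rewrite {}h2' in h2.
have c5 : #|[set phi | nzf phi]| = (q ^ 5).-1.
  have e5 : (q ^ 5)%N = #|{: 'cV[F]_(\rank S)}| by rewrite card_mx muln1 rS.
  by rewrite e5 -(cardC1 (0 : 'cV[F]_(\rank S))); apply: eq_card => phi; rewrite !inE.
have {}key : (q.+2 * (\sum_(phi | nzf phi) cs phi) + 2 * q ^ 2 * #|rich|
    <= \sum_(phi | nzf phi) cs phi ^ 2 + (q ^ 5).-1 * q.+1)%N.
  by move: key; rewrite -c5 -sum_pred_const big_distrr.
exact: second_moment_arith (q_gt1 F) h2 h1' key sum_full_deg.
Qed.

End Moments.

Lemma disjoint_sum_le (T U : finType) (I : {set T}) (B : T -> {set U}) (W : {set U}) :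
  (forall i, i \in I -> B i \subset W) ->
  (forall n i j, i \in I -> j \in I -> n \in B i -> n \in B j -> i = j) ->
  (\sum_(i in I) #|B i| <= #|W|)%N.
Proof.
move=> sB dB.
rewrite (eq_bigr (fun i => #|[set n in W | n \in B i]|)); last first.
  move=> i iI; apply: eq_card => n; rewrite inE andbC.
  by case: (boolP (n \in B i)) => //= /(subsetP (sB i iI))->.
rewrite double_count -[leqRHS]muln1 -sum_set_const; apply: leq_sum => n _.
apply: cards_le1 => i j; rewrite !inE => /andP[iI ni] /andP[jI nj].
exact: dB iI jI ni nj.
Qed.

Lemma card_disjoint3 (T : finType) (A B C W : {set T}) :
  A \subset W -> B \subset W -> C \subset W ->
  (forall n, n \in A -> n \in B -> False) -> (forall n, n \in A -> n \in C -> False) ->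
  (forall n, n \in B -> n \in C -> False) -> (#|A| + #|B| + #|C| <= #|W|)%N.
Proof.
move=> sA sB sC AB AC BC.
have e0 (X Y : {set T}) : (forall n, n \in X -> n \in Y -> False) -> #|X :&: Y| = 0%N.
  move=> h; apply/eqP; rewrite cards_eq0; apply/eqP/setP=> n; rewrite !inE.
  by apply/negbTE/negP => /andP[/h].
have h1 := cardsUI A B; have h2 := cardsUI (A :|: B) C.
have e1 : #|A :&: B| = 0%N by exact: e0.
have e2 : #|(A :|: B) :&: C| = 0%N.
  by apply: e0 => n; rewrite inE => /orP[/AC|/BC].
have : (#|A :|: B :|: C| <= #|W|)%N.
  by apply: subset_leq_card; rewrite !subUset sA sB sC.
by move: h1 h2; rewrite e1 e2; card_lia.
Qed.

(** * Degrees of full points and a lower bound for the lines of a 4-space *)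

Section FullPoints.
Variables (F : finFieldType) (N : nat) (L : {set 'M[F]_N}).
Local Notation q := #|F|.
Hypothesis hL : intersection_numbers L.
Let fL := numbers_flat hL.
Let s1 := numbers_no_three_pencils hL.
Let nq := numbers_no_quadrangle hL.
Variable (S : 'M[F]_N).
Hypothesis rS : \rank S = 5%N.
Implicit Types (x y z u v c a : 'rV[F]_N) (l k n : 'M[F]_N) (phi : 'cV[F]_(\rank S)).
Local Notation LS := (lines_in L S).
Local Notation sol phi := (@solid F N S phi).
Local Notation full := (full_pts L S).
Local Notation nbrs x := [set y in full | (y != x) && adj L x y].

Lemma card_nzf m (A : 'M[F]_(m, N)) : (A <= S)%MS ->
  #|[set phi | nzf phi && (A <= sol phi)%MS]| = (q ^ (5 - \rank A)).-1.
Proof.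
move=> AS; rewrite -(card_solids rS AS) [in RHS](cardsD1 0) inE.
have -> : (A <= sol 0)%MS by rewrite sub_solid // mulmx0.
by rewrite add1n /=; apply: eq_card => phi; rewrite !inE.
Qed.

(** A neighbour y determines the solid spanned by the planes of x and y. Different neighbours give
    different solids, since a solid holds at most two full planes, and only q + 1 solids of S
    contain the plane of x. *)
Lemma full_deg_le x : x \in full -> (full_deg L S x <= q.+1)%N.
Proof.
move=> xf; have [_ ox xS] := full_ptsP _ _ _ xf.
pose Phi := [set phi | nzf phi && (Pi L x <= sol phi)%MS].
have := double_count (nbrs x) Phi (fun y phi => (Pi L y <= sol phi)%MS).
rewrite (eq_bigr (fun=> q.-1)); last first.
  move=> y; rewrite inE => /andP[yf /andP[yx xy]].
  have [_ oy yS] := full_ptsP _ _ _ yf.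
  have sS : (Pi L x + Pi L y <= S)%MS by rewrite addsmx_sub xS.
  have := card_nzf sS; rewrite (rank_two_Pi hL) ?(full_npar xf yf) // expn1 => <-.
  by apply: eq_card => phi; rewrite !inE addsmx_sub andbA.
rewrite sum_set_const => e.
have : (\sum_(phi in Phi) #|[set y in nbrs x | (Pi L y <= sol phi)%MS]| <= #|Phi|)%N.
  rewrite -[leqRHS]muln1 -sum_set_const; apply: leq_sum => phi.
  rewrite inE => /andP[p0 xp]; have := full_in_solid_le2 hL rS p0.
  rewrite (cardsD1 x) inE xf xp /= add1n ltnS; apply: leq_trans.
  apply: subset_leq_card; apply/subsetP=> y.
  by rewrite !inE => /andP[/andP[-> /andP[-> _]] ->].
rewrite -e (card_nzf xS) (flat_rank fL ox) /full_deg -[(5 - 3)%N]/2%N.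
by have := q_gt1 F; card_nia.
Qed.

Lemma Pi_meet x a : x \in full -> a \in full -> exists z, [/\ z != 0, adj L x z & adj L z a].
Proof.
case/full_ptsP=> _ ox xS /full_ptsP[_ oa aS].
have [|z z0] := @nonzero_in _ _ _ (Pi L x :&: Pi L a)%MS.
  by have := rank_cap_ge xS aS; rewrite !(flat_rank fL) // rS; card_lia.
by rewrite sub_capmx -!(adjE fL) // => /andP[xz az]; exists z; rewrite z0 xz adjC.
Qed.

(** The planes of x and a meet because 3 + 3 > 5. The plane of a common point z is spanned by z, x
    and a, so z is again full. *)
Lemma common_nbr x a : x \in full -> a \in full -> ~~ adj L x a ->
  exists y, [/\ y \in full, y != x, adj L x y, y != a & adj L y a].
Proof.
move=> xf af nxa; have [z [z0 xz za]] := Pi_meet xf af.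
have [/ptsP[x0 _ xS] ox sx] := full_ptsP _ _ _ xf.
have [/ptsP[a0 _ aS] oa sa] := full_ptsP _ _ _ af.
have oz := adj_onR z0 xz; have on := normalize_nz z0; have en := normalize_eqmx z0.
have xz' : adj L x (normalize z) by apply: adj_sub xz _ _; rewrite ?en.
have za' : adj L (normalize z) a by apply: adj_sub za _ _; rewrite ?en.
have nxz : normalize z != x by apply: contraNneq nxa => <-.
have nza : normalize z != a by apply: contraNneq nxa => <-.
exists (normalize z); split=> //; apply/full_ptsP; split.
- by rewrite normalize_pts // (submx_trans _ sx) // -(adjE fL).
- exact: adj_onR xz'.
rewrite (PiE (adj_onR on xz') (y := z)) ?en //.
have zx : adj L z x by rewrite adjC.
apply: (Pi_sub fL oz zx za) => //; last by rewrite (submx_trans _ sx) // -(adjE fL).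
  by apply: contra nxa => xz1; apply: adj_sub za xz1 _.
apply: contra nxa => az; apply: (adj_comb x0 xz); first exact: addsmxSl.
by rewrite addsmxC.
Qed.

Section LowerBound.
Variables x a : 'rV[F]_N.
Hypotheses (xf : x \in full) (af : a \in full) (nxa : ~~ adj L x a).

Lemma common_nbr_uniq z v : z != 0 -> adj L x z -> adj L z a ->
  (v <= Pi L x)%MS -> (v <= Pi L a)%MS -> (v <= z)%MS.
Proof.
move=> z0 xz za; case: (eqVneq v 0) => [->|v0]; first by move=> *; rewrite sub0mx.
have [/ptsP[x0 _ _] ox _] := full_ptsP _ _ _ xf; have [/ptsP[a0 _ _] oa _] := full_ptsP _ _ _ af.
rewrite -!(adjE fL) // => xv av; apply: (nq x0 z0 a0 v0) => //; by rewrite adjC.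
Qed.

(** If some other line of the solid meets l in x', all lines that meet l pass through x': otherwise
    x', a second such point and the point of m in [Pi x'] would have their planes in the solid. Then
    q + 1 lines fail to be skew to l, so that the total must be 2q + 1. In the remaining case only l
    itself fails. *)
Lemma skew_lines_in_solid l m : l \in L -> m \in L -> (l :&: m)%MS = 0 ->
  (q <= #|[set n in lines_in L (l + m)%MS | \rank (l + n)%MS == 4%N]|)%N.
Proof.
move=> lL mL lm; have rT : \rank (l + m)%MS = 4%N.
  by rewrite mxrank_disjoint_sum // !(line_rank fL).
have nlm : l != m.
  apply/eqP => e; have : \rank (l :&: m)%MS = 0%N by rewrite lm mxrank0.
  by rewrite -e; have /capmx_idPl-> := submx_refl l; rewrite (line_rank fL).
have g1 := in_gt1 lL mL nlm (addsmxSl l m) (addsmxSr l m).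
pose X := [set n in lines_in L (l + m)%MS | \rank (l + n)%MS != 4%N].
pose A := [set n in lines_in L (l + m)%MS | \rank (l + n)%MS == 4%N].
have cA : (#|A| + #|X| = #|lines_in L (l + m)%MS|)%N.
  rewrite -[RHS](cardsID [set n | \rank (l + n)%MS == 4%N]); congr addn.
    by apply: eq_card => n; rewrite !inE.
  by apply: eq_card => n; rewrite !inE andbC.
have mA : m \in A by rewrite inE rT eqxx inE mL addsmxSr.
have A0 : (0 < #|A|)%N by apply/card_gt0P; exists m.
have meet n : n \in X -> n != l -> exists x', [/\ onL L x', (x' <= l)%MS, (x' <= n)%MS
    & (Pi L x' <= l + m)%MS].
  rewrite inE => /andP[/lines_inP[nL nT] r4] nl.
  have [|x' x0'] := @nonzero_in _ _ _ (l :&: n)%MS.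
    have := mxrank_sum_cap l n; rewrite (line_rank fL lL) (line_rank fL nL).
    have /mxrankS : (l + n <= l + m)%MS by rewrite addsmx_sub addsmxSl.
    by move: r4; rewrite rT; card_lia.
  rewrite sub_capmx => /andP[xl xn].
  have ox' : onL L x' by apply/onLP=> //; exists l.
  exists x'; split=> //; rewrite (Pi_two_lines hL ox' lL nL) // 1?eq_sym //.
  by rewrite addsmx_sub addsmxSl.
have sep u (d : 'rV[F]_N) : (u <= l)%MS -> (d <= m)%MS -> d != 0 -> ~~ (d <= u)%MS.
  move=> ul dm d0; apply: contra d0 => du.
  have : (d <= l :&: m)%MS by rewrite sub_capmx (submx_trans du).
  by rewrite lm submx0.
case: (boolP [exists n in X, n != l]) => [/exists_inP[n nX nl]|/exists_inPn h].
  have [x' [ox' xl xn xT]] := meet n nX nl.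
  have x0' := onL_nz ox'.
  have eX : X = lines_thru L x'.
    apply/setP=> k; apply/idP/idP => [kX|].
      have [kL kT] : k \in L /\ (k <= l + m)%MS by move: kX; rewrite inE => /andP[/lines_inP].
      rewrite inE kL /=; case: (eqVneq k l) => [->//|kl].
      have [x2 [ox2 x2l x2k x2T]] := meet k kX kl.
      apply: contraT => nxk.
      have nx2 : ~~ (x2 <= x')%MS.
        apply: contra nxk => h; apply: submx_trans x2k; exact: par_sym (onL_nz ox2) h.
      have [|d d0] := @nonzero_in _ _ _ (Pi L x' :&: m)%MS.
        have := rank_cap_ge xT (addsmxSr l m).
        by rewrite rT (flat_rank fL ox') (line_rank fL mL); card_lia.
      rewrite sub_capmx => /andP[dx dm].
      have od : onL L d by apply/onLP=> //; exists m.
      have dx' := sep _ _ xl dm d0; have dx2 := sep _ _ x2l dm d0.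
      exfalso; apply: (@s1 _ (l + m)%MS x' x2 d) => //; first by rewrite rT.
      have [e [ed de em]] := line_basis fL mL d0 dm.
      have xd : adj L x' d by rewrite (adjE fL).
      have eT : (e <= l + m)%MS.
        by apply: submx_trans (addsmxSr l m); rewrite em genmxE addsmxSr.
      apply: (Pi_sub fL od _ de (y := x')) => //; rewrite 1?adjC //.
      - exact: npar_sym dx'.
      - apply/negP => /sub_add2P[i [j De]].
        have j0 : j != 0.
          by apply: contraNneq ed => j0; rewrite De j0 scale0r addr0 scalemx_sub.
        have : (x' <= m)%MS.
          have -> : x' = j^-1 *: (e - i *: d) by rewrite De addrAC subrr add0r scalerA mulVf ?scale1r.
          by rewrite scalemx_sub // em genmxE addmx_sub ?addsmxSr // eqmx_opp scalemx_sub ?addsmxSl.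
        by move=> xm; case/negP: (sep _ _ xl xm x0').
      - by rewrite (submx_trans dm) ?addsmxSr.
      by rewrite (submx_trans xl) ?addsmxSl.
    rewrite inE => /andP[kL xk]; rewrite !inE kL (submx_trans (line_Pi kL xk) xT) /=.
    case: (eqVneq k l) => [->|kl].
      by have /addsmx_idPr-> := submx_refl l; rewrite (line_rank fL).
    by rewrite (meeting_rank3 hL x0') // eq_sym.
  move: cA A0; rewrite eX (in_pt hL) //.
  by case: (in_sd hL rT g1) => ->; rewrite -/A; card_lia.
have : (#|X| <= 1)%N.
  apply: cards_le1 => n n' /h; rewrite negbK => /eqP->.
  by move/h; rewrite negbK => /eqP->.
move: cA; case: (in_sd hL rT g1) => ->; rewrite -/A; card_lia.
Qed.

(** Three disjoint families: the q + 1 lines through x; the q further lines through each full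
    neighbour of x; and, for a line l through x missing the common neighbour z and each of the q
    lines m through a other than az, q lines of the solid l + m skew to l. *)
Lemma lines_lower_bound : (q ^ 2 + q + 1 + q * full_deg L S x <= #|LS|)%N.
Proof.
have [/ptsP[x0 _ xS] ox sx] := full_ptsP _ _ _ xf; have [/ptsP[a0 _ aS] oa sa] := full_ptsP _ _ _ af.
have [z [z0 xz za]] := Pi_meet xf af.
have zx : ~~ (z <= x)%MS by apply: contra nxa => zx; apply: adj_sub za (par_sym z0 zx) _.
have zna : ~~ (z <= a)%MS.
  by apply: contra nxa => h; apply: adj_sub xz _ (par_sym z0 h).
have [|y0 xy0 y0n] := @Pi_out _ _ _ fL _ (x + z)%MS x ox; first by rewrite rank_add2.
have yx0 : ~~ (y0 <= x)%MS.
  by apply: contra y0n => h; rewrite (submx_trans h) ?addsmxSl.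
pose l : 'M[F]_N := <<(x + y0)%MS>>%MS.
have lL : l \in L by exact: line_in.
have xl : (x <= l)%MS by rewrite genmxE addsmxSl.
have zl : ~~ (z <= l)%MS.
  rewrite genmxE; apply: contra y0n => /sub_add2P[i [j Dz]]; apply/sub_add2P.
  have j0 : j != 0 by apply: contraNneq zx => j0; rewrite Dz j0 scale0r addr0 scalemx_sub.
  exists (- (j^-1 * i)), j^-1; rewrite Dz scalerDr !scalerA mulVf // scale1r addrA scaleNr.
  by rewrite addNr add0r.
have lx : (l <= Pi L x)%MS by exact: line_Pi.
have lPa v : (v <= l)%MS -> (v <= Pi L a)%MS -> v = 0.
  move=> vl va; apply/eqP; apply: contraNT zl => v0.
  apply: submx_trans (vl); apply: par_sym v0 _.
  by apply: common_nbr_uniq va; rewrite // (submx_trans vl).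
pose M := lines_thru L a :\ <<(a + z)%MS>>%MS.
have cM : #|M| = q.
  have := cardsD1 <<(a + z)%MS>>%MS (lines_thru L a).
  rewrite (in_pt hL) // inE (line_in fL) //; last by rewrite adjC.
  by rewrite genmxE addsmxSl add1n => -[].
have lM m : m \in M -> [/\ m \in L, (a <= m)%MS, (l :&: m)%MS = 0 & m != <<(a + z)%MS>>%MS].
  rewrite !inE => /and3P[maz mL am]; split=> //.
  apply/eqP/rowV0P => v; rewrite sub_capmx => /andP[vl vm]; apply: lPa => //.
  exact: submx_trans vm (line_Pi mL am).
(* The plane of a meets that of x only in z, which is off l, whereas a line and a plane of a solid
   always meet. *)
have noPa m (T : 'M[F]_(m, N)) : (\rank T <= 4)%N -> (l <= T)%MS -> ~~ (Pi L a <= T)%MS.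
  move=> rT lT; apply/negP => aT.
  have [|v v0] := @nonzero_in _ _ _ (l :&: Pi L a)%MS.
    have := rank_cap_ge lT aT; rewrite (line_rank fL lL) (flat_rank fL oa).
    by move: rT; card_lia.
  by rewrite sub_capmx => /andP[vl va]; case/eqP: v0; apply: lPa.
pose A1 := lines_thru L x.
pose A2 := [set n in LS | ~~ (x <= n)%MS && [exists y in nbrs x, (y <= n)%MS]].
pose A3 := [set n in LS | (\rank (l + n)%MS == 4%N) && [exists m in M, (n <= l + m)%MS]].
have meetl n v : n \in L -> v != 0 -> (v <= l)%MS -> (v <= n)%MS -> \rank (l + n)%MS != 4%N.
  move=> nL v0 vl vn; case: (eqVneq l n) => [<-|ln].
    by have /addsmx_idPr-> := submx_refl l; rewrite (line_rank fL).
  by rewrite (meeting_rank3 hL v0).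
have := @card_disjoint3 _ A1 A2 A3 LS.
have c1 : #|A1| = q.+1 by rewrite (in_pt hL).
have c2 : (full_deg L S x * q <= #|A2|)%N.
  rewrite /full_deg -sum_set_const.
  rewrite (eq_bigr (fun y => #|lines_thru L y :\ <<(x + y)%MS>>%MS|)); last first.
    move=> y; rewrite inE => /andP[yf /andP[yx xy]]; have [_ oy _] := full_ptsP _ _ _ yf.
    have := cardsD1 <<(x + y)%MS>>%MS (lines_thru L y).
    rewrite (in_pt hL) // inE (line_in fL) ?(full_npar xf yf) //.
    by rewrite genmxE addsmxSr add1n => -[].
  apply: disjoint_sum_le => [y yY|n y y' yY yY'].
    apply/subsetP=> n; rewrite inE inE inE => /andP[nxy /andP[nL yn]].
    move: (yY); rewrite inE => /andP[yf /andP[yx xy]]; have [_ oy sy] := full_ptsP _ _ _ yf.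
    rewrite inE inE nL (submx_trans (line_Pi nL yn) sy) /=; apply/andP; split.
      apply: contra nxy => xn; apply/eqP; apply: (line_eq fL) => //.
      exact: full_npar xf yf yx.
    by apply/exists_inP; exists y.
  rewrite !inE => /and3P[nxy nL yn] /and3P[nxy' _ yn'].
  move: yY yY'; rewrite !inE => /andP[yf /andP[yx xy]] /andP[yf' /andP[yx' xy']].
  apply/eqP; apply: contraNT nxy => yy'; apply/eqP.
  apply: (line_eq fL) => //; first exact: full_npar xf yf yx.
  apply: (flat_vertex fL) => //.
  have [/ptsP[y00 _ _] _ _] := full_ptsP _ _ _ yf.
  rewrite (line_eq fL nL y00 _ yn yn'); last by apply: (full_npar yf yf'); rewrite eq_sym.
  by rewrite genmxE addsmx_sub -!(adjE fL) // xy.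
have c3 : (q * q <= #|A3|)%N.
  rewrite -{1}cM -sum_set_const.
  apply: leq_trans (_ : \sum_(m in M) #|[set n in lines_in L (l + m)%MS | \rank (l + n)%MS == 4%N]| <= _)%N.
    by apply: leq_sum => m /lM[mL _ lm _]; apply: skew_lines_in_solid.
  apply: disjoint_sum_le => [m mM|n m m' mM mM'].
    have [mL am lm _] := lM m mM; apply/subsetP=> n; rewrite inE => /andP[/lines_inP[nL nT] r4].
    rewrite inE r4 inE nL /=; apply/andP; split.
      apply: submx_trans nT _; rewrite addsmx_sub (submx_trans lx sx).
      exact: submx_trans (line_Pi mL am) sa.
    by apply/exists_inP; exists m.
  have [mL am lm _] := lM m mM; have [mL' am' lm' _] := lM m' mM'.
  rewrite !inE => /andP[/andP[nL nT] /eqP r4] /andP[/andP[_ nT'] _].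
  apply/eqP/negPn/negP => mm'.
  have rT : \rank (l + m)%MS = 4%N by rewrite mxrank_disjoint_sum // !(line_rank fL).
  have rT' : \rank (l + m')%MS = 4%N by rewrite mxrank_disjoint_sum // !(line_rank fL).
  have t : (l + n <= l + m)%MS by rewrite addsmx_sub addsmxSl.
  have t' : (l + n <= l + m')%MS by rewrite addsmx_sub addsmxSl.
  have s := sub_eq_rank t; rewrite rT r4 in s; move: (s isT) => {}s.
  have s' := sub_eq_rank t'; rewrite rT' r4 in s'; move: (s' isT) => {}s'.
  (* Two lines m and m' would put the whole plane of a into the solid spanned by l and n. *)
  have := @noPa _ (l + n)%MS; rewrite r4 addsmxSl => /(_ isT isT)/negP; apply.
  rewrite (Pi_two_lines hL oa mL mL' mm' am am') addsmx_sub.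
  by rewrite (submx_trans _ s) ?addsmxSr // (submx_trans _ s') ?addsmxSr.
have sA1 : A1 \subset LS.
  apply/subsetP=> n; rewrite !inE => /andP[nL xn]; rewrite nL.
  exact: submx_trans (line_Pi nL xn) sx.
have sA2 : A2 \subset LS by apply/subsetP=> n; rewrite inE => /andP[].
have sA3 : A3 \subset LS by apply/subsetP=> n; rewrite inE => /andP[].
move/(_ sA1 sA2 sA3) => h.
suff hh : (#|A1| + #|A2| + #|A3| <= #|LS|)%N by move: hh c2 c3; rewrite c1; card_nia.
apply: h => n.
- by rewrite !inE => /andP[nL xn] /andP[_]; rewrite xn.
- rewrite !inE => /andP[nL xn] /andP[_ /andP[r4 _]].
  by have := meetl n x nL x0 xl xn; rewrite r4.
rewrite inE => /andP[/lines_inP[nL nS] /andP[nxn /exists_inP[y]]].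
rewrite inE => /andP[yf /andP[yx xy]] yn.
rewrite inE => /andP[_ /andP[r4 /exists_inP[m mM nT]]].
have [mL am lm maz] := lM m mM.
have [/ptsP[y00 _ _] oy sy] := full_ptsP _ _ _ yf.
have yl : ~~ (y <= l)%MS.
  by apply/negP => yl; have := meetl n y nL y00 yl yn; rewrite r4.
have rT : \rank (l + m)%MS = 4%N by rewrite mxrank_disjoint_sum // !(line_rank fL).
have lT : (l <= l + m)%MS by exact: addsmxSl.
(* Since y is off l, the solid contains the plane of x and therefore z; then m and z put the plane
   of a into it. *)
have xT : (Pi L x <= l + m)%MS.
  apply: (Pi_sub fL ox xy0 xy) => //; first by rewrite -(genmxE (x + y0)%MS).
  - exact: submx_trans xl lT.
  - by apply: submx_trans lT; rewrite genmxE addsmxSr.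
  exact: submx_trans yn nT.
have := @noPa _ (l + m)%MS; rewrite rT lT => /(_ isT isT)/negP; apply.
have [e [ea ae em]] := line_basis fL mL a0 am.
have az : adj L a z by rewrite adjC.
apply: (Pi_sub fL oa ae az) => //.
- apply: contra maz => h; apply/eqP; apply: (line_eq fL) => //.
  by rewrite em genmxE.
- by rewrite (submx_trans am) ?addsmxSr.
- by apply: submx_trans (addsmxSr l m); rewrite em genmxE addsmxSr.
by apply: submx_trans xT; rewrite -(adjE fL).
Qed.

End LowerBound.
End FullPoints.

(** * The quadratic inequality for the number of lines in a 4-space *)

Section IntegerInequalities.
Import Order.TTheory Num.Theory.
Implicit Types (l u b c d q k : int).

(** A monic quadratic is its chord over the interval from l to u minus (b - l)(u - b), which is
    non-negative there. *)
Lemma quadratic_convex l u b c d :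
  l * l - c * l + d < 0 -> u * u - c * u + d < 0 -> l <= b -> b <= u ->
  b * b - c * b + d < 0.
Proof.
move=> fl fu bl bu; case: (eqVneq b l) => [->//|nbl].
have id : (u - l) * (b * b - c * b + d) = (u - b) * (l * l - c * l + d)
   + (b - l) * (u * u - c * u + d) - (u - l) * ((b - l) * (u - b)) by ring.
have h1 : 0 <= (u - l) * ((b - l) * (u - b)).
  by apply: mulr_ge0; [lia | apply: mulr_ge0; lia].
move: (b * b - c * b + d) (l * l - c * l + d) (u * u - c * u + d) fl fu id.
move=> B A C fl fu id.
have h2 : (u - b) * A <= 0 by apply: mulr_ge0_le0; lia.
have h3 : (b - l) * C < 0 by rewrite pmulr_rlt0 //; lia.
rewrite ltNge; apply/negP => B0.
have : 0 <= (u - l) * B by apply: mulr_ge0; lia.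
lia.
Qed.

(** After the shift q = p + 2 all coefficients are positive. *)
Lemma quintic_pos q : 2 <= q ->
  0 < 7 * q ^+ 5 - 30 * q ^+ 4 + 51 * q ^+ 3 - 44 * q ^+ 2 + 24 * q - 4.
Proof.
move=> q2; have [p -> p0] : exists2 p : int, q = p + 2 & 0 <= p.
  by exists (q - 2); lia.
have -> : 7 * (p + 2) ^+ 5 - 30 * (p + 2) ^+ 4 + 51 * (p + 2) ^+ 3 - 44 * (p + 2) ^+ 2
    + 24 * (p + 2) - 4
   = 7 * p ^+ 5 + 40 * p ^+ 4 + 91 * p ^+ 3 + 102 * p ^+ 2 + 60 * p + 20 by ring.
have := exprn_ge0 5 p0; have := exprn_ge0 4 p0; have := exprn_ge0 3 p0.
have := exprn_ge0 2 p0; move: (p ^+ 5) (p ^+ 4) (p ^+ 3) (p ^+ 2); lia.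
Qed.

Lemma quadratic_upper q k u : 2 <= q -> 2 <= k -> k <= q + 1 ->
  u = q ^+ 3 - q ^+ 2 + 4 * q ->
  u * u - (q ^+ 3 + 2 * q ^+ 2 + 2 * q + 2) * u + (q ^+ 2 * ((q + 1 - k) * (1 + k * q))
       + (q + 1) * (q ^+ 4 + q ^+ 3 + q ^+ 2 + q + 1)) < 0.
Proof.
move=> q2 k2 kq ->.
have h1 : 4 * (k * (q + 1 - k)) <= (q + 1) * (q + 1).
  by have := sqr_ge0 (2 * k - (q + 1)); rewrite expr2; lia.
have qq : 0 <= q ^+ 2 by apply: sqr_ge0.
have qqq : 0 <= q ^+ 3 by apply: exprn_ge0; lia.
have h2 : q ^+ 3 * (4 * (k * (q + 1 - k))) <= q ^+ 3 * ((q + 1) * (q + 1)).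
  exact: ler_wpM2l.
have h3 : q ^+ 2 * (q + 1 - k) <= q ^+ 2 * (q - 1).
  by apply: ler_wpM2l => //; lia.
have h4 := quintic_pos q2.
rewrite -(pmulr_rlt0 _ (isT : 0 < 4 :> int)).
have -> : 4 * ((q ^+ 3 - q ^+ 2 + 4 * q) * (q ^+ 3 - q ^+ 2 + 4 * q)
   - (q ^+ 3 + 2 * q ^+ 2 + 2 * q + 2) * (q ^+ 3 - q ^+ 2 + 4 * q)
   + (q ^+ 2 * ((q + 1 - k) * (1 + k * q)) + (q + 1) * (q ^+ 4 + q ^+ 3 + q ^+ 2 + q + 1)))
  = - (7 * q ^+ 5 - 30 * q ^+ 4 + 51 * q ^+ 3 - 44 * q ^+ 2 + 24 * q - 4)
    + (q ^+ 3 * (4 * (k * (q + 1 - k))) - q ^+ 3 * ((q + 1) * (q + 1)))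
    + 4 * (q ^+ 2 * (q + 1 - k) - q ^+ 2 * (q - 1)) by ring.
move: h2 h3 h4; move: (_ - 4) (q ^+ 3 * _) (q ^+ 3 * _) (q ^+ 2 * _) (q ^+ 2 * _); lia.
Qed.

(** At the lower bound the quadratic is exactly -q^2 k(k - 1)(q - 1), negative because k is at least
    2. *)
Lemma quadratic_gap q k b : 2 <= q -> 2 <= k -> k <= q + 1 ->
  q ^+ 2 + q + 1 + q * k <= b -> b <= q ^+ 3 - q ^+ 2 + 4 * q ->
  b * (q ^+ 3 + 2 * q ^+ 2 + 2 * q + 2)
    <= b * b + (q ^+ 2 * ((q + 1 - k) * (1 + k * q))
       + (q + 1) * (q ^+ 4 + q ^+ 3 + q ^+ 2 + q + 1)) -> False.
Proof.
move=> q2 k2 kq lb ub h.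
have fu := quadratic_upper q2 k2 kq erefl.
set c := q ^+ 3 + 2 * q ^+ 2 + 2 * q + 2 in h fu *.
set d := q ^+ 2 * ((q + 1 - k) * (1 + k * q)) + _ in h fu *.
have fl : (q ^+ 2 + q + 1 + q * k) * (q ^+ 2 + q + 1 + q * k)
    - c * (q ^+ 2 + q + 1 + q * k) + d < 0.
  have -> : (q ^+ 2 + q + 1 + q * k) * (q ^+ 2 + q + 1 + q * k)
    - c * (q ^+ 2 + q + 1 + q * k) + d = - (q * q * (k * (k - 1) * (q - 1))).
    by rewrite /c /d; ring.
  by rewrite oppr_lt0 !mulr_gt0 //; lia.
have := quadratic_convex fl fu lb ub.
by move: h; rewrite [b * c]mulrC; move: (b * b) (c * b) => B C; lia.
Qed.

End IntegerInequalities.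

Lemma quadratic_gap_nat (q k b f K : nat) : (1 < q)%N -> (1 < k)%N -> (k <= q.+1)%N ->
  (q ^ 2 + q + 1 + q * k <= b)%N -> (b <= q ^ 3 - q ^ 2 + 4 * q)%N ->
  (b * (q ^ 3 + 2 * q ^ 2 + 2 * q + 2) + q ^ 2 * K
   <= b ^ 2 + q ^ 2 * q.+1 * f + q.+1 * (q ^ 4 + q ^ 3 + q ^ 2 + q + 1))%N ->
  (q.+1 * f <= K + (q.+1 - k) * (1 + k * q))%N -> False.
Proof.
move=> q1 k1 kq lb ub sm df.
have df2 := leq_mul (leqnn (q ^ 2)%N) df.
have [d Dd] : exists d, (q.+1 = k + d)%N by exists (q.+1 - k)%N; lia.
have [e De] : exists e, (q ^ 3 = q ^ 2 + e)%N.
  by exists (q ^ 3 - q ^ 2)%N; rewrite subnKC // leq_exp2l.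
have Dd' : (q.+1 - k = d)%N by lia.
have De' : (q ^ 3 - q ^ 2 = e)%N by lia.
rewrite Dd' in df2; rewrite De' in ub.
apply: (@quadratic_gap q%:Z k%:Z b%:Z); [lia | lia | lia | | |].
- by move: lb; rewrite expr2 -mulnn; lia.
- by rewrite !exprS !expr0; move: ub De; rewrite !expnS !expn0; lia.
have -> : q%:Z + 1 - k%:Z = d%:Z by lia.
rewrite !exprS !expr0 !mulr1; move: sm df2; rewrite !expnS !expn0 !muln1; lia.
Qed.

(** The share of one neighbour of degree j: its own deficiency and that of at most j - 1 points
    behind it, each at most q + 1 - k. *)
Lemma deficiency_term (q j k : nat) : (1 < q)%N -> (j <= q.+1)%N -> (k <= j)%N ->
  (q.+1 - j + j.-1 * (q.+1 - k) <= q * (q.+1 - k))%N.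
Proof.
move=> q1 jq kj; have [d Dd] : exists d, (q.+1 - k = d)%N by exists (q.+1 - k)%N.
rewrite Dd; case: d Dd => [|d] Dd; first by rewrite !muln0; lia.
have : (j.-1 * d <= q * d)%N by rewrite leq_mul2r; apply/orP; right; lia.
rewrite !mulnS; case: j jq kj => [|j] //= jq kj; nia.
Qed.

(** * Absence of pentagons *)

Section Pentagons.
Variables (F : finFieldType) (N : nat) (L : {set 'M[F]_N}).
Local Notation q := #|F|.
Hypothesis hL : intersection_numbers L.
Let fL := numbers_flat hL.
Let s1 := numbers_no_three_pencils hL.
Let nq := numbers_no_quadrangle hL.
Implicit Types (x y z u v c a : 'rV[F]_N) (l k n : 'M[F]_N).

Section OneSpace.
Variable (S : 'M[F]_N).
Hypothesis rS : \rank S = 5%N.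
Local Notation full := (full_pts L S).
Local Notation deg := (full_deg L S).
Local Notation nbrs x := [set y in full | (y != x) && adj L x y].

(** Every full point is x, a neighbour of x or a neighbour of such a neighbour, and no deficiency q
    + 1 - deg v exceeds that of x. *)
Lemma deficiency x : x \in full -> (forall v, v \in full -> (deg x <= deg v)%N) ->
  (q.+1 * #|full| <= \sum_(v in full) deg v + (q.+1 - deg x) * (1 + deg x * q))%N.
Proof.
move=> xf kmin; pose d v := (q.+1 - deg v)%N.
have e : (\sum_(v in full) deg v + \sum_(v in full) d v = q.+1 * #|full|)%N.
  rewrite mulnC -sum_set_const -big_split; apply: eq_bigr => v vf /=.
  by rewrite subnKC // (full_deg_le hL rS).
rewrite -e leq_add2l -/(d x) (bigD1 x) //= mulnDr muln1 leq_add2l.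
rewrite (bigID (adj L x)) /=.
rewrite (eq_bigl (fun v => v \in nbrs x)) => [|v]; last by rewrite inE andbA.
pose rest := [set v in full | (v != x) && ~~ adj L x v].
rewrite [X in (_ + X <= _)%N](eq_bigl (fun v => v \in rest)) => [|v]; last by rewrite inE andbA.
have h1 : (\sum_(v in rest) d v <= #|rest| * d x)%N.
  rewrite -sum_set_const; apply: leq_sum => v; rewrite inE => /andP[vf _].
  by rewrite leq_sub2l // kmin.
have h2 : (#|rest| <= \sum_(y in nbrs x) (deg y).-1)%N.
  rewrite -[X in (X <= _)%N]muln1 -sum_set_const.
  apply: leq_trans (_ : \sum_(v in rest) #|[set y in nbrs x | (v != y) && adj L y v]| <= _)%N.
    apply: leq_sum => v; rewrite inE => /andP[vf /andP[vx nxv]].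
    have [y [yf yx xy yv yv']] := common_nbr hL rS xf vf nxv.
    by apply/card_gt0P; exists y; rewrite !inE yf yx xy yv' eq_sym yv.
  rewrite -double_count; apply: leq_sum => y; rewrite inE => /andP[yf /andP[yx xy]].
  rewrite /full_deg [X in (_ <= X.-1)%N](cardsD1 x) inE xf eq_sym yx adjC xy add1n /=.
  apply: subset_leq_card; apply/subsetP=> v.
  by rewrite !inE => /andP[/andP[-> /andP[-> _]] ->].
have h3 : (\sum_(y in nbrs x) d y + (\sum_(y in nbrs x) (deg y).-1) * d x
    <= \sum_(y in nbrs x) q * d x)%N.
  rewrite big_distrl -big_split; apply: leq_sum => y; rewrite inE => /andP[yf _] /=.
  have := kmin y yf; have := full_deg_le hL rS yf; have := q_gt1 F; rewrite /d.
  exact: deficiency_term.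
have h4 : (\sum_(y in nbrs x) q * d x = d x * (deg x * q))%N.
  by rewrite sum_set_const [RHS]mulnCA [(d x * q)%N]mulnC.
rewrite -h4; apply: leq_trans h3; rewrite leq_add2l; apply: leq_trans h1 _.
by rewrite leq_mul2r h2 orbT.
Qed.

(** A common neighbour y of x and a is not collinear with some full v. Either v or a common
    neighbour of x and v is a second neighbour of x, so the least degree is at least 2 and the
    bounds clash. *)
Lemma full_pts_star : (exists x, x \in full) ->
  (forall u, u \in full -> exists2 v, v \in full & ~~ adj L u v) -> False.
Proof.
move=> [x0 x0f] nostar.
have [x xf kmin] : exists2 x, x \in full & forall v, v \in full -> (deg x <= deg v)%N.
  by case: (arg_minnP deg x0f) => x xf h; exists x.
have [a af nxa] := nostar x xf.
have [y [yf yx xy ya ya']] := common_nbr hL rS xf af nxa.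
have deg2 : (1 < deg x)%N.
  have [v vf nyv] := nostar y yf.
  have vy : v != y.
    by apply: contraNneq nyv => ->; apply: adj_refl; case/full_ptsP: yf.
  have vx : v != x by apply: contraNneq nyv => ->; rewrite adjC.
  apply/card_gt1P; case: (boolP (adj L x v)) => xv.
    by exists y, v; rewrite !inE yf yx xy vf vx xv eq_sym vy.
  have [y' [yf' yx' xy' yv yv']] := common_nbr hL rS xf vf xv.
  exists y, y'; rewrite !inE yf yx xy yf' yx' xy'; split=> //.
  by apply: contraNneq nyv => ->.
apply: (quadratic_gap_nat (q_gt1 F) deg2 (full_deg_le hL rS xf)
  (lines_lower_bound hL rS xf af nxa) (in_4d hL rS) (second_moment hL rS)).
exact: deficiency.
Qed.

End OneSpace.

(** If no point of yy' were collinear with x, then x, c, y, y', c' would form a pentagon whose five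
    planes lie in the 4-space spanned by [Pi x] and yy'. *)
Lemma numbers_no_pentagon : no_pentagon L.
Proof.
move=> x y y' ox y0 yy' ny'y /dist2P[c [c0 xc cy]] /dist2P[c' [c0' xc' cy']].
have x0 := onL_nz ox.
case: (boolP [exists w, [&& w != 0, (w <= y + y')%MS & adj L x w]]) => [/existsP[w /and3P[]]|].
  by exists w.
move=> /existsPn now; exfalso.
have {}now w : w != 0 -> (w <= y + y')%MS -> ~~ adj L x w.
  by move=> w0 wy; have := now w; rewrite w0 wy.
have y0' : y' != 0 by exact: npar_nz ny'y.
have nxy : ~~ adj L x y by apply: now; rewrite ?addsmxSl.
have nxy' : ~~ adj L x y' by apply: now; rewrite ?addsmxSr.
have [oc oc'] := conj (adj_onL c0 cy) (adj_onL c0' cy').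
have [oy oy'] := conj (adj_onR y0 cy) (adj_onR y0' cy').
have cx : ~~ (c <= x)%MS by apply: contra nxy => h; apply: adj_sub cy (par_sym c0 h) _.
have cx' : ~~ (c' <= x)%MS by apply: contra nxy' => h; apply: adj_sub cy' (par_sym c0' h) _.
have yc : ~~ (y <= c)%MS by apply: contra nxy => h; apply: adj_sub xc _ h.
have yc' : ~~ (y' <= c')%MS by apply: contra nxy' => h; apply: adj_sub xc' _ h.
have yx : ~~ (y <= x)%MS by apply: contra nxy => h; apply: adj_sub (adj_refl ox) _ h.
have cyy : ~~ (c <= y + y')%MS by apply/negP => h; case/negP: (now _ c0 h).
have cyy' : ~~ (c' <= y + y')%MS by apply/negP => h; case/negP: (now _ c0' h).
have ycx : ~~ (y <= c + x)%MS.
  by apply: contra nxy => h; apply: (adj_comb x0 xc); rewrite ?addsmxSl // addsmxC.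
have ycx' : ~~ (y' <= c' + x)%MS.
  by apply: contra nxy' => h; apply: (adj_comb x0 xc'); rewrite ?addsmxSl // addsmxC.
pose S := (Pi L x + (y + y'))%MS.
have yS : (y <= S)%MS by rewrite /S; sub_sum.
have yS' : (y' <= S)%MS by rewrite /S; sub_sum.
have sx : (Pi L x <= S)%MS by exact: addsmxSl.
have xS : (x <= S)%MS by exact: submx_trans (onL_Pi ox) sx.
have cS : (c <= S)%MS by apply: submx_trans sx; rewrite -(adjE fL).
have cS' : (c' <= S)%MS by apply: submx_trans sx; rewrite -(adjE fL).
have sc : (Pi L c <= S)%MS.
  by apply: (Pi_sub fL oc _ cy (npar_sym x0 cx) ycx); rewrite // adjC.
have sc' : (Pi L c' <= S)%MS.
  by apply: (Pi_sub fL oc' _ cy' (npar_sym x0 cx') ycx'); rewrite // adjC.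
have sy : (Pi L y <= S)%MS.
  by apply: (Pi_sub fL oy yy' _ ny'y cyy); rewrite // adjC.
have sy' : (Pi L y' <= S)%MS.
  apply: (Pi_sub fL oy' _ _ _ (_ : ~~ (c' <= y' + y)%MS)) => //; rewrite 1?adjC //.
    exact: npar_sym y0 ny'y.
  by rewrite addsmxC.
have rS : \rank S = 5%N.
  apply/eqP; rewrite eqn_leq; apply/andP; split.
    apply: leq_trans (_ : _ <= \rank (Pi L x) + \rank (y + y')%MS)%N _.
      exact: mxrank_adds_leqif.
    by rewrite (flat_rank fL) // rank_add2.
  (* In a solid the planes of x, c and y alone would be too many. *)
  rewrite ltnNge; apply/negP => r4.
  by apply: (@s1 _ S x c y).
have fullP u : onL L u -> (Pi L u <= S)%MS -> normalize u \in full_pts L S.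
  move=> ou su; have u0 := onL_nz ou.
  have on : onL L (normalize u) by rewrite (onL_sub _ ou) ?normalize_nz ?normalize_eqmx.
  apply/full_ptsP; split=> //.
    by apply: normalize_pts => //; apply: submx_trans (onL_Pi ou) su.
  by rewrite (PiE on (y := u)) ?normalize_eqmx.
apply: (full_pts_star rS); first by exists (normalize x); exact: fullP.
move=> n /full_ptsP[/ptsP[n0 _ _] on _].
case: (boolP [exists v in full_pts L S, ~~ adj L n v]) => [/exists_inP//|/exists_inPn all].
have {}all u : onL L u -> (Pi L u <= S)%MS -> adj L u n.
  move=> ou su; have := all _ (fullP u ou su); rewrite negbK adjC => h.
  by apply: adj_sub h _ _; rewrite // normalize_eqmx // (onL_nz ou).
exfalso.
(* A point n collinear with all full points is on both lines uv and vw, so it is v. Applied at c and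
   at c', this makes c and c' coincide. *)
have two u v w : onL L u -> onL L v -> onL L w -> (Pi L u <= S)%MS -> (Pi L v <= S)%MS ->
    (Pi L w <= S)%MS -> adj L u v -> adj L v w -> ~~ (v <= u)%MS -> ~~ (w <= v + u)%MS -> (n <= v)%MS.
  move=> ou ov ow su sv sw uv vw vu wvu.
  have nuv := triangle fL ou vu uv (all u ou su) (all v ov sv).
  have wv : ~~ (w <= v)%MS by apply: contra wvu => h; rewrite (submx_trans h) ?addsmxSl.
  have nvw := triangle fL ov wv vw (all v ov sv) (all w ow sw).
  case/sub_add2P: nvw => i [j Dn].
  case: (eqVneq j 0) => [j0|j0]; first by rewrite Dn j0 scale0r addr0 scalemx_sub.
  case/negP: wvu.
  have -> : w = j^-1 *: (n - i *: v) by rewrite Dn addrAC subrr add0r scalerA mulVf ?scale1r.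
  by rewrite scalemx_sub // addmx_sub 1?addsmxC // eqmx_opp scalemx_sub ?addsmxSr.
have nc := two x c y ox oc oy sx sc sy xc cy cx ycx.
have nc' := two x c' y' ox oc' oy' sx sc' sy' xc' cy' cx' ycx'.
have cc' : (c <= c')%MS by apply: submx_trans nc'; apply: par_sym.
case/negP: cyy; apply: (triangle fL) => //; first by rewrite adjC.
by rewrite adjC; apply: adj_sub cy' cc' _.
Qed.

End Pentagons.

(** [A] counts the lines off x with a point collinear with x and turns out to be q^3 + q^2; [X2]
    counts the points at distance at most two, at least 1 + q + q^2 + q^3 + q^4. *)
Lemma near_count_arith (q L0 X2 A B : nat) : (1 < q)%N ->
  ((q ^ 2 + q + 1) * q.+1 = q.+1 * q.+1 + A)%N -> (L0 = q.+1 + A)%N ->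
  (q ^ 2 + q + 1 + A * q <= X2)%N -> (X2 * q.+1 <= L0 * q.+1 + B)%N ->
  (q ^ 5 + q ^ 4 + q ^ 3 + q ^ 2 + q + 1 <= L0 + B)%N.
Proof.
move=> q1 e1 -> h1 h2.
have eA : (A = q * q * q + q * q)%N.
  by move: e1; rewrite -mulnn; nia.
have h3 : ((q ^ 2 + q + 1 + A * q) * q.+1 <= (q.+1 + A) * q.+1 + B)%N.
  by apply: leq_trans h2; rewrite leq_mul2r h1 orbT.
by move: h3; rewrite eA !expnS !expn0 !muln1; lia.
Qed.

(** * The total number of lines *)

Section LinesNear.
Variables (F : finFieldType) (N : nat) (L : {set 'M[F]_N}).
Local Notation q := #|F|.
Hypothesis hL : intersection_numbers L.
Let fL := numbers_flat hL.
Let nq := numbers_no_quadrangle hL.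
Let np := numbers_no_pentagon hL.
Implicit Types (x y z u v c a : 'rV[F]_N) (l k n : 'M[F]_N).

Definition near_lines x :=
  [set l in L | [exists v in [set v in pts (1%:M : 'M[F]_N) | dist2 L x v], (v <= l)%MS]].

(** By [no_pentagon], a line without a point collinear with x has at most one point at distance at
    most two. Counting incidences with these points bounds the near lines from below by the size of
    a generalized hexagon. *)
Lemma numbers_near_lines x : onL L x ->
  (q ^ 5 + q ^ 4 + q ^ 3 + q ^ 2 + q + 1 <= #|near_lines x|)%N.
Proof.
move=> ox; have x0 := onL_nz ox.
pose P := pts (1%:M : 'M[F]_N).
pose X2 := [set v in P | dist2 L x v].
pose near := [set l in L | [exists v in X2, (v <= l)%MS]].
rewrite -[near_lines x]/near.
pose L0 := [set l in L | [exists v in pts (Pi L x), (v <= l)%MS]].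
have inP m (A : 'M[F]_(m, N)) v : v \in pts A -> v \in P.
  by rewrite !inE submx1 => /and3P[-> ->].
have X2_Pi v : v \in pts (Pi L x) -> v \in X2.
  move=> /[dup] vp /ptsP[v0 _ vx]; rewrite inE (inP _ _ _ vp) adj_dist2 //.
  by rewrite (adjE fL).
have L0_all l v : l \in L0 -> v \in pts l -> v \in X2.
  rewrite inE => /andP[lL /exists_inP[c /ptsP[c0 _ cx] cl]] /[dup] vp /ptsP[v0 _ vl].
  rewrite inE (inP _ _ _ vp); apply/dist2P; exists c; rewrite c0 (adjE fL) // cx.
  by split=> //; apply/adjP; exists l.
have L0_thru l : l \in L -> (x <= l)%MS -> l \in L0.
  move=> lL xl; rewrite inE lL; apply/exists_inP; exists (normalize x).
    by rewrite normalize_pts // onL_Pi.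
  by rewrite normalize_eqmx.
have sLx : lines_thru L x \subset L0 by apply/subsetP=> l; rewrite inE => /andP[]; exact: L0_thru.
have oneP l : l \in L0 -> ~~ (x <= l)%MS -> #|[set v in pts (Pi L x) | (v <= l)%MS]| = 1%N.
  rewrite inE => /andP[lL /exists_inP[c cP cl]] nxl.
  apply/eqP/cards1P; exists c; apply/setP=> v; rewrite inE inE.
  apply/idP/eqP => [/andP[vP vl]|->]; last by rewrite cP.
  apply/eqP; apply: contraNT nxl => vc; apply: (flat_vertex fL) => //.
  have [c0 _ cx] := ptsP _ _ cP; have [v0 _ vx] := ptsP _ _ vP.
  rewrite (line_eq fL lL c0 _ cl vl); last by apply: contra vc => /(pts_par vP cP)->.
  by rewrite genmxE addsmx_sub cx.
have nL0 l v w : l \in L -> l \notin L0 -> v \in pts l -> w \in pts l ->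
    v \in X2 -> w \in X2 -> v = w.
  move=> lL lL0 vp wp; rewrite !inE => /andP[_ dv] /andP[_ dw].
  apply/eqP; apply: contraNT lL0 => vw.
  have [v0 _ vl] := ptsP _ _ vp; have [w0 _ wl] := ptsP _ _ wp.
  have wv : ~~ (w <= v)%MS by apply: contra vw => /(pts_par wp vp)->.
  have avw : adj L v w by apply/adjP; exists l.
  have [u [u0 uvw xu]] := np ox v0 avw wv dv dw.
  rewrite inE lL; apply/exists_inP; exists (normalize u).
    by rewrite normalize_pts // -(adjE fL).
  rewrite normalize_eqmx // (submx_trans uvw) // addsmx_sub vl //.
pose A := #|L0 :\: lines_thru L x|.
have cL0 : #|L0| = (q.+1 + A)%N.
  rewrite -(cardsID (lines_thru L x)) (setIidPr sLx) (in_pt hL) //.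
have e1 : ((q ^ 2 + q + 1) * q.+1 = q.+1 * q.+1 + A)%N.
  rewrite -(card_pts_plane (flat_rank fL ox)) -sum_set_const.
  have -> : (\sum_(v in pts (Pi L x)) q.+1
     = \sum_(v in pts (Pi L x)) #|[set l in L0 | (v <= l)%MS]|)%N.
    apply: eq_bigr => v vP; have [v0 _ vx] := ptsP _ _ vP.
    have ov : onL L v by apply: (adj_onR (x := x) v0); rewrite (adjE fL).
    rewrite -(in_pt hL ov); apply: eq_card => l; rewrite inE [RHS]inE.
    case: (boolP (v <= l)%MS) => vl; rewrite ?andbF // !andbT inE.
    by apply/esym/andb_idr => lL; apply/exists_inP; exists v.
  rewrite double_count (big_setID (lines_thru L x)) /= (setIidPr sLx); congr addn.
    rewrite -{1}(in_pt hL ox) -sum_set_const; apply: eq_bigr => l; rewrite inE => /andP[lL xl].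
    rewrite -(card_pts_line (line_rank fL lL)); apply: eq_card => v; rewrite !inE.
    case: (boolP (v <= l)%MS) => vl; last by rewrite !andbF.
    by rewrite (submx_trans vl (line_Pi lL xl)) !andbT.
  rewrite /A -sum1_card; apply: eq_bigr => l; rewrite in_setD => /andP[nx lL0].
  apply: oneP => //; apply: contra nx => xl; rewrite inE xl andbT.
  by move: lL0; rewrite inE => /andP[].
have h1 : (q ^ 2 + q + 1 + A * q <= #|X2|)%N.
  rewrite -(card_pts_plane (flat_rank fL ox)) -(cardsID (pts (Pi L x)) X2).
  apply: leq_add.
    apply: subset_leq_card; apply/subsetP=> v vP.
    by rewrite in_setI vP X2_Pi.
  rewrite /A -sum_set_const.
  rewrite (eq_bigr (fun l => #|pts l :\: pts (Pi L x)|)); last first.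
    move=> l; rewrite in_setD => /andP[nx lL0].
    have lL : l \in L by move: lL0; rewrite inE => /andP[].
    have nxl : ~~ (x <= l)%MS by apply: contra nx => xl; rewrite inE xl lL.
    have := cardsID (pts (Pi L x)) (pts l); rewrite (card_pts_line (line_rank fL lL)).
    have -> : #|pts l :&: pts (Pi L x)| = 1%N.
      rewrite -[RHS](oneP l) //; apply: eq_card => v; rewrite !inE.
      by case: (v != 0); case: (normalize v == v); rewrite ?andbT //= andbC.
    by rewrite add1n => -[].
  apply: disjoint_sum_le => [l|v l l'].
    rewrite in_setD => /andP[_ lL0]; apply/subsetP=> v; rewrite in_setD => /andP[nv vl].
    by rewrite in_setD nv (L0_all l).
  have dec k : k \in L0 :\: lines_thru L x -> v \in pts k :\: pts (Pi L x) ->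
      exists c, [/\ c != 0, adj L x c, (c <= k)%MS & [/\ k \in L, ~~ adj L x v, v != 0 & (v <= k)%MS]].
    case/setDP; rewrite inE => /andP[kL /exists_inP[c /ptsP[c0 nc cx] ck]] _.
    case/setDP=> /ptsP[v0 nv' vk] nv; exists c; rewrite (adjE fL) //; split=> //.
    by split=> //; apply: contra nv; rewrite (adjE fL) // => vx; rewrite inE v0 nv' eqxx.
  move=> lD lD' vl vl'; have [c [c0 xc cl [lL nxv v0 {}vl]]] := dec l lD vl.
  have [c' [c0' xc' cl' [lL' _ _ {}vl']]] := dec l' lD' vl'.
  have cv : adj L c v by apply/adjP; exists l.
  have vc' : adj L v c' by apply/adjP; exists l'.
  have c'x : adj L c' x by rewrite adjC.
  have c'c := nq x0 c0 v0 c0' xc cv vc' c'x nxv.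
  have vc : ~~ (v <= c)%MS by apply: contra nxv => h; apply: adj_sub xc _ h.
  rewrite (line_eq fL lL c0 vc cl vl) -(line_eq fL lL' c0 vc _ vl') //.
  by apply: submx_trans cl'; apply: par_sym.
have sL0 : L0 \subset near.
  apply/subsetP=> l; rewrite [in X in X -> _]inE [in X in _ -> X]inE.
  case/andP=> -> /exists_inP[v vP vl]; apply/exists_inP; exists v => //; exact: X2_Pi.
have h2 : (#|X2| * q.+1 <= #|L0| * q.+1 + #|near :\: L0|)%N.
  rewrite -!sum_set_const.
  have -> : (\sum_(v in X2) q.+1 = \sum_(v in X2) #|[set l in near | (v <= l)%MS]|)%N.
    apply: eq_bigr => v vX; have : v \in X2 := vX; rewrite inE => /andP[/ptsP[v0 _ _] /dist2P[c [c0 _ cv]]].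
    have ov : onL L v by exact: adj_onR cv.
    rewrite -(in_pt hL ov); apply: eq_card => l; rewrite inE [RHS]inE.
    case: (boolP (v <= l)%MS) => vl; rewrite ?andbF // !andbT inE.
    by apply/esym/andb_idr => lL; apply/exists_inP; exists v.
  rewrite double_count (big_setID L0) /= (setIidPr sL0); apply: leq_add.
    apply: leq_sum => l lL0; have lL : l \in L by move: lL0; rewrite inE => /andP[].
    rewrite -(card_pts_line (line_rank fL lL)); apply: subset_leq_card.
    apply/subsetP=> v; rewrite inE => /andP[]; rewrite inE => /andP[/ptsP[v0 nv _] _] vl.
    by rewrite inE v0 nv eqxx.
  rewrite -sum1_card; apply: leq_sum => l; rewrite in_setD => /andP[nl ln].
  have lL : l \in L by move: ln; rewrite inE => /andP[].
  apply: cards_le1 => v w; rewrite inE => /andP[vX vl]; rewrite inE => /andP[wX wl].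
  have tp u : u \in X2 -> (u <= l)%MS -> u \in pts l.
    by rewrite inE => /andP[/ptsP[u0 nu _] _] ul; rewrite inE u0 nu eqxx.
  by apply: (nL0 l); rewrite ?tp.
have cn : (#|near| = #|L0| + #|near :\: L0|)%N.
  by rewrite -(cardsID L0 near) (setIidPr sL0).
by rewrite cn; exact: near_count_arith (q_gt1 F) e1 cL0 h1 h2.
Qed.

(** By (To) the near lines of x are already as many as L can have. *)
Lemma numbers_lines_near : lines_near L.
Proof.
move=> x l ox lL; have sn : near_lines x \subset L by apply/subsetP=> k; rewrite inE => /andP[].
have eL : near_lines x = L.
  by apply/eqP; rewrite eqEcard sn; exact: leq_trans (in_to hL) (numbers_near_lines ox).
have : l \in near_lines x by rewrite eL.
rewrite inE => /andP[_ /exists_inP[v]]; rewrite inE => /andP[/ptsP[v0 _ _] dv] vl.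
by exists v.
Qed.

Lemma numbers_total x : onL L x -> (q ^ 5 + q ^ 4 + q ^ 3 + q ^ 2 + q + 1 <= #|L|)%N.
Proof.
move=> ox; apply: leq_trans (numbers_near_lines ox) _; apply: subset_leq_card.
by apply/subsetP=> l; rewrite inE => /andP[].
Qed.

End LinesNear.

(** * Reguli and the hyperplane of a point *)

Section FlatHexagon.
Variables (F : finFieldType) (N : nat) (L : {set 'M[F]_N}).
Local Notation q := #|F|.

(** The interface between counting and geometry. Of (Sd) it keeps only that a solid with two lines
    has more than q of them and that no solid contains three pencils. *)
Record flat_hexagon : Prop := FlatHexagon {
  fh_flat : flat L;
  fh_pencils : no_three_pencils L;
  fh_quad : no_quadrangle L;
  fh_pent : no_pentagon L;
  fh_near : lines_near L;
  fh_solid : forall m (T : 'M[F]_(m, N)) l k, \rank T = 4%N -> l \in L -> k \in L ->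
    l != k -> (l <= T)%MS -> (k <= T)%MS -> (q < #|lines_in L T|)%N }.

Hypothesis hH : flat_hexagon.
Let fL := fh_flat hH.
Let s1 := fh_pencils hH.
Let nq := fh_quad hH.
Let np := fh_pent hH.
Let ln := fh_near hH.
Implicit Types (x y z u v w c a b p s r : 'rV[F]_N) (l k n : 'M[F]_N).

Lemma common_nbr_par x y c c' : x != 0 -> y != 0 -> c != 0 -> c' != 0 -> ~~ adj L x y ->
  adj L x c -> adj L c y -> adj L x c' -> adj L c' y -> (c' <= c)%MS.
Proof.
by move=> x0 y0 c0 c0' nxy xc cy xc' cy'; apply: (nq x0 c0 y0 c0'); rewrite 1?[adj L y _]adjC 1?[adj L c' x]adjC.
Qed.

Lemma line_sub_two l x y : l \in L -> x != 0 -> ~~ (y <= x)%MS -> (x <= l)%MS -> (y <= l)%MS ->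
  (l <= x + y)%MS.
Proof.
by move=> lL x0 yx xl yl; rewrite (line_eq fL lL x0 yx xl yl) genmxE.
Qed.

(** The plane of s meets those of v and v' for reasons of dimension, so s is at distance at most two
    from z, v and v'. By [no_pentagon] it has neighbours on zv and on zv'. If s and z were not
    collinear, these would coincide as common neighbours of both, but the two lines share only z. *)
Lemma star_full m (S : 'M[F]_(m, N)) z v v' s : (\rank S <= 5)%N ->
  onL L z -> onL L v -> onL L v' -> onL L s -> adj L z v -> adj L z v' ->
  ~~ (v <= z)%MS -> ~~ (v' <= z + v)%MS ->
  (Pi L v <= S)%MS -> (Pi L v' <= S)%MS -> (Pi L s <= S)%MS -> dist2 L s z -> adj L s z.
Proof.
move=> rS oz ov ov' os zv zv' vz v'zv sv sv' ss dsz; apply: contraT => nsz.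
have [z0 v0 v0' s0] : [/\ z != 0, v != 0, v' != 0 & s != 0].
  by split; apply: onL_nz; eassumption.
have meet u : onL L u -> (Pi L u <= S)%MS -> dist2 L s u.
  move=> ou su; have [|c c0] := @nonzero_in _ _ _ (Pi L s :&: Pi L u)%MS.
    by have := rank_cap_ge ss su; rewrite !(flat_rank fL) //; move: rS; card_lia.
  rewrite sub_capmx -!(adjE fL) // => /andP[sc uc]; apply/dist2P; exists c.
  by rewrite c0 sc adjC.
have v'z : ~~ (v' <= z)%MS by apply: contra v'zv => h; rewrite (submx_trans h) ?addsmxSl.
have [c [c0 czv sc]] := np os z0 zv vz dsz (meet v ov sv).
have [c' [c0' czv' sc']] := np os z0 zv' v'z dsz (meet v' ov' sv').
have cz : adj L c z by apply: (adj_comb z0 zv); rewrite ?addsmxSl.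
have cz' : adj L c' z by apply: (adj_comb z0 zv'); rewrite ?addsmxSl.
have c'c := common_nbr_par s0 z0 c0 c0' nsz sc cz sc' cz'.
have /sub_add2P[i [j Dc]] := czv'.
case: (eqVneq j 0) => [j0|j0].
  case/negP: nsz; apply: adj_sub sc' _ _ => //; apply: par_sym => //.
  by rewrite Dc j0 scale0r addr0 scalemx_sub.
case/negP: v'zv; have -> : v' = j^-1 *: (c' - i *: z).
  by rewrite Dc addrAC subrr add0r scalerA mulVf ?scale1r.
rewrite scalemx_sub // addmx_sub //; first exact: submx_trans c'c czv.
by rewrite eqmx_opp scalemx_sub ?addsmxSl.
Qed.

Section Regulus.
Variables l m : 'M[F]_N.
Hypotheses (lL : l \in L) (mL : m \in L).
Hypothesis opp : forall x y, x != 0 -> y != 0 -> (x <= l)%MS -> (y <= m)%MS -> ~~ adj L x y.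
Local Notation T := (l + m)%MS.

Lemma opp_cap : (l :&: m)%MS = 0.
Proof.
apply/eqP/rowV0P => v; rewrite sub_capmx => /andP[vl vm].
apply/eqP; apply: contraT => v0; have := opp v0 v0 vl vm.
by rewrite adj_refl //; apply/onLP=> //; exists l.
Qed.

Lemma rank_opp : \rank T = 4%N.
Proof. by rewrite mxrank_disjoint_sum ?opp_cap // (line_rank fL lL) (line_rank fL mL). Qed.

Lemma opp_split x y : (x <= l)%MS -> (y <= m)%MS -> x + y = 0 -> x = 0 /\ y = 0.
Proof.
move=> xl ym /eqP; rewrite addr_eq0 => /eqP e.
have y0 : y = 0.
  apply/eqP; have : (y <= l :&: m)%MS by rewrite sub_capmx ym andbT -eqmx_opp -e.
  by rewrite opp_cap submx0.
by rewrite e y0 oppr0.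
Qed.

Variables x y z : 'rV[F]_N.
Hypotheses (x0 : x != 0) (y0 : y != 0) (z0 : z != 0) (xl : (x <= l)%MS) (ym : (y <= m)%MS).
Hypotheses (xz : adj L x z) (zy : adj L z y).

(** Otherwise the planes of x, y and z would all lie in the solid T. *)
Lemma mid_notin : ~~ (z <= T)%MS.
Proof.
have [ox oz oy] := And3 (adj_onL x0 xz) (adj_onL z0 zy) (adj_onR y0 zy).
have [x2 [xx2 xx2' lE]] := line_basis fL lL x0 xl.
have [y2 [yy2 yy2' mE]] := line_basis fL mL y0 ym.
have nzl : ~~ (z <= l)%MS.
  by apply/negP => zl; have := opp z0 y0 zl ym; rewrite zy.
have nzm : ~~ (z <= m)%MS.
  by apply/negP => zm; have := opp x0 z0 xl zm; rewrite xz.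
have nzx : ~~ (z <= x)%MS by apply: contra nzl => h; apply: submx_trans h xl.
have nzy : ~~ (z <= y)%MS by apply: contra nzm => h; apply: submx_trans h ym.
have nyx : ~~ (y <= x)%MS.
  by apply: contra (opp x0 y0 xl ym) => h; apply: adj_sub (adj_refl ox) _ h.
apply/negP => zT; apply: (@s1 _ T x y z); rewrite ?rank_opp //.
- apply: (Pi_sub fL ox xx2' xz) => //; first by rewrite -(genmxE (x + x2)%MS) -lE.
  + by rewrite (submx_trans xl) ?addsmxSl.
  by rewrite (submx_trans _ (addsmxSl l m)) // lE genmxE addsmxSr.
- apply: (Pi_sub fL oy yy2' _ (z := z)) => //; first by rewrite adjC.
  + by rewrite -(genmxE (y + y2)%MS) -mE.
  + by rewrite (submx_trans ym) ?addsmxSr.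
  by rewrite (submx_trans _ (addsmxSr l m)) // mE genmxE addsmxSr.
apply: (Pi_sub fL oz _ zy (y := x)) => //; first by rewrite adjC.
- exact: npar_sym x0 nzx.
- apply/negP => /sub_add2P[i [j Dy]].
  have : adj L x y by rewrite Dy; apply: (adj_lin fL) => //; exact: adj_refl.
  by apply/negP; apply: opp.
- by rewrite (submx_trans xl) ?addsmxSl.
by rewrite (submx_trans ym) ?addsmxSr.
Qed.

(** A further point s of T in [Pi z] would span that plane with x and y and so put z into T. *)
Lemma mid_cap s : (s <= T)%MS -> adj L z s -> (s <= x + y)%MS.
Proof.
move=> sT zs; apply: contraT => sxy.
have [ox oz oy] := And3 (adj_onL x0 xz) (adj_onL z0 zy) (adj_onR y0 zy).
have nyx : ~~ (y <= x)%MS.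
  by apply: contra (opp x0 y0 xl ym) => h; apply: adj_sub (adj_refl ox) _ h.
case/negP: mid_notin; apply: (@submx_trans _ _ _ _ _ _ (x + y + s)%MS).
  apply: submx_trans (onL_Pi oz) _; apply: sub_eq_rank.
    by rewrite !addsmx_sub -!(adjE fL) // adjC xz zy.
  by rewrite (flat_rank fL) // rank_addv // rank_add2.
rewrite !addsmx_sub sT (submx_trans xl) ?addsmxSl //.
by rewrite (submx_trans ym) ?addsmxSr.
Qed.

(** Take s on k at distance at most two from z, with middle point r. Unless r is on k, the space T +
    z of rank 5 contains the planes of x, y and s, and [star_full] makes s collinear with z. A point
    of T collinear with z is on xy. *)
Lemma transversal k : k \in L -> (k <= T)%MS -> exists p, [/\ p != 0, (p <= k)%MS & (p <= x + y)%MS].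
Proof.
move=> kL kT; have [ox oz oy] := And3 (adj_onL x0 xz) (adj_onL z0 zy) (adj_onR y0 zy).
have [s [s0 sk /dist2P[r [r0 zr rs]]]] := ln oz kL.
have sT := submx_trans sk kT.
case: (boolP (adj L z s)) => [zs|nzs]; first by exists s; rewrite mid_cap.
case: (boolP (r <= k)%MS) => [rk|nrk].
  by exists r; rewrite mid_cap // (submx_trans rk).
have [x2 [xx2 xx2' lE]] := line_basis fL lL x0 xl.
have [y2 [yy2 yy2' mE]] := line_basis fL mL y0 ym.
have nzT := mid_notin.
have os : onL L s by exact: adj_onR rs.
have xT : (x <= T)%MS by rewrite (submx_trans xl) ?addsmxSl.
have yT : (y <= T)%MS by rewrite (submx_trans ym) ?addsmxSr.
have xS : (x <= T + z)%MS by sub_sum.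
have yS : (y <= T + z)%MS by sub_sum.
have zS : (z <= T + z)%MS by sub_sum.
have x2S : (x2 <= T + z)%MS.
  have : (x2 <= l)%MS by rewrite lE genmxE addsmxSr.
  by move=> h; sub_sum.
have y2S : (y2 <= T + z)%MS.
  have : (y2 <= m)%MS by rewrite mE genmxE addsmxSr.
  by move=> h; sub_sum.
have nzx : ~~ (z <= x)%MS by apply: contra nzT => h; apply: submx_trans h xT.
have nyzx : ~~ (y <= z + x)%MS.
  apply/negP => /sub_add2P[i [j Dy]].
  have : adj L x y by rewrite Dy; apply: (adj_lin fL) => //; exact: adj_refl.
  by apply/negP; apply: opp.
have nzl : ~~ (z <= x + x2)%MS.
  apply: contra nzT => h; apply: submx_trans (addsmxSl l m).
  by rewrite lE genmxE.
have nzm : ~~ (z <= y + y2)%MS.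
  apply: contra nzT => h; apply: submx_trans (addsmxSr l m).
  by rewrite mE genmxE.
have yz : adj L y z by rewrite adjC.
have zx : adj L z x by rewrite adjC.
exfalso; case/negP: nzs; rewrite adjC.
have sS : (T + z <= T + z)%MS by [].
have r5 : (\rank (T + z)%MS <= 5)%N by rewrite rank_addv // rank_opp.
apply: (star_full r5 oz ox oy os zx zy _ nyzx) => //.
- exact: npar_sym nzx.
- exact: (Pi_sub fL ox xx2' xz).
- exact: (Pi_sub fL oy yy2' yz).
- have [s2 [ss2 ss2' kE]] := line_basis fL kL s0 sk.
  have sr : adj L s r by rewrite adjC.
  apply: (Pi_sub fL os ss2' sr) => //.
  + by rewrite -(genmxE (s + s2)%MS) -kE.
  + by rewrite (submx_trans sT) ?addsmxSl.
  + have : (s2 <= k)%MS by rewrite kE genmxE addsmxSr.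
    by move=> h; apply: submx_trans (submx_trans h kT) _; exact: addsmxSl.
  have rP : (r <= Pi L z)%MS by rewrite -(adjE fL).
  apply: submx_trans rP _; apply: (Pi_sub fL oz zx zy) => //.
  exact: npar_sym nzx.
by apply/dist2P; exists r; rewrite r0 adjC rs adjC.
Qed.

(** More than q lines of T each meet xy, and no point of xy is on two of them, since its plane
    contains z and would lie in T. The q points other than p cannot suffice. *)
Lemma regulus_cover p : p != 0 -> (p <= x + y)%MS ->
  exists k, [/\ k \in L, (k <= T)%MS & (p <= k)%MS].
Proof.
move=> p0 pxy; have [ox oz oy] := And3 (adj_onL x0 xz) (adj_onL z0 zy) (adj_onR y0 zy).
have nyx : ~~ (y <= x)%MS.
  by apply: contra (opp x0 y0 xl ym) => h; apply: adj_sub (adj_refl ox) _ h.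
have nlm : l != m.
  by apply/eqP => e; have := opp x0 x0 xl; rewrite -e xl adj_refl // => /(_ isT).
have cT := fh_solid hH rank_opp lL mL nlm (addsmxSl l m) (addsmxSr l m).
have zt v : (v <= x + y)%MS -> adj L z v.
  by case/sub_add2P=> i [j ->]; apply: (adj_lin fL) => //; rewrite adjC.
case: (boolP [exists k in lines_in L T, (p <= k)%MS]) => [/exists_inP[k /lines_inP[kL kT] pk]|].
  by exists k.
move=> /exists_inPn none; exfalso.
have r2 : \rank (x + y)%MS = 2%N by rewrite rank_add2.
pose X := pts (x + y)%MS :\ normalize p.
have cX : #|X| = q.
  have := cardsD1 (normalize p) (pts (x + y)%MS).
  by rewrite normalize_pts // card_pts_line // add1n => -[].
have := double_count (lines_in L T) X (fun k v => (v <= k)%MS).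
have : (\sum_(k in lines_in L T) 1 <= \sum_(k in lines_in L T) #|[set v in X | (v <= k)%MS]|)%N.
  apply: leq_sum => k kT; have /lines_inP[kL kT'] := kT.
  have [v [v0 vk vxy]] := transversal kL kT'.
  apply/card_gt0P; exists (normalize v); rewrite in_set normalize_eqmx // vk andbT in_setD1.
  rewrite normalize_pts // andbT; apply/eqP => e; case/negP: (none k kT).
  by rewrite -(normalize_eqmx p0) -e normalize_eqmx.
have : (\sum_(v in X) #|[set k in lines_in L T | (v <= k)%MS]| <= \sum_(v in X) 1)%N.
  apply: leq_sum => v; rewrite in_setD1 => /andP[_ /ptsP[v0 _ vxy]].
  apply: cards_le1 => k k'; rewrite !inE => /andP[/andP[kL kT] vk] /andP[/andP[kL' kT'] vk'].
  apply/eqP; apply: contraT => kk'.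
  have [k1 [vk1 vk1' kE]] := line_basis fL kL v0 vk.
  have [k2 [vk2 vk2' kE']] := line_basis fL kL' v0 vk'.
  have ov := adj_onL v0 vk1'.
  have sP : (Pi L v <= T)%MS.
    apply: (Pi_sub fL ov vk1' vk2') => //.
    - apply: contra kk' => h; rewrite kE'; apply/eqP.
      by apply: (line_eq fL) => //; rewrite kE genmxE.
    - exact: submx_trans vk kT.
    - by apply: submx_trans kT; rewrite kE genmxE addsmxSr.
    by apply: submx_trans kT'; rewrite kE' genmxE addsmxSr.
  by case/negP: mid_notin; apply: submx_trans sP; rewrite -(adjE fL) // adjC zt.
rewrite !sum_set_const !muln1 cX => h1 h2 e; rewrite e in h2.
by have := leq_ltn_trans (leq_trans h2 h1) cT; rewrite ltnn.
Qed.

End Regulus.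

(** A collinear pair would close the pentagon z, u, x, y, u', or a quadrangle if y is u'. *)
Lemma regulus_opp z u u' w w' : u != 0 -> u' != 0 -> adj L z u -> adj L z u' -> ~~ adj L u u' ->
  z != 0 -> adj L u w -> adj L u' w' -> ~~ (w <= z + u)%MS -> ~~ (w' <= z + u')%MS ->
  forall x y, x != 0 -> y != 0 -> (x <= <<(u + w)%MS>>)%MS -> (y <= <<(u' + w')%MS>>)%MS ->
  ~~ adj L x y.
Proof.
move=> u0 u0' zu zu' nuu' z0 uw uw' nw nw' x y x0 y0; rewrite !genmxE => xl ym.
have [ou ou'] := conj (adj_onL u0 uw) (adj_onL u0' uw').
have wu : ~~ (w <= u)%MS by apply: contra nw => h; rewrite (submx_trans h) ?addsmxSr.
have wu' : ~~ (w' <= u')%MS by apply: contra nw' => h; rewrite (submx_trans h) ?addsmxSr.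
have uz : adj L u z by rewrite adjC.
have nzu : ~~ (z <= u)%MS by apply: contra nuu' => h; apply: adj_sub zu' (par_sym z0 h) _.
have nzu' : ~~ (z <= u')%MS by apply: contra nuu' => h; apply: adj_sub uz _ (par_sym z0 h).
have nzl : ~~ (z <= u + w)%MS.
  by apply: contra nw => h; rewrite addsmxC; apply: exchange h nzu.
have nzm : ~~ (z <= u' + w')%MS.
  by apply: contra nw' => h; rewrite addsmxC; apply: exchange h nzu'.
apply/negP => xy; have ux : adj L u x by apply: (adj_comb u0 uw); rewrite ?addsmxSl.
have uy' : adj L u' y by apply: (adj_comb u0' uw'); rewrite ?addsmxSl.
case: (boolP (y <= u')%MS) => [yu'|nyu'].
  have xu' : adj L x u' by apply: adj_sub xy _ (par_sym y0 yu').
  have xz := common_nbr_par u0 u0' z0 x0 nuu' uz zu' ux xu'.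
  by case/negP: nzl; apply: submx_trans xl; apply: par_sym.
have d1 : dist2 L u u' by apply/dist2P; exists z.
have d2 : dist2 L u y by apply/dist2P; exists x.
have [v [v0 vu uv]] := np ou u0' uy' nyu' d1 d2.
have vu' : adj L v u' by apply: (adj_comb u0' uy'); rewrite ?addsmxSl.
have vz := common_nbr_par u0 u0' z0 v0 nuu' uz zu' uv vu'.
case/negP: nzm; apply: submx_trans (par_sym v0 vz) _; apply: submx_trans vu _.
by rewrite addsmx_sub addsmxSl.
Qed.

(** Three transversals coordinatize the regulus: uu', ww' and the one through u + w, which
    determines c. *)
Lemma regulus z u u' w w' : u != 0 -> u' != 0 -> adj L z u -> adj L z u' -> ~~ adj L u u' ->
  z != 0 -> adj L u w -> adj L u' w' -> ~~ (w <= z + u)%MS -> ~~ (w' <= z + u')%MS ->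
  dist2 L w w' ->
  exists c : F, [/\ c != 0, forall i j, adj L (i *: u + j *: u') (i *: w + j *: (c *: w'))
    & forall i j, ((i *: w + j *: (c *: w'))%R <= Pi L z)%MS -> i = 0 /\ j = 0].
Proof.
move=> u0 u0' zu zu' nuu' z0 uw uw' nw nw' dww'.
have opp := regulus_opp u0 u0' zu zu' nuu' z0 uw uw' nw nw'.
have [ou ou'] := conj (adj_onL u0 uw) (adj_onL u0' uw').
have wu : ~~ (w <= u)%MS by apply: contra nw => h; rewrite (submx_trans h) ?addsmxSr.
have wu' : ~~ (w' <= u')%MS by apply: contra nw' => h; rewrite (submx_trans h) ?addsmxSr.
have [w0 w0'] := conj (npar_nz wu) (npar_nz wu').
have lL := line_in fL u0 wu uw; have mL := line_in fL u0' wu' uw'.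
set l := <<_>>%MS in opp lL; set m := <<_>>%MS in opp mL.
have uz : adj L u z by rewrite adjC.
have lE v : (v <= l)%MS = (v <= u + w)%MS by rewrite genmxE.
have mE v : (v <= m)%MS = (v <= u' + w')%MS by rewrite genmxE.
have ul : (u <= l)%MS by rewrite lE addsmxSl.
have wl : (w <= l)%MS by rewrite lE addsmxSr.
have um : (u' <= m)%MS by rewrite mE addsmxSl.
have wm : (w' <= m)%MS by rewrite mE addsmxSr.
have uuw : ~~ ((u + w)%R <= u)%MS.
  by apply: contra wu => h; rewrite -(addKr u w) addmx_sub // eqmx_opp.
have uww : ~~ ((u + w)%R <= w)%MS.
  apply: contra (npar_sym u0 wu) => h.
  by rewrite -(addrK w u) addmx_sub // eqmx_opp.
have uw0 := npar_nz uuw.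
have uwl : ((u + w)%R <= l)%MS by rewrite addmx_sub.
have ouw : onL L (u + w) by apply/onLP=> //; exists l.
have [y3 [y30 y3m d3]] := ln ouw mL.
have := y3m; rewrite mE => /sub_add2P[al [be Dy3]].
(* If y3 were w', the points w and u + w of l would both be at distance at most two from w', so some
   point of l would be collinear with w'. *)
have al0 : al != 0.
  apply: contraTneq d3 => al0; apply/negP => d3.
  have w'y : (w' <= y3)%MS.
    by apply: par_sym y30 _; rewrite Dy3 al0 scale0r add0r scalemx_sub.
  have ow' : onL L w' by exact: adj_onR uw'.
  have a1 : adj L w (u + w) by apply/adjP; exists l.
  have d1 : dist2 L w' w by rewrite dist2C.
  have d2 : dist2 L w' (u + w) by rewrite dist2C; apply: dist2_sub d3 _ _.
  have [v [v0 vw wv]] := np ow' w0 a1 uww d1 d2.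
  have vl : (v <= l)%MS by apply: submx_trans vw _; rewrite addsmx_sub wl.
  by have := opp v w' v0 w0' vl wm; rewrite adjC wv.
have be0 : be != 0.
  apply: contraTneq d3 => be0; apply/negP => d3.
  have u'y : (u' <= y3)%MS.
    by apply: par_sym y30 _; rewrite Dy3 be0 scale0r addr0 scalemx_sub.
  have a1 : adj L u (u + w) by apply/adjP; exists l.
  have d1 : dist2 L u' u by apply/dist2P; exists z; rewrite z0 adjC zu' zu.
  have d2 : dist2 L u' (u + w) by rewrite dist2C; apply: dist2_sub d3 _ _.
  have [v [v0 vw wv]] := np ou' u0 a1 uuw d1 d2.
  have vl : (v <= l)%MS by apply: submx_trans vw _; rewrite addsmx_sub ul.
  by have := opp v u' v0 u0' vl um; rewrite adjC wv.
(* With this c the third transversal joins u + w to u' + c w'. *)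
pose c := be / al; have c0 : c != 0 by rewrite mulf_neq0 ?invr_eq0.
have Dy4 : u' + c *: w' = al^-1 *: y3.
  by rewrite Dy3 scalerDr !scalerA mulVf // scale1r [al^-1 * be]mulrC.
have [y40 y4m] : (u' + c *: w' != 0) /\ ((u' + c *: w')%R <= m)%MS.
  by rewrite Dy4 scaler_eq0 invr_eq0 negb_or al0 scalemx_sub.
have {}d3 : dist2 L (u + w) (u' + c *: w').
  by apply: dist2_sub d3 _ _; rewrite // Dy4 scalemx_sub.
have /dist2P[z3 [z30 uwz3 z3y4]] := d3.
have /dist2P[zw [zw0 wzw zww']] := dww'.
have split4 i j i' j' : i *: u + j *: w + (i' *: u' + j' *: w') = 0 ->
    [/\ i = 0, j = 0, i' = 0 & j' = 0].
  case/(opp_split lL opp); first by rewrite addmx_sub ?scalemx_sub.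
    by rewrite addmx_sub ?scalemx_sub.
  by case/(comb_eq0 u0 wu)=> -> -> /(comb_eq0 u0' wu')[-> ->].
exists c; split=> // i j; last first.
  move=> h; have sT : ((i *: w + j *: (c *: w'))%R <= l + m)%MS.
    by rewrite addmx_sub_adds // ?scalemx_sub // ?scalemx_sub.
  have zs : adj L z (i *: w + j *: (c *: w')) by rewrite (adjE fL) // (adj_onL z0 zu).
  have /sub_add2P[a [b e]] := mid_cap lL mL opp u0 u0' z0 ul um uz zu' sT zs.
  have : (- a) *: u + i *: w + ((- b) *: u' + (j * c) *: w') = 0.
    by rewrite addrACA -[(j * c) *: w']scalerA e !scaleNr -opprD addrC subrr.
  case/split4=> _ -> _ /eqP; rewrite mulf_eq0 (negPf c0) orbF => /eqP->; by [].
case: (eqVneq (i *: u + j *: u') 0) => [e|p0].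
  have := split4 i 0 j 0; rewrite !scale0r !addr0 => /(_ e)[-> _ -> _].
  rewrite !scale0r addr0; apply: adj_sub (adj_refl ou) _ _; exact: sub0mx.
have pE : ((i *: u + j *: u')%R <= u + u')%MS by apply/sub_add2P; exists i, j.
have [k [kL kT pk]] := regulus_cover lL mL opp u0 u0' z0 ul um uz zu' p0 pE.
(* The line k of T through p meets the other two transversals in g and t. *)
have [g [g0 gk /sub_add2P[ga [de Dg]]]] := transversal lL mL opp w0 w0' zw0 wl wm wzw zww' kL kT.
have [t [t0 tk /sub_add2P[ep [ze Dt]]]] :=
  transversal lL mL opp uw0 y40 z30 uwl y4m uwz3 z3y4 kL kT.
have gp : ~~ (g <= (i *: u + j *: u')%R)%MS.
  apply/negP => /sub_rVP[la e].
  have : (- (la * i)) *: u + ga *: w + ((- (la * j)) *: u' + de *: w') = 0.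
    rewrite addrACA -Dg e scalerDr !scalerA !scaleNr -opprD addrC subrr //.
  by case/split4=> _ ga0 _ de0; move: g0; rewrite Dg ga0 de0 !scale0r addr0 eqxx.
have /sub_add2P[a [b e]] := submx_trans tk (line_sub_two kL p0 gp pk gk).
(* As t is a combination of p and g, comparing coordinates at u, w, u', w' shows that i w + j c w'
   is a multiple of g. *)
have : (ep - a * i) *: u + (ep - b * ga) *: w + ((ze - a * j) *: u' + (ze * c - b * de) *: w') = 0.
  have e' : ep *: (u + w) + ze *: (u' + c *: w')
     = a *: (i *: u + j *: u') + b *: (ga *: w + de *: w') by rewrite -Dt e Dg.
  apply/rowP=> r; move/rowP/(_ r): e'; rewrite !mxE => e'.
  set lhs := (X in X = _) in e'; set rhs := (X in _ = X) in e'.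
  by transitivity (lhs - rhs); [rewrite /lhs /rhs; ring | rewrite e' subrr].
case/split4=> e1 e2 e3 e4; move/eqP: e1; move/eqP: e2; move/eqP: e3; move/eqP: e4.
rewrite !subr_eq0 => /eqP e4 /eqP e3 /eqP e2 /eqP e1.
have a0 : a != 0.
  apply: contraNneq t0 => a0; rewrite Dt e1 e3 a0 !mul0r !scale0r addr0 //.
have : ((i *: w + j *: (c *: w'))%R <= k)%MS.
  have -> : i *: w + j *: (c *: w') = (a^-1 * b) *: g.
    apply: (scalerI a0); rewrite [RHS]scalerA mulrA divff // mul1r Dg !scalerDr !scalerA.
    by rewrite mulrA -e1 -e3 e2 e4.
  exact: scalemx_sub.
by move=> h; apply/adjP; exists k.
Qed.

Lemma nonadj_frame z u u' : onL L z -> adj L z u -> adj L z u' ->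
  ~~ (u <= z)%MS -> ~~ (u' <= z + u)%MS -> ~~ adj L u u'.
Proof.
by move=> oz zu zu' uz u'zu; apply: contra u'zu => uu'; apply: (triangle fL).
Qed.

(** On a line through u' outside [Pi z] there is a point at distance at most two from w; multiplied
    by the scalar of [regulus] it serves as w'. *)
Lemma regulus_frame z u u' w : onL L z -> adj L z u -> adj L z u' ->
  ~~ (u <= z)%MS -> ~~ (u' <= z + u)%MS -> adj L u w -> ~~ (w <= z + u)%MS ->
  exists w', [/\ adj L u' w', forall i j, adj L (i *: u + j *: u') (i *: w + j *: w')
    & forall i j, ((i *: w + j *: w')%R <= Pi L z)%MS -> i = 0 /\ j = 0].
Proof.
move=> oz zu zu' uz u'zu uw nw; have z0 := onL_nz oz.
have nuu' := nonadj_frame oz zu zu' uz u'zu.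
have u'z : ~~ (u' <= z)%MS by apply: contra u'zu => h; rewrite (submx_trans h) ?addsmxSl.
have [u0 u0'] := conj (npar_nz uz) (npar_nz u'z).
have [ou ou'] := conj (adj_onR u0 zu) (adj_onR u0' zu').
have [|w1 uw1 nw1] := @Pi_out _ _ _ fL _ (z + u')%MS u' ou'; first by rewrite rank_add2.
have w1u' : ~~ (w1 <= u')%MS by apply: contra nw1 => h; rewrite (submx_trans h) ?addsmxSr.
have wu : ~~ (w <= u)%MS by apply: contra nw => h; rewrite (submx_trans h) ?addsmxSr.
have ow : onL L w by apply: adj_onR uw; exact: npar_nz wu.
have mL := line_in fL u0' w1u' uw1.
have [y [y0 ym dwy]] := ln ow mL; rewrite genmxE in ym.
have uy : adj L u' y by apply: (adj_comb u0' uw1); rewrite ?addsmxSl.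
have yu' : ~~ (y <= u')%MS.
  apply/negP => h; have d1 : dist2 L u' w.
    by rewrite dist2C; apply: dist2_sub dwy _ (par_sym y0 h).
  have d2 : dist2 L u' u by apply/dist2P; exists z; rewrite z0 adjC zu' zu.
  have [v [v0 vuw u'v]] := np ou' u0 uw wu d2 d1.
  have := @regulus_opp z u u' w w1 u0 u0' zu zu' nuu' z0 uw uw1 nw nw1 v u' v0 u0'.
  by rewrite !genmxE vuw addsmxSl adjC u'v => /(_ isT isT).
have yzu : ~~ (y <= z + u')%MS.
  apply: contra nw1 => h; apply: submx_trans (exchange ym yu') _.
  by rewrite addsmx_sub addsmxSr.
have [c [c0 h1 h2]] := regulus u0 u0' zu zu' nuu' z0 uw uy nw yzu dwy.
by exists (c *: y); split=> //; apply: adj_scale.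
Qed.

(** A line of the regulus leads from p out of [Pi z]; together with z it spans the plane of p. *)
Lemma Pi_comb z v v' i j : onL L z -> adj L z v -> adj L z v' ->
  ~~ (v <= z)%MS -> ~~ (v' <= z + v)%MS -> i *: v + j *: v' != 0 ->
  (Pi L (i *: v + j *: v') <= Pi L z + Pi L v + Pi L v')%MS.
Proof.
move=> oz zv zv' vz v'zv p0.
have v'z : ~~ (v' <= z)%MS by apply: contra v'zv => h; rewrite (submx_trans h) ?addsmxSl.
have [v0 v0'] := conj (npar_nz vz) (npar_nz v'z).
have [ov ov'] := conj (adj_onR v0 zv) (adj_onR v0' zv').
have [|w vw nw] := @Pi_out _ _ _ fL _ (z + v)%MS v ov; first by rewrite rank_add2 ?(onL_nz oz).
have [w' [vw' h1 h2]] := regulus_frame oz zv zv' vz v'zv vw nw.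
set p := i *: v + j *: v' in p0 *.
have zp : adj L z p by apply: (adj_lin fL).
have op : onL L p by exact: adj_onR zp.
have pz : adj L p z by rewrite adjC.
have pP : (p <= Pi L z)%MS by rewrite -(adjE fL).
apply: (Pi_sub fL op pz (h1 i j)).
- apply: contra p0 => /sub_rVP[a e].
  have : (-1) *: z + (a * i) *: v + (a * j) *: v' = 0.
    by rewrite -addrA -!scalerA -scalerDr -/p -e scaleN1r addNr.
  case/(comb3_eq0 (onL_nz oz) vz v'zv) => /eqP.
  by rewrite oppr_eq0 oner_eq0.
- apply/negP => h; case: (h2 i j).
    by apply: submx_trans h _; rewrite addsmx_sub pP onL_Pi.
  by move=> i0 j0; move: p0; rewrite /p i0 j0 !scale0r addr0 eqxx.
- by apply: submx_trans pP _; sub_sum.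
- by apply: submx_trans (onL_Pi oz) _; sub_sum.
have wP : (w <= Pi L v)%MS by rewrite -(adjE fL).
have wP' : (w' <= Pi L v')%MS by rewrite -(adjE fL).
by rewrite addmx_sub ?scalemx_sub //; sub_sum.
Qed.

(* The points not opposite z span a hyperplane, and all points of it on a line of L
   are at distance at most two from z. *)
Definition Hyper z : 'M[F]_N := (\sum_(w : 'rV[F]_N | (w != 0) && (w <= Pi L z)%MS) Pi L w)%MS.

Lemma Pi_Hyper z w : w != 0 -> (w <= Pi L z)%MS -> (Pi L w <= Hyper z)%MS.
Proof. by move=> w0 wz; rewrite (sumsmx_sup w) // w0. Qed.

Lemma dist2_Hyper z y : dist2 L z y -> (y <= Hyper z)%MS.
Proof.
case/dist2P=> c [c0 zc cy]; apply: submx_trans (Pi_Hyper c0 (adj_Pi zc)).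
exact: adj_Pi cy.
Qed.

(** By [Pi_comb] the points of [Pi z] whose planes lie in B are closed under joining two of them by
    a line that misses z. Starting from z, u, u' and u + z this reaches every point. *)
Lemma Hyper_sub m (B : 'M[F]_(m, N)) z u u' : onL L z -> adj L z u -> adj L z u' ->
  ~~ (u <= z)%MS -> ~~ (u' <= z + u)%MS ->
  (Pi L z <= B)%MS -> (Pi L u <= B)%MS -> (Pi L u' <= B)%MS -> (Pi L (u + z) <= B)%MS ->
  (Hyper z <= B)%MS.
Proof.
move=> oz zu zu' uz u'zu sz su su' suz; have z0 := onL_nz oz.
have uncomb := comb3_eq0 z0 uz u'zu.
have close v v' i j : adj L z v -> adj L z v' -> ~~ (v <= z)%MS -> ~~ (v' <= z + v)%MS ->
    (Pi L v <= B)%MS -> (Pi L v' <= B)%MS -> i *: v + j *: v' != 0 ->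
    (Pi L (i *: v + j *: v') <= B)%MS.
  move=> zv zv' vz v'zv sv sv' p0; apply: submx_trans (Pi_comb oz zv zv' vz v'zv p0) _.
  by rewrite !addsmx_sub sz sv.
have zuz : adj L z (u + z) by apply: (adj_add fL) => //; exact: adj_refl.
have uzz : ~~ ((u + z)%R <= z)%MS.
  by apply: contra uz => h; rewrite -(addrK z u) addmx_sub // eqmx_opp.
have u'zuz : ~~ (u' <= z + (u + z)%R)%MS.
  by apply: contra u'zu => h; apply: submx_trans h _; rewrite addsmx_sub addsmxSl addmx_sub ?addsmxSl ?addsmxSr.
apply/sumsmx_subP => w /andP[w0 wP].
have /sub_addvP[b /sub_add2P[c [a Dw']]] := submx_trans wP (Pi_span fL oz zu zu' uz u'zu).
have Dw : w = c *: z + a *: u + b *: u' by rewrite -Dw' subrK.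
case: (eqVneq c 0) => [c0|c0].
  move: Dw w0; rewrite c0 scale0r add0r => -> w0; exact: close.
case: (boolP ((a == 0) && (b == 0))) => [/andP[/eqP a0 /eqP b0]|ab].
  have ow : onL L w by apply: (adj_onR (x := z) w0); rewrite (adjE fL).
  rewrite (PiE ow (y := z)) //.
  by rewrite Dw a0 b0 !scale0r !addr0 scalemx_sub.
(* The point w is on the line joining u + la u' to u + z + mu u'. This line misses z exactly when mu
   and la differ, that is, when a la and b differ. *)
have [la lab] : exists la, a * la != b.
  case: (eqVneq a 0) ab => [->|a0] /=; first by exists 0; rewrite mul0r eq_sym.
  move=> _; exists (b / a + 1).
  rewrite mulrDr mulrCA divff // mulr1 mulr1 -subr_eq0 addrAC subrr add0r //.
pose mu := c^-1 * (b - (a - c) * la).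
have mula : mu != la.
  apply: contra lab => /eqP e.
  have : c * mu = b - (a - c) * la by rewrite /mu mulrA divff // mul1r.
  rewrite e => e'; have -> : a * la = (a - c) * la + c * la by ring.
  by rewrite e' addrC subrK.
have Dw2 : w = (a - c) *: (1 *: u + la *: u') + c *: (1 *: (u + z) + mu *: u').
  rewrite Dw; apply/rowP=> r; rewrite !mxE /mu.
  by field.
have nz1 (i j k : F) : i != 0 -> i *: u + j *: u' + k *: z != 0.
  move=> i0; apply: contraNneq i0 => e.
  have : k *: z + i *: u + j *: u' = 0 by rewrite -e -addrA addrC.
  by case/uncomb=> _ ->.
have v1 : 1 *: u + la *: u' != 0.
  by have := nz1 1 la 0 (oner_neq0 _); rewrite scale0r addr0.
have v2 : 1 *: (u + z) + mu *: u' != 0.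
  by have := nz1 1 mu 1 (oner_neq0 _); rewrite addrAC -scalerDr.
have zv1 : adj L z (1 *: u + la *: u') by apply: (adj_lin fL).
have zv2 : adj L z (1 *: (u + z) + mu *: u') by apply: (adj_lin fL).
have e1 : ~~ ((1 *: u + la *: u')%R <= z)%MS.
  apply/negP => /sub_rVP[k e].
  have : (- k) *: z + 1 *: u + la *: u' = 0 by rewrite -addrA e scaleNr addNr.
  by case/uncomb=> _ /eqP; rewrite oner_eq0.
have e2 : ~~ ((1 *: (u + z) + mu *: u')%R <= z + (1 *: u + la *: u')%R)%MS.
  apply/negP => /sub_add2P[i [j e]].
  have : (1 - i) *: z + (1 - j) *: u + (mu - j * la) *: u' = 0.
    apply/rowP=> r; move/rowP/(_ r): e; rewrite !mxE => e.
    set lhs := (X in X = _) in e; set rhs := (X in _ = X) in e.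
    by transitivity (lhs - rhs); [rewrite /lhs /rhs; ring | rewrite e subrr].
  case/uncomb=> _ /eqP; rewrite subr_eq0 => /eqP <- /eqP.
  by rewrite mul1r subr_eq0 (negPf mula).
rewrite Dw2 in w0 *; apply: (close (1 *: u + la *: u')) => //; exact: (close u) || exact: (close (u + z)).
Qed.

(** The regulus gives w and w' independent modulo [Pi z], hence rank 5. If the plane of u + z lay in
    this space, one of its points would be i w + j w' modulo [Pi z], and the planes of z, i u + j u'
    and u + z would share a solid. So the fourth plane raises the rank to 6, and by [Hyper_sub] this
    is all. *)
Lemma Hyper_frame z u u' : onL L z -> adj L z u -> adj L z u' ->
  ~~ (u <= z)%MS -> ~~ (u' <= z + u)%MS ->
  [/\ \rank (Pi L z + Pi L u + Pi L u')%MS = 5%N, \rank (Hyper z) = 6%N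
    & ~~ (Pi L (u + z) <= Pi L z + Pi L u + Pi L u')%MS].
Proof.
move=> oz zu zu' uz u'zu; have z0 := onL_nz oz.
have u'z : ~~ (u' <= z)%MS by apply: contra u'zu => h; rewrite (submx_trans h) ?addsmxSl.
have [u0 u0'] := conj (npar_nz uz) (npar_nz u'z).
have [ou ou'] := conj (adj_onR u0 zu) (adj_onR u0' zu').
have [|w uw nw] := @Pi_out _ _ _ fL _ (z + u)%MS u ou; first by rewrite rank_add2.
have [w' [uw' h1 h2]] := regulus_frame oz zu zu' uz u'zu uw nw.
have zP := onL_Pi oz.
have uP : (u <= Pi L z)%MS by rewrite -(adjE fL).
have uP' : (u' <= Pi L z)%MS by rewrite -(adjE fL).
have nwP : ~~ (w <= Pi L z)%MS.
  apply/negP => h; case: (h2 1 0); first by rewrite scale1r scale0r addr0.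
  by move/eqP; rewrite oner_eq0.
have nw'P : ~~ (w' <= Pi L z + w)%MS.
  apply/negP => /sub_addvP[a h]; case: (h2 (- a) 1).
    by rewrite scale1r scaleNr addrC.
  by move=> _ /eqP; rewrite oner_eq0.
pose S := (Pi L z + w + w')%MS.
have rS : \rank S = 5%N by rewrite !rank_addv // (flat_rank fL).
have [zS wS wS'] : [/\ (Pi L z <= S)%MS, (w <= S)%MS & (w' <= S)%MS].
  by rewrite /S; split; sub_sum.
have uz' : adj L u z by rewrite adjC.
have uz2 : adj L u' z by rewrite adjC.
have sub1 : (Pi L z + Pi L u + Pi L u' <= S)%MS.
  have [z1 u1 u1'] : [/\ (z <= S)%MS, (u <= S)%MS & (u' <= S)%MS].
    by rewrite !(submx_trans _ zS).
  rewrite !addsmx_sub zS /=; apply/andP; split.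
    apply: (Pi_sub fL ou uz' uw) => //; first exact: npar_sym z0 uz.
    by rewrite addsmxC.
  apply: (Pi_sub fL ou' uz2 uw') => //; first exact: npar_sym z0 u'z.
  apply: contra nw'P => h; apply: submx_trans h _; rewrite addsmx_sub.
  by rewrite (submx_trans zP) ?(submx_trans uP') ?addsmxSl.
have sub2 : (S <= Pi L z + Pi L u + Pi L u')%MS.
  have wP : (w <= Pi L u)%MS by rewrite -(adjE fL).
  have wP' : (w' <= Pi L u')%MS by rewrite -(adjE fL).
  by rewrite /S !addsmx_sub; sub_sum.
have rS' : \rank (Pi L z + Pi L u + Pi L u')%MS = 5%N.
  by rewrite -rS; apply/eqmx_rank; rewrite sub1.
have uzz : ~~ ((u + z)%R <= z)%MS.
  by apply: contra uz => h; rewrite -(addrK z u) addmx_sub // eqmx_opp.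
have zuz : adj L z (u + z) by apply: (adj_add fL) => //; exact: adj_refl.
have ouz : onL L (u + z) by apply: adj_onR zuz; exact: npar_nz uzz.
have nS : ~~ (Pi L (u + z) <= Pi L z + Pi L u + Pi L u')%MS.
  apply/negP => h; have [|w2 uw2 nw2] := @Pi_out _ _ _ fL _ (z + (u + z)%R)%MS (u + z) ouz.
    by rewrite rank_add2.
  have w2S : (w2 <= S)%MS.
    by apply: submx_trans sub1; apply: submx_trans h; rewrite -(adjE fL).
  have /sub_addvP[j /sub_addvP[i h3]] := w2S.
  have nw2P : ~~ (w2 <= Pi L z)%MS.
    by apply: contra nw2; rewrite -(adjE fL) // => zw2; apply: (triangle fL).
  pose g := i *: u + j *: u'.
  have g0 : g != 0.
    apply/eqP => e; have : 0 *: z + i *: u + j *: u' = 0 by rewrite scale0r add0r.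
    case/(comb3_eq0 z0 uz u'zu) => _ i0 j0; case/negP: nw2P; move: h3.
    by rewrite i0 j0 !scale0r !subr0.
  have zg : adj L z g by apply: (adj_lin fL).
  have og : onL L g by exact: adj_onR zg.
  have gP : ((i *: w + j *: w')%R <= Pi L g)%MS by rewrite -(adjE fL) // h1.
  have gz : ~~ (g <= z)%MS.
    apply/negP => /sub_rVP[k e].
    have : (- k) *: z + i *: u + j *: u' = 0 by rewrite -addrA -/g e scaleNr addNr.
    case/(comb3_eq0 z0 uz u'zu) => _ i0 j0; move: g0; by rewrite /g i0 j0 !scale0r addr0 eqxx.
  have w2T : (w2 <= Pi L z + Pi L g)%MS.
    have -> : w2 = (w2 - j *: w' - i *: w) + (i *: w + j *: w').
      by rewrite addrA subrK subrK.
    exact: addmx_sub_adds.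
  have uzz' : adj L (u + z) z by rewrite adjC.
  have r4 : (\rank (Pi L z + Pi L g)%MS <= 4)%N.
    have := mxrank_sum_cap (Pi L z) (Pi L g); rewrite !(flat_rank fL) //.
    have : (2 <= \rank (Pi L z :&: Pi L g)%MS)%N.
      rewrite -(rank_add2 z0 gz); apply: mxrankS.
      by rewrite addsmx_sub !sub_capmx !onL_Pi // -!(adjE fL) // zg adjC zg.
    by card_lia.
  apply: (@s1 _ (Pi L z + Pi L g)%MS z g (u + z)) => //; rewrite ?addsmxSl ?addsmxSr //.
  - apply/negP => /sub_rVP[k e].
    have : 1 *: z + (1 - k * i) *: u + (- (k * j)) *: u' = 0.
      apply/rowP=> r; move/rowP/(_ r): e; rewrite !mxE => e.
      set lhs := (X in X = _) in e; set rhs := (X in _ = X) in e.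
      by transitivity (lhs - rhs); [rewrite /lhs /rhs; ring | rewrite e subrr].
    by case/(comb3_eq0 z0 uz u'zu) => /eqP; rewrite oner_eq0.
  apply: (Pi_sub fL ouz uzz' uw2) => //.
  - by apply: npar_sym z0 uzz.
  - by rewrite addsmxC.
  - by rewrite (submx_trans _ (addsmxSl _ _)) // -(adjE fL).
  by rewrite (submx_trans zP) ?addsmxSl.
split=> //.
have sH : (Pi L z + Pi L u + Pi L u' <= Hyper z)%MS.
  by rewrite !addsmx_sub !Pi_Hyper.
have suzH : (Pi L (u + z) <= Hyper z)%MS.
  by rewrite Pi_Hyper ?(onL_nz ouz) // -(adjE fL).
apply/eqP; rewrite eqn_leq; apply/andP; split; last first.
  rewrite -rS'; apply: sub_notsub_rank => //.
  by apply: contra nS => h; apply: submx_trans suzH h.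
have [|w2 uw2 nw2] := @Pi_out _ _ _ fL _ (z + (u + z)%R)%MS (u + z) ouz.
  by rewrite rank_add2.
have : (Hyper z <= S + w2)%MS.
  have uzz' : adj L (u + z) z by rewrite adjC.
  have sS : (S <= S + w2)%MS by exact: addsmxSl.
  have t : (Pi L z + Pi L u + Pi L u' <= S + w2)%MS by exact: submx_trans sub1 sS.
  move: t; rewrite !addsmx_sub => /andP[/andP[t1 t2] t3].
  apply: (Hyper_sub oz zu zu' uz u'zu) => //.
  apply: (Pi_sub fL ouz uzz' uw2) => //.
  - by apply: npar_sym z0 uzz.
  - by rewrite addsmxC.
  - by rewrite (submx_trans _ t1) // -(adjE fL).
  - exact: submx_trans zP t1.
  exact: addsmxSr.
by move/mxrankS/leq_trans; apply; apply: leq_trans (rank_addv_le _ _) _; rewrite rS.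
Qed.

End FlatHexagon.

(** * Hyperplanes, connectedness and the 7-space carrying L *)

Section HexagonSpan.
Variables (F : finFieldType) (N : nat) (L : {set 'M[F]_N}).
Hypothesis hH : flat_hexagon L.
Let fL := fh_flat hH.
Let s1 := fh_pencils hH.
Let nq := fh_quad hH.
Let np := fh_pent hH.
Let ln := fh_near hH.
Implicit Types (x y z u v w a b p s r : 'rV[F]_N) (l n : 'M[F]_N).

Lemma nonzero_onL x y : onL L x -> y != 0 -> (y <= Pi L x)%MS -> onL L y.
Proof. by move=> ox y0 yx; apply: (adj_onR (x := x) y0); rewrite (adjE fL). Qed.

(** Each of two lines through p has a point at distance at most two from z, and this point is not
    p. *)
Lemma near_pair z p : onL L z -> onL L p -> ~~ dist2 L z p ->
  exists b1 b2, [/\ adj L p b1, adj L p b2, ~~ (b1 <= p)%MS, ~~ (b2 <= p + b1)%MS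
    & dist2 L z b1 /\ dist2 L z b2].
Proof.
move=> oz op nd; have p0 := onL_nz op.
have near y : adj L p y -> ~~ (y <= p)%MS ->
    exists b, [/\ adj L p b, ~~ (b <= p)%MS, (b <= p + y)%MS & dist2 L z b].
  move=> py yp; have [b [b0 bl db]] := ln oz (line_in fL p0 yp py).
  rewrite genmxE in bl; exists b; split=> //.
    by apply: (adj_comb p0 py); rewrite ?addsmxSl.
  by apply: contra nd => bp; apply: dist2_sub db _ (par_sym b0 bp).
have [|y1 py1 y1p] := @Pi_out _ _ _ fL _ p p op; first by rewrite rank_nz.
have [b1 [pb1 b1p b1y d1]] := near _ py1 y1p.
have [|y2 py2 y2p] := @Pi_out _ _ _ fL _ (p + b1)%MS p op; first by rewrite rank_add2.
have y2p' : ~~ (y2 <= p)%MS by apply: contra y2p => h; rewrite (submx_trans h) ?addsmxSl.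
have [b2 [pb2 b2p b2y d2]] := near _ py2 y2p'.
exists b1, b2; split=> //; apply: contra y2p => h.
by apply: submx_trans (exchange b2y b2p) _; rewrite addsmx_sub addsmxSl.
Qed.

Lemma pencil_frame z : onL L z -> exists u u', [/\ adj L z u, adj L z u', ~~ (u <= z)%MS & ~~ (u' <= z + u)%MS].
Proof.
move=> oz; have [|u zu uz] := @Pi_out _ _ _ fL _ z z oz; first by rewrite rank_nz ?(onL_nz oz).
have [|u' zu' u'z] := @Pi_out _ _ _ fL _ (z + u)%MS z oz; first by rewrite rank_add2 ?(onL_nz oz).
by exists u, u'.
Qed.

Lemma rank_Hyper z : onL L z -> \rank (Hyper L z) = 6%N.
Proof.
move=> oz; have [u [u' [zu zu' uz u'z]]] := pencil_frame oz.
by case: (Hyper_frame hH oz zu zu' uz u'z).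
Qed.

Lemma Pi_Hyper_self z : onL L z -> (Pi L z <= Hyper L z)%MS.
Proof. by move=> oz; rewrite Pi_Hyper ?onL_Pi // (onL_nz oz). Qed.

Lemma opp_Pi_Hyper z p : onL L z -> onL L p -> ~~ dist2 L z p -> (p <= Hyper L z)%MS ->
  (Pi L p <= Hyper L z)%MS.
Proof.
move=> oz op nd pH; have [b1 [b2 [pb1 pb2 b1p b2p [d1 d2]]]] := near_pair oz op nd.
by apply: (Pi_sub fL op pb1 pb2) => //; apply: dist2_Hyper.
Qed.

(** The plane of p shares a line with S because 3 + 5 - 6 = 2. A point s of this line at distance at
    most two from z has its plane in S, spanned by the line and the middle point r, so [star_full]
    applies. *)
Lemma solid5_dist2 z v v' p : onL L z -> adj L z v -> adj L z v' ->
  ~~ (v <= z)%MS -> ~~ (v' <= z + v)%MS -> onL L p -> (p <= Pi L z + Pi L v + Pi L v')%MS ->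
  (Pi L p <= Hyper L z)%MS -> dist2 L z p.
Proof.
move=> oz zv zv' vz v'zv op pS pH; have [r5 r6 _] := Hyper_frame hH oz zv zv' vz v'zv.
have z0 := onL_nz oz; have p0 := onL_nz op.
have v'z : ~~ (v' <= z)%MS by apply: contra v'zv => h; rewrite (submx_trans h) ?addsmxSl.
have [v0 v0'] := conj (npar_nz vz) (npar_nz v'z).
have [ov ov'] := conj (adj_onR v0 zv) (adj_onR v0' zv').
set S := (Pi L z + Pi L v + Pi L v')%MS in pS r5.
have [zS vS vS'] : [/\ (Pi L z <= S)%MS, (Pi L v <= S)%MS & (Pi L v' <= S)%MS].
  by rewrite /S; split; sub_sum.
have SH : (S <= Hyper L z)%MS.
  by rewrite /S !addsmx_sub !Pi_Hyper ?onL_Pi // -(adjE fL).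
have [|p2 p2PS p2p] := @outside_vector _ _ _ _ (Pi L p :&: S)%MS p.
  have := rank_cap_ge pH SH; rewrite r5 r6 (flat_rank fL op) (rank_nz p0).
  by card_lia.
move: p2PS; rewrite sub_capmx -(adjE fL) // => /andP[pp2 p2S].
have nL := line_in fL p0 p2p pp2.
have [s [s0 sn /dist2P[r [r0 zr rs]]]] := ln oz nL; rewrite genmxE in sn.
case: (boolP (r <= p + p2)%MS) => [rn|nrn].
  by apply/dist2P; exists r; rewrite r0 zr; split=> //; apply: (adj_comb p0 pp2); rewrite ?addsmxSl.
have ps : adj L p s by apply: (adj_comb p0 pp2); rewrite ?addsmxSl.
have os : onL L s by exact: adj_onR rs.
have sS : (s <= S)%MS by apply: submx_trans sn _; rewrite addsmx_sub pS.
apply/dist2P; exists s; rewrite s0 adjC [adj L s p]adjC ps; split=> //.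
have sr : adj L s r by rewrite adjC.
apply: (@star_full _ _ _ hH _ S z v v' s) => //; first by rewrite r5.
- have [e [es se E]] : exists e, [/\ ~~ (e <= s)%MS, adj L s e & (e <= p + p2)%MS /\ (p + p2 <= s + e)%MS].
    have sn' : (s <= <<(p + p2)%MS>>)%MS by rewrite genmxE.
    have [e [es se E]] := line_basis fL nL s0 sn'; exists e; split=> //.
    by rewrite -(genmxE (p + p2)%MS) E !genmxE addsmxSr -(genmxE (p + p2)%MS) E genmxE.
  apply: (Pi_sub fL os se sr) => //.
  + by apply: contra nrn => h; apply: submx_trans h _; rewrite addsmx_sub sn E.1.
  + by apply: submx_trans E.1 _; rewrite addsmx_sub pS.
  by apply: submx_trans zS; rewrite -(adjE fL).
by apply/dist2P; exists r; rewrite r0 sr adjC.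
Qed.

(** If y were in the hyperplane, its neighbours b1 and b2 at distance at most two from z would lie
    in the rank 5 space of every frame of [Pi z], which would thus be [Pi z] + b1 + b2. But two
    frames already generate [Hyper z], of rank 6. *)
Lemma opp_notin_Hyper z y : onL L z -> onL L y -> ~~ dist2 L z y -> ~~ (y <= Hyper L z)%MS.
Proof.
move=> oz oy nd; apply/negP => yH; have y0 := onL_nz oy; have z0 := onL_nz oz.
have [b1 [b2 [yb1 yb2 b1y b2y [d1 d2]]]] := near_pair oz oy nd.
have yP := opp_Pi_Hyper oz oy nd yH.
(* The line yb meets the intersection of [Pi y] and S in a point p, which is at distance at most two
   from z. If p were not b, [no_pentagon] would give a point of yb collinear with z, and y would not
   be opposite z. *)
have b_in v v' b : adj L z v -> adj L z v' -> ~~ (v <= z)%MS -> ~~ (v' <= z + v)%MS ->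
    adj L y b -> ~~ (b <= y)%MS -> dist2 L z b -> (b <= Pi L z + Pi L v + Pi L v')%MS.
  move=> zv zv' vz v'zv yb by' db; have [r5 r6 _] := Hyper_frame hH oz zv zv' vz v'zv.
  set S := (_ + _)%MS in r5 *.
  have SH : (S <= Hyper L z)%MS.
    have v'z : ~~ (v' <= z)%MS by apply: contra v'zv => h; rewrite (submx_trans h) ?addsmxSl.
    by rewrite /S !addsmx_sub !Pi_Hyper ?onL_Pi ?(npar_nz vz) ?(npar_nz v'z) // -(adjE fL).
  have r2 : (1 < \rank (Pi L y :&: S)%MS)%N.
    by have := rank_cap_ge yP SH; rewrite r5 r6 (flat_rank fL oy); card_lia.
  have [|p p0] := @nonzero_in _ _ _ ((y + b) :&: (Pi L y :&: S))%MS.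
    have s1' : (y + b <= Pi L y)%MS by rewrite addsmx_sub onL_Pi // -(adjE fL).
    have := rank_cap_ge s1' (capmxSl (Pi L y) S); rewrite rank_add2 // (flat_rank fL oy).
    by move: r2; card_lia.
  rewrite !sub_capmx => /and3P[pyb py pS].
  have op := nonzero_onL oy p0 py.
  have dp : dist2 L z p.
    apply: contraT => ndp.
    have pH : (p <= Hyper L z)%MS by exact: submx_trans pS SH.
    have pH2 := opp_Pi_Hyper oz op ndp pH.
    by case/negP: ndp; apply: (solid5_dist2 oz zv zv' vz v'zv op pS pH2).
  case: (boolP (p <= b)%MS) => [pb|pb].
    by apply: submx_trans pS; apply: par_sym.
  have b0 := npar_nz by'.
  have bp : adj L b p by apply: (adj_comb y0 yb); rewrite ?addsmxSr.
  have [w [w0 wb zw]] := np oz b0 bp pb db dp.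
  have wy : adj L w y.
    have wyb : (w <= y + b)%MS.
      by apply: submx_trans wb _; rewrite addsmx_sub addsmxSr.
    by apply: (adj_comb y0 yb); rewrite ?addsmxSl.
  by case/negP: nd; apply/dist2P; exists w.
have [u [u' [zu zu' uz u'z]]] := pencil_frame oz.
have zuz : adj L z (u + z) by apply: (adj_add fL) => //; exact: adj_refl.
have uzz : ~~ ((u + z)%R <= z)%MS.
  by apply: contra uz => h; rewrite -(addrK z u) addmx_sub // eqmx_opp.
have u'zuz : ~~ (u' <= z + (u + z)%R)%MS.
  by apply: contra u'z => h; apply: submx_trans h _; rewrite addsmx_sub addsmxSl addmx_sub ?addsmxSl ?addsmxSr.
have b2y' : ~~ (b2 <= y)%MS by apply: contra b2y => h; rewrite (submx_trans h) ?addsmxSl.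
pose B := (Pi L z + b1 + b2)%MS.
have capzy v : (v <= Pi L z)%MS -> (v <= Pi L y)%MS -> v = 0.
  move=> vz vy; apply/eqP; apply: contraT => v0; case/negP: nd; apply/dist2P; exists v.
  by split=> //; [rewrite (adjE fL) | rewrite adjC (adjE fL)].
have rB : \rank B = 5%N.
  rewrite rank_addv ?rank_addv ?(flat_rank fL) //.
    apply/negP => h; case/eqP: (npar_nz b1y); apply: capzy => //; by rewrite -(adjE fL).
  apply/negP => /sub_addvP[a h].
  have e : (b2 - a *: b1)%R = 0.
    have b1P : (b1 <= Pi L y)%MS by rewrite -(adjE fL).
    have b2P : (b2 <= Pi L y)%MS by rewrite -(adjE fL).
    by apply: capzy => //; rewrite addmx_sub // eqmx_opp scalemx_sub.
  case/negP: b2y; have -> : b2 = a *: b1 by apply/eqP; rewrite -subr_eq0 e.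
  by rewrite scalemx_sub ?addsmxSr.
have inB v v' : adj L z v -> adj L z v' -> ~~ (v <= z)%MS -> ~~ (v' <= z + v)%MS ->
   (Pi L z + Pi L v + Pi L v' <= B)%MS.
  move=> zv zv' vz v'zv; have [r5 _ _] := Hyper_frame hH oz zv zv' vz v'zv.
  apply: sub_eq_rank; last by rewrite rB r5.
  rewrite !addsmx_sub b_in // b_in // !andbT; sub_sum.
have t1 := inB u u' zu zu' uz u'z; have t2 := inB _ u' zuz zu' uzz u'zuz.
move: t1 t2; rewrite !addsmx_sub => /andP[/andP[t1 t2] t3] /andP[/andP[_ t4] _].
have := mxrankS (Hyper_sub hH oz zu zu' uz u'z t1 t2 t3 t4).
by rewrite rank_Hyper // rB.
Qed.

Lemma in_Hyper z y : onL L z -> onL L y -> (y <= Hyper L z)%MS = dist2 L z y.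
Proof.
move=> oz oy; apply/idP/idP => [|/dist2_Hyper//].
by apply: contraTT; apply: opp_notin_Hyper.
Qed.

Section Connected.
Variables (k : nat) (K : 'M[F]_(k, N)) (Q : 'rV[F]_N -> Prop).
Hypothesis step : forall p p' c, onL L p -> onL L p' -> ~~ (p <= K)%MS -> ~~ (p' <= K)%MS ->
  c != 0 -> adj L p c -> adj L c p' -> Q p -> Q p'.

(** Two paths lead from p to an opposite p', through b1, r1 and through b2, r2. If all four points
    are in K, pass to the neighbour p1 = p + b1 outside K: a shortest path from p1 to the line r2 p'
    either leaves K or closes the quadrangle p, b2, s, p1. *)
Lemma far_connected p p' : onL L p -> onL L p' -> ~~ (p <= K)%MS -> ~~ (p' <= K)%MS ->
  Q p -> Q p'.
Proof.
move=> op op' pK pK' Qp.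
have [p0 p0'] := conj (onL_nz op) (onL_nz op').
case: (boolP (dist2 L p' p)) => [/dist2P[c [c0 p'c cp]]|nd].
  by apply: (step op op' pK pK' c0 _ _ Qp); rewrite adjC.
(* On a path of length three a single inner vertex outside K suffices to transport Q. *)
have path x s r : onL L x -> ~~ (x <= K)%MS -> s != 0 -> r != 0 -> adj L x s -> adj L s r ->
    adj L r p' -> Q x -> Q p' \/ (s <= K)%MS /\ (r <= K)%MS.
  move=> ox xK s0 r0 xs sr rp' Qx.
  have [os or] := conj (adj_onL s0 sr) (adj_onL r0 rp').
  case: (boolP (s <= K)%MS) => sK; last first.
    left; have Qs := step ox os xK sK s0 xs (adj_refl os) Qx.
    exact: step os op' sK pK' r0 sr rp' Qs.
  case: (boolP (r <= K)%MS) => rK; last first.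
    left; have Qr := step ox or xK rK s0 xs sr Qx.
    exact: step or op' rK pK' r0 (adj_refl or) rp' Qr.
  by right.
have [b1 [b2 [pb1 pb2 b1p b2p [/dist2P[r1 [r10 p'r1 r1b1]] /dist2P[r2 [r20 p'r2 r2b2]]]]]] :=
  near_pair op' op nd.
have b10 := npar_nz b1p.
have b2p' : ~~ (b2 <= p)%MS by apply: contra b2p => h; rewrite (submx_trans h) ?addsmxSl.
have b20 := npar_nz b2p'.
case: (path p b1 r1) => //; try by rewrite adjC.
move=> [b1K r1K]; case: (path p b2 r2) => //; try by rewrite adjC.
move=> [b2K r2K].
pose p1 := p + b1.
have pp1 : adj L p p1 by apply: (adj_add fL) => //; exact: adj_refl.
have p1K : ~~ (p1 <= K)%MS.
  by apply: contra pK => h; rewrite -(addrK b1 p) addmx_sub // eqmx_opp.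
have p10 : p1 != 0 := npar_nz p1K.
have op1 : onL L p1 by exact: adj_onR pp1.
have Qp1 : Q p1 := step op op1 pK p1K p0 (adj_refl op) pp1 Qp.
have nd1 : ~~ dist2 L p' p1.
  apply/negP => d1; have db1 : dist2 L p' b1 by apply/dist2P; exists r1.
  have b1p1 : adj L b1 p1 by apply: (adj_comb p0 pb1); rewrite ?addsmxSr // addmx_sub ?addsmxSl ?addsmxSr.
  have p1b1 : ~~ (p1 <= b1)%MS by apply: contra p1K => h; exact: submx_trans h b1K.
  have [w [w0 wb p'w]] := np op' b10 b1p1 p1b1 db1 d1.
  have wp : (w <= p + b1)%MS.
    by apply: submx_trans wb _; rewrite addsmx_sub addsmxSr addmx_sub ?addsmxSl ?addsmxSr.
  case/negP: nd; apply/dist2P; exists w; split=> //.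
  by apply: (adj_comb p0 pb1); rewrite ?addsmxSl.
have p'r2' : ~~ (p' <= r2)%MS by apply: contra pK' => h; exact: submx_trans h r2K.
have r2p' : adj L r2 p' by rewrite adjC.
have mL := line_in fL r20 p'r2' r2p'.
have [r3 [r30 r3m /dist2P[s [s0 p1s sr3]]]] := ln op1 mL; rewrite genmxE in r3m.
have r3p' : adj L r3 p' by apply: (adj_comb r20 r2p'); rewrite ?addsmxSr.
case: (path p1 s r3) => //; move=> [sK r3K].
have r32 : (r3 <= r2)%MS.
  apply: contraT => h; case/negP: pK'.
  by apply: submx_trans (exchange r3m h) _; rewrite addsmx_sub r2K.
have sr2 : adj L s r2 by apply: adj_sub sr3 _ (par_sym r30 r32).
have or2 : onL L r2 by exact: adj_onL r2p'.
have b2r2 : ~~ (b2 <= r2)%MS.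
  apply: contra nd => h; apply/dist2P; exists b2; rewrite b20 adjC [adj L b2 p]adjC; split=> //.
  by apply: adj_sub r2p' h _.
have sb2 : adj L b2 s.
  case: (boolP (s <= r2 + b2)%MS) => [h|h].
    by apply: (adj_comb r20 r2b2); rewrite ?addsmxSr.
  have r2s : adj L r2 s by rewrite adjC.
  have := Pi_sub fL or2 r2b2 r2s b2r2 h r2K b2K sK => PK.
  by case/negP: pK'; apply: submx_trans PK; rewrite -(adjE fL).
have p1p : adj L p1 p by rewrite adjC.
have sp1 : adj L s p1 by rewrite adjC.
have nps : ~~ adj L p s.
  apply/negP => ps.
  have b1s : (s <= p + b1)%MS.
    have p1p' : ~~ (p1 <= p)%MS.
      by apply: contra b1p => h; rewrite -(addKr p b1) addmx_sub // eqmx_opp.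
    apply: submx_trans (triangle fL op p1p' pp1 ps p1s) _.
    by rewrite addsmx_sub addsmxSl addmx_sub ?addsmxSl ?addsmxSr.
  have sp : ~~ (s <= p)%MS by apply: contra pK => h; exact: submx_trans (par_sym s0 h) sK.
  have t := triangle fL op b2p' pb2 ps sb2.
  case/negP: b2p; apply: submx_trans (exchange t sp) _.
  by rewrite addsmx_sub addsmxSl.
have := nq p0 b20 s0 p10 pb2 sb2 sp1 p1p nps => h.
by case/negP: p1K; exact: submx_trans h b2K.
Qed.

End Connected.

(** Every line through p meets K; two of the points obtained span the plane of p together with p. *)
Lemma two_lines_span k (K : 'M[F]_(k, N)) m (V : 'M[F]_(m, N)) p :
  (forall l, l \in L -> exists v, [/\ v != 0, (v <= l)%MS & (v <= K)%MS]) ->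
  onL L p -> ~~ (p <= K)%MS -> (K <= V)%MS -> (p <= V)%MS -> (Pi L p <= V)%MS.
Proof.
move=> meetK op pK KV pV; have p0 := onL_nz op.
have near y : adj L p y -> ~~ (y <= p)%MS ->
    exists b, [/\ adj L p b, ~~ (b <= p)%MS, (b <= p + y)%MS & (b <= K)%MS].
  move=> py yp; have [b [b0 bl bK]] := meetK _ (line_in fL p0 yp py).
  rewrite genmxE in bl; exists b; split=> //.
    by apply: (adj_comb p0 py); rewrite ?addsmxSl.
  by apply: contra pK => bp; apply: submx_trans (par_sym b0 bp) bK.
have [|y1 py1 y1p] := @Pi_out _ _ _ fL _ p p op; first by rewrite rank_nz.
have [b1 [pb1 b1p b1y b1K]] := near _ py1 y1p.
have [|y2 py2 y2p] := @Pi_out _ _ _ fL _ (p + b1)%MS p op; first by rewrite rank_add2.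
have y2p' : ~~ (y2 <= p)%MS by apply: contra y2p => h; rewrite (submx_trans h) ?addsmxSl.
have [b2 [pb2 b2p b2y b2K]] := near _ py2 y2p'.
apply: (Pi_sub fL op pb1 pb2) => //; try by apply: submx_trans KV.
apply: contra y2p => h.
by apply: submx_trans (exchange b2y b2p) _; rewrite addsmx_sub addsmxSl.
Qed.

(** Membership in this sum is transported from y through the points outside [Hyper z]. *)
Lemma hexagon_span z y p : onL L z -> onL L y -> ~~ dist2 L z y -> onL L p ->
  (p <= Hyper L z + y)%MS.
Proof.
move=> oz oy nd op; set V := (_ + _)%MS.
have HV : (Hyper L z <= V)%MS by exact: addsmxSl.
case: (boolP (p <= Hyper L z)%MS) => [pH|pH]; first exact: submx_trans pH HV.
have meetH l : l \in L -> exists v, [/\ v != 0, (v <= l)%MS & (v <= Hyper L z)%MS].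
  by move=> lL; have [v [v0 vl dv]] := ln oz lL; exists v; rewrite v0 vl dist2_Hyper.
have yH := opp_notin_Hyper oz oy nd.
refine (@far_connected _ (Hyper L z) (fun p => is_true (p <= V)%MS) _ y p oy op yH pH (addsmxSr _ _)).
move=> a b c oa ob aH bH c0 ac cb aV.
have oc := adj_onL c0 cb.
have bP : (b <= Pi L c)%MS by rewrite -(adjE fL).
have aP := two_lines_span meetH oa aH HV aV.
have cV : (c <= V)%MS by apply: submx_trans aP; rewrite -(adjE fL).
apply: submx_trans bP _.
case: (boolP (c <= Hyper L z)%MS) => [cH|cH]; last exact: two_lines_span meetH oc cH HV cV.
move: (cH); rewrite in_Hyper // => /dist2P[r [r0 zr rc]].
have rH : (r <= Hyper L z)%MS.
  apply: submx_trans (Pi_Hyper_self oz); by rewrite -(adjE fL).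
have cr : adj L c r by rewrite adjC.
have ca : adj L c a by rewrite adjC.
apply: (Pi_sub fL oc cr ca) => //; last exact: submx_trans rH HV.
  apply/negP => h.
  have : dist2 L z a by apply/dist2P; exists c; rewrite c0 ca (adj_sub zr _ (par_sym r0 h)).
  by rewrite -in_Hyper // (negPf aH).
by apply: contra aH => h; apply: submx_trans h _; rewrite addsmx_sub cH.
Qed.

(** The end of a path z, a, b, y, each step of which leaves the plane line just traversed. *)
Lemma opposite_ex z : onL L z -> exists2 y, onL L y & ~~ dist2 L z y.
Proof.
move=> oz; have z0 := onL_nz oz.
have [|a za az] := @Pi_out _ _ _ fL _ z z oz; first by rewrite rank_nz.
have a0 := npar_nz az; have oa := adj_onR a0 za.
have [|b ab baz] := @Pi_out _ _ _ fL _ (a + z)%MS a oa.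
  by rewrite rank_add2 // npar_sym.
have ba : ~~ (b <= a)%MS by apply: contra baz => h; rewrite (submx_trans h) ?addsmxSl.
have b0 := npar_nz ba; have ob := adj_onR b0 ab.
have [|y by' yba] := @Pi_out _ _ _ fL _ (b + a)%MS b ob.
  by rewrite rank_add2 // npar_sym.
have yb : ~~ (y <= b)%MS by apply: contra yba => h; rewrite (submx_trans h) ?addsmxSl.
have y0 := npar_nz yb; have oy := adj_onR y0 by'.
exists y => //; apply/negP => dy.
have db : dist2 L z b by apply/dist2P; exists a.
have [w [w0 wb zw]] := np oz b0 by' yb db dy.
have nzb : ~~ adj L z b.
  apply: contra baz => zb; rewrite addsmxC; exact: (triangle fL oz az za zb ab).
have wb' : adj L w b by apply: (adj_comb b0 by'); rewrite ?addsmxSl.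
have wa := common_nbr_par hH z0 b0 a0 w0 nzb za ab zw wb'.
have wb2 : ~~ (w <= b)%MS.
  by apply: contra nzb => h; apply: adj_sub zw _ (par_sym w0 h).
case/negP: yba; apply: submx_trans (exchange wb wb2) _.
by rewrite addsmx_sub addsmxSl (submx_trans wa) ?addsmxSr.
Qed.

End HexagonSpan.

(** * Coordinates *)

Section Vectors3.
Variable F : finFieldType.
Implicit Types (x y z a b c : 'rV[F]_3).

Definition cd3 x (i : nat) : F := x 0 (inord i).
Definition vec3 (r s t : F) : 'rV[F]_3 := \row_i nth 0 [:: r; s; t] i.
Definition dot x y : F := cd3 x 0 * cd3 y 0 + cd3 x 1 * cd3 y 1 + cd3 x 2 * cd3 y 2.
Definition cross x y : 'rV[F]_3 :=
  vec3 (cd3 x 1 * cd3 y 2 - cd3 x 2 * cd3 y 1) (cd3 x 2 * cd3 y 0 - cd3 x 0 * cd3 y 2)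
       (cd3 x 0 * cd3 y 1 - cd3 x 1 * cd3 y 0).

Lemma cd3D x y i : cd3 (x + y) i = cd3 x i + cd3 y i. Proof. by rewrite /cd3 mxE. Qed.
Lemma cd3N x i : cd3 (- x) i = - cd3 x i. Proof. by rewrite /cd3 mxE. Qed.
Lemma cd3Z r x i : cd3 (r *: x) i = r * cd3 x i. Proof. by rewrite /cd3 mxE. Qed.
Lemma cd30 i : cd3 0 i = 0. Proof. by rewrite /cd3 mxE. Qed.
Lemma cd3_0 r s t : cd3 (vec3 r s t) 0 = r. Proof. by rewrite /cd3 mxE inordK. Qed.
Lemma cd3_1 r s t : cd3 (vec3 r s t) 1 = s. Proof. by rewrite /cd3 mxE inordK. Qed.
Lemma cd3_2 r s t : cd3 (vec3 r s t) 2 = t. Proof. by rewrite /cd3 mxE inordK. Qed.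
Definition cd3E := (cd3D, cd3N, cd3Z, cd30, cd3_0, cd3_1, cd3_2).

Lemma vec3P x y : cd3 x 0 = cd3 y 0 -> cd3 x 1 = cd3 y 1 -> cd3 x 2 = cd3 y 2 -> x = y.
Proof.
move=> e0 e1 e2; apply/rowP=> i; move: e0 e1 e2; rewrite /cd3.
rewrite -[i]inord_val.
by case: i => -[|[|[|i]]].
Qed.

Lemma nz3 x : x != 0 -> [\/ cd3 x 0 != 0, cd3 x 1 != 0 | cd3 x 2 != 0].
Proof.
move=> x0; case: (eqVneq (cd3 x 0) 0) => [e0|]; last by constructor 1.
case: (eqVneq (cd3 x 1) 0) => [e1|]; last by constructor 2.
case: (eqVneq (cd3 x 2) 0) => [e2|]; last by constructor 3.
by case/eqP: x0; apply: vec3P; rewrite ?e0 ?e1 ?e2 cd30.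
Qed.

Lemma dotC x y : dot x y = dot y x. Proof. by rewrite /dot; ring. Qed.
Lemma dotDl x y z : dot (x + y) z = dot x z + dot y z. Proof. by rewrite /dot !cd3E; ring. Qed.
Lemma dotDr x y z : dot z (x + y) = dot z x + dot z y. Proof. by rewrite /dot !cd3E; ring. Qed.
Lemma dotZl r x y : dot (r *: x) y = r * dot x y. Proof. by rewrite /dot !cd3E; ring. Qed.
Lemma dotZr r x y : dot x (r *: y) = r * dot x y. Proof. by rewrite /dot !cd3E; ring. Qed.
Lemma dotNl x y : dot (- x) y = - dot x y. Proof. by rewrite /dot !cd3E; ring. Qed.
Lemma dotNr x y : dot x (- y) = - dot x y. Proof. by rewrite /dot !cd3E; ring. Qed.
Lemma dot0l x : dot 0 x = 0. Proof. by rewrite /dot !cd3E; ring. Qed.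
Lemma dot0r x : dot x 0 = 0. Proof. by rewrite /dot !cd3E; ring. Qed.
Definition dotE := (dotDl, dotDr, dotZl, dotZr, dotNl, dotNr, dot0l, dot0r).

Lemma crossDr x a b : cross x (a + b) = cross x a + cross x b.
Proof. by apply: vec3P; rewrite !cd3E; ring. Qed.
Lemma crossDl x a b : cross (a + b) x = cross a x + cross b x.
Proof. by apply: vec3P; rewrite !cd3E; ring. Qed.
Lemma crossZr x r a : cross x (r *: a) = r *: cross x a.
Proof. by apply: vec3P; rewrite !cd3E; ring. Qed.
Lemma crossZl x r a : cross (r *: a) x = r *: cross a x.
Proof. by apply: vec3P; rewrite !cd3E; ring. Qed.
Lemma crossxx x : cross x x = 0. Proof. by apply: vec3P; rewrite !cd3E; ring. Qed.
Lemma crossC x y : cross x y = - cross y x. Proof. by apply: vec3P; rewrite !cd3E; ring. Qed.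
Lemma dot_crossl x a : dot x (cross x a) = 0. Proof. by rewrite /dot !cd3E; ring. Qed.
Lemma dot_crossr x a : dot a (cross x a) = 0. Proof. by rewrite /dot !cd3E; ring. Qed.
Lemma dot_cross_rot x y z : dot x (cross y z) = dot (cross x y) z.
Proof. by rewrite /dot !cd3E; ring. Qed.
Lemma cross_cross x y z : cross x (cross y z) = dot x z *: y - dot x y *: z.
Proof. by apply: vec3P; rewrite /dot !cd3E; ring. Qed.

(** The identity for the double cross product, applied with some c not orthogonal to a, expresses b
    as a multiple of a. *)
Lemma cross_eq0 a b : a != 0 -> cross a b = 0 -> (b <= a)%MS.
Proof.
move=> a0 e.
have [c cab] : exists c, dot a c != 0.
  case: (nz3 a0) => h; [exists (vec3 1 0 0)|exists (vec3 0 1 0)|exists (vec3 0 0 1)];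
    by rewrite /dot !cd3E ?mulr0 ?mulr1 ?addr0 ?add0r.
have h : dot c b *: a = dot c a *: b.
  by apply/eqP; rewrite -subr_eq0 -cross_cross e; apply/eqP/vec3P; rewrite !cd3E; ring.
have ca : dot c a != 0 by rewrite dotC.
by apply/sub_rVP; exists ((dot c a)^-1 * dot c b); rewrite -scalerA h scalerA mulVf ?scale1r.
Qed.

Lemma cross_nz a b : ~~ (b <= a)%MS -> a != 0 -> cross a b != 0.
Proof. by move=> ba a0; apply: contra ba => /eqP/(cross_eq0 a0). Qed.

Lemma perp_sub a y : (a <= kermx y^T)%MS = (dot a y == 0).
Proof.
have e : (a *m y^T) 0 0 = dot a y.
  rewrite mxE !big_ord_recl big_ord0 !mxE addr0 addrA /dot /cd3.
  have -> : lift ord0 (lift ord0 ord0) = inord 2 :> 'I_3 by apply: val_inj; rewrite /= inordK.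
  have -> : lift ord0 ord0 = inord 1 :> 'I_3 by apply: val_inj; rewrite /= inordK.
  by have -> : ord0 = inord 0 :> 'I_3 by apply: val_inj; rewrite /= inordK.
rewrite sub_kermx -e; apply/eqP/eqP => [->|h]; first by rewrite mxE.
by apply/rowP=> i; rewrite ord1 h mxE.
Qed.

Lemma rank_perp y : y != 0 -> \rank (kermx y^T) = 2%N.
Proof. by move=> y0; rewrite mxrank_ker mxrank_tr (rank_nz y0). Qed.

Lemma perp_basis y : y != 0 -> exists a1 a2, [/\ a1 != 0, ~~ (a2 <= a1)%MS, dot a1 y = 0, dot a2 y = 0
  & forall a, dot a y = 0 -> exists i j, a = i *: a1 + j *: a2].
Proof.
move=> y0; have rk := rank_perp y0.
have [|a1 a10 a1y] := @nonzero_in _ _ _ (kermx y^T); first by rewrite rk.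
have [|a2 a2y a21] := @outside_vector _ _ _ _ (kermx y^T) a1; first by rewrite rk rank_nz.
exists a1, a2; move: (a1y) (a2y); rewrite !perp_sub => /eqP e1 /eqP e2; split=> // a /eqP.
rewrite -perp_sub => ay; apply/sub_add2P; apply: submx_trans ay _; apply: sub_eq_rank.
  by rewrite addsmx_sub a1y.
by rewrite rk rank_add2.
Qed.

Lemma perp_out x y : x != 0 -> exists2 b, dot x b = 0 & ~~ (b <= y)%MS.
Proof.
move=> x0; have [|b bx nb] := @outside_vector _ _ _ _ (kermx x^T) y.
  by rewrite rank_perp // ltnS rank_leq_row.
by exists b => //; apply/eqP; rewrite dotC -perp_sub.
Qed.

Lemma perp2 x y : exists b, [/\ b != 0, dot x b = 0 & dot y b = 0].
Proof.
have [|b b0] := @nonzero_in _ _ _ (kermx x^T :&: kermx y^T)%MS.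
  have := rank_cap_ge (submx1 (kermx x^T)) (submx1 (kermx y^T)).
  rewrite !mxrank_ker !mxrank_tr mxrank1.
  have := rank_leq_row x; have := rank_leq_row y; card_lia.
by rewrite sub_capmx !perp_sub ![dot b _]dotC => /andP[/eqP ? /eqP ?]; exists b.
Qed.

Lemma dot_nondeg x : x != 0 -> exists b, dot x b != 0.
Proof.
move=> x0; case: (nz3 x0) => h; [exists (vec3 1 0 0)|exists (vec3 0 1 0)|exists (vec3 0 0 1)];
  by rewrite /dot !cd3E ?mulr0 ?mulr1 ?addr0 ?add0r.
Qed.

Lemma perp_sep x y : x != 0 -> ~~ (y <= x)%MS -> exists2 b, dot x b = 0 & dot y b != 0.
Proof.
move=> x0 yx; have [c cx] := dot_nondeg (cross_nz yx x0).
exists (cross x c); first exact: dot_crossl.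
by apply: contra cx; rewrite dot_cross_rot crossC dotNl oppr_eq0.
Qed.

End Vectors3.

(** * Existence of frames *)

Section FrameEx.
Variables (F : finFieldType) (N : nat) (L : {set 'M[F]_N}).
Hypothesis hH : flat_hexagon L.
Let fL := fh_flat hH.
Let nq := fh_quad hH.
Let np := fh_pent hH.
Implicit Types (u v w p z g : 'rV[F]_N) (a b x y : 'rV[F]_3).

(* The rows e_i of E and f_i of Fm form an ordinary hexagon e0 f1 e2 f0 e1 f2,
   scaled so that the collinear pairs are the incident ones. *)
Record frame (E Fm : 'M[F]_(3, N)) : Prop := Frame {
  fr_inj : forall x y, x *m E + y *m Fm = 0 -> x = 0 /\ y = 0;
  fr_adj : forall a b, dot a b = 0 -> adj L (a *m E) (b *m Fm) }.

Lemma frame_sym E Fm : frame E Fm -> frame Fm E.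
Proof.
case=> inj ad; split=> [x y|a b ab]; first by rewrite addrC => /inj[].
by rewrite adjC; apply: ad; rewrite dotC.
Qed.

Definition rows3 u v w : 'M[F]_(3, N) := \matrix_(i < 3) nth 0 [:: u; v; w] i.

Lemma mul_rows3 x u v w : x *m rows3 u v w = cd3 x 0 *: u + cd3 x 1 *: v + cd3 x 2 *: w.
Proof.
rewrite mulmx_sum_row !big_ord_recl big_ord0 addr0 addrA !rowK /= /cd3.
have -> : lift ord0 (lift ord0 ord0) = inord 2 :> 'I_3 by apply: val_inj; rewrite /= inordK.
have -> : lift ord0 ord0 = inord 1 :> 'I_3 by apply: val_inj; rewrite /= inordK.
by have -> : ord0 = inord 0 :> 'I_3 by apply: val_inj; rewrite /= inordK.
Qed.

Section FrameOf.
Variables (e0 e1 e2 f0 f1 f2 : 'rV[F]_N) (d : F).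
Hypothesis ind : forall x0 x1 x2 y0 y1 y2 : F,
  x0 *: e0 + x1 *: e1 + x2 *: e2 + (y0 *: f0 + y1 *: f1 + y2 *: f2) = 0 ->
  [/\ x0 = 0, x1 = 0 & x2 = 0] /\ [/\ y0 = 0, y1 = 0 & y2 = 0].
Hypotheses (a01 : adj L e0 f1) (a02 : adj L e0 f2) (a10 : adj L e1 f0) (a12 : adj L e1 f2)
  (a20 : adj L e2 f0) (a21 : adj L e2 f1).
Hypothesis R1 : forall i j, adj L (i *: e0 + j *: e1) (i *: f1 - j *: f0).
Hypothesis R2 : forall i j, adj L (i *: e0 + j *: e2) (i *: f2 - j *: f0).
(** The scalar d is not at disposal: scaling f0, f1 and f2 normalizes only two of the three
    reguli. *)
Hypothesis R3 : forall i j, adj L (i *: e1 + j *: e2) (i *: f2 + j *: (d *: f1)).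

Let sE (x0 x1 x2 : F) := x0 *: e0 + x1 *: e1 + x2 *: e2.
Let sF (y0 y1 y2 : F) := y0 *: f0 + y1 *: f1 + y2 *: f2.

Lemma sF_nz (y0 y1 y2 : F) : [|| y0 != 0, y1 != 0 | y2 != 0] -> sF y0 y1 y2 != 0.
Proof.
move=> h; apply/negP => /eqP e; have [|_ [e0' e1' e2']] := @ind 0 0 0 y0 y1 y2.
  by rewrite !scale0r !add0r.
by move: h; rewrite e0' e1' e2' eqxx.
Qed.

Lemma sE_nz (y0 y1 y2 : F) : [|| y0 != 0, y1 != 0 | y2 != 0] -> sE y0 y1 y2 != 0.
Proof.
move=> h; apply/negP => /eqP e; have [|[e0' e1' e2'] _] := @ind y0 y1 y2 0 0 0.
  by rewrite !scale0r !addr0.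
by move: h; rewrite e0' e1' e2' eqxx.
Qed.

Lemma frame_nz : [/\ e0 != 0, e1 != 0 & e2 != 0].
Proof.
have h0 := sE_nz (y0 := 1) (y1 := 0) (y2 := 0).
have h1 := sE_nz (y0 := 0) (y1 := 1) (y2 := 0).
have h2 := sE_nz (y0 := 0) (y1 := 0) (y2 := 1).
rewrite /sE !scale0r !scale1r !addr0 ?add0r !oner_eq0 /= ?orbT in h0 h1 h2.
by split; [apply: h0|apply: h1|apply: h2].
Qed.

Lemma adj_b (b u v : 'rV[F]_N) : b != 0 -> adj L u b -> adj L v b -> adj L (u + v) b.
Proof.
move=> b0 ub vb; have ob : onL L b by exact: adj_onR ub.
by rewrite adjC; apply: (adj_add fL ob); rewrite adjC.
Qed.

Lemma adj_b01 (x0 x1 x2 : F) : (x0 != 0) || (x1 != 0) -> adj L (sE x0 x1 x2) (x0 *: f1 - x1 *: f0).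
Proof.
move=> h; apply: adj_b; last first.
- apply: adj_scalel; rewrite -scaleNr; apply: (adj_lin fL) => //; apply: adj_onL a20.
  by case: frame_nz.
- exact: R1.
have := sF_nz (y0 := - x1) (y1 := x0) (y2 := 0).
rewrite /sF scale0r addr0 scaleNr addrC; apply; by rewrite oppr_eq0 eqxx orbF orbC.
Qed.

Lemma adj_b02 (x0 x1 x2 : F) : (x0 != 0) || (x2 != 0) -> adj L (sE x0 x1 x2) (x0 *: f2 - x2 *: f0).
Proof.
move=> h; rewrite /sE addrAC; apply: adj_b; last first.
- apply: adj_scalel; rewrite -scaleNr; apply: (adj_lin fL) => //; apply: adj_onL a10.
  by case: frame_nz.
- exact: R2.
have := sF_nz (y0 := - x2) (y1 := 0) (y2 := x0).
rewrite /sF scale0r addr0 scaleNr addrC; apply; by rewrite oppr_eq0 eqxx /= orbC.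
Qed.

Lemma adj_b12 (x0 x1 x2 : F) : d != 0 -> (x1 != 0) || (x2 != 0) ->
  adj L (sE x0 x1 x2) (x1 *: f2 + x2 *: (d *: f1)).
Proof.
move=> d0 h; rewrite /sE -addrA; apply: adj_b.
- have := sF_nz (y0 := 0) (y1 := x2 * d) (y2 := x1).
  rewrite /sF scale0r add0r -scalerA addrC; apply; by rewrite eqxx /= mulf_eq0 (negPf d0) orbF orbC.
- apply: adj_scalel; apply: (adj_lin fL) => //; last exact: adj_scale.
  by apply: adj_onL a01; case: frame_nz.
exact: R3.
Qed.

(** The point e0 + e1 + e2 has the neighbours f1 - f0, f2 - f0 and f2 + d f1. If d were not -1, they
    would be independent, and with the point itself its plane would have rank 4. *)
Lemma frame_sign : d != 0 -> d = -1.
Proof.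
move=> d0; apply/eqP; rewrite eq_sym -subr_eq0 -opprD oppr_eq0; apply: contraT => d1.
pose g := sE 1 1 1.
have h1 : (f1 - f0 <= Pi L g)%MS.
  by have := @adj_b01 1 1 1; rewrite oner_eq0 !scale1r => /(_ isT)/adj_Pi.
have h2 : (f2 - f0 <= Pi L g)%MS.
  by have := @adj_b02 1 1 1; rewrite oner_eq0 !scale1r => /(_ isT)/adj_Pi.
have h3' : adj L g (f2 + d *: f1).
  by have := @adj_b12 1 1 1 d0; rewrite oner_eq0 !scale1r => /(_ isT).
have h3 := adj_Pi h3'.
have g0 : g != 0 by apply: sE_nz; rewrite oner_eq0.
have og : onL L g := adj_onL g0 h3'.
have hf1 : (f1 <= Pi L g)%MS.
  have : ((1 + d) *: f1 <= Pi L g)%MS.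
    have -> : (1 + d) *: f1 = (f2 + d *: f1) + (f1 - f0) - (f2 - f0).
      by apply/rowP=> r; rewrite !mxE; ring.
    by rewrite addmx_sub ?eqmx_opp // addmx_sub.
  by rewrite eqmx_scale.
have hf0 : (f0 <= Pi L g)%MS by rewrite -(subKr f1 f0) addmx_sub // eqmx_opp.
have hf2 : (f2 <= Pi L g)%MS by rewrite -(subrK f0 f2) addmx_sub.
have f00 : f0 != 0.
  by have := sF_nz (y0 := 1) (y1 := 0) (y2 := 0); rewrite /sF !scale0r !addr0 scale1r oner_eq0; apply.
have n1 : ~~ (f1 <= f0)%MS.
  apply/negP => /sub_rVP[i e]; have := sF_nz (y0 := - i) (y1 := 1) (y2 := 0).
  by rewrite /sF e scale0r addr0 scale1r scaleNr addNr !eqxx oner_eq0 orbT => /(_ isT).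
have n2 : ~~ (f2 <= f0 + f1)%MS.
  apply/negP => /sub_add2P[i [j e]]; have := sF_nz (y0 := - i) (y1 := - j) (y2 := 1).
  by rewrite /sF e scale1r !scaleNr -opprD addNr !eqxx oner_eq0 !orbT => /(_ isT).
have n3 : ~~ (g <= f0 + f1 + f2)%MS.
  apply/negP => /sub_addvP[k /sub_add2P[i [j /eqP]]]; rewrite subr_eq => /eqP e.
  have [|[h _ _] _] := @ind 1 1 1 (- i) (- j) (- k).
    by rewrite -[X in X + _]/g e !scaleNr -!opprD subrr.
  by move/eqP: h; rewrite oner_eq0.
have : (f0 + f1 + f2 + g <= Pi L g)%MS by rewrite !addsmx_sub hf0 hf1 hf2 onL_Pi.
by move/mxrankS; rewrite (flat_rank fL og) (rank_addv n3) (rank_addv n2) (rank_addv n1) (rank_nz f00).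
Qed.

(** When a has a nonzero coordinate, b is up to this factor a combination of the neighbours of a
    supplied by the two reguli that involve the coordinate; the remainder is a multiple of a . b. *)
Lemma frame_of : d != 0 -> frame (rows3 e0 e1 e2) (rows3 f0 f1 f2).
Proof.
move=> d0; have d1 := frame_sign d0; split=> [x y|].
  rewrite !mul_rows3 => /ind[[? ? ?] [? ? ?]].
  by split; apply: vec3P; rewrite cd30.
have main a b : a != 0 -> dot a b = 0 -> adj L (a *m rows3 e0 e1 e2) (b *m rows3 f0 f1 f2).
  move=> a0; rewrite !mul_rows3 /dot; have := nz3 a0.
  move: (cd3 a 0) (cd3 a 1) (cd3 a 2) (cd3 b 0) (cd3 b 1) (cd3 b 2) => x0 x1 x2 y0 y1 y2 nz e.
  rewrite -[X in adj L X]/(sE x0 x1 x2) -[X in adj L _ X]/(sF y0 y1 y2).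
  have g0 : sE x0 x1 x2 != 0 by apply: sE_nz; apply/or3P.
  have ln (r : F) (u : 'rV[F]_N * 'rV[F]_N) w : onL L (sE x0 x1 x2) -> (exists i j, [/\ r != 0, r *: w = i *: u.1 + j *: u.2,
      adj L (sE x0 x1 x2) u.1 & adj L (sE x0 x1 x2) u.2]) -> adj L (sE x0 x1 x2) w.
    move=> og [i [j [r0 ew au1 au2]]]; rewrite -[w]scale1r -(mulVf r0) -scalerA ew.
    by apply: adj_scale; apply: (adj_lin fL).
  case: nz => h.
  - have b01 : adj L (sE x0 x1 x2) (x0 *: f1 - x1 *: f0) by apply: adj_b01; rewrite h.
    have b02 : adj L (sE x0 x1 x2) (x0 *: f2 - x2 *: f0) by apply: adj_b02; rewrite h.
    apply: (ln x0 (_, _)) (adj_onL g0 b01) _; exists y1, y2; split; [by []| |exact: b01|exact: b02].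
    rewrite /sF /=; apply/rowP=> r; rewrite !mxE.
    have -> : x0 * (y0 * f0 0 r + y1 * f1 0 r + y2 * f2 0 r) =
      (x0 * y0 + x1 * y1 + x2 * y2) * f0 0 r +
      (y1 * (x0 * f1 0 r - x1 * f0 0 r) + y2 * (x0 * f2 0 r - x2 * f0 0 r)) by ring.
    by rewrite e mul0r add0r.
  - have b01 : adj L (sE x0 x1 x2) (x0 *: f1 - x1 *: f0) by apply: adj_b01; rewrite h orbT.
    have b12 : adj L (sE x0 x1 x2) (x1 *: f2 + x2 *: (d *: f1)) by apply: adj_b12; rewrite ?h.
    apply: (ln x1 (_, _)) (adj_onL g0 b01) _; exists (- y0), y2; split; [by []| |exact: b01|exact: b12].
    rewrite /sF /= d1; apply/rowP=> r; rewrite !mxE.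
    have -> : x1 * (y0 * f0 0 r + y1 * f1 0 r + y2 * f2 0 r) =
      (x0 * y0 + x1 * y1 + x2 * y2) * f1 0 r +
      (- y0 * (x0 * f1 0 r - x1 * f0 0 r) + y2 * (x1 * f2 0 r + x2 * (-1 * f1 0 r))) by ring.
    by rewrite e mul0r add0r.
  have b02 : adj L (sE x0 x1 x2) (x0 *: f2 - x2 *: f0) by apply: adj_b02; rewrite h orbT.
  have b12 : adj L (sE x0 x1 x2) (x1 *: f2 + x2 *: (d *: f1)) by apply: adj_b12; rewrite ?h ?orbT.
  apply: (ln x2 (_, _)) (adj_onL g0 b02) _; exists (- y0), (- y1); split; [by []| |exact: b02|exact: b12].
  rewrite /sF /= d1; apply/rowP=> r; rewrite !mxE.
  have -> : x2 * (y0 * f0 0 r + y1 * f1 0 r + y2 * f2 0 r) =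
    (x0 * y0 + x1 * y1 + x2 * y2) * f2 0 r +
    (- y0 * (x0 * f2 0 r - x2 * f0 0 r) + - y1 * (x1 * f2 0 r + x2 * (-1 * f1 0 r))) by ring.
  by rewrite e mul0r add0r.
move=> a b; case: (eqVneq a 0) => [->|a0] ab; last exact: main.
have [a' [a0' a'b _]] := perp2 b b; rewrite mul0mx; apply: adj_sub (sub0mx _ _) (submx_refl _).
by apply: (main a'); rewrite // dotC.
Qed.

End FrameOf.

Lemma frame_exists z : onL L z -> exists E Fm, frame E Fm.
Proof.
move=> oe0; set e0 := z in oe0 *; have [f0 of0 nd] := opposite_ex hH oe0.
have nd' : ~~ dist2 L f0 e0 by rewrite dist2C.
have [f1 [f2 [a01 a02 f1e0 f2e0 [/dist2P[e2 [e20 a20' a21]] /dist2P[e1 [e10 a10' a12]]]]]] :=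
  near_pair hH of0 oe0 nd'.
have [e00 f00] := conj (onL_nz oe0) (onL_nz of0).
have f2e0' : ~~ (f2 <= e0)%MS by apply: contra f2e0 => h; rewrite (submx_trans h) ?addsmxSl.
have [f10 f20] := conj (npar_nz f1e0) (npar_nz f2e0').
have a10 : adj L e1 f0 by rewrite adjC.
have a20 : adj L e2 f0 by rewrite adjC.
have nf12 := nonadj_frame hH oe0 a01 a02 f1e0 f2e0.
have e2f0 : ~~ (e2 <= f0)%MS.
  apply: contra nd => h; apply/dist2P; exists f1; rewrite f10 a01; split=> //.
  by rewrite adjC; apply: adj_sub a21 _ _ => //; exact: par_sym h.
have e1f0 : ~~ (e1 <= f0)%MS.
  apply: contra nd => h; apply/dist2P; exists f2; rewrite f20 a02; split=> //.
  by rewrite adjC; apply: adj_sub a12 _ _ => //; exact: par_sym h.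
have e1f0e2 : ~~ (e1 <= f0 + e2)%MS.
  apply/negP => h.
  have e12 : ~~ (e1 <= e2)%MS.
    apply/negP => e12; have e1f1 : adj L e1 f1 by apply: adj_sub a21 e12 _.
    have f1e1 : adj L f1 e1 by rewrite adjC.
    have f1e0' : adj L f1 e0 by rewrite adjC.
    have e1e0 := common_nbr_par hH f10 f20 e00 e10 nf12 f1e0' a02 f1e1 a12.
    case/negP: nd; apply: adj_dist2 => //; apply: adj_sub a10 _ (submx_refl _).
    exact: par_sym.
  have ad : adj L e2 e1 by apply: (adj_comb f00 a20'); rewrite ?addsmxSr.
  have d1 : dist2 L e0 e1 by apply/dist2P; exists f2; split=> //; rewrite adjC.
  have d2 : dist2 L e0 e2 by apply/dist2P; exists f1; split=> //; rewrite adjC.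
  have [w [w0 we ew]] := np oe0 e20 ad e12 d2 d1.
  case/negP: nd; apply/dist2P; exists w; split=> //; rewrite adjC.
  apply: (adj_comb f00 a20'); rewrite ?addsmxSl // (submx_trans we) //.
  by rewrite addsmx_sub addsmxSr.
have capzy v : (v <= Pi L e0)%MS -> (v <= Pi L f0)%MS -> v = 0.
  move=> vz vy; apply/eqP; apply: contraT => v0; case/negP: nd; apply/dist2P; exists v.
  by split=> //; [rewrite (adjE fL) | rewrite adjC (adjE fL)].
have ind (x0 x1 x2 y0 y1 y2 : F) : x0 *: e0 + x1 *: e1 + x2 *: e2 + (y0 *: f0 + y1 *: f1 + y2 *: f2) = 0 ->
  [/\ x0 = 0, x1 = 0 & x2 = 0] /\ [/\ y0 = 0, y1 = 0 & y2 = 0].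
  move=> e; pose v := x0 *: e0 + y1 *: f1 + y2 *: f2.
  have ev : v = - (y0 *: f0 + x2 *: e2 + x1 *: e1).
    apply/eqP; rewrite -addr_eq0 -e; apply/eqP/rowP=> r; rewrite !mxE; ring.
  have v0 : v = 0.
    apply: capzy.
      by rewrite /v !addmx_sub ?scalemx_sub ?onL_Pi ?adj_Pi.
    by rewrite ev eqmx_opp !addmx_sub ?scalemx_sub ?onL_Pi ?adj_Pi.
  have [-> -> ->] := comb3_eq0 e00 f1e0 f2e0 v0.
  move/eqP: ev; rewrite v0 eq_sym oppr_eq0 => /eqP/(comb3_eq0 f00 e2f0 e1f0e2)[-> -> ->].
  by [].
have ind2 (x0 x1 x2 y0 y1 y2 c0 c1 c2 : F) : c0 != 0 -> c1 != 0 -> c2 != 0 ->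
  x0 *: e0 + x1 *: e1 + x2 *: e2 + (y0 *: (c0 *: f0) + y1 *: (c1 *: f1) + y2 *: (c2 *: f2)) = 0 ->
  [/\ x0 = 0, x1 = 0 & x2 = 0] /\ [/\ y0 = 0, y1 = 0 & y2 = 0].
  move=> c00 c10 c20; rewrite !scalerA => /ind[h []].
  move=> /eqP; rewrite mulf_eq0 (negPf c00) orbF => /eqP ->.
  move=> /eqP; rewrite mulf_eq0 (negPf c10) orbF => /eqP ->.
  by move=> /eqP; rewrite mulf_eq0 (negPf c20) orbF => /eqP ->.
have notin (u v w : 'rV[F]_N) : (forall i j, w != i *: u + j *: v) -> ~~ (w <= u + v)%MS.
  by move=> h; apply/negP => /sub_add2P[i [j e]]; case/eqP: (h i j).
have f2e0a : adj L f2 e0 by rewrite adjC.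
have f2e1a : adj L f2 e1 by rewrite adjC.
have f1e0a : adj L f1 e0 by rewrite adjC.
have f1e2a : adj L f1 e2 by rewrite adjC.
have n01 : ~~ adj L e0 e1 by apply: contra nd => h; apply/dist2P; exists e1.
have n02 : ~~ adj L e0 e2 by apply: contra nd => h; apply/dist2P; exists e2.
have oner := oner_eq0 F.
have [|||c [c0 R1 _]] := regulus hH e00 e10 f2e0a f2e1a n01 f20 a01 a10.
- apply: notin => i j; apply/eqP => e; have [|_ [_ h _]] := ind (- j) 0 0 0 1 (- i).
    by rewrite e; apply/rowP=> r; rewrite !mxE; ring.
  by move/eqP: h; rewrite oner.
- apply: notin => i j; apply/eqP => e; have [|_ [h _ _]] := ind 0 (- j) 0 1 0 (- i).
    by rewrite e; apply/rowP=> r; rewrite !mxE; ring.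
  by move/eqP: h; rewrite oner.
- by apply/dist2P; exists e2.
have [|||c' [c0' R2 _]] := regulus hH e00 e20 f1e0a f1e2a n02 f10 a02 a20.
- apply: notin => i j; apply/eqP => e; have [|_ [_ _ h]] := ind (- j) 0 0 0 (- i) 1.
    by rewrite e; apply/rowP=> r; rewrite !mxE; ring.
  by move/eqP: h; rewrite oner.
- apply: notin => i j; apply/eqP => e; have [|_ [h _ _]] := ind 0 0 (- j) 1 (- i) 0.
    by rewrite e; apply/rowP=> r; rewrite !mxE; ring.
  by move/eqP: h; rewrite oner.
- by apply/dist2P; exists e1; split=> //; rewrite adjC.
have n12 : ~~ adj L e1 e2.
  apply/negP => h; have := triangle fL of0 e2f0 a20' a10'; rewrite [adj L e2 e1]adjC => /(_ h).
  by rewrite (negPf e1f0e2).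
have [|||d [d0 R3 _]] := regulus hH e10 e20 a10' a20' n12 f00 a12 a21.
- apply: notin => i j; apply/eqP => e; have [|_ [_ _ h]] := ind 0 (- j) 0 (- i) 0 1.
    by rewrite e; apply/rowP=> r; rewrite !mxE; ring.
  by move/eqP: h; rewrite oner.
- apply: notin => i j; apply/eqP => e; have [|_ [_ h _]] := ind 0 0 (- j) (- i) 1 0.
    by rewrite e; apply/rowP=> r; rewrite !mxE; ring.
  by move/eqP: h; rewrite oner.
- by apply/dist2P; exists e0.
(* These factors turn the scalars c and c' of the first two reguli into the signs of [R1] and [R2].
   The third regulus is left with d c / c', which [frame_sign] evaluates. *)
pose g0 := (- c) *: f0; pose g1 := 1 *: f1; pose g2 := (c / c') *: f2.
have cc' : c / c' != 0 by rewrite mulf_neq0 ?invr_eq0.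
exists (rows3 e0 e1 e2), (rows3 g0 g1 g2).
apply: (@frame_of e0 e1 e2 g0 g1 g2 (d * (c / c'))); rewrite /g0 /g1 /g2 ?adj_scale //.
- by move=> ? ? ? ? ? ? h; apply: (ind2 _ _ _ _ _ _ (- c) 1 (c / c')); rewrite ?oppr_eq0 ?oner_eq0.
- move=> i j; have := R1 i j; congr adj; apply/rowP=> r; rewrite !mxE; ring.
- move=> i j; have := adj_scale (c / c') (R2 i j); congr adj; apply/rowP=> r; rewrite !mxE.
  by field.
- move=> i j; have := adj_scale (c / c') (R3 i j); congr adj; apply/rowP=> r; rewrite !mxE; ring.
by rewrite mulf_neq0.
Qed.

End FrameEx.

(** * The hexagon inside the span of a frame *)

Section FrameTheory.
Variables (F : finFieldType) (N : nat) (L : {set 'M[F]_N}).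
Hypothesis hH : flat_hexagon L.
Let fL := fh_flat hH.
Let np := fh_pent hH.
Let ln := fh_near hH.
Implicit Types (u v w p z : 'rV[F]_N) (a b x y : 'rV[F]_3).

Section OneFrame.
Variables (E Fm : 'M[F]_(3, N)).
Hypothesis fr : frame L E Fm.

Lemma frame_split x y x' y' : x *m E + y *m Fm = x' *m E + y' *m Fm -> x = x' /\ y = y'.
Proof.
move=> e; have [|/eqP h1 /eqP h2] := @fr_inj _ _ _ _ _ fr (x - x') (y - y').
  by rewrite !mulmxBl addrACA e -opprD subrr.
by move: h1 h2; rewrite !subr_eq0 => /eqP-> /eqP->.
Qed.

Lemma frame_E_nz a : a != 0 -> a *m E != 0.
Proof.
apply: contra => /eqP e; have [|-> //] := @fr_inj _ _ _ _ _ fr a 0.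
by rewrite e mul0mx addr0.
Qed.

Lemma frame_F_nz a : a != 0 -> a *m Fm != 0.
Proof.
apply: contra => /eqP e; have [|_ -> //] := @fr_inj _ _ _ _ _ fr 0 a.
by rewrite e mul0mx addr0.
Qed.

Lemma frame_onL a : a != 0 -> onL L (a *m E).
Proof.
by move=> a0; apply: (@adj_onL _ _ _ _ (0 *m Fm)); rewrite ?frame_E_nz ?(fr_adj fr) ?dot0r.
Qed.

Lemma in_frameP w : reflect (exists x y, w = x *m E + y *m Fm) (w <= E + Fm)%MS.
Proof.
apply: (iffP sub_addsmxP) => [[[x y] ->]|[x [y ->]]]; first by exists x, y.
by exists (x, y).
Qed.

Lemma in_frame x y : ((x *m E + y *m Fm)%R <= E + Fm)%MS.
Proof. by apply/in_frameP; exists x, y. Qed.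

Lemma in_frameE x : (x *m E <= E + Fm)%MS.
Proof. exact: submx_trans (submxMl _ _) (addsmxSl _ _). Qed.

Lemma rank_frame : \rank (E + Fm)%MS = 6%N.
Proof.
rewrite addsmxE; apply/eqP; apply: inj_row_free => v.
rewrite -[v]hsubmxK mul_row_col => /(fr_inj fr)[-> ->]; exact: row_mx0.
Qed.

Lemma FE_npar a b : b != 0 -> ~~ (b *m Fm <= a *m E)%MS.
Proof.
move=> b0; apply/negP => /sub_rVP[r e]; have [|_ h] := @frame_split 0 b (r *: a) 0.
  by rewrite !mul0mx add0r addr0 e -scalemxAl.
by case/eqP: b0.
Qed.

Lemma FF_npar a b b' : ~~ (b' <= b)%MS -> ~~ (b' *m Fm <= a *m E + b *m Fm)%MS.
Proof.
apply: contra => /sub_add2P[i [j e]]; have [|_ ->] := @frame_split 0 b' (i *: a) (j *: b).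
  by rewrite mul0mx add0r e -!scalemxAl.
exact: scalemx_sub.
Qed.

Lemma Pi_E a w : a != 0 -> adj L (a *m E) w ->
  exists r b, w = r *: (a *m E) + b *m Fm /\ dot a b = 0.
Proof.
move=> a0 aw; have [b1 [b2 [b10 b21 e1 e2 _]]] := perp_basis a0.
have oa := frame_onL a0.
have d1 : dot a b1 = 0 by rewrite dotC.
have d2 : dot a b2 = 0 by rewrite dotC.
have := Pi_span fL oa (fr_adj fr d1) (fr_adj fr d2) (FE_npar _ b10) (FF_npar _ b21).
rewrite (adjE fL _ oa) in aw => h; have /sub_addvP[j] := submx_trans aw h.
case/sub_add2P=> r [i /eqP]; rewrite subr_eq => /eqP->.
exists r, (i *: b1 + j *: b2); rewrite mulmxDl -!scalemxAl addrA; split=> //.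
by rewrite !dotE d1 d2 !mulr0 addr0.
Qed.

Lemma frame_nz_dot a b : dot a b != 0 -> a != 0 /\ b != 0.
Proof.
by move=> d; split; apply: contraNneq d => ->; rewrite ?dot0l ?dot0r.
Qed.

End OneFrame.

Lemma frame_opp E Fm a b : frame L E Fm -> dot a b != 0 -> ~~ dist2 L (a *m E) (b *m Fm).
Proof.
move=> fr d; have [a0 b0] := frame_nz_dot d.
apply/negP => /dist2P[c [c0 ac]]; rewrite adjC => bc.
have [r [b1 [ec d1]]] := Pi_E fr a0 ac.
have [s [a1 [ec' d2]]] := Pi_E (frame_sym fr) b0 bc.
have [|e1 e2] := @frame_split _ _ fr (r *: a) b1 a1 (s *: b).
  by rewrite -scalemxAl -ec ec' addrC scalemxAl.
move: d1 d2; rewrite e2 -e1 !dotE => /eqP; rewrite mulf_eq0 (negPf d) orbF => /eqP s0.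
move=> /eqP; rewrite mulf_eq0 dotC (negPf d) orbF => /eqP r0.
by case/eqP: c0; rewrite ec e2 s0 r0 !scale0r mul0mx addr0.
Qed.

(** All of E lies in the hyperplane: for each x some b is orthogonal to both a and x, which gives a
    path. In Fm the points with a . y nonzero are opposite to a E. *)
Lemma in_Hyper_frame E Fm a x y : frame L E Fm -> a != 0 ->
  ((x *m E + y *m Fm)%R <= Hyper L (a *m E))%MS = (dot a y == 0).
Proof.
move=> fr a0; have oa := frame_onL fr a0.
have hx : (x *m E <= Hyper L (a *m E))%MS.
  have [b [b0 ab xb]] := perp2 a x.
  apply: submx_trans (Pi_Hyper (frame_F_nz fr b0) (adj_Pi (fr_adj fr ab))).
  by apply: adj_Pi; rewrite adjC (fr_adj fr).
apply/idP/eqP => [h|h]; last first.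
  by rewrite addmx_sub // (submx_trans (adj_Pi (fr_adj fr h))) // Pi_Hyper_self.
apply/eqP; apply: contraT => d.
have oy : onL L (y *m Fm) by apply: (frame_onL (frame_sym fr)); case: (frame_nz_dot d).
case/negP: (opp_notin_Hyper hH oa oy (frame_opp fr d)).
by rewrite -(addKr (x *m E) (y *m Fm)) addmx_sub // eqmx_opp.
Qed.

(** The planes of a E, b Fm and b' Fm span a rank 5 space inside both E + Fm and the hyperplane of a
    E, hence the whole intersection; by [Hyper_frame] the plane of the flag point is not in it. *)
Lemma frame_nonfull E Fm a b : frame L E Fm -> a != 0 -> b != 0 -> dot a b = 0 ->
  ~~ (Pi L (a *m E + b *m Fm) <= E + Fm)%MS.
Proof.
move=> fr a0 b0 ab; apply/negP => full; have oa := frame_onL fr a0.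
have [b' ab' b'b] := perp_out b a0.
have [zu zu'] := conj (fr_adj fr ab) (fr_adj fr ab').
have [r5 r6] := Hyper_frame hH oa zu zu' (FE_npar fr a b0) (FF_npar fr a b'b).
set S := (_ + _ + _)%MS in r5 *; case/negP.
have SW : (S <= (E + Fm) :&: Hyper L (a *m E))%MS.
  have b0' := npar_nz b'b.
  have PiW c : c != 0 -> (Pi L (c *m Fm) <= E + Fm)%MS.
    move=> c0; apply/rV_subP => v; have oc := frame_onL (frame_sym fr) c0.
    rewrite -(adjE fL _ oc) => /(Pi_E (frame_sym fr) c0)[r [d [-> _]]].
    by rewrite addrC scalemxAl in_frame.
  rewrite sub_capmx /S !addsmx_sub !PiW // !andbT !(Pi_Hyper, Pi_Hyper_self) ?adj_Pi ?(frame_F_nz fr) ?(frame_E_nz fr) ?adj_refl // ?andbT.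
  apply/rV_subP => v; rewrite -(adjE fL _ oa) => /(Pi_E fr a0)[r [d [-> _]]].
  by rewrite scalemxAl in_frame.
have oab : a *m E + b *m Fm != 0.
  by apply: contra a0 => /eqP/(fr_inj fr)[->].
rewrite addrC; apply: (@submx_trans _ _ _ _ _ _ ((E + Fm) :&: Hyper L (a *m E))%MS).
  rewrite sub_capmx full Pi_Hyper // addmx_sub ?onL_Pi // adj_Pi //.
apply: (sub_eq_rank SW); rewrite r5 -ltnS -(rank_frame fr); apply: sub_notsub_rank (capmxSl _ _) _.
apply/negP => h; have [c ac] := dot_nondeg a0.
have := submx_trans (in_frame E Fm 0 c) h; rewrite sub_capmx => /andP[_].
by rewrite in_Hyper_frame // (negPf ac).
Qed.

Lemma nonfull_cap E Fm a b w : frame L E Fm -> a != 0 -> b != 0 -> dot a b = 0 ->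
  adj L (a *m E + b *m Fm) w -> (w <= E + Fm)%MS -> (w <= a *m E + b *m Fm)%MS.
Proof.
move=> fr a0 b0 ab pw wW; apply: contraT => nw; case/negP: (frame_nonfull fr a0 b0 ab).
set p := (_ + _)%R in pw *.
have p0 : p != 0 by apply: contra a0 => /eqP/(fr_inj fr)[->].
have pE : (p <= a *m E + b *m Fm)%MS by rewrite addmx_sub ?addsmxSl ?addsmxSr.
have pa : adj L p (a *m E).
  by apply: (adj_comb (frame_E_nz fr a0) (fr_adj fr ab)); rewrite ?addsmxSl.
apply: (Pi_sub fL (adj_onL p0 pw) pa pw) => //; [| |exact: in_frame|exact: in_frameE].
  apply/negP => /sub_rVP[r e]; have [|e1 e2] := @frame_split _ _ fr a 0 (r *: a) (r *: b).
    by rewrite mul0mx addr0 -!scalemxAl -scalerDr -e.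
  move/esym/eqP: e2; rewrite scaler_eq0 (negPf b0) orbF => /eqP r0.
  by move: a0; rewrite e1 r0 scale0r eqxx.
by apply: contra nw => h; apply: submx_trans h _; rewrite addsmx_sub pE addsmxSl.
Qed.

Lemma flag_point_cases E Fm a b p : frame L E Fm -> dot a b = 0 -> p != 0 ->
  (p <= a *m E + b *m Fm)%MS ->
  [\/ (p <= a *m E)%MS, (p <= b *m Fm)%MS
   | exists a' b', [/\ a' != 0, b' != 0, dot a' b' = 0, (a' <= a)%MS /\ (b' <= b)%MS & p = a' *m E + b' *m Fm]].
Proof.
move=> fr ab p0 /sub_add2P[i [j e]].
case: (eqVneq (j *: b) 0) => [jb|jb].
  by constructor 1; rewrite e [j *: _]scalemxAl jb mul0mx addr0 scalemx_sub.
case: (eqVneq (i *: a) 0) => [ia|ia].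
  by constructor 2; rewrite e [i *: _]scalemxAl ia mul0mx add0r scalemx_sub.
constructor 3; exists (i *: a), (j *: b); rewrite -!scalemxAl -e !scalemx_sub //.
by split=> //; rewrite !dotE ab !mulr0.
Qed.

(** If x . y is nonzero, take a orthogonal to y and b = x cross a. Both a E and b Fm are at distance
    at most two from p, so p has a neighbour w on their flag line. In each position of w its
    neighbours inside E + Fm satisfy x . y = 0. *)
Lemma frame_point_dot E Fm x y : frame L E Fm -> onL L (x *m E + y *m Fm) -> dot x y = 0.
Proof.
move=> fr; set p := (_ + _) => op; apply/eqP; apply: contraT => d.
have p0 := onL_nz op; have [x0 y0] := frame_nz_dot d.
have [a [a0 ya _]] := perp2 y y; rewrite dotC in ya.
have ax : ~~ (a <= x)%MS.
  apply/negP => /sub_rVP[r e]; move/eqP: ya; rewrite e dotZl mulf_eq0 (negPf d) orbF => /eqP r0.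
  by move: a0; rewrite e r0 scale0r eqxx.
have b0 := cross_nz ax x0; set b := cross x a in b0.
have [ab xb] : dot a b = 0 /\ dot x b = 0 by rewrite dot_crossl dot_crossr.
have [oa ob] := conj (frame_onL fr a0) (frame_onL (frame_sym fr) b0).
have da : dist2 L p (a *m E) by rewrite dist2C -in_Hyper // (in_Hyper_frame _ _ fr) // ya.
have db : dist2 L p (b *m Fm).
  by rewrite dist2C -in_Hyper // /p addrC (in_Hyper_frame _ _ (frame_sym fr)) // dotC xb.
have [w [w0 wab pw]] := np op (frame_E_nz fr a0) (fr_adj fr ab) (FE_npar fr a b0) da db.
case: (flag_point_cases fr ab w0 wab) => [wa|wb|[a' [b' [a0' b0' ab' [a'a b'b] ew]]]].
- have : adj L (a *m E) p by rewrite adjC; apply: adj_sub pw _ (par_sym w0 wa).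
  case/(Pi_E fr a0) => r [c [e ac]].
  have [|e1 e2] := @frame_split _ _ fr x y (r *: a) c; first by rewrite -scalemxAl -e.
  by move: d; rewrite e1 e2 !dotE ac mulr0 eqxx.
- have : adj L (b *m Fm) p by rewrite adjC; apply: adj_sub pw _ (par_sym w0 wb).
  case/(Pi_E (frame_sym fr) b0) => r [c [e ac]].
  have [|e1 e2] := @frame_split _ _ fr x y c (r *: b); first by rewrite -scalemxAl [RHS]addrC -e.
  by move: d; rewrite e1 e2 !dotE dotC ac mulr0 eqxx.
rewrite ew adjC in pw; have := nonfull_cap fr a0' b0' ab' pw (in_frame E Fm x y).
case/sub_add2P=> i [j e].
have [|e1 e2] := @frame_split _ _ fr x y (i *: a') (j *: b'); first by rewrite -!scalemxAl -e.
by move: d; rewrite e1 e2 !dotE ab' !mulr0 eqxx.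
Qed.

Lemma frame_lines E Fm l : frame L E Fm -> l \in L -> (l <= E + Fm)%MS ->
  exists a b, [/\ a != 0, b != 0, dot a b = 0 & l = <<(a *m E + b *m Fm)%MS>>%MS].
Proof.
move=> fr lL lW.
have [p [p' [p0 p'p pp' el]]] := line_two fL lL.
have op : onL L p := adj_onL p0 pp'.
have pW : (p <= E + Fm)%MS by apply: submx_trans lW; rewrite el genmxE addsmxSl.
have pW' : (p' <= E + Fm)%MS by apply: submx_trans lW; rewrite el genmxE addsmxSr.
have [x [y ep]] := in_frameP _ _ _ pW.
have fin a b : a != 0 -> b != 0 -> dot a b = 0 -> (p + p' <= a *m E + b *m Fm)%MS ->
    exists a b, [/\ a != 0, b != 0, dot a b = 0 & l = <<(a *m E + b *m Fm)%MS>>%MS].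
  move=> a0 b0 ab s; exists a, b; split=> //; rewrite el; apply: genmx_eqP => //.
  by apply: (sub_eq_rank s); rewrite !rank_add2 ?(frame_E_nz fr) // FE_npar.
have xy : dot x y = 0 by apply: (frame_point_dot fr); rewrite -ep.
case: (eqVneq y 0) => [y0|y0].
  have ep' : p = x *m E by rewrite ep y0 mul0mx addr0.
  have x0 : x != 0 by apply: contraNneq p0 => x0; rewrite ep' x0 mul0mx.
  have := pp'; rewrite ep' => /(Pi_E fr x0)[r [b [e xb]]]; apply: (fin x b) => //.
    by apply: contraNneq p'p => b0; rewrite e b0 mul0mx addr0 ep' scalemx_sub.
  by rewrite addsmx_sub ep' addsmxSl e addmx_sub ?addsmxSr // scalemx_sub ?addsmxSl.
case: (eqVneq x 0) => [x0|x0].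
  have ep' : p = y *m Fm by rewrite ep x0 mul0mx add0r.
  have := pp'; rewrite ep' => /(Pi_E (frame_sym fr) y0)[r [a [e ya]]]; apply: (fin a y) => //.
  - by apply: contraNneq p'p => b0; rewrite e b0 mul0mx addr0 ep' scalemx_sub.
  - by rewrite dotC.
  by rewrite addsmx_sub ep' addsmxSr e addmx_sub ?addsmxSl // scalemx_sub ?addsmxSr.
apply: (fin x y) => //; rewrite addsmx_sub {1}ep addmx_sub ?addsmxSl ?addsmxSr //=.
by apply: nonfull_cap => //; rewrite -ep.
Qed.

(** The point u is the middle of a path from a point of the flag line (a1, b1) to the flag line (a2,
    b2). Since b1 is not orthogonal to a2, nor b2 to a1, no such middle lies inside E + Fm. *)
Lemma far_point E Fm a1 a2 : frame L E Fm -> a1 != 0 -> ~~ (a2 <= a1)%MS ->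
  exists u, [/\ onL L u, ~~ (u <= E + Fm)%MS, dist2 L u (a1 *m E) & dist2 L u (a2 *m E)].
Proof.
move=> fr a10 a21; have a20 := npar_nz a21; have a12 := npar_sym a10 a21.
have [b1 d1 d21] := perp_sep a10 a21; have [b2 d2 d12] := perp_sep a20 a12.
have [_ b10] := frame_nz_dot d21; have [_ b20] := frame_nz_dot d12.
have w1 : a1 *m E + b1 *m Fm != 0 by apply: contra a10 => /eqP/(fr_inj fr)[->].
have a1b1 : ((a1 *m E + b1 *m Fm)%R <= a1 *m E + b1 *m Fm)%MS by rewrite addmx_sub ?addsmxSl ?addsmxSr.
have wa1 : adj L (a1 *m E + b1 *m Fm) (a1 *m E).
  by apply: (adj_comb (frame_E_nz fr a10) (fr_adj fr d1)) => //; rewrite addsmxSl.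
have ow := adj_onL w1 wa1.
have lL := line_in fL (frame_E_nz fr a20) (FE_npar fr a2 b20) (fr_adj fr d2).
have [w' [w0' w'l /dist2P[u [u0 wu uw']]]] := ln ow lL; rewrite genmxE in w'l.
exists u; split.
- exact: adj_onR wu.
- apply/negP => uW.
  have := nonfull_cap fr a10 b10 d1 wu uW => /sub_add2P[i [j eu]].
  rewrite !scalemxAl in eu; rewrite adjC in uw'.
  have fin : (j *: b1 = 0) /\ (i *: a1 = 0) -> False.
    by case=> e1 e2; case/eqP: u0; rewrite eu e1 e2 !mul0mx addr0.
  have cancel (r s : F) : r * s = 0 -> s != 0 -> r = 0.
    by move/eqP; rewrite mulf_eq0 => /orP[/eqP//|/eqP->]; rewrite eqxx.
  case: (flag_point_cases fr d2 w0' w'l) => [wa|wb|[a' [b' [a0' b0' ab' [a'a b'b] ew]]]].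
  + have : adj L (a2 *m E) u by apply: adj_sub uw' (par_sym w0' wa) _.
    case/(Pi_E fr a20)=> r [c [e dc]]; rewrite eu scalemxAl in e.
    have [e1 e2] := frame_split fr e; apply: fin.
    move: dc; rewrite -e2 dotZr => /cancel/(_ d21) ->; rewrite scale0r; split=> //.
    case: (eqVneq i 0) => [->|i0]; first by rewrite scale0r.
    case/negP: a12; have -> : a1 = i^-1 * r *: a2 by rewrite -scalerA -e1 scalerA mulVf ?scale1r.
    exact: scalemx_sub.
  + have : adj L (b2 *m Fm) u by apply: adj_sub uw' (par_sym w0' wb) _.
    case/(Pi_E (frame_sym fr) b20)=> r [c [e dc]]; rewrite eu scalemxAl [RHS]addrC in e.
    have [e1 e2] := frame_split fr e; apply: fin.
    move: dc; rewrite -e1 dotC dotZl => /cancel/(_ d12) ->; rewrite scale0r; split=> //.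
    have : j * dot a2 b1 = r * dot a2 b2 by rewrite -!dotZr e2.
    by rewrite d2 mulr0 => /cancel/(_ d21) ->; rewrite scale0r.
  rewrite ew in uw'; have := nonfull_cap fr a0' b0' ab' uw' uW => /sub_add2P[i' [j' e]].
  rewrite eu !scalemxAl in e; have [e1 e2] := frame_split fr e; apply: fin.
  have [r a'E] := sub_rVP a'a; have [s b'E] := sub_rVP b'b.
  have : j * dot a2 b1 = (j' * s) * dot a2 b2 by rewrite -!dotZr e2 b'E scalerA.
  rewrite d2 mulr0 => /cancel/(_ d21) ->; rewrite scale0r; split=> //.
  have : i * dot a1 b2 = (i' * r) * dot a2 b2 by rewrite -!dotZl e1 a'E scalerA.
  by rewrite d2 mulr0 => /cancel/(_ d12) ->; rewrite scale0r.
- by apply/dist2P; exists (a1 *m E + b1 *m Fm); rewrite adjC.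
apply/dist2P; exists w'; split=> //.
by apply: (adj_comb (frame_E_nz fr a20) (fr_adj fr d2)) => //; rewrite addsmxSl.
Qed.

End FrameTheory.

(** * The seventh coordinate vector *)

Section Axis.
Variables (F : finFieldType) (N : nat) (L : {set 'M[F]_N}).
Hypothesis hH : flat_hexagon L.
Let fL := fh_flat hH.
Implicit Types (u v w p z e : 'rV[F]_N) (a b x y : 'rV[F]_3).

(** As e lies in the hyperplanes of all frame points, these are given by a . y = 0 and x . b = 0,
    with no condition on the coefficient of e. *)
Record axis (E Fm : 'M[F]_(3, N)) e : Prop := Axis {
  ax_frame : frame L E Fm;
  ax_out : ~~ (e <= E + Fm)%MS;
  ax_all : forall p, onL L p -> (p <= E + Fm + e)%MS;
  ax_E : forall a, a != 0 -> (e <= Hyper L (a *m E))%MS;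
  ax_F : forall b, b != 0 -> (e <= Hyper L (b *m Fm))%MS }.

Lemma axis_sym E Fm e : axis E Fm e -> axis Fm E e.
Proof.
case=> fr out all_ hE hF; split=> //; first exact: frame_sym.
  by rewrite addsmxC.
by move=> p /all_; rewrite [(Fm + E)%MS]addsmxC.
Qed.

Lemma in_axisP E Fm e p : (p <= E + Fm + e)%MS ->
  exists x t y, p = x *m E + t *: e + y *m Fm.
Proof.
case/sub_addvP=> t /in_frameP[x [y /eqP]]; rewrite subr_eq => /eqP->.
by exists x, t, y; rewrite addrAC.
Qed.

(** A point u off the frame is at distance at most two from a1 E and a2 E. Its own hyperplane is
    linear, so it contains a E as well; hence u is in the hyperplane of a E, and so is its component
    along e. *)
Lemma axis_Hyper_comb E Fm e a1 a2 i j : frame L E Fm -> ~~ (e <= E + Fm)%MS ->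
  (forall p, onL L p -> (p <= E + Fm + e)%MS) -> a1 != 0 -> ~~ (a2 <= a1)%MS ->
  i *: a1 + j *: a2 != 0 -> (e <= Hyper L (a1 *m E))%MS -> (e <= Hyper L (a2 *m E))%MS ->
  (e <= Hyper L ((i *: a1 + j *: a2) *m E))%MS.
Proof.
move=> fr eo eall a10 a21 a0 e1 e2; have a20 := npar_nz a21.
have [u [ou uW d1 d2]] := far_point hH fr a10 a21.
have [x [t [y eu]]] := in_axisP (eall u ou).
have t0 : t != 0.
  by apply: contraNneq uW => t0; rewrite eu t0 scale0r addr0 in_frame.
have doty a : a != 0 -> dist2 L u (a *m E) -> (e <= Hyper L (a *m E))%MS -> dot a y = 0.
  move=> {}a0 d he; apply/eqP; rewrite -(in_Hyper_frame hH x y fr a0).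
  have -> : x *m E + y *m Fm = u - t *: e by rewrite eu addrAC addrK.
  by rewrite addmx_sub ?(eqmx_opp, scalemx_sub) // dist2_Hyper // dist2C.
have [y1 y2] := conj (doty _ a10 d1 e1) (doty _ a20 d2 e2).
set a := _ + _ in a0 *; have oa := frame_onL fr a0.
have dua : dist2 L u (a *m E).
  rewrite -(in_Hyper hH) // /a mulmxDl -!scalemxAl addmx_sub ?scalemx_sub ?(in_Hyper hH) ?(frame_onL fr) //.
have ya : dot a y == 0 by rewrite /a !dotE y1 y2 !mulr0 addr0.
rewrite -(in_Hyper_frame hH x y fr a0) in ya.
have : (t *: e <= Hyper L (a *m E))%MS.
  have -> : t *: e = u - (x *m E + y *m Fm) by rewrite eu; move: (x *m E) (y *m Fm) => A B; apply/rowP=> r; rewrite !mxE; ring.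
  by rewrite addmx_sub ?eqmx_opp // dist2_Hyper // dist2C.
by rewrite eqmx_scale.
Qed.

Lemma axis_Hyper_all E Fm e : frame L E Fm -> ~~ (e <= E + Fm)%MS ->
  (forall p, onL L p -> (p <= E + Fm + e)%MS) ->
  (e <= Hyper L (vec3 1 0 0 *m E))%MS -> (e <= Hyper L (vec3 0 1 0 *m E))%MS ->
  (e <= Hyper L (vec3 0 0 1 *m E))%MS -> forall a, a != 0 -> (e <= Hyper L (a *m E))%MS.
Proof.
move=> fr eo eall h0 h1 h2 a a0.
have dn (v : 'rV[F]_3) i : cd3 v i = 1 -> v != 0.
  by move=> e1; apply: contra_eq_neq e1 => ->; rewrite cd30 eq_sym oner_eq0.
have n0 : vec3 1 0 0 != 0 :> 'rV[F]_3 by apply: (dn _ 0%N); rewrite cd3_0.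
have n10 : ~~ ((vec3 0 1 0 : 'rV[F]_3) <= vec3 1 0 0)%MS.
  apply/negP => /sub_rVP[r /(congr1 (fun v : 'rV[F]_3 => cd3 v 1))]; rewrite !cd3E mulr0 => /eqP.
  by rewrite oner_eq0.
have n20 : ~~ ((vec3 0 0 1 : 'rV[F]_3) <= vec3 1 0 0)%MS.
  apply/negP => /sub_rVP[r /(congr1 (fun v : 'rV[F]_3 => cd3 v 2))]; rewrite !cd3E mulr0 => /eqP.
  by rewrite oner_eq0.
pose c : 'rV[F]_3 := cd3 a 0 *: vec3 1 0 0 + cd3 a 1 *: vec3 0 1 0.
have ea : a = c + cd3 a 2 *: vec3 0 0 1 by apply: vec3P; rewrite !cd3E; ring.
case: (eqVneq c 0) => [c0|c0].
  have ea' : a = 0 *: vec3 1 0 0 + cd3 a 2 *: vec3 0 0 1 by rewrite scale0r [LHS]ea c0.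
  by rewrite ea'; apply: (axis_Hyper_comb fr) => //; rewrite -ea'.
have hc : (e <= Hyper L (c *m E))%MS by apply: (axis_Hyper_comb fr).
have ea' : a = 1 *: c + cd3 a 2 *: vec3 0 0 1 by rewrite scale1r [LHS]ea.
rewrite ea'; apply: (axis_Hyper_comb fr) => //; last by rewrite -ea'.
apply/negP => /sub_rVP[r /(congr1 (fun v : 'rV[F]_3 => cd3 v 2))]; rewrite !cd3E !mulr0 addr0 mulr0 => /eqP.
by rewrite oner_eq0.
Qed.

(** The hyperplanes of six frame vertices share a nonzero vector of the 7-space. It is not in E +
    Fm, where the six equations leave only 0. *)
Lemma axis_ex z : onL L z -> exists E Fm e, axis E Fm e.
Proof.
move=> oz; have [E [Fm fr]] := frame_exists hH oz; have frs := frame_sym fr.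
have dn (v : 'rV[F]_3) i : cd3 v i = 1 -> v != 0.
  by move=> e1; apply: contra_eq_neq e1 => ->; rewrite cd30 eq_sym oner_eq0.
have n0 : vec3 1 0 0 != 0 :> 'rV[F]_3 by apply: (dn _ 0%N); rewrite cd3_0.
have n1 : vec3 0 1 0 != 0 :> 'rV[F]_3 by apply: (dn _ 1%N); rewrite cd3_1.
have n2 : vec3 0 0 1 != 0 :> 'rV[F]_3 by apply: (dn _ 2%N); rewrite cd3_2.
have [oe0 of0] := conj (frame_onL fr n0) (frame_onL frs n0).
have nd : ~~ dist2 L (vec3 1 0 0 *m E) (vec3 1 0 0 *m Fm).
  apply: (frame_opp hH fr); rewrite /dot !cd3E !mulr0 !addr0 mulr1; exact: oner_neq0.
pose V := (Hyper L (vec3 1 0 0 *m E) + vec3 1 0 0 *m Fm)%MS.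
have allV p : onL L p -> (p <= V)%MS by exact: hexagon_span.
have rV : \rank V = 7%N by rewrite rank_addv ?(rank_Hyper hH) // (opp_notin_Hyper hH).
have HV p : onL L p -> (Hyper L p <= V)%MS.
  move=> op; apply/sumsmx_subP => w /andP[w0 wp]; apply/rV_subP => v vw.
  have ow := nonzero_onL hH op w0 wp.
  case: (eqVneq v 0) => [->|v0]; first exact: sub0mx.
  exact/allV/(nonzero_onL hH ow v0 vw).
have step m (A : 'M[F]_(m, N)) k p : onL L p -> (A <= V)%MS -> (k.+1 <= \rank A)%N ->
    (A :&: Hyper L p <= V)%MS /\ (k <= \rank (A :&: Hyper L p)%MS)%N.
  move=> op AV rA; split; first exact: submx_trans (capmxSl _ _) AV.
  by have := rank_cap_ge AV (HV p op); rewrite (rank_Hyper hH op) rV; move: rA; card_lia.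
have s1 : (Hyper L (vec3 1 0 0 *m E) <= V)%MS /\ leq 6 (\rank (Hyper L (vec3 1 0 0 *m E))).
  by split; [exact: HV | rewrite (rank_Hyper hH)].
have s2 := step _ _ _ _ (frame_onL fr n1) s1.1 s1.2.
have s3 := step _ _ _ _ (frame_onL fr n2) s2.1 s2.2.
have s4 := step _ _ _ _ (frame_onL frs n0) s3.1 s3.2.
have s5 := step _ _ _ _ (frame_onL frs n1) s4.1 s4.2.
have s6 := step _ _ _ _ (frame_onL frs n2) s5.1 s5.2.
have [e e0 ] := nonzero_in s6.2; rewrite !sub_capmx => /andP[/andP[/andP[/andP[/andP[h0 h1] h2] k0] k1] k2].
have eV : (e <= V)%MS by exact: submx_trans h0 (HV _ oe0).
have WV : (E + Fm <= V)%MS.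
  apply/rV_subP => v /in_frameP[x [y ->]]; rewrite addmx_sub //.
    case: (eqVneq x 0) => [->|x0]; first by rewrite mul0mx sub0mx.
    exact/allV/(frame_onL fr).
  case: (eqVneq y 0) => [->|y0]; first by rewrite mul0mx sub0mx.
  exact/allV/(frame_onL frs).
have eo : ~~ (e <= E + Fm)%MS.
  apply/negP => /in_frameP[x [y ee]]; case/eqP: e0.
  move: h0 h1 h2 k0 k1 k2; rewrite ee !(in_Hyper_frame hH _ _ fr) //.
  rewrite [x *m E + _]addrC !(in_Hyper_frame hH _ _ frs) // /dot !cd3E.
  rewrite !mul0r !mul1r !addr0 !add0r => /eqP y0 /eqP y1 /eqP y2 /eqP x0 /eqP x1 /eqP x2.
  have -> : x = 0 by apply: vec3P; rewrite cd30.
  have -> : y = 0 by apply: vec3P; rewrite cd30.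
  by rewrite !mul0mx addr0.
have eall p : onL L p -> (p <= E + Fm + e)%MS.
  move=> op; apply: submx_trans (allV p op) _; apply: sub_eq_rank.
    by rewrite addsmx_sub WV.
  by rewrite rV rank_addv // (rank_frame fr).
exists E, Fm, e; split=> //; first exact: (axis_Hyper_all fr).
apply: (axis_Hyper_all frs) => //; first by rewrite addsmxC.
by move=> p op; rewrite [(Fm + E)%MS]addsmxC eall.
Qed.

End Axis.

(** * Points and lines outside the span of the frame *)

Section OffFrame.
Variables (F : finFieldType) (N : nat) (L : {set 'M[F]_N}).
Hypothesis hH : flat_hexagon L.
Let fL := fh_flat hH.
Let np := fh_pent hH.
Implicit Types (u v w p z e : 'rV[F]_N) (a b x y : 'rV[F]_3).

(* Up to scaling, the points outside the span of the frame. *)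
Definition apt (E Fm : 'M[F]_(3, N)) e x y : 'rV[F]_N := x *m E + e + y *m Fm.

Lemma apt_sym E Fm e x y : apt E Fm e x y = apt Fm E e y x.
Proof. by rewrite /apt addrC addrA addrAC. Qed.

Lemma axis_split E Fm e x t y x' t' y' : axis L E Fm e ->
  x *m E + t *: e + y *m Fm = x' *m E + t' *: e + y' *m Fm -> [/\ x = x', t = t' & y = y'].
Proof.
move=> ax eq.
have h : (t - t') *: e = (x' - x) *m E + (y' - y) *m Fm.
  rewrite !mulmxBl; move: (x *m E) (x' *m E) (y *m Fm) (y' *m Fm) eq => A A' B B' /rowP eq.
  apply/rowP=> r; move: (eq r); rewrite !mxE => {}eq.
  by apply/eqP; rewrite -subr_eq0; move/eqP: eq; rewrite -subr_eq0; congr (_ == _); ring.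
have tt : t = t'.
  apply/eqP; rewrite -subr_eq0; apply: contraT => t0; case/negP: (ax_out ax).
  by rewrite -(eqmx_scale _ t0) h in_frame.
split=> //; rewrite tt subrr scale0r in h;
by have /eqP := esym h => /eqP/(fr_inj (ax_frame ax))[/eqP e1 /eqP e2]; apply/eqP; rewrite eq_sym -subr_eq0.
Qed.

Section OneAxis.
Variables (E Fm : 'M[F]_(3, N)) (e : 'rV[F]_N).
Hypothesis ax : axis L E Fm e.
Let fr := ax_frame ax.
Notation pt := (apt E Fm e).
Notation W := (E + Fm)%MS.

Lemma apt_out x y : ~~ (pt x y <= W)%MS.
Proof.
apply: contra (ax_out ax) => h.
have -> : e = pt x y - (x *m E + y *m Fm).
  by rewrite /apt; move: (x *m E) (y *m Fm) => A B; apply/rowP=> r; rewrite !mxE; ring.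
by rewrite addmx_sub // eqmx_opp in_frame.
Qed.

Lemma apt_split x y x' y' : pt x y = pt x' y' -> x = x' /\ y = y'.
Proof. by move=> h; have [|-> _ ->] := @axis_split _ _ _ x 1 y x' 1 y' ax; rewrite ?scale1r. Qed.

Lemma apt_dist2 x y a : onL L (pt x y) -> a != 0 -> dist2 L (pt x y) (a *m E) = (dot a y == 0).
Proof.
move=> op a0; rewrite dist2C -(in_Hyper hH) ?(frame_onL fr) // -(in_Hyper_frame hH x y fr a0).
have -> : pt x y = (x *m E + y *m Fm) + e by rewrite /apt addrAC.
have eH := ax_E ax a0; apply/idP/idP => h; last by rewrite addmx_sub.
by rewrite -(addrK e (_ + _)) addmx_sub // eqmx_opp.
Qed.

Lemma apt_nadj x y a : a != 0 -> ~~ adj L (pt x y) (a *m E).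
Proof.
move=> a0; rewrite adjC; apply/negP => /(Pi_E hH fr a0)[r [b [h _]]].
by case/negP: (apt_out x y); rewrite h scalemxAl in_frame.
Qed.

(** Otherwise the plane of p would lie in E + Fm, and p with it. *)
Lemma off_span p w1 w2 w3 : onL L p -> ~~ (p <= W)%MS -> adj L p w1 -> adj L p w2 -> adj L p w3 ->
  (w1 <= W)%MS -> (w2 <= W)%MS -> (w3 <= W)%MS -> w1 != 0 -> ~~ (w2 <= w1)%MS -> (w3 <= w1 + w2)%MS.
Proof.
move=> op pW; rewrite !(adjE fL _ op) => p1 p2 p3 h1 h2 h3 w10 w21; apply: contraT => n3.
have s : (w1 + w2 + w3 <= Pi L p :&: W)%MS.
  by rewrite !addsmx_sub !sub_capmx p1 p2 p3 h1 h2.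
have := mxrankS s; rewrite (rank_addv n3) rank_add2 // => r.
have t := sub_eq_rank (capmxSl (Pi L p) W); rewrite (flat_rank fL op) in t.
case/negP: pW; have := submx_trans (onL_Pi op) (t r); by rewrite sub_capmx => /andP[].
Qed.

End OneAxis.

Lemma flagv_nz E Fm a b : frame L E Fm -> a != 0 -> a *m E + b *m Fm != 0.
Proof. by move=> fr; apply: contra => /eqP/(fr_inj fr)[->]. Qed.

Lemma flagv_npar E Fm a b a' b' : frame L E Fm -> ~~ (a' <= a)%MS ->
  ~~ ((a' *m E + b' *m Fm)%R <= (a *m E + b *m Fm)%R)%MS.
Proof.
move=> fr; apply: contra => /sub_rVP[r]; rewrite scalerDr !scalemxAl => /(frame_split fr)[-> _].
exact: scalemx_sub.
Qed.

(** The point is at distance at most two from both ends of the flag, so [no_pentagon] gives it a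
    neighbour on the flag line, which is neither end. *)
Lemma apt_flag E Fm e x y a b : axis L E Fm e -> onL L (apt E Fm e x y) -> a != 0 -> b != 0 ->
  dot a b = 0 -> dot a y = 0 -> dot x b = 0 ->
  exists2 k : F, k != 0 & adj L (apt E Fm e x y) (a *m E + (k *: b) *m Fm).
Proof.
move=> ax op a0 b0 ab ay xb; have fr := ax_frame ax.
have da : dist2 L (apt E Fm e x y) (a *m E) by rewrite (apt_dist2 ax) // ay.
have db : dist2 L (apt E Fm e x y) (b *m Fm).
  by move: op; rewrite apt_sym => op; rewrite (apt_dist2 (axis_sym ax)) // dotC xb.
have [w [w0 wab pw]] := np op (frame_E_nz fr a0) (fr_adj fr ab) (FE_npar fr a b0) da db.
have [i [j ew]] := sub_add2P _ _ _ wab.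
have i0 : i != 0.
  apply: contraTneq pw => i0; rewrite ew i0 scale0r add0r scalemxAl.
  rewrite apt_sym; apply: (apt_nadj (axis_sym ax)).
  by apply: contraNneq w0 => h; rewrite ew i0 scale0r add0r scalemxAl h mul0mx.
have j0 : j != 0.
  apply: contraTneq pw => j0; rewrite ew j0 scale0r addr0 scalemxAl.
  apply: (apt_nadj ax).
  by apply: contraNneq w0 => h; rewrite ew j0 scale0r addr0 scalemxAl h mul0mx.
exists (i^-1 * j); first by rewrite mulf_neq0 ?invr_eq0.
have := adj_scale i^-1 pw; rewrite ew scalerDr !scalerA mulVf // scale1r.
by rewrite scalemxAl.
Qed.

(** For y = 0 every flag (a, b) with b orthogonal to x yields a neighbour. Two flags on one b and
    one on another b' give independent neighbours, against [off_span]. *)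
Lemma apt_y_nz E Fm e x y : axis L E Fm e -> onL L (apt E Fm e x y) -> y != 0.
Proof.
move=> ax op; apply/eqP => y0; have fr := ax_frame ax.
have ay a : dot a y = 0 by rewrite y0 dot0r.
have [b [b0 xb _]] := perp2 x x.
have [a1 [a2 [a10 a21 e1 e2 _]]] := perp_basis b0; have a20 := npar_nz a21.
have [b' xb' b'b] : exists2 b', dot x b' = 0 & ~~ (b' <= b)%MS.
  case: (eqVneq x 0) => [->|]; last exact: perp_out.
  by have [b' _ nb'] := perp_out b b0; exists b'; rewrite ?dot0l.
have b0' := npar_nz b'b; have [a3 [a30 d3 _]] := perp2 b' b'.
rewrite dotC in d3.
have [k1 k10 p1] := apt_flag ax op a10 b0 e1 (ay a1) xb.
have [k2 k20 p2] := apt_flag ax op a20 b0 e2 (ay a2) xb.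
have [k3 k30 p3] := apt_flag ax op a30 b0' d3 (ay a3) xb'.
have := off_span op (apt_out ax x y) p1 p2 p3 (in_frame _ _ _ _) (in_frame _ _ _ _) (in_frame _ _ _ _) (flagv_nz _ fr a10) (flagv_npar _ _ fr a21).
case/sub_add2P=> i [j]; rewrite !scalerDr !scalemxAl addrACA -!mulmxDl => /(frame_split fr)[_ h].
case/negP: b'b; rewrite -(eqmx_scale _ k30) h !scalerA -scalerDl; exact: scalemx_sub.
Qed.

Lemma apt_x_nz E Fm e x y : axis L E Fm e -> onL L (apt E Fm e x y) -> x != 0.
Proof. by move=> ax; rewrite apt_sym; apply: apt_y_nz; apply: axis_sym. Qed.

(** If x . y = 0, the flags (x, y), (x, b) and (a, y) yield three independent neighbours. *)
Lemma apt_dot_nz E Fm e x y : axis L E Fm e -> onL L (apt E Fm e x y) -> dot x y != 0.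
Proof.
move=> ax op; apply/eqP => xy; have fr := ax_frame ax.
have [x0 y0] := conj (apt_x_nz ax op) (apt_y_nz ax op).
have [b xb by'] := perp_out y x0; have b0 := npar_nz by'.
have [a ya ax'] := perp_out x y0; have a0 := npar_nz ax'; rewrite dotC in ya.
have [k1 k10 p1] := apt_flag ax op x0 y0 xy xy xy.
have [k2 k20 p2] := apt_flag ax op x0 b0 xb xy xb.
have [k3 k30 p3] := apt_flag ax op a0 y0 ya ya xy.
have n21 : ~~ ((x *m E + (k2 *: b) *m Fm)%R <= (x *m E + (k1 *: y) *m Fm)%R)%MS.
  rewrite [X in (X <= _)%MS]addrC [X in (_ <= X)%MS]addrC; apply: (flagv_npar _ _ (frame_sym fr)).
  apply: contra by' => h; rewrite -(eqmx_scale _ k20); apply: submx_trans h _.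
  exact: scalemx_sub.
have := off_span op (apt_out ax x y) p1 p2 p3 (in_frame _ _ _ _) (in_frame _ _ _ _) (in_frame _ _ _ _) (flagv_nz _ fr x0) n21.
case/sub_add2P=> i [j]; rewrite !scalerDr !scalemxAl addrACA -!mulmxDl => /(frame_split fr)[h _].
case/negP: ax'; rewrite h -scalerDl; exact: scalemx_sub.
Qed.

Lemma perp_npar x y a : dot x y != 0 -> dot a y = 0 -> a != 0 -> ~~ (a <= x)%MS.
Proof.
move=> xy ay; apply: contra => /sub_rVP[r h]; move/eqP: ay; rewrite h dotZl mulf_eq0 (negPf xy) orbF.
by move/eqP->; rewrite scale0r.
Qed.

Lemma cross0 x : cross x 0 = 0.
Proof. by apply: vec3P; rewrite !cd3E; ring. Qed.

(* The hexagon lines through apt x y meet the span of the frame in these points;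
   the constant k turns out not to depend on the point. *)
Definition kappa E Fm e (k : F) x y := forall a, dot a y = 0 ->
  adj L (apt E Fm e x y) (a *m E + (k *: cross x a) *m Fm).

(** [apt_flag] gives a scalar for each a orthogonal to y, with b = x cross a. By [off_span] the
    neighbour for a1 + a2 depends linearly on those for a1 and a2, which makes the scalars equal. *)
Lemma kappa_ex E Fm e x y : axis L E Fm e -> onL L (apt E Fm e x y) ->
  exists2 k, k != 0 & kappa E Fm e k x y.
Proof.
move=> ax op; have fr := ax_frame ax.
have [x0 y0] := conj (apt_x_nz ax op) (apt_y_nz ax op); have xy := apt_dot_nz ax op.
have fl a : dot a y = 0 -> a != 0 ->
    exists2 k, k != 0 & adj L (apt E Fm e x y) (a *m E + (k *: cross x a) *m Fm).
  move=> ay a0; apply: apt_flag => //; rewrite ?dot_crossl ?dot_crossr //.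
  exact: cross_nz (perp_npar xy ay a0) x0.
have [a1 [a2 [a10 a21 e1 e2 gen]]] := perp_basis y0; have a20 := npar_nz a21.
have e3 : dot (a1 + a2) y = 0 by rewrite dotDl e1 e2 addr0.
have a30 : a1 + a2 != 0.
  by apply: contra a21; rewrite addrC addr_eq0 => /eqP->; rewrite eqmx_opp.
have [k1 k10 p1] := fl _ e1 a10; have [k2 k20 p2] := fl _ e2 a20; have [k3 k30 p3] := fl _ e3 a30.
have := off_span op (apt_out ax x y) p1 p2 p3 (in_frame _ _ _ _) (in_frame _ _ _ _) (in_frame _ _ _ _) (flagv_nz _ fr a10) (flagv_npar _ _ fr a21).
case/sub_add2P=> i [j]; rewrite !scalerDr !scalemxAl addrACA -!mulmxDl => /(frame_split fr)[h1 h2].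
have [i1 j1] : i = 1 /\ j = 1.
  have [|/eqP h3 /eqP h4] := @comb_eq0 _ _ a1 a2 (i - 1) (j - 1) a10 a21.
    by rewrite !scalerBl !scale1r addrACA -opprD -h1 subrr.
  by move: h3 h4; rewrite !subr_eq0 => /eqP-> /eqP->.
have c21 : ~~ (cross x a2 <= cross x a1)%MS.
  apply/negP => /sub_rVP[r hr].
  have : cross x (a2 - r *: a1) = 0 by rewrite crossDr -scaleNr crossZr hr scaleNr subrr.
  move/(cross_eq0 x0) => hp; apply/negP: hp; apply: perp_npar xy _ _.
    by rewrite !dotE e1 e2 mulr0 subr0.
  by apply: contra a21; rewrite subr_eq0 => /eqP->; exact: scalemx_sub.
have [|/eqP h3 /eqP h4] := @comb_eq0 _ _ _ _ (k3 - k1) (k3 - k2) (cross_nz (perp_npar xy e1 a10) x0) c21.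
  rewrite i1 j1 !scale1r crossDr !scalerDr in h2.
  by rewrite !scalerBl addrACA -opprD -h2 subrr.
move: h3 h4; rewrite !subr_eq0 => /eqP k31 /eqP k32; exists k1 => // a /gen[r [s ->]].
rewrite crossDr !crossZr scalerDr !mulmxDl addrACA.
have -> : (k1 *: (r *: cross x a1)) *m Fm = r *: ((k1 *: cross x a1) *m Fm).
  by rewrite scalemxAl !scalerA mulrC.
have -> : (k1 *: (s *: cross x a2)) *m Fm = s *: ((k2 *: cross x a2) *m Fm).
  by rewrite scalemxAl !scalerA mulrC -k31 k32.
by rewrite -!scalemxAl -!scalerDr !scalemxAl; apply: (adj_lin fL).
Qed.

Lemma kappa_conv E Fm e k x y w : axis L E Fm e -> onL L (apt E Fm e x y) -> kappa E Fm e k x y ->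
  adj L (apt E Fm e x y) w -> (w <= E + Fm)%MS ->
  exists2 a, dot a y = 0 & w = a *m E + (k *: cross x a) *m Fm.
Proof.
move=> ax op kp pw wW; have fr := ax_frame ax.
have [a1 [a2 [a10 a21 e1 e2 gen]]] := perp_basis (apt_y_nz ax op).
have := off_span op (apt_out ax x y) (kp _ e1) (kp _ e2) pw (in_frame _ _ _ _) (in_frame _ _ _ _) wW (flagv_nz _ fr a10) (flagv_npar _ _ fr a21).
case/sub_add2P=> i [j ->]; exists (i *: a1 + j *: a2).
  by rewrite !dotE e1 e2 !mulr0 addr0.
rewrite !scalerDr !scalemxAl addrACA -!mulmxDl crossDr !crossZr scalerDr.
by congr (_ + _ *m Fm); rewrite !scalerA ![k * _]mulrC.
Qed.

(** With c = a E + b Fm the plane of c is spanned by c, a E and the first point, so x' = x + (i + j)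
    a and y' = y + i b. As a . b, a . y and x . b vanish, neither x . y nor x cross a changes. *)
Lemma kappa_step E Fm e k x y x' y' c : axis L E Fm e ->
  onL L (apt E Fm e x y) -> onL L (apt E Fm e x' y') -> c != 0 -> (c <= E + Fm)%MS ->
  adj L (apt E Fm e x y) c -> adj L c (apt E Fm e x' y') -> kappa E Fm e k x y ->
  dot x' y' = dot x y /\ kappa E Fm e k x' y'.
Proof.
move=> ax op op' c0 cW pc cp' kp; have fr := ax_frame ax.
have [a ay ec] := kappa_conv ax op kp pc cW.
have a0 : a != 0.
  by apply: contraNneq c0 => a0; rewrite ec a0 cross0 scaler0 !mul0mx addr0.
have oc := adj_onR c0 pc.
set b := k *: cross x a in ec.
have ab : dot a b = 0 by rewrite dotZr dot_crossr mulr0.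
have xb : dot x b = 0 by rewrite dotZr dot_crossl mulr0.
have eb : b = k *: cross x a by [].
clearbody b.
have ca : adj L c (a *m E).
  apply: (adj_comb (frame_E_nz fr a0) (fr_adj fr ab)); rewrite ?addsmxSl //.
  by rewrite ec addmx_sub ?addsmxSl ?addsmxSr.
have ac : ~~ (a *m E <= c)%MS.
  apply/negP => h; have h' := par_sym (frame_E_nz fr a0) h.
  by case/negP: (apt_nadj ax x y a0); apply: adj_sub pc _ _.
have acW : ~~ (apt E Fm e x y <= c + a *m E)%MS.
  apply: contra (apt_out ax x y) => h; apply: submx_trans h _.
  by rewrite addsmx_sub cW in_frameE.
have cp : adj L c (apt E Fm e x y) by rewrite adjC.
have := submx_trans (adj_Pi cp') (Pi_span fL oc ca cp ac acW).
case/sub_addvP=> t /sub_add2P[i [j /eqP]]; rewrite subr_eq => /eqP h.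
have [|ex t1 ey] := @axis_split E Fm e x' 1 y' (i *: a + j *: a + t *: x) t (i *: b + t *: y) ax.
  rewrite scale1r -[LHS]/(apt E Fm e x' y') h ec /apt !mulmxDl -!scalemxAl.
  move: (a *m E) (b *m Fm) (x *m E) (y *m Fm) => A B X Y.
  by apply/rowP=> r; rewrite !mxE; ring.
rewrite -t1 scale1r in ex ey.
have dxy : dot x' y' = dot x y by rewrite ex ey !dotE ab ay xb; ring.
split=> //; have [k' k0' kp'] := kappa_ex ax op'.
have ay' : dot a y' = 0 by rewrite ey !dotE ab ay; ring.
have cx : cross x' a = cross x a.
  by rewrite ex !crossDl !crossZl crossxx; apply: vec3P; rewrite !cd3E; ring.
suff -> : k = k' by [].
(* Otherwise a nonzero multiple of (x cross a) Fm would be collinear with the second point. *)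
apply/eqP; rewrite eq_sym -subr_eq0; apply: contraT => kk.
have p'c : adj L (apt E Fm e x' y') c by rewrite adjC.
have := adj_lin fL 1 (-1) op' (kp' a ay') p'c; rewrite cx ec eb.
have -> : 1 *: (a *m E + (k' *: cross x a) *m Fm) + -1 *: (a *m E + (k *: cross x a) *m Fm) =
    ((k' - k) *: cross x a) *m Fm.
  rewrite -!scalemxAl; move: (a *m E) (cross x a *m Fm) => A B.
  by apply/rowP=> r; rewrite !mxE; ring.
rewrite apt_sym (negPf (apt_nadj (axis_sym ax) _ _ _)) // scaler_eq0 negb_or kk.
exact: cross_nz (perp_npar (apt_dot_nz ax op) ay a0) (apt_x_nz ax op).
Qed.

(** The difference of two normalized points is a point of their line inside E + Fm and serves as
    common neighbour. *)
Lemma kappa_adj E Fm e k x y x' y' : axis L E Fm e ->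
  onL L (apt E Fm e x y) -> onL L (apt E Fm e x' y') ->
  adj L (apt E Fm e x y) (apt E Fm e x' y') -> kappa E Fm e k x y ->
  dot x' y' = dot x y /\ kappa E Fm e k x' y'.
Proof.
move=> ax op op' pp' kp; pose w := apt E Fm e x y - apt E Fm e x' y'.
case: (eqVneq w 0) => [/eqP|w0].
  by rewrite subr_eq0 => /eqP/(apt_split ax)[<- <-].
have wW : (w <= E + Fm)%MS.
  have -> : w = (x - x') *m E + (y - y') *m Fm.
    rewrite /w /apt !mulmxBl; move: (x *m E) (x' *m E) (y *m Fm) (y' *m Fm) => A A' B B'.
    by apply/rowP=> r; rewrite !mxE; ring.
  exact: in_frame.
have wl : (w <= apt E Fm e x y + apt E Fm e x' y')%MS.
  by rewrite addmx_sub ?eqmx_opp ?addsmxSl ?addsmxSr.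
apply: (kappa_step ax op op' w0 wW) kp; apply: (adj_comb (onL_nz op) pp') => //.
  by rewrite addsmxSl.
by rewrite addsmxSr.
Qed.

Lemma off_norm E Fm e p : axis L E Fm e -> onL L p -> ~~ (p <= E + Fm)%MS ->
  exists t x y, [/\ t != 0, p = t *: apt E Fm e x y & onL L (apt E Fm e x y)].
Proof.
move=> ax op pW; have [x [t [y ep]]] := in_axisP (ax_all ax op).
have t0 : t != 0 by apply: contraNneq pW => t0; rewrite ep t0 scale0r addr0 in_frame.
have ep' : p = t *: apt E Fm e (t^-1 *: x) (t^-1 *: y).
  by rewrite ep /apt -!scalemxAl !scalerDr !scalerA divff // !scale1r.
exists t, (t^-1 *: x), (t^-1 *: y); split=> //; apply: (onL_sub _ op).
  by apply: contraNneq (onL_nz op) => h; rewrite ep' h scaler0.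
by rewrite ep' eqmx_scale.
Qed.

Lemma kappa_const E Fm e k x y x' y' : axis L E Fm e ->
  onL L (apt E Fm e x y) -> onL L (apt E Fm e x' y') -> kappa E Fm e k x y ->
  dot x' y' = dot x y /\ kappa E Fm e k x' y'.
Proof.
move=> ax op op' kp.
(* Q allows a factor t because connectedness is stated for all vectors off the frame, not only for
   normalized ones. *)
pose Q p := exists (t : F) (u v : 'rV[F]_3), [/\ t != 0, p = t *: apt E Fm e u v, dot u v = dot x y & kappa E Fm e k u v].
have : Q (apt E Fm e x' y').
  apply: (far_connected hH (K := (E + Fm)%MS)) op op' (apt_out ax _ _) (apt_out ax _ _) _; last first.
    by exists 1, x, y; rewrite scale1r oner_eq0.
  move=> p p' c {}op {}op' pW pW' c0 pc cp' [t [u [v [t0 ep duv kuv]]]].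
  have [t' [u' [v' [t0' ep' o']]]] := off_norm ax op' pW'.
  have o : onL L (apt E Fm e u v).
    apply: (onL_sub _ op); last by rewrite ep eqmx_scale.
    by apply: contraNneq (onL_nz op) => h; rewrite ep h scaler0.
  rewrite ep in pc; rewrite ep' in cp'.
  have pc' : adj L (apt E Fm e u v) c by apply: adj_sub pc _ _; rewrite ?eqmx_scale.
  have cp1 : adj L c (apt E Fm e u' v') by apply: adj_sub cp' _ _; rewrite ?eqmx_scale.
  exists t', u', v'; rewrite t0' ep' -duv; case: (boolP (c <= E + Fm)%MS) => [cW|cW].
    by case: (kappa_step ax o o' c0 cW pc' cp1 kuv).
  have oc := adj_onR c0 pc'; have [s [u2 [v2 [s0 ec o2]]]] := off_norm ax oc cW.
  rewrite ec in pc' cp1.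
  have pc2 : adj L (apt E Fm e u v) (apt E Fm e u2 v2) by apply: adj_sub pc' _ _; rewrite ?eqmx_scale.
  have cp2 : adj L (apt E Fm e u2 v2) (apt E Fm e u' v') by apply: adj_sub cp1 _ _; rewrite ?eqmx_scale.
  have [<- k2] := kappa_adj ax o o2 pc2 kuv.
  by case: (kappa_adj ax o2 o' cp2 k2).
case=> t [u [v [t0 ep <- kuv]]].
have [|ex t1 ey] := @axis_split E Fm e x' 1 y' (t *: u) t (t *: v) ax.
  by rewrite scale1r -[LHS]/(apt E Fm e x' y') ep /apt -!scalemxAl !scalerDr.
by rewrite -t1 !scale1r in ex ey; rewrite ex ey.
Qed.

Lemma off_lines E Fm e k x0 y0 l : axis L E Fm e ->
  onL L (apt E Fm e x0 y0) -> kappa E Fm e k x0 y0 -> l \in L -> ~~ (l <= E + Fm)%MS ->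
  exists x y a, [/\ a != 0, dot x y = dot x0 y0, dot a y = 0 &
    l = <<(apt E Fm e x y + (a *m E + (k *: cross x a) *m Fm)%R)%MS>>%MS].
Proof.
move=> ax o0 k0 lL /row_subPn[i]; set p := row i l => pW.
have p0 := npar_nz pW; have pl : (p <= l)%MS by exact: row_sub.
have op : onL L p by apply/onLP=> //; exists l.
have [t [x [y [t0 ep o1]]]] := off_norm ax op pW.
have [dxy kxy] := kappa_const ax o0 o1 k0.
have p1l : (apt E Fm e x y <= l)%MS by rewrite -(eqmx_scale _ t0) -ep.
have [p' [p'p pp' el]] := line_basis fL lL (onL_nz o1) p1l.
have p'0 := npar_nz p'p.
have [x' [t' [y' ep']]] := in_axisP (ax_all ax (adj_onR p'0 pp')).
pose w := p' - t' *: apt E Fm e x y.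
have wW : (w <= E + Fm)%MS.
  have -> : w = (x' - t' *: x) *m E + (y' - t' *: y) *m Fm.
    rewrite /w ep' /apt !mulmxBl -!scalemxAl.
    move: (x *m E) (x' *m E) (y *m Fm) (y' *m Fm) => A A' B B'.
    by apply/rowP=> r; rewrite !mxE; ring.
  exact: in_frame.
have wp : ~~ (w <= apt E Fm e x y)%MS.
  by apply: contra p'p => h; rewrite -(subrK (t' *: apt E Fm e x y) p') addmx_sub // scalemx_sub.
have wl : (w <= l)%MS.
  by rewrite addmx_sub ?eqmx_opp ?scalemx_sub // el genmxE addsmxSr.
have pw : adj L (apt E Fm e x y) w by apply/adjP; exists l.
have [a ay ew] := kappa_conv ax o1 kxy pw wW.
exists x, y, a; split=> //; last by rewrite -ew; apply: (line_eq fL lL (onL_nz o1)).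
by apply: contraNneq wp => a0; rewrite ew a0 cross0 scaler0 !mul0mx addr0 sub0mx.
Qed.

End OffFrame.

(** * The standard hexagon *)

Section StandardForms.
Variable F : finFieldType.
Implicit Types (x y a b : 'rV[F]_3) (p r s u v w : 'rV[F]_7) (t : F).

Definition mk7 x t y : 'rV[F]_7 :=
  \row_i nth 0 [:: cd3 x 0; cd3 x 1; cd3 x 2; t; cd3 y 0; cd3 y 1; cd3 y 2] i.
Definition xc p := vec3 (cd p 0) (cd p 1) (cd p 2).
Definition tc p := cd p 3.
Definition yc p := vec3 (cd p 4) (cd p 5) (cd p 6).

Lemma cdD u v i : cd (u + v) i = cd u i + cd v i. Proof. by rewrite /cd mxE. Qed.
Lemma cdZ k u i : cd (k *: u) i = k * cd u i. Proof. by rewrite /cd mxE. Qed.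
Lemma xcD u v : xc (u + v) = xc u + xc v. Proof. by apply: vec3P; rewrite /xc !cd3E cdD. Qed.
Lemma ycD u v : yc (u + v) = yc u + yc v. Proof. by apply: vec3P; rewrite /yc !cd3E cdD. Qed.
Lemma tcD u v : tc (u + v) = tc u + tc v. Proof. exact: cdD. Qed.
Lemma xcZ k u : xc (k *: u) = k *: xc u. Proof. by apply: vec3P; rewrite /xc !cd3E cdZ. Qed.
Lemma ycZ k u : yc (k *: u) = k *: yc u. Proof. by apply: vec3P; rewrite /yc !cd3E cdZ. Qed.
Lemma tcZ k u : tc (k *: u) = k * tc u. Proof. exact: cdZ. Qed.
Lemma xc_mk x t y : xc (mk7 x t y) = x.
Proof. by apply: vec3P; rewrite /xc !cd3E /cd mxE inordK. Qed.
Lemma yc_mk x t y : yc (mk7 x t y) = y.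
Proof. by apply: vec3P; rewrite /yc !cd3E /cd mxE inordK. Qed.
Lemma tc_mk x t y : tc (mk7 x t y) = t.
Proof. by rewrite /tc /cd mxE inordK. Qed.
Definition c7E := (xcD, ycD, tcD, xcZ, ycZ, tcZ, xc_mk, yc_mk, tc_mk).

Lemma eq7 u v : xc u = xc v -> tc u = tc v -> yc u = yc v -> u = v.
Proof.
move=> ex et ey.
have e0 := congr1 (fun v : 'rV[F]_3 => cd3 v 0) ex; have e1 := congr1 (fun v : 'rV[F]_3 => cd3 v 1) ex; have e2 := congr1 (fun v : 'rV[F]_3 => cd3 v 2) ex.
have e4 := congr1 (fun v : 'rV[F]_3 => cd3 v 0) ey; have e5 := congr1 (fun v : 'rV[F]_3 => cd3 v 1) ey; have e6 := congr1 (fun v : 'rV[F]_3 => cd3 v 2) ey.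
rewrite /= !cd3E in e0 e1 e2 e4 e5 e6.
apply/rowP=> i; rewrite -[i]inord_val.
by case: i => -[|[|[|[|[|[|[|i]]]]]]].
Qed.

Lemma xc0 : xc 0 = 0. Proof. by rewrite -(scale0r 0) xcZ scale0r. Qed.
Lemma yc0 : yc 0 = 0. Proof. by rewrite -(scale0r 0) ycZ scale0r. Qed.
Lemma tc0 : tc 0 = 0. Proof. by rewrite -(scale0r 0) tcZ mul0r. Qed.

Lemma row7_pair u v : (u *m v^T) 0 0 = dot (xc u) (xc v) + tc u * tc v + dot (yc u) (yc v).
Proof.
have -> : (u *m v^T) 0 0 = \sum_(i < 7) cd u i * cd v i.
  by rewrite mxE; apply: eq_bigr => i _; rewrite mxE /cd inord_val.
by rewrite !big_ord_recr big_ord0 /= /dot /xc /yc /tc !cd3E; ring.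
Qed.

Definition qf p := dot (xc p) (yc p) - tc p ^+ 2.
Definition bf p r := dot (xc p) (yc r) + dot (xc r) (yc p) - (tc p * tc r) *+ 2.
(** The cross product equations are the six Grassmann relations. The equations on inner products
    follow for points spanning a line of the quadric ([hex_condE]); all four are linear in r, so the
    neighbours of p form a subspace. *)
Definition hadj p r := [&& cross (xc p) (xc r) == tc p *: yc r - tc r *: yc p,
  cross (yc p) (yc r) == tc r *: xc p - tc p *: xc r,
  dot (xc p) (yc r) == tc p * tc r & dot (xc r) (yc p) == tc p * tc r].
(* The imaginary part of the product of two trace-zero split octonions. *)
Definition mid p r := mk7 (tc p *: xc r - tc r *: xc p + cross (yc p) (yc r))
  (tc p * tc r - dot (xc p) (yc r)) (tc r *: yc p - tc p *: yc r + cross (xc p) (xc r)).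

Lemma hadjP p r : reflect [/\ cross (xc p) (xc r) = tc p *: yc r - tc r *: yc p,
  cross (yc p) (yc r) = tc r *: xc p - tc p *: xc r,
  dot (xc p) (yc r) = tc p * tc r & dot (xc r) (yc p) = tc p * tc r] (hadj p r).
Proof.
apply: (iffP and4P) => [[/eqP h1 /eqP h2 /eqP h3 /eqP h4]|[-> -> -> ->]]; by split.
Qed.

Lemma qf_comb k l p r : qf (k *: p + l *: r) = k ^+ 2 * qf p + l ^+ 2 * qf r + k * l * bf p r.
Proof. rewrite /qf /bf !c7E !dotE; ring. Qed.

Lemma bfC p r : bf p r = bf r p. Proof. by rewrite /bf; ring. Qed.
Lemma bf_comb s p r c d : bf s (c *: p + d *: r) = c * bf s p + d * bf s r.
Proof. rewrite /bf !c7E !dotE; ring. Qed.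
Lemma bfxx p : bf p p = qf p *+ 2. Proof. by rewrite /bf /qf; ring. Qed.
Lemma hadj_bf p r : hadj p r -> bf p r = 0.
Proof. by case/hadjP=> _ _ e1 e2; rewrite /bf e1 e2; ring. Qed.

Lemma hadjC p r : hadj p r = hadj r p.
Proof.
suff h u v : hadj u v -> hadj v u by apply/idP/idP; apply: h.
case/hadjP=> h1 h2 h3 h4; apply/hadjP; split.
- by rewrite crossC h1 opprB.
- by rewrite crossC h2 opprB.
- by rewrite h4 mulrC.
by rewrite h3 mulrC.
Qed.

Lemma hadj_comb p r s c d : hadj p r -> hadj p s -> hadj p (c *: r + d *: s).
Proof.
case/hadjP=> h1 h2 h3 h4 /hadjP[k1 k2 k3 k4]; apply/hadjP; rewrite !c7E; split.
- rewrite crossDr !crossZr h1 k1; apply: vec3P; rewrite !cd3E; ring.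
- rewrite crossDr !crossZr h2 k2; apply: vec3P; rewrite !cd3E; ring.
- rewrite !dotE h3 k3; ring.
rewrite !dotE h4 k4; ring.
Qed.

Lemma hadj_scale p r c : hadj p r -> hadj p (c *: r).
Proof. by move=> h; have := hadj_comb c 0 h h; rewrite scale0r addr0. Qed.

Lemma hadj_refl p : qf p = 0 -> hadj p p.
Proof.
move=> /eqP; rewrite subr_eq0 expr2 => /eqP q; apply/hadjP.
by rewrite !crossxx !subrr dotC [dot (yc p) _]dotC.
Qed.

Lemma comp_nz p : p != 0 -> [\/ tc p != 0, xc p != 0 | yc p != 0].
Proof.
move=> p0; case: (eqVneq (tc p) 0) => [et|]; last by constructor 1.
case: (eqVneq (xc p) 0) => [ex|]; last by constructor 2.
case: (eqVneq (yc p) 0) => [ey|]; last by constructor 3.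
by case/eqP: p0; apply: eq7; rewrite ?xc0 ?yc0 ?tc0.
Qed.

(** If the t-coordinate of p is nonzero, pair the first equation with x'. If it vanishes, double
    cross products show that the form at r annihilates x, or y. *)
Lemma hadj_qf p r : p != 0 -> qf p = 0 -> hadj p r -> qf r = 0.
Proof.
move=> p0 /eqP; rewrite subr_eq0 => /eqP q /hadjP[].
rewrite /qf; have := comp_nz p0; move: q.
move: (xc p) (xc r) (yc p) (yc r) (tc p) (tc r) => x x' y y' t t' q nz h1 h2 h3 h4.
case: (eqVneq t 0) nz => [t0 nz|t0 _]; last first.
  apply: (mulfI t0); rewrite mulr0.
  have e : t *: y' = cross x x' + t' *: y by rewrite h1 subrK.
  have := dot_crossr x x' => d0; have := congr1 (dot x') e.
  rewrite !dotE d0 h4 add0r => e'.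
  have -> : t * (dot x' y' - t' ^+ 2) = t * dot x' y' - t' * (t * t') by ring.
  by rewrite e' subrr.
rewrite t0 in h1 h2 h3 h4; rewrite !mul0r in h3 h4.
rewrite !scale0r ?sub0r ?subr0 in h1 h2.
case: nz => //.
- move=> x0; have : (t' ^+ 2 - dot x' y') *: x = 0.
    have : t' *: cross y y' = cross (- cross x x') y' by rewrite h1 opprK crossZl.
    rewrite h2 => e.
    have e2 : cross (- cross x x') y' = dot y' x' *: x - dot y' x *: x'.
      by rewrite -cross_cross; apply: vec3P; rewrite !cd3E; ring.
    rewrite scalerBl expr2 -scalerA e e2 [dot y' x]dotC h3 scale0r subr0 dotC subrr //.
  by move/eqP; rewrite scaler_eq0 (negPf x0) orbF subr_eq0 => /eqP->; rewrite subrr.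
move=> y0; have : (t' ^+ 2 - dot x' y') *: y = 0.
  have : t' *: (- cross x x') = cross (- cross y y') x'.
    by rewrite h2; apply: vec3P; rewrite !cd3E; ring.
  rewrite h1 opprK => e.
  have e2 : cross (- cross y y') x' = dot x' y' *: y - dot x' y *: y'.
    by rewrite -cross_cross; apply: vec3P; rewrite !cd3E; ring.
  by rewrite scalerBl expr2 -scalerA e e2 h4 scale0r subr0 subrr.
by move/eqP; rewrite scaler_eq0 (negPf y0) orbF subr_eq0 => /eqP->; rewrite subrr.
Qed.

Lemma mid_comb p r s c d : mid p (c *: r + d *: s) = c *: mid p r + d *: mid p s.
Proof.
apply: eq7; rewrite /mid !c7E ?crossDr ?crossZr ?dotE; last 2 first.
- ring.
- by apply: vec3P; rewrite !cd3E; ring.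
by apply: vec3P; rewrite !cd3E; ring.
Qed.

Lemma mid_anti p r : bf p r = 0 -> mid r p = - mid p r.
Proof.
rewrite /bf => /eqP; rewrite subr_eq0 => /eqP b; rewrite -scaleN1r; apply: eq7; rewrite /mid !c7E.
- by rewrite [cross (yc r) _]crossC; apply: vec3P; rewrite !cd3E; ring.
- have -> : dot (xc r) (yc p) = (tc p * tc r) *+ 2 - dot (xc p) (yc r) by rewrite -b addrC addKr.
  by ring.
by rewrite [cross (xc r) _]crossC; apply: vec3P; rewrite !cd3E; ring.
Qed.

(** This is p(pr) = (pp)r = 0 in the alternative algebra of octonions. *)
Lemma hadj_mid p r : qf p = 0 -> bf p r = 0 -> hadj p (mid p r).
Proof.
rewrite /qf /bf => /eqP; rewrite subr_eq0 => /eqP q /eqP; rewrite subr_eq0 => /eqP b.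
apply/hadjP; rewrite /mid !c7E; move: q b.
move: (xc p) (xc r) (yc p) (yc r) (tc p) (tc r) => x x' y y' t t' q b.
have d : dot x' y = (t * t') *+ 2 - dot x y' by rewrite -b addrC addKr.
split.
- rewrite !crossDr cross_cross -scaleNr !crossZr crossxx q.
  by apply: vec3P; rewrite !cd3E; ring.
- rewrite !crossDr cross_cross -scaleNr !crossZr crossxx [dot y x]dotC [dot y x']dotC q d.
  by apply: vec3P; rewrite !cd3E; ring.
- by rewrite !dotE dot_crossl q; ring.
rewrite !dotE [dot (cross _ _) _]dotC dot_crossl d q; ring.
Qed.

Lemma mid_eq0 p r : bf p r = 0 -> (mid p r == 0) = hadj p r.
Proof.
move=> b; apply/eqP/hadjP => [m|[h1 h2 h3 h4]].
  have mx := congr1 xc m; have my := congr1 yc m; have mt := congr1 tc m.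
  rewrite /mid !c7E xc0 yc0 tc0 in mx my mt.
  have e3 : dot (xc p) (yc r) = tc p * tc r by apply/eqP; rewrite eq_sym -subr_eq0 mt.
  split=> //.
  - by apply/eqP; rewrite -subr_eq0 -my; apply/eqP/vec3P; rewrite !cd3E; ring.
  - by apply/eqP; rewrite -subr_eq0 -mx; apply/eqP/vec3P; rewrite !cd3E; ring.
  move/eqP: b; rewrite /bf e3 subr_eq0 mulr2n => /eqP/addrI; exact.
apply: eq7; rewrite /mid !c7E ?xc0 ?yc0 ?tc0 ?h1 ?h2 ?h3 ?subrr //; apply: vec3P; rewrite !cd3E; ring.
Qed.

Lemma hadj_mid_r p r : qf r = 0 -> bf p r = 0 -> hadj r (mid p r).
Proof.
move=> q b; have := @hadj_mid r p q; rewrite bfC => /(_ b)/(hadj_scale (-1)).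
by rewrite scaleN1r mid_anti // opprK.
Qed.

Lemma hex_condE p r :
  hex_cond p r = [&& \rank (p + r)%MS == 2%N, qf p == 0, qf r == 0 & hadj p r].
Proof.
have qE u : Qform u = qf u by rewrite /Qform /qf /dot /xc /yc /tc !cd3E.
rewrite /hex_cond addsmxE; case: eqP => //= _.
have c1 : (cross (xc p) (xc r) == tc p *: yc r - tc r *: yc p) =
   [&& pl p r 1 2 == pl p r 3 4, pl p r 2 0 == pl p r 3 5 & pl p r 0 1 == pl p r 3 6].
  rewrite /pl; apply/eqP/and3P => [e|[/eqP e1 /eqP e2 /eqP e3]].
    have e1 := congr1 (fun v : 'rV[F]_3 => cd3 v 0) e; have e2 := congr1 (fun v : 'rV[F]_3 => cd3 v 1) e; have e3 := congr1 (fun v : 'rV[F]_3 => cd3 v 2) e.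
    rewrite /= /xc /yc /tc !cd3E in e1 e2 e3.
    by rewrite e1 e2 e3; split; apply/eqP; ring.
  by apply: vec3P; rewrite /xc /yc /tc !cd3E ?e1 ?e2 ?e3; ring.
have c2 : (cross (yc p) (yc r) == tc r *: xc p - tc p *: xc r) =
   [&& pl p r 5 4 == pl p r 3 2, pl p r 6 5 == pl p r 3 0 & pl p r 4 6 == pl p r 3 1].
  rewrite /pl; apply/eqP/and3P => [e|[/eqP e1 /eqP e2 /eqP e3]].
    have e1 := congr1 (fun v : 'rV[F]_3 => cd3 v 0) e; have e2 := congr1 (fun v : 'rV[F]_3 => cd3 v 1) e; have e3 := congr1 (fun v : 'rV[F]_3 => cd3 v 2) e.
    rewrite /= /xc /yc /tc !cd3E in e1 e2 e3.
    by split; apply/eqP; [move: e3|move: e1|move: e2] => /eqP; rewrite -subr_eq0 -oppr_eq0 => e0;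
       apply/eqP; rewrite -subr_eq0; move: e0; congr (_ == 0); ring.
  by apply: vec3P; rewrite /xc /yc /tc !cd3E; [move: e2|move: e3|move: e1] => /eqP;
     rewrite -subr_eq0 -oppr_eq0 => e0; apply/eqP; rewrite -subr_eq0; move: e0; congr (_ == 0); ring.
have pls : [&& pl p r 1 2 == pl p r 3 4, pl p r 5 4 == pl p r 3 2, pl p r 2 0 == pl p r 3 5,
  pl p r 6 5 == pl p r 3 0, pl p r 0 1 == pl p r 3 6 & pl p r 4 6 == pl p r 3 1] =
  (cross (xc p) (xc r) == tc p *: yc r - tc r *: yc p) && (cross (yc p) (yc r) == tc r *: xc p - tc p *: xc r).
  by rewrite c1 c2; do !case: (_ == _).
rewrite pls; apply/and3P/and3P => [[/forallP q /eqP h1 /eqP h2]|[q1 q2 /and4P[h1 h2 h3 h4]]]; last first.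
  split=> //; apply/forallP => k; apply/forallP => l; rewrite qE qf_comb (eqP q1) (eqP q2) !mulr0 addr0 add0r.
  by rewrite hadj_bf ?mulr0 //; apply/and4P.
have qc k l : qf (k *: p + l *: r) = 0 by apply/eqP; have /forallP := q k => /(_ l); rewrite qE.
have q1 : qf p = 0 by have := qc 1 0; rewrite scale1r scale0r addr0.
have q2 : qf r = 0 by have := qc 0 1; rewrite scale1r scale0r add0r.
have b : bf p r = 0 by have := qc 1 1; rewrite qf_comb q1 q2 !mulr0 !add0r !mul1r.
rewrite q1 q2 !eqxx; split=> //; apply/hadjP.
(* Pairing the first equation with x or with x' gives this when t or t' is nonzero. When both
   vanish, x' is a multiple of x and singularity of the second point decides. *)
suff d : dot (xc p) (yc r) = tc p * tc r.
  by split=> //; move/eqP: b; rewrite /bf d subr_eq0 mulr2n => /eqP/addrI.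
move: q1 q2 b h1 h2; rewrite /qf /bf.
move: (xc p) (xc r) (yc p) (yc r) (tc p) (tc r) => x x' y y' t t' /eqP; rewrite subr_eq0 => /eqP q1.
move=> /eqP; rewrite subr_eq0 => /eqP q2 /eqP; rewrite subr_eq0 => /eqP b h1 h2.
case: (eqVneq t 0) => [t0|t0]; last first.
  have := congr1 (dot x) h1; rewrite dot_crossl !dotE q1 => /eqP; rewrite eq_sym subr_eq0 => /eqP e.
  by apply: (mulfI t0); rewrite e; ring.
case: (eqVneq t' 0) => [t0'|t0']; last first.
  have := congr1 (dot x') h1; rewrite dot_crossr !dotE q2 => /eqP; rewrite eq_sym subr_eq0 => /eqP e.
  have e' : dot x' y = t * t' by apply: (mulfI t0'); rewrite -e; ring.
  by move: b; rewrite e' mulr2n => /addIr.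
rewrite t0 t0' !scale0r subr0 in h1 *; rewrite t0 t0' !mul0r mul0rn in b *.
rewrite t0 expr0n in q1; rewrite t0' expr0n in q2.
case: (eqVneq x 0) => [->|x0]; first by rewrite dot0l.
have /sub_rVP[k ex] := cross_eq0 x0 h1.
case: (eqVneq k 0) => [k0|k0].
  by move: b; rewrite ex k0 scale0r dot0l addr0.
by move: q2; rewrite ex dotZl => /eqP; rewrite mulf_eq0 (negPf k0) => /eqP.
Qed.

End StandardForms.

(** * Totally singular subspaces and neighbourhoods *)

Section StandardSubspaces.
Variable F : finFieldType.
Implicit Types (p r s u v w : 'rV[F]_7).

Lemma lin_matrix m n (f : 'rV[F]_m -> 'rV[F]_n) : linear f ->
  exists M : 'M[F]_(m, n), forall u : 'rV[F]_m, u *m M = f u.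
Proof.
move=> fl; pose h := GRing.isLinear.Build _ _ _ _ f fl.
pose g : {linear 'rV[F]_m -> 'rV[F]_n} := HB.pack f h.
by exists (lin1_mx g) => u; rewrite mul_rV_lin1.
Qed.

(** The map f represents the polar form. A vector of its kernel has only a t-coordinate and is
    singular only if it is 0, in every characteristic. So f is injective on A and maps it into the
    annihilator of A, of rank 7 - rank A. *)
Lemma tot_sing_rank m (A : 'M[F]_(m, 7)) : (forall v, (v <= A)%MS -> qf v = 0) -> (\rank A <= 3)%N.
Proof.
move=> sA; pose f v := mk7 (yc v) (- (tc v *+ 2)) (xc v).
have [|M fM] := @lin_matrix _ _ f.
  by move=> k u v; apply: eq7; rewrite /f !c7E //; ring.
have fE v w : (f v *m w^T) 0 0 = bf v w.
  by rewrite row7_pair /f !c7E /bf [dot (yc v) _]dotC; ring.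
have bA v w : (v <= A)%MS -> (w <= A)%MS -> bf v w = 0.
  move=> vA wA; have := sA (1 *: v + 1 *: w); rewrite qf_comb !sA // !mulr0 !add0r !mul1r; apply.
  by rewrite addmx_sub // scalemx_sub.
have k0 : \rank (A :&: kermx M)%MS = 0%N.
  apply/eqP; rewrite mxrank_eq0; apply/rowV0P => v; rewrite sub_capmx sub_kermx fM => /andP[vA /eqP fv].
  have := congr1 (@xc F) fv; have := congr1 (@yc F) fv; rewrite /f !c7E xc0 yc0 => x0 y0.
  have := sA v vA; rewrite /qf x0 y0 dot0l sub0r => /eqP; rewrite oppr_eq0 expf_eq0 /= => /eqP t0.
  by apply: eq7; rewrite ?xc0 ?yc0 ?tc0.
have rAM : \rank (A *m M) = \rank A by have := mxrank_mul_ker A M; rewrite k0 addn0.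
have s : (A *m M <= kermx A^T)%MS.
  apply/rV_subP => v /submxP[D ->]; rewrite mulmxA fM sub_kermx; apply/eqP/rowP => j.
  have -> : (f (D *m A) *m A^T) 0 j = (f (D *m A) *m (row j A)^T) 0 0.
    by rewrite !mxE; apply: eq_bigr => k _; rewrite !mxE.
  by rewrite fE bA ?mxE ?row_sub // submxMl.
have := mxrankS s; rewrite mxrank_ker mxrank_tr rAM; move: (\rank A) => n; lia.
Qed.

Lemma bf_nondeg p : p != 0 -> qf p = 0 -> exists r, bf p r != 0.
Proof.
move=> p0 q; case: (eqVneq (xc p) 0) => [x0|x0].
  have y0 : yc p != 0.
    apply: contraNneq p0 => y0; move: q; rewrite /qf x0 dot0l sub0r => /eqP.
    rewrite oppr_eq0 expf_eq0 /= => /eqP t0; apply/eqP; apply: eq7; rewrite ?xc0 ?yc0 ?tc0 //.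
  have [b db] := dot_nondeg y0; exists (mk7 b 0 0).
  by rewrite /bf !c7E dot0r add0r mulr0 mul0rn subr0 dotC.
have [b db] := dot_nondeg x0; exists (mk7 0 0 b).
by rewrite /bf !c7E dot0l addr0 mulr0 mul0rn subr0.
Qed.

Lemma bf_space p : exists2 c : 'M[F]_(7, 1), forall v, (v <= kermx c)%MS = (bf p v == 0)
  & p != 0 -> qf p = 0 -> \rank (kermx c) = 6%N.
Proof.
have [|c fc] := @lin_matrix 7 1 (fun v => (bf p v)%:M).
  by move=> k u v; rewrite -[v in LHS]scale1r bf_comb mul1r raddfD /= -scale_scalar_mx.
have cE v : (v <= kermx c)%MS = (bf p v == 0).
  rewrite sub_kermx fc; apply/eqP/eqP => [/matrixP/(_ 0 0)|->]; first by rewrite !mxE mulr1n.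
  by apply/matrixP=> i j; rewrite !mxE mul0rn.
exists c => // p0 q; have [r br] := bf_nondeg p0 q; rewrite mxrank_ker.
suff -> : \rank c = 1%N by [].
apply/eqP; rewrite eqn_leq rank_leq_col lt0n mxrank_eq0; apply/eqP => c0.
by move: br; rewrite -cE c0 kermx0 submx1.
Qed.

(** At most 3, because the neighbours form a totally singular space. At least 3, because
    multiplication by p maps the hyperplane orthogonal to p, of rank 6, into this space, and its
    kernel there is the same space. *)
Lemma nbr_space p : p != 0 -> qf p = 0 ->
  exists2 A : 'M[F]_7, forall v, (v <= A)%MS = hadj p v & \rank A = 3%N.
Proof.
move=> p0 q; have [c cE rc] := bf_space p; have {rc} rc := rc p0 q.
have [|M fM] := @lin_matrix _ _ (mid p).
  by move=> k u v; rewrite -[v in LHS]scale1r mid_comb scale1r.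
pose A := (kermx c :&: kermx M)%MS.
have AE v : (v <= A)%MS = hadj p v.
  rewrite sub_capmx cE sub_kermx fM; apply/andP/idP => [[/eqP b]|h].
    by rewrite mid_eq0.
  by rewrite hadj_bf // mid_eq0 ?hadj_bf.
exists A => //; apply/eqP; rewrite eqn_leq tot_sing_rank /=; last first.
  by move=> v; rewrite AE; apply: hadj_qf.
have s : (kermx c *m M <= A)%MS.
  apply/rV_subP => v /submxP[D ->]; rewrite mulmxA fM AE hadj_mid //.
  by apply/eqP; rewrite -cE submxMl.
have := mxrank_mul_ker (kermx c) M; rewrite rc -/A => e; have := mxrankS s.
by move: e; card_lia.
Qed.

Section Triangle.
Variables u v w : 'rV[F]_7.
Hypotheses (uv : hadj u v) (uw : hadj u w) (vw : hadj v w).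
Hypotheses (qu : qf u = 0) (qv : qf v = 0) (qw : qf w = 0).
Hypothesis ind : forall i j k : F, i *: u + j *: v + k *: w = 0 -> [/\ i = 0, j = 0 & k = 0].

Lemma triangle_hadj i j : hadj (1 *: v + i *: u) (1 *: w + j *: u).
Proof.
have [wv wu] : hadj w v /\ hadj w u by rewrite !(hadjC w).
have uu := hadj_refl qu.
by apply: hadj_comb; rewrite hadjC; apply: hadj_comb.
Qed.

Lemma triangle_ind i j k : (1 *: v + i *: u != 0) /\ (1 *: w + j *: u) - k *: (1 *: v + i *: u) != 0.
Proof.
split; apply/eqP => e.
  have [|_ /eqP] := @ind i 1 0; first by rewrite scale0r addr0 addrC.
  by rewrite oner_eq0.
have [|_ _ /eqP] := @ind (j - k * i) (- k) 1; last by rewrite oner_eq0.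
by rewrite -e; apply/rowP=> r; rewrite !mxE; ring.
Qed.

(** Multiples of u clear the t-coordinates of v and w. Their x-parts are then proportional, and a
    combination with vanishing t and x that is a neighbour of u must be 0. *)
Lemma triangle_t : tc u != 0 -> False.
Proof.
move=> t0; pose i := - (tc v / tc u); pose j := - (tc w / tc u).
set a := 1 *: v + i *: u; set b := 1 *: w + j *: u.
have ta : tc a = 0 by rewrite /a !c7E /i; field.
have tb : tc b = 0 by rewrite /b !c7E /j; field.
have ua : hadj u a by apply: hadj_comb => //; apply: hadj_refl.
have ub : hadj u b by apply: hadj_comb => //; apply: hadj_refl.
have claim c : hadj u c -> tc c = 0 -> xc c = 0 -> c = 0.
  case/hadjP=> h _ _ _ tc0' xc0'; apply: eq7; rewrite ?xc0 ?tc0 ?yc0 //.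
  move: h; rewrite tc0' xc0' scale0r subr0 => h; apply: (scalerI t0); rewrite -h scaler0.
  by apply: vec3P; rewrite !cd3E; ring.
have a0 : xc a != 0.
  by apply: contraNneq (triangle_ind i j 0).1 => x0; apply/eqP; apply: claim.
have /hadjP[h _ _ _] : hadj a b by exact: (triangle_hadj i j).
rewrite ta tb !scale0r subr0 in h; have /sub_rVP[k ek] := cross_eq0 a0 h.
case/eqP: (triangle_ind i j k).2; apply: claim.
- by rewrite -scaleNr -[_ + j *: u]scale1r; apply: hadj_comb.
- by rewrite -scaleNr !c7E -/a -/b ; move: ta tb; rewrite /a /b !c7E => -> ->; ring.
rewrite -scaleNr xcD [xc (- k *: _)]xcZ -/a -/b ek scaleNr subrr //.
Qed.

(** Here multiples of u clear the x-parts, and the y-parts become proportional. *)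
Lemma triangle_x : tc u = 0 -> tc v = 0 -> tc w = 0 -> xc u != 0 -> False.
Proof.
move=> tu tv tw x0.
have /hadjP[h1 _ _ _] := uv; have /hadjP[h2 _ _ _] := uw.
rewrite tu tv !scale0r subr0 in h1; rewrite tu tw !scale0r subr0 in h2.
have /sub_rVP[i' ei] := cross_eq0 x0 h1; have /sub_rVP[j' ej] := cross_eq0 x0 h2.
pose i := - i'; pose j := - j'.
set a := 1 *: v + i *: u; set b := 1 *: w + j *: u.
have ta : tc a = 0 by rewrite /a !c7E tu tv; ring.
have tb : tc b = 0 by rewrite /b !c7E tu tw; ring.
have xa : xc a = 0 by rewrite /a !c7E ei scale1r scaleNr subrr.
have xb : xc b = 0 by rewrite /b !c7E ej scale1r scaleNr subrr.
have a0 : yc a != 0.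
  apply: contraNneq (triangle_ind i j 0).1 => y0; apply/eqP; apply: eq7; rewrite ?xc0 ?tc0 ?yc0 //.
have /hadjP[_ h _ _] : hadj a b by exact: (triangle_hadj i j).
rewrite ta tb !scale0r subr0 in h; have /sub_rVP[k ek] := cross_eq0 a0 h.
case/eqP: (triangle_ind i j k).2; rewrite -/a -/b -scaleNr; apply: eq7.
- by rewrite xcD xcZ xa xb scaler0 addr0 xc0.
- by rewrite tcD tcZ ta tb mulr0 addr0 tc0.
by rewrite ycD ycZ ek scaleNr subrr yc0.
Qed.

End Triangle.

(** In the case left over by [triangle_t] and [triangle_x] the points u and v have only y-parts,
    which are proportional. *)
Lemma no_triangle u v w : hadj u v -> hadj u w -> hadj v w -> qf u = 0 -> qf v = 0 -> qf w = 0 ->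
  u != 0 -> ~~ (v <= u)%MS -> ~~ (w <= u + v)%MS -> False.
Proof.
move=> uv uw vw qu qv qw u0 vu wuv.
have ind (i j k : F) : i *: u + j *: v + k *: w = 0 -> [/\ i = 0, j = 0 & k = 0].
  exact: comb3_eq0.
have ind2 (i j k : F) : i *: v + j *: u + k *: w = 0 -> [/\ i = 0, j = 0 & k = 0].
  by rewrite [i *: v + _]addrC => /ind[].
have ind3 (i j k : F) : i *: w + j *: u + k *: v = 0 -> [/\ i = 0, j = 0 & k = 0].
  by rewrite -addrA addrC => /ind[].
have [vu' wu' wv'] : [/\ hadj v u, hadj w u & hadj w v] by rewrite hadjC uv hadjC uw hadjC.
case: (eqVneq (tc u) 0) => [tu|]; last exact: (@triangle_t u v w).
case: (eqVneq (tc v) 0) => [tv|]; last exact: (@triangle_t v u w).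
case: (eqVneq (tc w) 0) => [tw|]; last exact: (@triangle_t w u v).
case: (eqVneq (xc u) 0) => [xu|]; last exact: (@triangle_x u v w).
case: (eqVneq (xc v) 0) => [xv|]; last exact: (@triangle_x v u w).
have yu : yc u != 0 by apply: contraNneq u0 => yu; apply/eqP; apply: eq7; rewrite ?xc0 ?tc0 ?yc0.
have /hadjP[_ h _ _] := uv; rewrite tu tv !scale0r subr0 in h.
have /sub_rVP[k ek] := cross_eq0 yu h; case/negP: vu; apply/sub_rVP; exists k.
by apply: eq7; rewrite !c7E ?xu ?xv ?tu ?tv ?scaler0 ?mulr0.
Qed.

End StandardSubspaces.

(** * Absence of short circuits in the standard hexagon *)

Section StandardGeometry.
Variable F : finFieldType.
Implicit Types (p r s u v w x y c z : 'rV[F]_7).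
Notation H := (hexL F).

Lemma hex_line p r : p != 0 -> ~~ (r <= p)%MS -> qf p = 0 -> hadj p r -> <<(p + r)%MS>>%MS \in H.
Proof.
move=> p0 rp q pr; apply/imsetP; exists (p, r); last by apply: eq_genmx; apply: addsmxE.
by rewrite inE hex_condE rank_add2 // q (hadj_qf p0 q pr) pr !eqxx.
Qed.

Lemma hexP l : l \in H -> exists p r, [/\ p != 0, ~~ (r <= p)%MS, qf p = 0 /\ qf r = 0, hadj p r
  & l = <<(p + r)%MS>>%MS].
Proof.
case/imsetP=> -[p r]; rewrite inE hex_condE /= => /and4P[/eqP rk /eqP qp /eqP qr pr] ->.
have rp : ~~ (r <= p)%MS.
  apply/negP => h; have := rank_leq_row p; rewrite -ltnS -[X in (_ < X)%N]rk ltnNge => /negP[].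
  by apply: mxrankS; rewrite addsmx_sub h submx_refl.
exists p, r; split=> //; last by apply/esym/eq_genmx/addsmxE.
apply: contra_eq_neq rk => ->; rewrite adds0mx; have := rank_leq_row r; lia.
Qed.

Lemma adj_hex p r : p != 0 -> adj H p r = (qf p == 0) && hadj p r.
Proof.
move=> p0; apply/adjP/andP => [[l [/hexP[u [v [u0 vu [qu qv] uv ->]]]]]|[/eqP q pr]].
  rewrite !genmxE => /sub_add2P[i [j ->]] /sub_add2P[k [m ->]].
  have sg a b : qf (a *: u + b *: v) = 0 by rewrite qf_comb qu qv hadj_bf // !mulr0 !addr0.
  have [vu' uu vv] : [/\ hadj v u, hadj u u & hadj v v] by rewrite hadjC uv !hadj_refl.
  by rewrite sg; split=> //; apply: hadj_comb; rewrite hadjC; apply: hadj_comb.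
have [A AE rA] := nbr_space p0 q.
case: (boolP (r <= p)%MS) => rp; last first.
  by exists (<<(p + r)%MS>>%MS); rewrite hex_line // !genmxE addsmxSl addsmxSr.
(* When r is a multiple of p, another neighbour of p is needed to produce a line. *)
have [|s sA sp] := @outside_vector _ _ _ _ A p; first by rewrite rA rank_nz.
rewrite AE in sA; exists (<<(p + s)%MS>>%MS); rewrite hex_line // !genmxE addsmxSl (submx_trans rp) ?addsmxSl //.
Qed.

Lemma onL_hex p : onL H p = (p != 0) && (qf p == 0).
Proof.
case: (eqVneq p 0) => [->|p0]; first by rewrite /onL eqxx.
apply/idP/idP => /= [/adj_refl|q]; first by rewrite adj_hex // => /andP[->].
by apply: (adj_onL p0 (y := p)); rewrite adj_hex // q hadj_refl ?(eqP q).
Qed.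

Lemma adj_hadj p r : onL H p -> adj H p r = hadj p r.
Proof. by rewrite onL_hex => /andP[p0 q]; rewrite adj_hex // q. Qed.

Lemma Pi_hadj p v : onL H p -> (v <= Pi H p)%MS = hadj p v.
Proof.
move=> op; move: (op); rewrite onL_hex => /andP[p0 /eqP q].
have [A AE rA] := nbr_space p0 q; rewrite -AE; apply/idP/idP => [h|].
  apply: submx_trans h _; apply/sumsmx_subP => l /andP[lH pl]; apply/rV_subP => w wl.
  by rewrite AE -adj_hadj //; apply/adjP; exists l.
by rewrite AE -adj_hadj // => /adj_Pi.
Qed.

Lemma hex_flat : flat H.
Proof.
split.
- by move=> l /hexP[p [r [p0 rp _ _ ->]]]; rewrite genmx_id mxrank_gen rank_add2.
- move=> p op; move: (op); rewrite onL_hex => /andP[p0 /eqP q].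
  have [A AE rA] := nbr_space p0 q; transitivity (\rank A) => //; apply: eqmx_rank; apply/andP; split; apply/rV_subP => v; rewrite AE Pi_hadj //.
- by move=> p r op; rewrite Pi_hadj // adj_hadj.
move=> x l ox /hexP[p [r [p0 rp [qp qr] pr ->]]]; rewrite !genmxE addsmx_sub !Pi_hadj // => /andP[xp xr].
apply: contraT => nx; exfalso; move: ox; rewrite onL_hex => /andP[x0 /eqP qx].
by apply: (no_triangle pr _ _ qp qr qx p0 rp nx); rewrite hadjC.
Qed.

Lemma dist2_hex x y : onL H x -> onL H y -> dist2 H x y = (bf x y == 0).
Proof.
move=> ox oy; apply/dist2P/eqP => [[c [c0 xc' cy]]|b].
  have oc := adj_onL c0 cy; rewrite adjC adj_hadj // in xc'; rewrite adj_hadj // in cy.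
  move: oc; rewrite onL_hex => /andP[_ /eqP qc].
  have := hadj_qf c0 qc (hadj_comb 1 1 xc' cy); rewrite qf_comb.
  by rewrite (hadj_qf c0 qc xc') (hadj_qf c0 qc cy) !mulr0 !add0r !mul1r.
move: (ox) (oy); rewrite !onL_hex => /andP[x0 /eqP qx] /andP[y0 /eqP qy].
case: (eqVneq (mid x y) 0) => [/eqP m|m].
  by exists y; rewrite mid_eq0 // in m; rewrite y0 !adj_hadj // m hadj_refl.
by exists (mid x y); rewrite m adj_hadj // hadj_mid // adjC adj_hadj // hadj_mid_r.
Qed.

(** The neighbours of x form a totally singular space of the maximal rank 3, which v cannot
    extend. *)
Lemma perp_Pi x v : onL H x -> onL H v -> (forall w, hadj x w -> bf v w = 0) -> hadj x v.
Proof.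
move=> ox; rewrite onL_hex => /andP[v0 /eqP qv] h.
move: (ox); rewrite onL_hex => /andP[x0 /eqP qx].
have [A AE rA] := nbr_space x0 qx; rewrite -AE; apply: contraT => nv.
suff : (\rank (A + v)%MS <= 3)%N by rewrite rank_addv // rA.
apply: tot_sing_rank => u /sub_addvP[k]; rewrite AE => hu.
rewrite -[u](subrK (k *: v)) -[_ - _]scale1r qf_comb qv (hadj_qf x0 qx hu) bfC h //.
by rewrite !mulr0 !addr0.
Qed.

Lemma hadj_perp x v w : onL H x -> hadj x v -> hadj x w -> bf v w = 0.
Proof.
rewrite onL_hex => /andP[x0 /eqP qx] xv xw.
have := hadj_qf x0 qx (hadj_comb 1 1 xv xw); rewrite qf_comb.
by rewrite (hadj_qf x0 qx xv) (hadj_qf x0 qx xw) !mulr0 !add0r !mul1r.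
Qed.

(** The products m and m' of x with y and y' are neighbours of x. If they are dependent or have x in
    their span, a combination of y and y' is collinear with x. Otherwise x, m and m' span the plane
    of x, and y is orthogonal to it. *)
Lemma hex_no_pentagon : no_pentagon H.
Proof.
move=> x y y' ox y0 yy' y'y d d'.
have oy := adj_onL y0 yy'; have y'0 := npar_nz y'y; have oy' := adj_onR y'0 yy'.
rewrite dist2_hex // in d; rewrite dist2_hex // in d'.
have [/eqP b /eqP b'] := (d, d'); pose m := mid x y; pose m' := mid x y'.
move: (ox) (oy) (oy'); rewrite !onL_hex => /andP[x0 /eqP qx] /andP[_ /eqP qy] /andP[_ /eqP qy'].
have comb i j : i *: y + j *: y' != 0 -> i *: m + j *: m' = 0 ->
    exists w, [/\ w != 0, (w <= y + y')%MS & adj H x w].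
  move=> w0 e; exists (i *: y + j *: y'); split=> //; first by rewrite addmx_sub_adds ?scalemx_sub.
  by rewrite adj_hadj // -mid_eq0 ?mid_comb ?e // bf_comb b b' !mulr0 addr0.
have ncomb i j : (i != 0) || (j != 0) -> i *: y + j *: y' != 0.
  by apply: contraTneq => /(comb_eq0 y0 y'y)[-> ->]; rewrite eqxx.
case: (eqVneq m 0) => [m0|m0].
  by apply: (comb 1 0); rewrite ?ncomb ?oner_eq0 // m0 scaler0 scale0r addr0.
case: (boolP (m' <= m)%MS) => [/sub_rVP[k ek]|m'm].
  by apply: (comb (- k) 1); rewrite ?ncomb ?oner_eq0 ?orbT // ek scale1r scaleNr addNr.
have [xm xm'] : hadj x m /\ hadj x m' by rewrite !hadj_mid.
case: (boolP (x <= m + m')%MS) => [/sub_add2P[i [j ex]]|xmm'].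
  have w0 : i *: y + j *: y' != 0.
    apply: ncomb; rewrite -negb_and; apply: contra x0 => /andP[/eqP i0 /eqP j0].
    by rewrite ex i0 j0 !scale0r addr0.
  exists (i *: y + j *: y'); split=> //; first by rewrite addmx_sub_adds ?scalemx_sub.
  have bw : bf x (i *: y + j *: y') = 0 by rewrite bf_comb b b' !mulr0 addr0.
  have yyh : hadj y y' by rewrite -adj_hadj.
  have qw : qf (i *: y + j *: y') = 0.
    by rewrite qf_comb qy qy' hadj_bf // !mulr0 !addr0.
  (* The product of x with this combination is x itself, and a product is a neighbour of both
     factors. *)
  by have := hadj_mid_r qw bw; rewrite mid_comb -/m -/m' -ex hadjC -adj_hadj.
exists y; split=> //; first exact: addsmxSl.
rewrite adj_hadj //; apply: perp_Pi => // w.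
have xm'' : adj H x m by rewrite adj_hadj.
have xm2 : adj H x m' by rewrite adj_hadj.
have mx : ~~ (m <= x)%MS.
  by apply: contra xmm' => h; rewrite (submx_trans (par_sym m0 h)) // addsmxSl.
have m'mx : ~~ (m' <= x + m)%MS.
  apply: contra xmm' => h; rewrite addsmxC in h.
  by have := exchange h m'm; rewrite addsmxC // addsmxC.
rewrite -Pi_hadj // => /submx_trans/(_ (Pi_span hex_flat ox xm'' xm2 mx m'mx)).
have ym : bf y m = 0 by apply: hadj_bf; rewrite hadj_mid_r.
have ym' : bf y m' = 0.
  have oym : hadj y' m' by rewrite hadj_mid_r.
  have yyh : hadj y' y by rewrite hadjC -adj_hadj.
  exact: hadj_perp oy' yyh oym.
case/sub_addvP=> k /sub_add2P[i [j /eqP]]; rewrite subr_eq => /eqP ->.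
rewrite -[_ *: x + _]scale1r bf_comb bf_comb ym ym' bfC b; ring.
Qed.

(** The plane of x is spanned by x, y and v, all orthogonal to u. *)
Lemma hex_no_quadrangle : no_quadrangle H.
Proof.
move=> x y u v x0 y0 u0 v0 xy yu uv vx nxu; apply: contraT => nvy.
have [ox oy ou ov] := And4 (adj_onL x0 xy) (adj_onL y0 yu) (adj_onL u0 uv) (adj_onL v0 vx).
have [xy' yu' uv' vx'] : [/\ hadj x y, hadj y u, hadj u v & hadj v x].
  by rewrite -!adj_hadj.
case/negP: nxu; rewrite adj_hadj //.
have xv : adj H x v by rewrite adjC.
case: (boolP (x <= y + v)%MS) => [/sub_add2P[i [j ->]]|nx].
  by rewrite hadjC; apply: hadj_comb; rewrite // hadjC.
have yx : ~~ (y <= x)%MS.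
  by apply: contra nx => h; rewrite (submx_trans (par_sym y0 h)) // addsmxSl.
have vxy : ~~ (v <= x + y)%MS.
  by apply: contra nx => h; rewrite addsmxC in h; exact: exchange h nvy.
apply: perp_Pi => // w; rewrite -Pi_hadj // => /submx_trans/(_ (Pi_span hex_flat ox xy xv yx vxy)).
case/sub_addvP=> k /sub_add2P[i [j /eqP]]; rewrite subr_eq => /eqP ->.
have ux : bf u x = 0 by apply: (hadj_perp oy) => //; rewrite hadjC.
have uy : bf u y = 0 by rewrite bfC hadj_bf.
have uv2 : bf u v = 0 by rewrite hadj_bf.
by rewrite -[_ *: x + _]scale1r bf_comb bf_comb ux uy uv2; ring.
Qed.

(** Planes of a solid share a line, so x, y and z are pairwise collinear, hence on one line. Let u,
    v, w be further points of their planes and write w = n + a u + b v with n on xy. Singularity of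
    w makes ab times the polar form of u and v vanish; as a and b are nonzero, the solid would be
    totally singular. *)
Lemma hex_no_three_pencils : no_three_pencils H.
Proof.
move=> m T x y z rT ox oy oz yx zx zy xT yT zT.
have nq := hex_no_quadrangle.
have adjT u v : onL H u -> onL H v -> ~~ (v <= u)%MS -> (Pi H u <= T)%MS -> (Pi H v <= T)%MS -> adj H u v.
  move=> ou ov vu uT vT; apply: contraT => nuv.
  have rk : (2 <= \rank (Pi H u :&: Pi H v)%MS)%N.
    by have := rank_cap_ge uT vT; rewrite !(flat_rank hex_flat) //; move: rT; card_lia.
  have [|c c0] := @nonzero_in _ _ _ (Pi H u :&: Pi H v)%MS; first by move: rk; card_lia.
  rewrite sub_capmx => /andP[cu cv].
  have [|d] := @outside_vector _ _ _ _ (Pi H u :&: Pi H v)%MS c; first by rewrite (rank_nz c0).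
  rewrite sub_capmx => /andP[du dv] dc; have d0 := npar_nz dc.
  case/negP: dc; apply: (nq u c v d) => //; rewrite ?(onL_nz ou) ?(onL_nz ov) //.
  - by rewrite (adjE hex_flat).
  - by rewrite adjC (adjE hex_flat).
  - by rewrite (adjE hex_flat).
  by rewrite adjC (adjE hex_flat).
have xy := adjT _ _ ox oy yx xT yT; have xz := adjT _ _ ox oz zx xT zT; have yz := adjT _ _ oy oz zy yT zT.
have zxy := triangle hex_flat ox yx xy xz yz.
have x0 := onL_nz ox.
have [|u xu nu] := @Pi_out _ _ _ hex_flat _ (x + y)%MS x ox; first by rewrite rank_add2.
have [|v yv nv] := @Pi_out _ _ _ hex_flat _ (x + y)%MS y oy; first by rewrite rank_add2.
have [|w zw nw] := @Pi_out _ _ _ hex_flat _ (x + y)%MS z oz; first by rewrite rank_add2.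
have nvu : ~~ (v <= x + y + u)%MS.
  apply: contra nv => h; have xv : adj H x v.
    rewrite (adjE hex_flat) //; apply: submx_trans h _.
    by rewrite !addsmx_sub onL_Pi // -!(adjE hex_flat) // xy.
  rewrite addsmxC; apply: (triangle hex_flat oy) => //; first exact: npar_sym.
  by rewrite adjC.
have TE : (T <= x + y + u + v)%MS.
  apply: sub_eq_rank; last by rewrite !rank_addv // rank_nz.
  rewrite !addsmx_sub (submx_trans (onL_Pi ox)) // (submx_trans (onL_Pi oy)) //.
  by rewrite (submx_trans (adj_Pi xu)) // (submx_trans (adj_Pi yv)).
have wT : (w <= x + y + u + v)%MS by apply: submx_trans TE; apply: submx_trans zT; apply: adj_Pi.
case/sub_addvP: wT => b /sub_addvP[a hw].
have ow : onL H w by apply: (adj_onR _ zw); exact: npar_nz nw.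
have [xu' yv' zw' xy'] : [/\ hadj x u, hadj y v, hadj z w & hadj x y] by rewrite -!adj_hadj.
have [xz' yz'] : hadj x z /\ hadj y z by rewrite -!adj_hadj.
pose n := w - b *: v - a *: u; have nE : w = n + (a *: u + b *: v).
  by rewrite /n; apply/rowP=> r; rewrite !mxE; ring.
have [qx qy] : qf x = 0 /\ qf y = 0.
  by move: ox oy; rewrite !onL_hex => /andP[_ /eqP->] /andP[_ /eqP->].
have qu : qf u = 0 by apply: hadj_qf x0 qx xu'.
have qv : qf v = 0 by apply: hadj_qf (onL_nz oy) qy yv'.
have [i [j en]] := sub_add2P _ _ _ hw; rewrite -/n in en.
have ql : qf n = 0 by rewrite en qf_comb qx qy hadj_bf // !mulr0 !addr0.
have xv : bf x v = 0 by apply: (hadj_perp oy) => //; rewrite hadjC.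
have yu : bf y u = 0 by apply: (hadj_perp ox).
have nuv : bf n (a *: u + b *: v) = 0.
  rewrite bf_comb !(bfC n) en !bf_comb (bfC u) (bfC u) (bfC v) (bfC v) xv yu hadj_bf // (hadj_bf yv').
  by rewrite !mulr0 !addr0 !mulr0 addr0.
have qw : qf w = 0 by move: ow; rewrite onL_hex => /andP[_ /eqP].
have : a * b * bf u v = 0.
  move: qw; rewrite nE -[n]scale1r -[_ + b *: v]scale1r qf_comb ql nuv [qf (_ + _)]qf_comb qu qv.
  by rewrite !mulr0 !add0r !addr0 expr1n mul1r.
have a0 : a != 0.
  apply: contraNneq nw => a0; have yw : adj H y w.
    rewrite adj_hadj // nE a0 scale0r add0r -[n]scale1r; apply: hadj_comb => //.
    by rewrite en; apply: hadj_comb; [rewrite hadjC | apply: hadj_refl].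
  have wyz := triangle hex_flat oy zy yz yw zw.
  by apply: submx_trans wyz _; rewrite addsmx_sub addsmxSr.
have b0 : b != 0.
  apply: contraNneq nw => b0; have xw : adj H x w.
    rewrite adj_hadj // nE b0 scale0r addr0 -[n]scale1r; apply: hadj_comb => //.
    by rewrite en; apply: hadj_comb; [apply: hadj_refl|].
  have wxz := triangle hex_flat ox zx xz xw zw.
  by apply: submx_trans wxz _; rewrite addsmx_sub addsmxSl.
move/eqP; rewrite mulf_eq0 mulf_eq0 (negPf a0) (negPf b0) /= => /eqP uv.
suff : (\rank (x + y + u + v)%MS <= 3)%N by rewrite !rank_addv // rank_nz.
apply: tot_sing_rank => s /sub_addvP[k /sub_addvP[l /sub_add2P[i' [j' /eqP]]]].
rewrite !subr_eq => /eqP ->.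
rewrite -[_ *: x + _]scale1r -[1 *: _ + _]scale1r qf_comb qf_comb qf_comb qx qy qu qv hadj_bf //.
have -> : bf (1 *: (i' *: x + j' *: y) + l *: u) v = 0.
  by rewrite bfC !bf_comb (bfC v) xv (bfC v) (hadj_bf yv') (bfC v) uv; ring.
have -> : bf (i' *: x + j' *: y) u = 0.
  by rewrite bfC !bf_comb (bfC u) (hadj_bf xu') (bfC u) yu; ring.
ring.
Qed.

End StandardGeometry.

(** * Lines of the standard hexagon in planes and solids *)

Section StandardSolids.
Variable F : finFieldType.
Implicit Types (p r s u v w x y c z : 'rV[F]_7) (l k n : 'M[F]_7).
Notation H := (hexL F).
Let fH := hex_flat F.
Let nq := @hex_no_quadrangle F.
Let np := @hex_no_pentagon F.
Let s1 := @hex_no_three_pencils F.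
Local Notation q := #|F|.

Lemma pencil_sub m (T : 'M[F]_(m, 7)) x l k : x != 0 -> l \in H -> k \in H -> l != k ->
  (x <= l)%MS -> (x <= k)%MS -> (l <= T)%MS -> (k <= T)%MS -> (Pi H x <= T)%MS.
Proof.
move=> x0 lH kH lk xl xk lT kT.
have [y [yx xy el]] := line_basis fH lH x0 xl; have [z [zx xz ek]] := line_basis fH kH x0 xk.
have yl : (y <= l)%MS by rewrite el genmxE addsmxSr.
have zk : (z <= k)%MS by rewrite ek genmxE addsmxSr.
apply: (Pi_sub fH (adj_onL x0 xy) xy xz yx) => //; try by [exact: submx_trans xl lT | exact: submx_trans yl lT | exact: submx_trans zk kT].
apply: contra lk => h; apply/eqP; rewrite (line_eq fH lH x0 zx xl) ?ek //.
by apply: submx_trans h _; rewrite addsmx_sub xl.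
Qed.

Lemma pencil_lines x l : onL H x -> l \in H -> (l <= Pi H x)%MS = (x <= l)%MS.
Proof.
move=> ox lH; apply/idP/idP; first exact: (flat_vertex fH).
exact: line_Pi.
Qed.

(** The rank is only bounded, here and below, because the preimage of a subspace under the embedding
    can be smaller. *)
Lemma hex_plane m (T : 'M[F]_(m, 7)) : (\rank T <= 3)%N -> (1 < #|lines_in H T|)%N ->
  #|lines_in H T| = q.+1.
Proof.
move=> rT /card_gt1P[l [k [/lines_inP[lH lT] /lines_inP[kH kT] lk]]].
have [|x x0] := @nonzero_in _ _ _ (l :&: k)%MS.
  by have := rank_cap_ge lT kT; rewrite (line_rank fH lH) (line_rank fH kH); move: rT; card_lia.
rewrite sub_capmx => /andP[xl xk].
have ox : onL H x by apply/onLP=> //; exists l.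
have xT := pencil_sub x0 lH kH lk xl xk lT kT.
have Tx : (T <= Pi H x)%MS by apply: (sub_eq_rank xT); rewrite (flat_rank fH ox).
rewrite -(card_lines_through fH ox); apply: eq_card => n; rewrite !inE.
case: (boolP (n \in H)) => //= nH; rewrite -pencil_lines //.
by apply/idP/idP => h; [apply: submx_trans h Tx | apply: submx_trans h xT].
Qed.

(** A line of T not through x meets the plane of x in a point y whose plane is also in T; there is
    at most one such y, since three pencils are impossible. *)
Lemma solid_pencils m (T : 'M[F]_(m, 7)) x : (\rank T <= 4)%N -> onL H x -> (Pi H x <= T)%MS ->
  #|lines_in H T| = q.+1 \/ #|lines_in H T| = (2 * q).+1.
Proof.
move=> rT ox xT; have x0 := onL_nz ox.
have sx : lines_thru H x \subset lines_in H T.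
  by apply/subsetP=> l; rewrite !inE => /andP[lH xl]; rewrite lH (submx_trans (line_Pi lH xl)).
have meet l : l \in lines_in H T -> ~~ (x <= l)%MS -> exists y, [/\ y != 0, (y <= l)%MS, adj H x y,
    ~~ (y <= x)%MS & onL H y /\ (Pi H y <= T)%MS].
  case/lines_inP=> lH lT xl; have [|y y0] := @nonzero_in _ _ _ (l :&: Pi H x)%MS.
    have := rank_cap_ge lT xT; rewrite (line_rank fH lH) (flat_rank fH ox); move: rT; card_lia.
  rewrite sub_capmx => /andP[yl yx].
  have ny : ~~ (y <= x)%MS by apply: contra xl => h; rewrite (submx_trans (par_sym y0 h)).
  have xy : adj H x y by rewrite (adjE fH).
  exists y; split=> //; split; first exact: adj_onR xy.
  have kH := line_in fH x0 ny xy; apply: (pencil_sub y0 lH kH) => //.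
  - by apply: contraNneq xl => ->; rewrite genmxE addsmxSl.
  - by rewrite genmxE addsmxSr.
  by rewrite genmxE addsmx_sub (submx_trans (onL_Pi ox)) // (submx_trans yx).
case: (set_0Vmem (lines_in H T :\: lines_thru H x)) => [e|[l /setDP[lT nx]]].
  left; rewrite -(card_lines_through fH ox); congr #|pred_of_set _|; apply/eqP.
  by rewrite eqEsubset sx -setD_eq0 e eqxx.
have lH : l \in H by case/lines_inP: lT.
have xl : ~~ (x <= l)%MS by apply: contra nx => xl; rewrite inE lH.
right; have [y [y0 yl xy yx [oy yT]]] := meet l lT xl.
have -> : lines_in H T = lines_thru H x :|: lines_thru H y.
  apply/setP=> n; rewrite in_setU; apply/idP/orP => [nT|[]]; last 2 first.
  - by move/(subsetP sx).
  - by rewrite !inE => /andP[nH yn]; rewrite nH (submx_trans (line_Pi nH yn)).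
  have nH : n \in H by case/lines_inP: nT.
  case: (boolP (x <= n)%MS) => xn; [left|right]; rewrite inE nH //=.
  have [z [z0 zn xz zx [oz zT]]] := meet n nT xn.
  case: (boolP (z <= y)%MS) => zy; first by rewrite (submx_trans (par_sym z0 zy)).
  by case: (s1 rT ox oy oz yx zx zy xT yT zT).
have := cardsUI (lines_thru H x) (lines_thru H y); rewrite !(card_lines_through fH) //.
have -> : lines_thru H x :&: lines_thru H y = [set <<(x + y)%MS>>%MS].
  apply/setP=> n; rewrite !inE; apply/andP/eqP => [[/andP[nH xn] /andP[_ yn]]|->].
    exact: (line_eq fH).
  by rewrite (line_in fH) // !genmxE addsmxSl addsmxSr.
by rewrite cards1; card_lia.
Qed.

Lemma perp_in l p : \rank l = 2%N -> exists p', [/\ p' != 0, (p' <= l)%MS & bf p p' = 0].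
Proof.
move=> rl; have [c cE _] := bf_space p.
have [|p' p0'] := @nonzero_in _ _ _ (l :&: kermx c)%MS.
  have := rank_cap_ge (submx1 l) (submx1 (kermx c)); rewrite mxrank1 rl mxrank_ker.
  by have := rank_leq_col c; card_lia.
by rewrite sub_capmx cE => /andP[? /eqP ?]; exists p'.
Qed.

Section SkewSolid.
Variables (m : nat) (T : 'M[F]_(m, 7)).
Hypothesis rT : (\rank T <= 4)%N.
Hypothesis noPi : forall x, onL H x -> ~~ (Pi H x <= T)%MS.

Lemma skew_meet x l k : x != 0 -> l \in H -> k \in H -> (x <= l)%MS -> (x <= k)%MS ->
  (l <= T)%MS -> (k <= T)%MS -> l = k.
Proof.
move=> x0 lH kH xl xk lT kT; apply/eqP; apply: contraT => lk.
have ox : onL H x by apply/onLP=> //; exists l.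
by have := noPi ox; rewrite (pencil_sub x0 lH kH lk).
Qed.

Variables (l k : 'M[F]_7).
Hypotheses (lH : l \in H) (kH : k \in H) (lk : l != k) (lT : (l <= T)%MS) (kT : (k <= T)%MS).

Lemma skew_nadj p r : p != 0 -> r != 0 -> (p <= l)%MS -> (r <= k)%MS -> ~~ adj H p r.
Proof.
move=> p0 r0 pl rk; apply/negP => /adjP[n [nH pn rn]].
have rp : ~~ (r <= p)%MS.
  apply/negP => h; case/eqP: lk; apply: (skew_meet r0) => //; exact: submx_trans h pl.
have nT : (n <= T)%MS.
  by rewrite (line_eq fH nH p0 rp pn rn) genmxE addsmx_sub (submx_trans pl) // (submx_trans rk).
case/eqP: lk; rewrite (skew_meet p0 lH nH pl pn lT nT).
exact: (skew_meet r0).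
Qed.

(** Let z be the middle of a path from p1 to r1, and z' of one from p2 to r2; both are orthogonal to
    T. Each line of T has a point collinear with z, and this is on the line p1 r1. Conversely each
    point of p1 r1 is on exactly one line of T, found by means of z'. *)
Lemma skew_count : #|lines_in H T| = q.+1.
Proof.
have [p1 [p2 [p10 p21 p12 el]]] := line_two fH lH.
have [p1l p2l] : (p1 <= l)%MS /\ (p2 <= l)%MS by rewrite el !genmxE addsmxSl addsmxSr.
have p20 := npar_nz p21.
have rk := line_rank fH kH.
have [r1 [r10 r1k b1]] := perp_in p1 rk; have [r2 [r20 r2k b2]] := perp_in p2 rk.
have [o1 o2] := conj (adj_onL p10 p12) (adj_onR p20 p12).
have oi v : v != 0 -> (v <= k)%MS -> onL H v by move=> v0 vk; apply/onLP=> //; exists k.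
have [or1 or2] := conj (oi _ r10 r1k) (oi _ r20 r2k).
have n11 : ~~ adj H p1 r1 by apply: skew_nadj.
have r21 : ~~ (r2 <= r1)%MS.
  (* Otherwise r1 would be at distance at most two from p1 and p2, hence collinear with a point of
     l. *)
  apply/negP => h; have [a r2E] := sub_rVP h.
  have a0 : a != 0 by apply: contraNneq r20 => a0; rewrite r2E a0 scale0r.
  have d1 : dist2 H r1 p1 by rewrite dist2_hex // bfC b1.
  have d2 : dist2 H r2 p2 by rewrite dist2_hex // bfC b2.
  have d2' : dist2 H r1 p2 by apply: dist2_sub d2 _ _ => //; rewrite r2E eqmx_scale.
  have [w [w0 wl rw]] := np or1 p10 p12 p21 d1 d2'.
  have : ~~ adj H w r1 by apply: skew_nadj; rewrite // el genmxE.
  by rewrite adjC rw.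
have r12 : adj H r1 r2 by apply/adjP; exists k.
have /dist2P[z [z0 p1z zr1]] : dist2 H p1 r1 by rewrite dist2_hex // b1.
have /dist2P[z' [z0' p2z' z'r2]] : dist2 H p2 r2 by rewrite dist2_hex // b2.
have [oz oz'] := conj (adj_onL z0 zr1) (adj_onL z0' z'r2).
have hp : [/\ hadj p1 z, hadj z r1, hadj p2 z' & hadj z' r2] by rewrite -!adj_hadj.
case: hp => hp1z hzr1 hp2z' hz'r2.
have [h12 hr12] : hadj p1 p2 /\ hadj r1 r2 by rewrite -!adj_hadj.
have TE : (T <= p1 + p2 + (r1 + r2))%MS.
  have lc : (l :&: k)%MS = 0.
    apply/eqP/rowV0P => v; rewrite sub_capmx => /andP[vl vk]; apply/eqP; apply: contraT => v0.
    by case/eqP: lk; apply: (skew_meet v0).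
  have sl : (p1 + p2 <= l)%MS by rewrite addsmx_sub p1l.
  have sk : (r1 + r2 <= k)%MS by rewrite addsmx_sub r1k.
  apply: sub_eq_rank.
    by rewrite addsmx_sub (submx_trans sl) // (submx_trans sk).
  apply: leq_trans rT _; rewrite mxrank_disjoint_sum ?rank_add2 //.
  by apply/eqP; rewrite -submx0 -lc capmxS.
have Tdec v : (v <= T)%MS -> exists a b, [/\ (a <= p1 + p2)%MS, (b <= r1 + r2)%MS & v = a + b].
  move=> vT; have /sub_addsmxP[[D D'] ->] := submx_trans vT TE.
  by exists (D *m (p1 + p2)%MS), (D' *m (r1 + r2)%MS); rewrite !submxMl.
have perpT s : bf s p1 = 0 -> bf s p2 = 0 -> bf s r1 = 0 -> bf s r2 = 0 ->
    forall v, (v <= T)%MS -> bf s v = 0.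
  move=> e1 e2 e3 e4 v /Tdec[a [b [/sub_add2P[i [j ->]] /sub_add2P[i' [j' ->]] ->]]].
  rewrite -[i *: p1 + _]scale1r -[i' *: r1 + _]scale1r !bf_comb e1 e2 e3 e4; ring.
have zT := perpT z (etrans (bfC _ _) (hadj_bf hp1z)) (hadj_perp o1 hp1z h12) (hadj_bf hzr1).
have {}zT : forall v, (v <= T)%MS -> bf z v = 0.
  by apply: zT; apply: (hadj_perp or1) => //; rewrite hadjC.
have zT' : forall v, (v <= T)%MS -> bf z' v = 0.
  apply: perpT; last exact: hadj_bf.
  - by apply: (hadj_perp o2) => //; rewrite hadjC.
  - by rewrite bfC hadj_bf.
  by apply: (hadj_perp or2); rewrite hadjC.
have zl : ~~ (z <= l)%MS.
  by apply/negP => h; have := skew_nadj z0 r10 h r1k; rewrite zr1.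
have zp1 : ~~ (z <= p1)%MS by apply: contra zl => h; exact: submx_trans h p1l.
have znT : ~~ (z <= T)%MS.
  apply: contra zl => zT1; have nH := line_in fH p10 zp1 p1z.
  rewrite (@skew_meet p1 l <<(p1 + z)%MS>>%MS) // !genmxE ?addsmxSl ?addsmxSr //.
  by rewrite addsmx_sub zT1 (submx_trans p1l).
have r1p1 : ~~ (r1 <= p1)%MS.
  by apply: contra n11 => h; apply: adj_sub (adj_refl o1) _ h.
have capz v : (v <= T)%MS -> adj H z v -> (v <= p1 + r1)%MS.
  move=> vT zv; apply: contraT => nv; case/negP: znT.
  apply: (@submx_trans _ _ _ _ _ _ (p1 + r1 + v)%MS); last first.
    by rewrite !addsmx_sub vT (submx_trans p1l) // (submx_trans r1k).
  apply: submx_trans (onL_Pi oz) _; apply: sub_eq_rank.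
    by rewrite !addsmx_sub -!(adjE fH) // [adj H z p1]adjC p1z zr1.
  by rewrite (flat_rank fH) // rank_addv // rank_add2.
have cover n : n \in lines_in H T -> exists2 w, w \in pts (p1 + r1)%MS & (w <= n)%MS.
  case/lines_inP=> nH nT; have [a [b [a0 ba ab en]]] := line_two fH nH.
  have [an bn] : (a <= n)%MS /\ (b <= n)%MS by rewrite en !genmxE addsmxSl addsmxSr.
  have [oa ob] := conj (adj_onL a0 ab) (adj_onR (npar_nz ba) ab).
  have da : dist2 H z a by rewrite dist2_hex // zT // (submx_trans an).
  have db : dist2 H z b by rewrite dist2_hex // zT // (submx_trans bn).
  have [w [w0 wab zw]] := np oz a0 ab ba da db.
  have wn : (w <= n)%MS by rewrite en genmxE.
  exists (normalize w); last by rewrite normalize_eqmx.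
  by apply: normalize_pts => //; apply: capz zw; exact: submx_trans wn nT.
(* If z were orthogonal to z', it would be orthogonal to the whole plane of z', hence collinear with
   z', and close a quadrangle p1, p2, z', z. *)
have bzz' : bf z z' != 0.
  apply/negP => /eqP b.
  have p2nz' : ~~ (p2 <= z')%MS.
    apply/negP => h; have := skew_nadj p20 r20 p2l r2k.
    by rewrite (adj_sub z'r2 h).
  have r2n : ~~ (r2 <= z' + p2)%MS.
    apply/negP => h; have := skew_nadj p20 r20 p2l r2k; apply/negP; rewrite negbK.
    have z'p2 : adj H z' p2 by rewrite adjC.
    by apply: (adj_comb z0' z'p2) => //; rewrite addsmxSr.
  have z'p2 : adj H z' p2 by rewrite adjC.
  have zz' : adj H z' z.
    rewrite adj_hadj //; apply: perp_Pi => // w; rewrite -Pi_hadj //.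
    move=> /submx_trans/(_ (Pi_span fH oz' z'p2 z'r2 p2nz' r2n)).
    case/sub_addvP=> c /sub_add2P[i [j /eqP]]; rewrite subr_eq => /eqP ->.
    rewrite -[i *: z' + _]scale1r !bf_comb b (zT p2 (submx_trans p2l lT)) (zT r2 (submx_trans r2k kT)); ring.
  case: (boolP (adj H p1 z')) => [p1z'|np1].
    have z'l := triangle fH o1 p21 p12 p1z' p2z'.
    have := @skew_nadj z' r2 z0' r20; rewrite z'r2 el genmxE z'l r2k => /(_ isT isT) //.
  have zp1' : adj H z p1 by rewrite adjC.
  have zp2 := nq p10 p20 z0' z0 p12 p2z' zz' zp1' np1.
  have := skew_nadj p20 r10 p2l r1k; rewrite (adj_sub zr1 (par_sym z0 zp2)) //.
have fib w : w \in pts (p1 + r1)%MS -> #|[set n in lines_in H T | (w <= n)%MS]| = 1%N.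
  case/ptsP=> w0 _ wt; apply/eqP; rewrite eqn_leq cards_le1 /=; last first.
    move=> n n'; rewrite !inE => /andP[/andP[nH nT] wn] /andP[/andP[nH' nT'] wn'].
    exact: (skew_meet w0).
  have zp1' : adj H z p1 by rewrite adjC.
  have zw : adj H z w.
    rewrite (adjE fH) //; apply: submx_trans wt _; by rewrite addsmx_sub -!(adjE fH) // zp1'.
  have ow := adj_onR w0 zw.
  have wT : (w <= T)%MS.
    by apply: submx_trans wt _; rewrite addsmx_sub (submx_trans p1l) // (submx_trans r1k).
  (* The common neighbour c of w and z' is orthogonal to z, so its coefficient at z' vanishes and c
     is on p2 r2, inside T. *)
  have /dist2P[c [c0 wc cz']] : dist2 H w z' by rewrite dist2_hex // bfC zT'.
  have bzc : bf z c = 0.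
    by apply: (hadj_perp ow); rewrite -adj_hadj // adjC.
  have p2nz' : ~~ (p2 <= z')%MS.
    apply/negP => h; have := skew_nadj p20 r20 p2l r2k.
    by rewrite (adj_sub z'r2 h).
  have z'p2 : adj H z' p2 by rewrite adjC.
  have r2n : ~~ (r2 <= z' + p2)%MS.
    apply/negP => h; have := skew_nadj p20 r20 p2l r2k; apply/negP; rewrite negbK.
    by apply: (adj_comb z0' z'p2) => //; rewrite addsmxSr.
  have cP : (c <= Pi H z')%MS by rewrite -(adjE fH) // adjC.
  have := submx_trans cP (Pi_span fH oz' z'p2 z'r2 p2nz' r2n).
  case/sub_addvP=> a2 /sub_add2P[a0 [a1 /eqP]]; rewrite subr_eq => /eqP ec.
  have a00 : a0 = 0.
    move: bzc; rewrite ec -[a0 *: z' + _]scale1r !bf_comb.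
    rewrite (zT p2 (submx_trans p2l lT)) (zT r2 (submx_trans r2k kT)) !mulr0 !addr0 mul1r => /eqP.
    by rewrite mulf_eq0 (negPf bzz') orbF => /eqP.
  rewrite a00 scale0r add0r in ec.
  have cT : (c <= T)%MS.
    by rewrite ec addmx_sub ?scalemx_sub // ?(submx_trans p2l) ?(submx_trans r2k).
  have cw : ~~ (c <= w)%MS.
    apply/negP => /sub_rVP[a h]; have [i [j ew]] := sub_add2P _ _ _ wt.
    have ind : (a1 *: p2 - (a * i) *: p1) + (a2 *: r2 - (a * j) *: r1) = 0.
      have : c - a *: w = 0 by rewrite h subrr.
      by rewrite ec ew => <-; apply/rowP=> t; rewrite !mxE; ring.
    have lc v : (v <= l)%MS -> (v <= k)%MS -> v = 0.
      move=> vl vk; apply/eqP; apply: contraT => v0; case/eqP: lk; exact: (skew_meet v0).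
    have e1 : a1 *: p2 - (a * i) *: p1 = 0.
      apply: lc; first by rewrite addmx_sub ?eqmx_opp ?scalemx_sub.
      by move/eqP: ind; rewrite addr_eq0 => /eqP->; rewrite eqmx_opp addmx_sub ?eqmx_opp ?scalemx_sub.
    have e2 : a2 *: r2 - (a * j) *: r1 = 0 by rewrite e1 add0r in ind.
    have [|_ a10] := @comb_eq0 _ _ _ _ (- (a * i)) a1 p10 p21; first by rewrite scaleNr addrC.
    have [|_ a20] := @comb_eq0 _ _ _ _ (- (a * j)) a2 r10 r21; first by rewrite scaleNr addrC.
    by case/eqP: c0; rewrite ec a10 a20 !scale0r addr0.
  apply/card_gt0P; exists <<(w + c)%MS>>%MS; rewrite !inE (line_in fH) // !genmxE addsmxSl addsmx_sub wT cT //.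
have fib2 n : n \in lines_in H T -> #|[set w in pts (p1 + r1)%MS | (w <= n)%MS]| = 1%N.
  move=> nT; have [w wt wn] := cover n nT; apply/eqP; rewrite eqn_leq cards_le1 /=; last first.
    move=> u v; rewrite !inE => /andP[/and3P[u0 nu ut] un] /andP[/and3P[v0 nv vt] vn].
    have pu : u \in pts (p1 + r1)%MS by rewrite inE u0 nu.
    have pv : v \in pts (p1 + r1)%MS by rewrite inE v0 nv.
    apply: (pts_par pu pv); apply: contraT => uv; case/negP: n11.
    have [nH _] := lines_inP _ _ _ nT.
    have s : (u + v <= p1 + r1)%MS by rewrite addsmx_sub ut.
    have vu : ~~ (u <= v)%MS := uv.
    have s' : (p1 + r1 <= v + u)%MS.
      by apply: sub_eq_rank; [rewrite addsmxC | rewrite !rank_add2].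
    have sn : (p1 + r1 <= n)%MS by apply: submx_trans s' _; rewrite addsmx_sub vn.
    by apply/adjP; exists n; move: sn; rewrite addsmx_sub => /andP[].
  by apply/card_gt0P; exists w; rewrite inE wt.
have := double_count (pts (p1 + r1)%MS) (lines_in H T) (fun w n => (w <= n)%MS).
rewrite (eq_bigr (fun=> 1%N)) // [X in _ = X](eq_bigr (fun=> 1%N)) // !sum_set_const !muln1.
by rewrite card_pts_line // rank_add2.
Qed.

End SkewSolid.

Lemma hex_solid m (T : 'M[F]_(m, 7)) : (\rank T <= 4)%N -> (1 < #|lines_in H T|)%N ->
  #|lines_in H T| = q.+1 \/ #|lines_in H T| = (2 * q).+1.
Proof.
move=> rT /card_gt1P[l [k [/lines_inP[lH lT] /lines_inP[kH kT] lk]]].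
case: (boolP [exists x, onL H x && (Pi H x <= T)%MS]) => [/existsP[x /andP[ox xT]]|no].
  exact: solid_pencils ox xT.
left; apply: (skew_count rT _ lH kH lk lT kT) => x ox; apply: contra no => xT.
by apply/existsP; exists x; rewrite ox.
Qed.

End StandardSolids.

(** * Lines of the standard hexagon in a 4-space and in total *)

Section StandardCounts.
Variable F : finFieldType.
Implicit Types (p r s u v w x y c z : 'rV[F]_7) (l k n : 'M[F]_7).
Notation H := (hexL F).
Let fH := hex_flat F.
Let nq := @hex_no_quadrangle F.
Let np := @hex_no_pentagon F.
Local Notation q := #|F|.

Lemma qfZ (k0 : F) p : qf (k0 *: p) = k0 ^+ 2 * qf p.
Proof. by rewrite /qf !c7E !dotE; ring. Qed.

Lemma bfZ (k0 : F) p r : bf p (k0 *: r) = k0 * bf p r.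
Proof. by rewrite /bf !c7E !dotE; ring. Qed.

Lemma points_vectors N (A V : {set 'rV[F]_N}) :
  (forall u : 'rV[F]_N, u \in A -> u != 0 /\ normalize u = u) ->
  (forall (u : 'rV[F]_N) (c : F), u \in A -> c != 0 -> c *: u \in V) -> (#|A| * q.-1 <= #|V|)%N.
Proof.
move=> hA hV; pose D := setX A [set~ (0 : F)].
have cD : #|D| = (#|A| * q.-1)%N by rewrite cardsX cardsC1.
rewrite -cD; pose f (d : 'rV[F]_N * F) := d.2 *: d.1.
have inj : {in D &, injective f}.
  move=> [u c] [u' c'] /setXP[/= uA c0] /setXP[/= uA' c0']; rewrite !inE in c0 c0'.
  rewrite /f /= => e; have [u0 nu] := hA u uA; have [u0' nu'] := hA u' uA'.
  have eu : u = u' by rewrite -nu -nu' -(normalize_scale u c0) e normalize_scale.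
  have /eqP : (c - c') *: u = 0 by rewrite scalerBl e eu subrr.
  by rewrite scaler_eq0 (negPf u0) orbF subr_eq0 eu => /eqP->.
rewrite -(card_in_imset inj); apply: subset_leq_card; apply/subsetP=> v /imsetP[[u c] /setXP[/= uA]].
by rewrite !inE => c0 ->; exact: hV.
Qed.

Lemma card_affine N (A : {set 'rV[F]_N}) m (K : 'M[F]_(m, N)) :
  (forall u v : 'rV[F]_N, u \in A -> v \in A -> ((u - v)%R <= K)%MS) -> (#|A| <= q ^ \rank K)%N.
Proof.
move=> h; case: (set_0Vmem A) => [->|[v vA]]; first by rewrite cards0.
rewrite -card_rowspace -(card_imset A (addIr (- v))); apply: subset_leq_card.
by apply/subsetP=> w /imsetP[u uA ->]; rewrite inE h.
Qed.

Section FourDim.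
Variables (m : nat) (T : 'M[F]_(m, 7)).
Hypothesis rT : (\rank T <= 5)%N.

Definition sing_pts := [set p in pts T | qf p == 0].
Definition full_sing := [set p in sing_pts | (Pi H p <= T)%MS].

Lemma sing_ptsP p : reflect [/\ p != 0, normalize p = p, (p <= T)%MS & qf p = 0] (p \in sing_pts).
Proof.
apply: (iffP idP); first by rewrite inE => /andP[/ptsP[? ? ?] /eqP ?].
by case=> p0 np' pT q0; rewrite inE q0 eqxx andbT; apply/ptsP.
Qed.

(** For singular v with polar value 1 against p, the form at v + s p is s; so there are at most q^4
    / q such vectors, which represent the points not orthogonal to p. The others lie in a space of
    rank at most 4. *)
Lemma sing_pts_far p : p \in sing_pts -> (exists2 v, (v <= T)%MS & bf p v != 0) ->
  (#|sing_pts| <= 2 * q ^ 3 + q ^ 2 + q + 1)%N.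
Proof.
case/sing_ptsP=> p0 _ pT qp [v0 v0T bv0]; have q1 := q_gt1 F.
have [c cE rc] := bf_space p.
pose K := (T :&: kermx c)%MS.
have rK : (\rank K <= 4)%N.
  rewrite -ltnS; apply: leq_trans rT; apply: sub_notsub_rank (capmxSl _ _) _.
  apply/negP => h; have := submx_trans v0T h; by rewrite sub_capmx cE (negPf bv0) andbF.
have KE v : (v <= K)%MS = (v <= T)%MS && (bf p v == 0) by rewrite sub_capmx cE.
pose Z := [set v | [&& (v <= T)%MS, bf p v == 1 & qf v == 0]].
pose D := [set v | (v <= T)%MS && (bf p v == 1)].
have ZD : (#|Z| * q <= #|D|)%N.
  have -> : (#|Z| * q)%N = #|setX Z [set: F]| by rewrite cardsX cardsT.
  pose f (d : 'rV[F]_7 * F) := d.1 + d.2 *: p.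
  have qv d : d \in setX Z [set: F] -> qf (f d) = d.2.
    case: d => v s /setXP[/=]; rewrite inE => /and3P[_ /eqP b /eqP qv] _.
    by rewrite /f /= -[v]scale1r qf_comb qv qp bfC b; ring.
  have inj : {in setX Z [set: F] &, injective f}.
    move=> [v s] [v' s'] d d' e; have := qv _ d; rewrite e (qv _ d') /= => es.
    by move: e; rewrite /f /= es => /addIr ->.
  rewrite -(card_in_imset inj); apply: subset_leq_card; apply/subsetP=> w /imsetP[[v s] /setXP[/=]].
  rewrite inE => /and3P[vT /eqP b _] _ ->; rewrite inE /f /= addmx_sub ?scalemx_sub //=.
  by rewrite -[v]scale1r bf_comb b bfxx qp mul0rn mulr0 addr0 mulr1.
have cD : (#|D| <= q ^ 4)%N.
  apply: leq_trans (_ : q ^ \rank K <= _)%N; last by rewrite leq_exp2l.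
  apply: card_affine => u v; rewrite !inE => /andP[uT /eqP bu] /andP[vT /eqP bv].
  rewrite KE addmx_sub ?eqmx_opp //= -[u]scale1r -scaleN1r bf_comb bu bv mul1r mulr1 subrr //.
have cZ : (#|Z| <= q ^ 3)%N.
  by move: (leq_trans ZD cD); rewrite (expnSr _ 3) leq_pmul2r // (leq_trans _ q1).
have cF : (#|sing_pts :\: pts K| <= q ^ 3)%N.
  apply: leq_trans cZ; pose g v := (bf p v)^-1 *: v.
  have nb v : v \in sing_pts :\: pts K -> v != 0 /\ bf p v != 0.
    case/setDP=> /sing_ptsP[v0' nv vT qv]; rewrite inE v0' nv eqxx KE vT /= => b; by [].
  have inj : {in sing_pts :\: pts K &, injective g}.
    move=> u v uS vS e; have [u0 bu] := nb u uS; have [_ bv] := nb v vS.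
    move: uS vS; rewrite !in_setD => /andP[_ uS] /andP[_ vS].
    have [_ nu _ _] := sing_ptsP _ uS; have [_ nv _ _] := sing_ptsP _ vS.
    have nz w : bf p w != 0 -> normalize (g w) = normalize w.
      by move=> bw; rewrite normalize_scale ?invr_eq0.
    by rewrite -nu -nv -(nz u) // -(nz v) // e.
  rewrite -(card_in_imset inj); apply: subset_leq_card; apply/subsetP=> w /imsetP[v vS ->].
  have [_ bv] := nb v vS; move: vS; rewrite in_setD => /andP[_ /sing_ptsP[_ _ vT qv]].
  by rewrite inE /g scalemx_sub //= bfZ mulVf // eqxx qfZ qv mulr0 eqxx.
have cK := card_pts K; have e4 : (q ^ \rank K <= q ^ 4)%N by rewrite leq_exp2l.
have := cardsID (pts K) sing_pts.
have : (#|sing_pts :&: pts K| <= #|pts K|)%N by rewrite subset_leq_card // subsetIr.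
move: cK e4 cF q1; rewrite !expnS expn0 !muln1.
move: #|sing_pts| #|pts K| #|sing_pts :&: pts K| #|sing_pts :\: pts K| (q ^ \rank K)%N => a b d e f.
case: (#|F|) => // Q /=; nia.
Qed.

(** If the form vanishes on T, the rank is at most 3. Otherwise the vectors v + s v0, with v
    singular and v0 fixed and nonsingular, are distinct because singular vectors are orthogonal to
    T. *)
Lemma sing_pts_rad : (forall p v, p \in sing_pts -> (v <= T)%MS -> bf p v = 0) ->
  (#|sing_pts| <= 2 * q ^ 3 + q ^ 2 + q + 1)%N.
Proof.
move=> rad; have q1 := q_gt1 F.
case: (boolP [exists v : 'rV[F]_7, (v <= T)%MS && (qf v != 0)]) => [/existsP[v0 /andP[v0T qv0]]|no]; last first.
  have r3 : (\rank T <= 3)%N.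
    apply: tot_sing_rank => v vT; apply/eqP; apply: contraNT no => qv.
    by apply/existsP; exists v; rewrite vT.
  have := card_pts T; have : (q ^ \rank T <= q ^ 3)%N by rewrite leq_exp2l.
  have : (#|sing_pts| <= #|pts T|)%N.
    by apply: subset_leq_card; apply/subsetP=> v; rewrite inE => /andP[].
  move: q1; rewrite !expnS expn0 !muln1.
  move: #|sing_pts| #|pts T| (q ^ \rank T)%N => a b f; case: (#|F|) => // Q /=; nia.
pose V := [set v : 'rV[F]_7 | [&& v != 0, (v <= T)%MS & qf v == 0]].
have c1 : (#|sing_pts| * q.-1 <= #|V|)%N.
  apply: points_vectors => [u /sing_ptsP[]//|u c /sing_ptsP[u0 _ uT qu] c0].
  rewrite inE scaler_eq0 negb_or c0 u0 scalemx_sub //=.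
  by rewrite qfZ qu mulr0.
have radV u v : u \in V -> (v <= T)%MS -> bf u v = 0.
  rewrite inE => /and3P[u0 uT /eqP qu] vT; have [a a0 ea] := normalizeE u0.
  have : normalize u \in sing_pts.
    apply/sing_ptsP; rewrite normalize_nz // normalize_idem // normalize_eqmx //; split=> //.
    by rewrite ea qfZ qu mulr0.
  move/rad/(_ vT); rewrite ea bfC bfZ => /eqP.
  by rewrite mulf_eq0 (negPf a0) bfC => /eqP.
have c2 : (#|V| * q <= q ^ 5)%N.
  apply: leq_trans (_ : #|[set v : 'rV[F]_7 | (v <= T)%MS]| <= _)%N; last first.
    by rewrite card_rowspace leq_exp2l.
  have -> : (#|V| * q)%N = #|setX V [set: F]| by rewrite cardsX cardsT.
  pose f (d : 'rV[F]_7 * F) := d.1 + d.2 *: v0.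
  have inj : {in setX V [set: F] &, injective f}.
    move=> [u s] [u' s'] /setXP[/= uV _] /setXP[/= uV' _]; rewrite /f /= => e.
    have e' : (s - s') *: v0 = 1 *: u' + (-1) *: u.
      by move/rowP: e => e; apply/rowP=> i; move: (e i); rewrite !mxE => ei;
        apply/eqP; rewrite -subr_eq0; move/eqP: ei; rewrite -subr_eq0; congr (_ == 0); ring.
    have uT : (u <= T)%MS by move: uV; rewrite inE => /and3P[].
    have : qf ((s - s') *: v0) = 0.
      rewrite e' qf_comb (radV _ _ uV' uT); move: uV uV'; rewrite !inE => /and3P[_ _ /eqP->] /and3P[_ _ /eqP->].
      by rewrite !mulr0 !addr0.
    rewrite qfZ => /eqP.
    rewrite mulf_eq0 (negPf qv0) orbF expf_eq0 /= subr_eq0 => /eqP es.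
    by move: e; rewrite es => /addIr ->.
  rewrite -(card_in_imset inj); apply: subset_leq_card; apply/subsetP=> w /imsetP[[u s] /setXP[/= uV _] ->].
  by rewrite inE /f /= addmx_sub ?scalemx_sub //; move: uV; rewrite inE => /and3P[].
have {}c2 : (#|V| <= q ^ 4)%N.
  by move: c2; rewrite (expnSr _ 4) leq_pmul2r // (leq_trans _ q1).
move: (leq_trans c1 c2) q1; rewrite !expnS expn0 !muln1.
move: #|sing_pts| => a; case: (#|F|) => // Q /=; nia.
Qed.

Lemma card_sing_pts : (#|sing_pts| <= 2 * q ^ 3 + q ^ 2 + q + 1)%N.
Proof.
case: (boolP [exists p in sing_pts, exists v : 'rV[F]_7, (v <= T)%MS && (bf p v != 0)]).
  by case/exists_inP=> p pS /existsP[v /andP[vT b]]; apply: (sing_pts_far pS); exists v.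
move=> no; apply: sing_pts_rad => p v pS vT; apply/eqP; apply: contraNT no => b.
by apply/exists_inP; exists p => //; apply/existsP; exists v; rewrite vT.
Qed.

Lemma full_dist2 x y : onL H x -> onL H y -> (Pi H x <= T)%MS -> (Pi H y <= T)%MS -> dist2 H x y.
Proof.
move=> ox oy xT yT; have [|z z0] := @nonzero_in _ _ _ (Pi H x :&: Pi H y)%MS.
  have := rank_cap_ge xT yT; rewrite (flat_rank fH ox) (flat_rank fH oy); move: rT; card_lia.
rewrite sub_capmx => /andP[zx zy]; apply/dist2P; exists z; rewrite z0 [adj H z y]adjC.
by rewrite !(adjE fH).
Qed.

(** If two full points are not collinear, every full point is collinear with their common neighbour
    z, as in [star_full]. *)
Lemma full_in_pencil : exists2 A : 'M[F]_7, (\rank A <= 3)%N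
  & forall p, onL H p -> (Pi H p <= T)%MS -> (p <= A)%MS.
Proof.
pose full p := onL H p && (Pi H p <= T)%MS.
case: (boolP [exists x, exists y, [&& full x, full y & ~~ adj H x y]]) => [|no]; last first.
  case: (boolP [exists x, full x]) => [/existsP[x /andP[ox xT]]|no1].
    exists (Pi H x); first by rewrite (flat_rank fH ox).
    move=> p op pT; rewrite -(adjE fH) //; apply: contraT => h; case/negP: no.
    by apply/existsP; exists x; apply/existsP; exists p; rewrite /full ox xT op pT.
  exists 0; first by rewrite mxrank0.
  by move=> p op pT; case/negP: no1; apply/existsP; exists p; rewrite /full op.
case/existsP=> x /existsP[y /and3P[/andP[ox xT] /andP[oy yT] nxy]].
have /dist2P[z [z0 xz zy]] := full_dist2 ox oy xT yT.
have oz := adj_onL z0 zy; have zx : adj H z x by rewrite adjC.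
have [x0 y0] := conj (onL_nz ox) (onL_nz oy).
have xnz : ~~ (x <= z)%MS by apply: contra nxy => h; apply: adj_sub zy h _.
have yzx : ~~ (y <= z + x)%MS.
  by apply: contra nxy => h; apply: (adj_comb z0 zx); rewrite ?addsmxSr.
have ynz : ~~ (y <= z)%MS by apply: contra yzx => h; rewrite (submx_trans h) ?addsmxSl.
have zT : (Pi H z <= T)%MS.
  apply: (Pi_sub fH oz zx zy xnz yzx).
  - by apply: submx_trans xT; apply: adj_Pi.
  - by apply: submx_trans (onL_Pi ox) xT.
  by apply: submx_trans (onL_Pi oy) yT.
exists (Pi H z); first by rewrite (flat_rank fH oz).
move=> v ov vT; rewrite -(adjE fH) //; apply: contraT => nzv; have v0 := onL_nz ov.
have [w [w0 wl vw]] := np ov z0 zx xnz (full_dist2 ov oz vT zT) (full_dist2 ov ox vT xT).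
have [w' [w0' wl' vw']] := np ov z0 zy ynz (full_dist2 ov oz vT zT) (full_dist2 ov oy vT yT).
have zw : adj H z w by apply: (adj_comb z0 zx); rewrite ?addsmxSl.
have zw' : adj H w' z by apply: (adj_comb z0 zy); rewrite ?addsmxSl.
have wv : adj H w v by rewrite adjC.
have w'w := nq z0 w0 v0 w0' zw wv vw' zw' nzv.
case/negP: nzv; case: (boolP (w <= z)%MS) => wz.
  by apply: adj_sub wv (par_sym w0 wz) _.
case/negP: yzx; have wn' : ~~ (w' <= z)%MS.
  by apply: contra wz => h; apply: submx_trans (par_sym w0' w'w) h.
apply: submx_trans (exchange wl' wn') _; rewrite addsmx_sub addsmxSl.
exact: submx_trans w'w wl.
Qed.

(** A singular point of T is on at most one line of T unless its whole plane is in T. So (q + 1) b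
    is at most the number of singular points plus q times that of the full ones, at most 3q^3 + 2q^2
    + 2q + 1. *)
Lemma hex_4d : (#|lines_in H T| <= q ^ 3 - q ^ 2 + 4 * q)%N.
Proof.
have q1 := q_gt1 F.
have cf : (#|full_sing| <= q ^ 2 + q + 1)%N.
  have [A rA hA] := full_in_pencil.
  have : (#|full_sing| <= #|pts A|)%N.
    apply: subset_leq_card; apply/subsetP=> p; rewrite inE => /andP[/sing_ptsP[p0 np' pT qp] fp].
    by apply/ptsP; split=> //; apply: hA fp; rewrite onL_hex p0 qp eqxx.
  have := card_pts A; have : (q ^ \rank A <= q ^ 3)%N by rewrite leq_exp2l.
  move: q1; rewrite !expnS expn0 !muln1.
  move: #|full_sing| #|pts A| (q ^ \rank A)%N => a b f; case: (#|F|) => // Q /=; nia.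
have key : (#|lines_in H T| * q.+1 <= #|sing_pts| + #|full_sing| * q)%N.
  rewrite -sum_set_const.
  have -> : (\sum_(l in lines_in H T) q.+1 = \sum_(l in lines_in H T) #|[set p in sing_pts | (p <= l)%MS]|)%N.
    apply: eq_bigr => l /lines_inP[lH lT]; rewrite -(card_pts_line (line_rank fH lH)).
    apply: eq_card => p; rewrite inE; apply/idP/andP => [/ptsP[p0 np' pl]|[/sing_ptsP[p0 np' _ _] pl]]; last exact/ptsP.
    split=> //; apply/sing_ptsP; split=> //; first exact: submx_trans pl lT.
    have : onL H p by apply/onLP=> //; exists l.
    by rewrite onL_hex => /andP[_ /eqP].
  rewrite -(double_count sing_pts (lines_in H T) (fun p l => (p <= l)%MS)).
  have fs : full_sing \subset sing_pts by apply/subsetP=> p; rewrite inE => /andP[].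
  rewrite (big_setID full_sing) /= (setIidPr fs).
  have -> : (#|sing_pts| + #|full_sing| * q = #|full_sing| * q.+1 + #|sing_pts :\: full_sing| * 1)%N.
    by have := cardsID full_sing sing_pts; rewrite (setIidPr fs); card_lia.
  rewrite -!sum_set_const; apply: leq_add; apply: leq_sum => p.
    rewrite inE => /andP[/sing_ptsP[p0 _ _ qp] _].
    have op : onL H p by rewrite onL_hex p0 qp eqxx.
    rewrite -(card_lines_through fH op); apply: subset_leq_card; apply/subsetP=> l.
    by rewrite !inE => /andP[/andP[-> _] ->].
  rewrite in_setD => /andP[nf pS]; apply: cards_le1 => l k.
  rewrite !inE => /andP[/andP[lH lT] pl] /andP[/andP[kH kT] pk].
  have [p0 _ _ _] := sing_ptsP _ pS.
  apply/eqP; apply: contraNT nf => lk; rewrite inE pS.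
  exact: (pencil_sub p0 lH kH lk).
have := card_sing_pts; move: cf key q1; rewrite !expnS expn0 !muln1.
move: #|full_sing| #|sing_pts| #|lines_in H T| => f s b; case: (#|F|) => [|[|[|Q]]] //.
  (* For q = 2 this reads 3b <= 37, and b <= 12 follows by integrality only. *)
  by move=> *; lia.
move=> h1 h2 _ h3.
have h4 : (b * Q.+4 <= 3 * (Q.+3 * (Q.+3 * Q.+3)) + 2 * (Q.+3 * Q.+3) + 2 * Q.+3 + 1)%N by nia.
have h5 : (3 * (Q.+3 * (Q.+3 * Q.+3)) + 2 * (Q.+3 * Q.+3) + 2 * Q.+3 + 1 <=
  (Q.+3 * (Q.+3 * Q.+3) - Q.+3 * Q.+3 + 4 * Q.+3) * Q.+4)%N by nia.
by rewrite -(leq_pmul2r (m := Q.+4)) //; exact: leq_trans h4 h5.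
Qed.

End FourDim.

Lemma card_dot_eq (x : 'rV[F]_3) (t : F) : x != 0 -> (#|[set y : 'rV[F]_3 | dot x y == t]| <= q ^ 2)%N.
Proof.
move=> x0; apply: leq_trans (card_affine (K := kermx x^T) _) _; last by rewrite rank_perp.
move=> u v; rewrite !inE => /eqP eu /eqP ev.
by rewrite perp_sub dotC dotDr dotNr eu ev subrr.
Qed.

(** For x nonzero and given t, the vector y solves one linear equation; x = 0 forces t = 0 and
    leaves y free. The total is at most q^3 + (q^3 - 1) q^3. *)
Lemma card_sing_vectors : (#|[set v : 'rV[F]_7 | qf v == 0%R]| <= q ^ 6)%N.
Proof.
have q1 := q_gt1 F.
pose n (x : 'rV[F]_3) (t : F) := #|[set y : 'rV[F]_3 | dot x y == t ^+ 2]|.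
apply: leq_trans (_ : \sum_(xt : 'rV[F]_3 * F) n xt.1 xt.2 <= _)%N.
  rewrite -sum1_card (partition_big (fun v => (xc v, tc v)) predT) //=.
  apply: leq_sum => -[x t] _; rewrite sum1dep_card /n /=.
  have inj : {in [set v : 'rV[F]_7 | (v \in [set v | qf v == 0]) && ((xc v, tc v) == (x, t))] &, injective (@yc F)}.
    move=> u v; rewrite !inE => /andP[_ /eqP[ux ut]] /andP[_ /eqP[vx vt]] e.
    by apply: eq7; rewrite ?ux ?vx ?ut ?vt.
  rewrite -(card_in_imset inj); apply: subset_leq_card; apply/subsetP=> y /imsetP[v].
  by rewrite !inE => /andP[h /eqP[<- <-]] ->; move: h; rewrite /qf subr_eq0.
rewrite -(pair_big predT predT n) /= (bigD1 (0 : 'rV[F]_3)) //=.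
have cV (k : nat) : #|{: 'rV[F]_k}| = (q ^ k)%N by rewrite card_mx mul1n.
have e0 : (\sum_(t : F) n 0%R t <= q ^ 3)%N.
  rewrite (bigD1 0) //= big1 ?addn0 => [|t t0]; last first.
    apply/eqP; rewrite cards_eq0; apply/eqP/setP=> y; rewrite !inE dot0l eq_sym.
    by rewrite expf_eq0 /= (negPf t0).
  by rewrite -cV max_card.
have e1 : (\sum_(x : 'rV[F]_3 | x != 0%R) \sum_(t : F) n x t <= (q ^ 3).-1 * (q * q ^ 2))%N.
  rewrite -(cV 3%N) -(cardsC1 (0 : 'rV[F]_3)) -[X in (_ <= X)%N]sum_set_const.
  rewrite [X in (_ <= X)%N](eq_bigl (fun x : 'rV[F]_3 => x != 0)); last by move=> x; rewrite !inE.
  apply: leq_sum => x x0; apply: leq_trans (_ : \sum_(t : F) q ^ 2 <= _)%N.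
    by apply: leq_sum => t _; exact: card_dot_eq.
  by rewrite sum_nat_const.
apply: leq_trans (leq_add e0 e1) _; move: q1; rewrite !expnS expn0 !muln1.
case: (#|F|) => // Q _ /=; nia.
Qed.

(** Points and lines are equally many, with q + 1 of either kind on each of the other, so singular
    points are counted instead. *)
Lemma hex_total : (#|H| <= q ^ 5 + q ^ 4 + q ^ 3 + q ^ 2 + q + 1)%N.
Proof.
have q1 := q_gt1 F; pose P := [set p in pts (1%:M : 'M[F]_7) | qf p == 0].
have onP p : p \in P -> onL H p.
  by rewrite inE => /andP[/ptsP[p0 _ _] qp]; rewrite onL_hex p0.
have e : (#|H| * q.+1 = #|P| * q.+1)%N.
  rewrite -!sum_set_const.
  have -> : (\sum_(p in P) q.+1 = \sum_(p in P) #|[set l in H | (p <= l)%MS]|)%N.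
    by apply: eq_bigr => p pP; rewrite -(card_lines_through fH (onP p pP)).
  rewrite double_count; apply: eq_bigr => l lH; rewrite -(card_pts_line (line_rank fH lH)).
  apply: eq_card => p; rewrite [RHS]inE; apply/idP/andP => [/ptsP[p0 np' pl]|[pP pl]].
    split=> //; rewrite inE; apply/andP; split; first by apply/ptsP; rewrite submx1.
    have : onL H p by apply/onLP=> //; exists l.
    by rewrite onL_hex => /andP[].
  by apply/ptsP; move: pP; rewrite inE => /andP[/ptsP[]].
have -> : #|H| = #|P| by apply/eqP; rewrite -(eqn_pmul2r (m := q.+1)) // e.
have c1 : (#|P| * q.-1 <= #|[set v : 'rV[F]_7 | qf v == 0%R] :\ 0%R|)%N.
  apply: points_vectors => [u|u c]; first by rewrite inE => /andP[/ptsP[]].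
  rewrite inE => /andP[/ptsP[u0 _ _] /eqP qu] c0; rewrite !inE scaler_eq0 negb_or c0 u0 /=.
  by rewrite qfZ qu mulr0.
have := cardsD1 0 [set v : 'rV[F]_7 | qf v == 0%R].
rewrite inE (_ : qf 0 == 0); last by rewrite /qf xc0 dot0l tc0 expr0n subrr.
have := card_sing_vectors; move: c1 q1; rewrite !expnS expn0 !muln1.
move: #|P| #|_ :\ _| #|[set v : 'rV[F]_7 | _]| => a b c; case: (#|F|) => [|[|Q]] // /= h1 _ h2 h3.
have h : (a * Q.+1 < Q.+2 * (Q.+2 * (Q.+2 * (Q.+2 * (Q.+2 * Q.+2)))))%N by lia.
rewrite -(leq_pmul2r (m := Q.+1)) //; move: h; clear; nia.
Qed.

End StandardCounts.

(** * The characterisation *)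

Section Transfer.
Variables (F : finFieldType) (N : nat) (M : 'M[F]_(7, N)).
Hypothesis frM : row_free M.
Notation H := (hexL F).
Local Notation q := #|F|.
Implicit Types (X Y : 'M[F]_7).

Let img X : 'M[F]_N := <<X *m M>>%MS.

Lemma img_inj : {in H &, injective img}.
Proof.
move=> X Y XH YH /esym e.
have gX := line_gen (hex_flat F) XH; have gY := line_gen (hex_flat F) YH.
have s : (X <= Y)%MS.
  by rewrite -(submxMfree _ _ frM) -(genmxE (Y *m M)) -[<<_>>%MS]/(img Y) e genmxE.
have s' : (Y <= X)%MS.
  by rewrite -(submxMfree _ _ frM) -(genmxE (X *m M)) -[<<_>>%MS]/(img X) -e genmxE.
by rewrite -gX -gY; apply: genmx_eqP.
Qed.

Lemma preimage_space m (T : 'M[F]_(m, N)) : exists2 T' : 'M[F]_7,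
  forall k (X : 'M[F]_(k, 7)), ((X *m M)%R <= T)%MS = (X <= T')%MS & (\rank T' <= \rank T)%N.
Proof.
have h k (X : 'M[F]_(k, 7)) : ((X *m M)%R <= T)%MS = (X <= kermx (M *m cokermx T))%MS.
  by rewrite sub_kermx mulmxA submxE.
exists (kermx (M *m cokermx T)) => //.
by rewrite -(mxrankMfree _ frM); apply: mxrankS; rewrite h.
Qed.

Lemma card_lines_in_img m (T : 'M[F]_(m, N)) (T' : 'M[F]_7) :
  (forall k (X : 'M[F]_(k, 7)), ((X *m M)%R <= T)%MS = (X <= T')%MS) ->
  #|[set l in img @: H | (l <= T)%MS]| = #|lines_in H T'|.
Proof.
move=> h; rewrite -(@card_in_imset _ _ img (lines_in H T')); last first.
  by move=> X Y /lines_inP[XH _] /lines_inP[YH _]; exact: img_inj.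
congr #|pred_of_set _|; apply/setP=> l; rewrite inE; apply/andP/imsetP.
  by case=> /imsetP[X XH ->]; rewrite genmxE h => XT; exists X => //; apply/lines_inP.
by case=> X /lines_inP[XH XT] ->; rewrite imset_f // genmxE h.
Qed.

Lemma card_lines_thru_img (p : 'M[F]_N) : \rank p = 1%N ->
  #|[set l in img @: H | (p <= l)%MS]| = 0%N \/ #|[set l in img @: H | (p <= l)%MS]| = q.+1.
Proof.
move=> rp; case: (set_0Vmem [set l in img @: H | (p <= l)%MS]) => [->|[l]]; first by left; rewrite cards0.
rewrite inE => /andP[/imsetP[X XH ->]]; rewrite genmxE => pX; right.
have [|w w0 wp] := @nonzero_in _ _ _ p; first by rewrite rp.
have pw : (p <= w)%MS by apply: (sub_eq_rank wp); rewrite rp (rank_nz w0).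
have /submxP[D wE] := submx_trans wp pX; pose v := D *m X.
have vE : v *m M = w by rewrite /v wE mulmxA.
have v0 : v != 0 by apply: contraNneq w0 => v0; rewrite -vE v0 mul0mx.
have ov : onL H v by apply/onLP=> //; exists X => //; exact: submxMl.
have pY Y : (p <= Y *m M)%MS = (v <= Y)%MS.
  by rewrite -(submxMfree _ _ frM) vE; apply/idP/idP; apply: submx_trans.
rewrite -(card_lines_through (hex_flat F) ov) -(@card_in_imset _ _ img (lines_thru H v)); last first.
  by move=> Y Z; rewrite !inE => /andP[YH _] /andP[ZH _]; exact: img_inj.
congr #|pred_of_set _|; apply/setP=> l'; rewrite inE; apply/andP/imsetP.
  by case=> /imsetP[Y YH ->]; rewrite genmxE pY => vY; exists Y => //; rewrite inE YH.
by case=> Y; rewrite inE => /andP[YH vY] ->; rewrite imset_f // genmxE pY.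
Qed.

End Transfer.

(** * Identification of L with the standard hexagon *)

Section Embedding.
Variables (F : finFieldType) (N : nat) (L : {set 'M[F]_N}).
Hypothesis hH : flat_hexagon L.
Notation H := (hexL F).
Local Notation q := #|F|.
Let fL := fh_flat hH.

Section Scaling.
Variables (t k : F).
Hypotheses (t0 : t != 0) (k0 : k != 0).
Implicit Types (x y a b : 'rV[F]_3).

(* With these scalings tau and kappa become 1. *)
Definition scale_x x := vec3 (t / k * cd3 x 0) (cd3 x 1) (cd3 x 2).
Definition scale_y y := vec3 (k * cd3 y 0) (t * cd3 y 1) (t * cd3 y 2).

Lemma scale_x_onto x : exists x', x = scale_x x'.
Proof.
by exists (vec3 (k / t * cd3 x 0) (cd3 x 1) (cd3 x 2)); apply: vec3P; rewrite !cd3E //; field; rewrite t0 k0.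
Qed.

Lemma scale_y_onto y : exists y', y = scale_y y'.
Proof.
by exists (vec3 (k^-1 * cd3 y 0) (t^-1 * cd3 y 1) (t^-1 * cd3 y 2)); apply: vec3P; rewrite !cd3E //; field.
Qed.

Lemma scale_x_eq0 x : scale_x x = 0 -> x = 0.
Proof.
move=> e; have e0 := congr1 (fun v : 'rV[F]_3 => cd3 v 0) e.
have e1 := congr1 (fun v : 'rV[F]_3 => cd3 v 1) e; have e2 := congr1 (fun v : 'rV[F]_3 => cd3 v 2) e.
rewrite /= !cd3E in e0 e1 e2; apply: vec3P; rewrite cd30 //.
by move/eqP: e0; rewrite !mulf_eq0 invr_eq0 (negPf t0) (negPf k0) => /eqP.
Qed.

Lemma scale_y_eq0 x : scale_y x = 0 -> x = 0.
Proof.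
move=> e; have e0 := congr1 (fun v : 'rV[F]_3 => cd3 v 0) e.
have e1 := congr1 (fun v : 'rV[F]_3 => cd3 v 1) e; have e2 := congr1 (fun v : 'rV[F]_3 => cd3 v 2) e.
rewrite /= !cd3E in e0 e1 e2; apply: vec3P; rewrite cd30.
- by move/eqP: e0; rewrite mulf_eq0 (negPf k0) => /eqP.
- by move/eqP: e1; rewrite mulf_eq0 (negPf t0) => /eqP.
by move/eqP: e2; rewrite mulf_eq0 (negPf t0) => /eqP.
Qed.

Lemma dot_scale x y : dot (scale_x x) (scale_y y) = t * dot x y.
Proof. by rewrite /dot !cd3E; field. Qed.

Lemma cross_scale x a : k *: cross (scale_x x) (scale_x a) = scale_y (cross x a).
Proof. by apply: vec3P; rewrite !cd3E; field. Qed.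

End Scaling.

(** After rescaling, a line inside E + Fm joins points (a, 0, 0) and (0, 0, b), and any other line
    joins points (x, 1, y) and (a, 0, x cross a) with x . y = 1 and a . y = 0; both kinds satisfy
    [hadj]. *)
Lemma hexagon_embedding z : onL L z -> (q ^ 5 + q ^ 4 + q ^ 3 + q ^ 2 + q + 1 <= #|L|)%N ->
  exists M : 'M[F]_(7, N), row_free M /\ L = [set <<(X *m M)>>%MS | X in H].
Proof.
move=> oz big; have [E [Fm [e ax]]] := axis_ex hH oz; have fr := ax_frame ax.
have [x0 [y0 o0]] : exists x0 y0, onL L (apt E Fm e x0 y0).
  have n0 : vec3 1 0 0 != 0 :> 'rV[F]_3.
    by apply/eqP => /(congr1 (fun v : 'rV[F]_3 => cd3 v 0)); rewrite !cd3E => /eqP; rewrite oner_eq0.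
  have [a2 _ na] := perp_out (vec3 1 0 0) n0.
  have [u [ou uW _ _]] := far_point hH fr n0 na.
  by have [_ [x0 [y0 [_ _ h]]]] := off_norm ax ou uW; exists x0, y0.
have [k k0 kp] := kappa_ex hH ax o0.
have t0 := apt_dot_nz hH ax o0; set t := dot x0 y0 in t0.
pose f (p : 'rV[F]_7) := scale_x t k (xc p) *m E + tc p *: e + scale_y t k (yc p) *m Fm.
have [|M fM] := @lin_matrix _ _ _ f.
  move=> c u v; rewrite /f !c7E.
  have -> : scale_x t k (c *: xc u + xc v) = c *: scale_x t k (xc u) + scale_x t k (xc v).
    by apply: vec3P; rewrite !cd3E; ring.
  have -> : scale_y t k (c *: yc u + yc v) = c *: scale_y t k (yc u) + scale_y t k (yc v).
    by apply: vec3P; rewrite !cd3E; ring.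
  rewrite !mulmxDl -!scalemxAl.
  move: (scale_x t k (xc u) *m E) (scale_x t k (xc v) *m E) => A A'.
  move: (scale_y t k (yc u) *m Fm) (scale_y t k (yc v) *m Fm) => B B'.
  by apply/rowP=> i; rewrite !mxE; ring.
have frM : row_free M.
  apply: inj_row_free => v; rewrite fM => fv.
  have [|ex et ey] := @axis_split _ _ _ E Fm e (scale_x t k (xc v)) (tc v) (scale_y t k (yc v)) 0 0 0 ax.
    by rewrite -/(f v) fv !mul0mx scale0r !addr0.
  apply: eq7; rewrite ?xc0 ?yc0 ?tc0 //; first exact: (scale_x_eq0 t0 k0 ex).
  exact: (scale_y_eq0 t0 k0 ey).
exists M; split=> //.
have img p r : <<(<<(p + r)%MS>>%MS *m M)%R>>%MS = <<(f p + f r)%MS>>%MS.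
  rewrite -!fM; apply: eq_genmx; apply: eqmx_trans (addsmxMr p r M).
  by apply: eqmxMr; exact: genmxE.
have sub : L \subset [set <<(X *m M)>>%MS | X in H].
  apply/subsetP=> l lL; case: (boolP (l <= E + Fm)%MS) => lW.
    have [a [b [a0 b0 ab ->]]] := frame_lines hH fr lL lW.
    have [a' ea] := scale_x_onto t0 k0 a; have [b' eb] := scale_y_onto t0 k0 b.
    have a0' : a' != 0.
      by apply: contraNneq a0 => h; rewrite ea h; apply/eqP/vec3P; rewrite !cd3E ?mulr0.
    have b0' : b' != 0.
      by apply: contraNneq b0 => h; rewrite eb h; apply/eqP/vec3P; rewrite !cd3E ?mulr0.
    have ab' : dot a' b' = 0.
      by move/eqP: ab; rewrite ea eb dot_scale // mulf_eq0 (negPf t0) => /eqP.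
    have s0 : scale_x t k 0 = 0 /\ scale_y t k 0 = 0.
      by split; apply: vec3P; rewrite !cd3E ?mulr0.
    pose p := mk7 a' 0 0; pose r := mk7 0 0 b'.
    have -> : a *m E = f p by rewrite /f /p !c7E ea s0.2 scale0r !mul0mx !addr0.
    have -> : b *m Fm = f r by rewrite /f /r !c7E eb s0.1 scale0r !mul0mx !add0r.
    rewrite -img; apply: imset_f; apply: hex_line.
    - by apply: contraNneq a0' => /(congr1 (@xc F)); rewrite /p !c7E xc0 => ->.
    - apply: contra b0' => /sub_rVP[c /(congr1 (@yc F))]; rewrite /p /r !c7E scaler0 => ->; exact: eqxx.
    - by rewrite /qf /p !c7E dot0r expr0n subr0.
    apply/hadjP; rewrite /p /r !c7E ab' dot0l !scale0r !mulr0 !subr0.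
    by split=> //; apply: vec3P; rewrite !cd3E; ring.
  have [x [y [a [a0 xy ay ->]]]] := off_lines hH ax o0 kp lL lW; rewrite -/t in xy.
  have [x' ex] := scale_x_onto t0 k0 x; have [y' ey] := scale_y_onto t0 k0 y.
  have [a' ea] := scale_x_onto t0 k0 a.
  have a0' : a' != 0.
    by apply: contraNneq a0 => h; rewrite ea h; apply/eqP/vec3P; rewrite !cd3E ?mulr0.
  have xy' : dot x' y' = 1.
    by apply: (mulfI t0); rewrite mulr1 -[RHS]xy ex ey dot_scale.
  have ay' : dot a' y' = 0.
    by move/eqP: ay; rewrite ea ey dot_scale // mulf_eq0 (negPf t0) => /eqP.
  pose p := mk7 x' 1 y'; pose r := mk7 a' 0 (cross x' a').
  have -> : apt E Fm e x y = f p by rewrite /f /p /apt !c7E -ex -ey scale1r.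
  have -> : a *m E + (k *: cross x a) *m Fm = f r.
    by rewrite /f /r !c7E -ea scale0r addr0 ex ea cross_scale.
  rewrite -img; apply: imset_f; apply: hex_line.
  - by apply/eqP => /(congr1 (@tc F)); rewrite /p !c7E tc0 => /eqP; rewrite oner_eq0.
  - apply: contra a0' => /sub_rVP[c h]; have := congr1 (@tc F) h; rewrite /p /r !c7E mulr1 => c0.
    by have := congr1 (@xc F) h; rewrite /p /r !c7E -c0 scale0r => ->.
  - by rewrite /qf /p !c7E xy' expr1n subrr.
  apply/hadjP; rewrite /p /r !c7E cross_cross [dot y' _]dotC ay' [dot y' x']dotC xy' dot_crossl.
  by split; rewrite ?mulr0 // ?scale1r ?scale0r ?subr0.
(* Only the inclusion was shown; equality holds because the standard hexagon has no more lines than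
   L. *)
apply/eqP; rewrite eqEcard sub /=; apply: leq_trans big.
exact: leq_trans (leq_imset_card _ _) (hex_total F).
Qed.

End Embedding.

Lemma numbers_hexagon (F : finFieldType) N (L : {set 'M[F]_N}) :
  intersection_numbers L -> flat_hexagon L.
Proof.
move=> hL; split.
- exact: numbers_flat.
- exact: numbers_no_three_pencils.
- exact: numbers_no_quadrangle.
- exact: numbers_no_pentagon.
- exact: numbers_lines_near.
move=> m T l k rT lL kL lk lT kT.
have := in_sd hL rT (in_gt1 lL kL lk lT kT); have := q_gt1 F; card_lia.
Qed.

Theorem theorem1 (F : finFieldType) (n : nat) (L : {set 'M[F]_(n.+1)}) :
  (2 <= n)%N ->
  L != set0 ->
  (forall l, l \in L -> proj_subspace 1 l) ->
  is_split_cayley_hexagon L <->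
  [/\ (* (Pt) *)
      (forall p : 'M[F]_(n.+1), proj_subspace 0 p ->
         nb_through L p = 0%N \/ nb_through L p = #|F|.+1),
      (* (Pl) *)
      (forall S : 'M[F]_(n.+1), proj_subspace 2 S ->
         nb_in L S = 0%N \/ nb_in L S = 1%N \/ nb_in L S = #|F|.+1),
      (* (Sd) *)
      (forall S : 'M[F]_(n.+1), proj_subspace 3 S ->
         nb_in L S = 0%N \/ nb_in L S = 1%N \/ nb_in L S = #|F|.+1
         \/ nb_in L S = (2 * #|F|).+1),
      (* (4d) *)
      (forall S : 'M[F]_(n.+1), proj_subspace 4 S ->
         (nb_in L S <= #|F| ^ 3 - #|F| ^ 2 + 4 * #|F|)%N) &
      (* (To) *)
      (#|L| <= #|F| ^ 5 + #|F| ^ 4 + #|F| ^ 3 + #|F| ^ 2 + #|F| + 1)%N].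
Proof.
move=> _ L0 linL; split.
  case=> M [frM ->]; rewrite /nb_in /nb_through.
  have count (S : 'M[F]_(n.+1)) : exists2 T : 'M[F]_7, (\rank T <= \rank S)%N &
      #|[set l in [set <<(X *m M)>>%MS | X in hexL F] | (l <= S)%MS]| = #|lines_in (hexL F) T|.
    by have [T h rT] := preimage_space frM S; exists T => //; apply: (card_lines_in_img frM).
  split.
  - by move=> p /andP[_ /eqP rp]; apply: (card_lines_thru_img frM).
  - move=> S /andP[_ /eqP rS]; have [T rT ->] := count S; rewrite rS in rT.
    case: (ltnP 1 #|lines_in (hexL F) T|) => [/(hex_plane rT)->|]; first by right; right.
    by case: #|lines_in (hexL F) T| => [|[|?]]; [left|right; left|].
  - move=> S /andP[_ /eqP rS]; have [T rT ->] := count S; rewrite rS in rT.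
    case: (ltnP 1 #|lines_in (hexL F) T|) => [/(hex_solid rT)[]->|].
    + by right; right; left.
    + by right; right; right.
    by case: #|lines_in (hexL F) T| => [|[|?]]; [left|right; left|].
  - by move=> S /andP[_ /eqP rS]; have [T rT ->] := count S; apply: hex_4d; rewrite rS in rT.
  exact: leq_trans (leq_imset_card _ _) (hex_total F).
case=> Pt Pl Sd D4 To.
have gen k m (S : 'M[F]_(m, n.+1)) : \rank S = k.+1 -> proj_subspace k <<S>>%MS.
  by move=> rS; rewrite /proj_subspace genmx_id eqxx mxrank_gen rS eqxx.
have inE' m (S : 'M[F]_(m, n.+1)) : nb_in L <<S>>%MS = #|lines_in L S|.
  by apply: eq_card => l; rewrite !inE genmxE.
have hL : intersection_numbers L.
  split=> //.
  - by move=> l /linL/andP[/eqP-> /eqP->].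
  - move=> x ox; have <- : nb_through L <<x>>%MS = #|lines_thru L x|.
      by apply: eq_card => l; rewrite !inE genmxE.
    (* The value 0 in (Pt) is excluded because x is on a line of L. *)
    case: (Pt _ (gen _ _ _ (rank_nz (onL_nz ox)))) => // /eqP; rewrite cards_eq0 => /eqP/setP h.
    have [l lL xl] := onLP _ (onL_nz ox) ox; have := h l; by rewrite !inE lL genmxE xl.
  - move=> m T rT; rewrite -inE'; case: (Pl _ (gen _ _ _ rT)) => [->|[->|->]] //.
  - move=> m T rT; rewrite -inE'; case: (Sd _ (gen _ _ _ rT)) => [->|[->|[->|->]]] //; by [left|right].
  by move=> m T rT; rewrite -inE'; apply: D4; apply: gen.
have hH := numbers_hexagon hL.
have [l lL] := set0Pn _ L0; have [x [y [x0 _ xy _]]] := line_two (fh_flat hH) lL.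
have ox := adj_onL x0 xy.
exact: (hexagon_embedding hH ox (numbers_total hL ox)).
Qed.
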